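(* Let $X(\xi,t)$, $(\xi,t)\in\mathbb{S}^1\times[0,T]$, be a solution of the area-preserving curve shortening flow $$\partial_tX=\frac{1}{|\partial_\xi X|}\partial_\xi\Big(\frac{\partial_\xi X}{|\partial_\xi X|}\Big)-\frac{2\pi}{L}\Big(\frac{\partial_\xi X}{|\partial_\xi X|}\Big)^\perp,\qquad X(\cdot,0)=X^0,$$ satisfying Assumption (B) of the context, and assume that the partition of $\mathbb{S}^1$ satisfies Assumption (A) of the context. Then there exists $h_0>0$ such that for all $0<h\le h_0$ there exists a unique semidiscrete solution $X_h$ on $[0,T]$ (as defined in the context). Furthermore, the solution satisfies $$\int_0^T\|\partial_tX-\partial_tX_h\|_{L^2}^2\,ds+\sup_{[0,T]}\|X-X_h\|_{H^1}^2\le Ch^2,$$ where $h_0$ and $C$ depend on $C_p,C_P,\kappa_1,\kappa_2,T$ and $K(X)$. In particular, $\min_jq_j(t)>0$ for all $t\in[0,T]$, where $q_j(t)=|X_j(t)-X_{j-1}(t)|$.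
   Context: $\mathbb{S}^1=[0,2\pi]$ with endpoints identified; $T>0$; $(a,b)^\perp=(-b,a)$; $L=L(t)=\int_{\mathbb{S}^1}|\partial_\xi X|\,d\xi$ is the length of the curve; all norms $\|\cdot\|_{L^2},\|\cdot\|_{H^1}$ are over $\mathbb{S}^1$. Let $0=\xi_0<\xi_1<\dots<\xi_N=2\pi$ be a partition, $I_j=[\xi_{j-1},\xi_j]$, $h_j=\xi_j-\xi_{j-1}$, $h=\max_jh_j$; indices are periodic modulo $N$. Assumption (A) (regular partition): there are constants $C_p,C_P$ (independent of $h$) with $\min_jh_j\ge C_ph$ and $|h_{j+1}-h_j|\le C_Ph^2$ for $1\le j\le N$. Assumption (B) (regular solution): $X$ is the unique solution of the flow with initial value $X^0\in H^2(\mathbb{S}^1)$, $X\in W^{1,\infty}([0,T],H^2(\mathbb{S}^1))$ with $K(X):=\|X\|_{W^{1,\infty}([0,T],H^2(\mathbb{S}^1))}<\infty$, and there are constants $0<\kappa_1<\kappa_2$ with $\kappa_1\le|\partial_\xi X(\xi,t)|\le\kappa_2$ for all $(\xi,t)\in\mathbb{S}^1\times[0,T]$. $V_h$ is the space of continuous periodic functions $\mathbb{S}^1\to\mathbb{R}^2$ that are affine on each $I_j$; $\varphi_j$ is the scalar continuous periodic piecewise affine nodal basis function with $\varphi_j(\xi_i)=\delta_{ij}$; $I_hv=\sum_{j=1}^Nv(\xi_j)\varphi_j$ for continuous $v$. Semidiscrete solution: a function $X_h(\xi,t)=\sum_{j=1}^NX_j(t)\varphi_j(\xi)$ with $X_h(\cdot,0)=I_hX^0$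 satisfying, for all $v_h\in V_h$ and all $t$, $$\int_{\mathbb{S}^1}|\partial_\xi X_h|\,\partial_tX_h\cdot v_h\,d\xi+\int_{\mathbb{S}^1}\frac{\partial_\xi X_h}{|\partial_\xi X_h|}\cdot\partial_\xi v_h\,d\xi+\int_{\mathbb{S}^1}\frac{\mathbf{h}^2|\partial_\xi X_h|}{6}\,\partial_\xi\partial_tX_h\cdot\partial_\xi v_h\,d\xi+\int_{\mathbb{S}^1}\frac{2\pi}{L_h}(\partial_\xi X_h)^\perp\cdot v_h\,d\xi=0,$$ where $\mathbf{h}=h_j$ on $I_j$ and $L_h=\sum_{j=1}^N|X_j-X_{j-1}|$. *)

(* Defs.v *)
From mathcomp Require Export all_boot all_order all_algebra.
From mathcomp Require Export all_classical all_reals all_analysis.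
From mathcomp Require Export ess_sup_inf.
Export Order.TTheory GRing.Theory Num.Theory.
Export numFieldNormedType.Exports.

Set Implicit Arguments.
Unset Strict Implicit.
Unset Printing Implicit Defensive.

Local Open Scope classical_set_scope.
Local Open Scope ring_scope.

Section Plane.
Context {R : realType}.
Implicit Types u v : 'rV[R]_2.

Definition dot u v : R := \sum_i u 0 i * v 0 i.

(* Euclidean norm; the library norm `|u| of 'rV is the sup norm. *)
Definition enorm u : R := Num.sqrt (dot u u).

(* (a, b)^perp = (- b, a) *)
Definition perp u : 'rV[R]_2 := \row_i (if i == 0 then - u 0 1 else u 0 0).

End Plane.

(* Functions on the circle are 2pi-periodic functions on the line; integrals
   run over one period. A time-dependent curve is X : R -> R -> 'rV[R]_2 with
   X t x the position at time t and parameter x. *)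
Section Sobolev.
Context {R : realType}.
Local Notation mu := (@lebesgue_measure R).
Local Notation E2 := 'rV[R]_2.
Implicit Types (v g phi : R -> E2) (X Y : R -> R -> E2).

Definition S1 : set R := `[0, 2 * pi].

Definition C1 phi : Prop :=
  (forall x, derivable phi x 1) /\ continuous (derive1 phi).

Definition C1per : set (R -> E2) :=
  [set phi | C1 phi /\ periodic phi (2 * pi)].

Definition C1c (T : R) : set (R -> E2) :=
  [set phi | C1 phi /\ exists a b, [/\ 0 < a, b < T &
     forall t, ~ (a <= t <= b) -> phi t = 0]].

Definition weak_derivative (D : set R) (tests : set (R -> E2)) v g : Prop :=
  forall phi, tests phi ->
    \int[mu]_(x in D) dot (v x) (derive1 phi x) =
    - \int[mu]_(x in D) dot (g x) (phi x).

Definition L2sq v : \bar R := \int[mu]_(x in S1) ((enorm (v x) ^+ 2)%:E).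

Definition L2 v : Prop :=
  (forall i, measurable_fun S1 (fun x => v x 0 i)) /\ (L2sq v < +oo)%E.

Definition H1 v : Prop :=
  L2 v /\ exists g, L2 g /\ weak_derivative S1 C1per v g.

(* A representative of the weak derivative of an H1 function. *)
Definition wderiv v : R -> E2 :=
  xget (fun=> 0) [set g | L2 g /\ weak_derivative S1 C1per v g].

Definition H1sq v : \bar R := (L2sq v + L2sq (wderiv v))%E.

(* Since H^2 embeds into the continuous functions, elements of H^2 are taken
   to be their continuous periodic representatives. *)
Definition H2 v : Prop :=
  [/\ periodic v (2 * pi), continuous v, H1 v & H1 (wderiv v)].

Definition H2norm v : \bar R :=
  sqrte (L2sq v + L2sq (wderiv v) + L2sq (wderiv (wderiv v)))%E.

(* X in W^{1,oo}([0,T], H^2), with Xt its time derivative; X is the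
   representative that is continuous in time.
   Point evaluations are continuous on H^2 and separate its points. Hence, H^2
   being separable, strong measurability of t |-> Xt t is measurability of all
   its point evaluations, and the H^2-valued identity that says that Xt is the
   weak derivative of X can be tested on point evaluations. *)
Definition W1infty_norm (T : R) X Xt : \bar R :=
  ess_sup mu ((fun t => H2norm (X t) + H2norm (Xt t))%E \_ `[0, T]).

Definition W1infty (T : R) X Xt : Prop :=
  [/\ forall t, t \in `[0, T] -> H2 (X t) /\ H2 (Xt t),
      forall x, {within `[0, T], continuous (fun t => X t x)},
      forall x i, measurable_fun `[0, T] (fun t => Xt t x 0 i),
      forall x, weak_derivative `[0, T] (C1c T) (X^~ x) (Xt^~ x) &
      (W1infty_norm T X Xt < +oo)%E].

End Sobolev.

Section Flow.
Context {R : realType}.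
Local Notation mu := (@lebesgue_measure R).
Local Notation E2 := 'rV[R]_2.
Implicit Types (v : R -> E2) (X Xt : R -> R -> E2).

Definition tangent v (x : R) : E2 := (enorm (derive1 v x))^-1 *: derive1 v x.

Definition curve_length v : R := \int[mu]_(x in S1) enorm (derive1 v x).

(* For v in H^2 the first derivative is classical, and [tangent v] is an H^1
   function when it does not vanish, so that its derivative is a weak one. *)
Definition flow_rhs v (x : R) : E2 :=
  (enorm (derive1 v x))^-1 *: wderiv (tangent v) x
  - (2 * pi / curve_length v) *: perp (tangent v x).

Definition flow_solution (T : R) (X0 : R -> E2) X Xt : Prop :=
  [/\ W1infty T X Xt,
      forall t x, t \in `[0, T] -> derive1 (X t) x != 0,
      X 0 = X0 &
      {ae mu, forall t, t \in `[0, T] ->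
        {ae mu, forall x, x \in `[0, 2 * pi] -> Xt t x = flow_rhs (X t) x}}].

Definition unique_flow_solution (T : R) (X0 : R -> E2) X Xt : Prop :=
  flow_solution T X0 X Xt /\
  forall Y Yt, flow_solution T X0 Y Yt ->
    forall t x, t \in `[0, T] -> Y t x = X t x.

Definition regular_solution (T k1 k2 K : R) (X0 : R -> E2) X Xt : Prop :=
  [/\ H2 X0, unique_flow_solution T X0 X Xt, W1infty_norm T X Xt = K%:E &
      forall t x, t \in `[0, T] -> k1 <= enorm (derive1 (X t) x) <= k2].

End Flow.

(* A partition is given by its nodes xi 0 < ... < xi N. Elements, and nodes
   modulo periodicity, are numbered by 'I_N: the ordinal j stands for the
   element [xi j, xi (j + 1)] and for its right end point xi (j + 1). Cyclic
   successor and predecessor are [ordS] and [ord_pred]. *)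
Section FiniteElements.
Context {R : realType}.
Local Notation mu := (@lebesgue_measure R).
Local Notation E2 := 'rV[R]_2.
Variables (N : nat) (xi : nat -> R).

Definition partition_of_S1 : Prop :=
  [/\ xi 0 = 0, xi N = 2 * pi & forall j : 'I_N, xi j < xi j.+1].

Definition elem_size (j : 'I_N) : R := xi j.+1 - xi j.

Definition mesh : R := \big[Num.max/0]_(j < N) elem_size j.

Definition regular_partition (Cp CP : R) : Prop :=
  forall j : 'I_N, Cp * mesh <= elem_size j /\
    `|elem_size (ordS j) - elem_size j| <= CP * mesh ^+ 2.

Definition local_size (x : R) : R :=
  \sum_(j < N) elem_size j * \1_(`]xi j, xi j.+1]%classic) x.

Definition periodic_P1 (V : normedModType R) (v : R -> V) : Prop :=
  [/\ periodic v (2 * pi), continuous v &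
      forall j : 'I_N, exists a b : V,
        forall x, x \in `[xi j, xi j.+1] -> v x = a + x *: b].

Definition nodal_basis (phi : 'I_N -> R -> R) : Prop :=
  forall j, periodic_P1 (phi j : R -> R^o) /\
    forall i : 'I_N, phi j (xi i.+1) = (i == j)%:R.

Variable phi : 'I_N -> R -> R.

Definition interpolate (v : R -> E2) (x : R) : E2 :=
  \sum_(j < N) phi j x *: v (xi j.+1).

Definition discrete_curve (Xn : 'I_N -> R -> E2) (t x : R) : E2 :=
  \sum_(j < N) phi j x *: Xn j t.

Definition side (Xn : 'I_N -> R -> E2) (j : 'I_N) (t : R) : R :=
  enorm (Xn j t - Xn (ord_pred j) t).

Definition discrete_length (Xn : 'I_N -> R -> E2) (t : R) : R :=
  \sum_(j < N) side Xn j t.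

(* Time derivative on [0, T], one-sided at the end points. *)
Definition diff_quotient (f : R -> E2) (t s : R) : E2 :=
  (s - t)^-1 *: (f s - f t).

Definition tderivable (T : R) (f : R -> E2) (t : R) : Prop :=
  cvg (diff_quotient f t @ within `[0, T] t^').

Definition tderiv (T : R) (f : R -> E2) (t : R) : E2 :=
  lim (diff_quotient f t @ within `[0, T] t^').

Definition discrete_velocity (T : R) (Xn : 'I_N -> R -> E2) (t x : R) : E2 :=
  tderiv T (fun s => discrete_curve Xn s x) t.

(* No nondegeneracy is required of X_h: where its derivative vanishes, the
   quotient in the second integral takes the conventional value 0. *)
Definition weak_equation (T : R) (Xn : 'I_N -> R -> E2) (t : R) (v : R -> E2)
    : Prop :=
  let U := discrete_curve Xn t in
  let W := discrete_velocity T Xn t in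
  \int[mu]_(x in S1) (enorm (derive1 U x) * dot (W x) (v x))
  + \int[mu]_(x in S1) dot (tangent U x) (derive1 v x)
  + \int[mu]_(x in S1) (local_size x ^+ 2 * enorm (derive1 U x) / 6
                        * dot (derive1 W x) (derive1 v x))
  + \int[mu]_(x in S1) (2 * pi / discrete_length Xn t
                        * dot (perp (derive1 U x)) (v x)) = 0.

Definition semidiscrete_solution (T : R) (X0 : R -> E2)
    (Xn : 'I_N -> R -> E2) : Prop :=
  [/\ forall j t, t \in `[0, T] -> tderivable T (Xn j) t,
      forall x, discrete_curve Xn 0 x = interpolate X0 x &
      forall t, t \in `[0, T] ->
        forall v : R -> E2, periodic_P1 v -> weak_equation T Xn t v].

Definition error_sq (T : R) (X Xt : R -> R -> E2) (Xn : 'I_N -> R -> E2)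
    : \bar R :=
  (\int[mu]_(t in `[0%R, T]) L2sq (Xt t \- discrete_velocity T Xn t)%R
   + ereal_sup [set H1sq (X t \- discrete_curve Xn t)%R | t in `[0%R, T]])%E.

End FiniteElements.

(* Main.v *)
Require Import Defs.
From mathcomp Require Import measurable_realfun.
From mathcomp Require Import ring lra zify.

(** Testing the scheme with nodal basis functions turns it into a system of
    ordinary differential equations for the vertices: the term carrying the
    squared mesh size is exactly the difference between the exact and the lumped
    mass matrix, so that the velocity of a vertex is multiplied by the mean
    length of its two sides ([semidiscrete_nodal]). With side lengths cut off
    from below and sides cut off from above this system has a bounded Lipschitz
    right hand side and a global solution ([field_flow]); everything then rests on showing
    that the cut-offs are never active.

    The comparison polygon is the one inscribed in the exact curve. At almost
    every time it solves the nodal system up to a residual whose squares sum up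
    to O(h^3) ([slice_consistent]). This uses the curve only through the L2 norm of the second
    derivative: on an element the first derivative oscillates by at most the
    square root of h times the local L2 norm of the second derivative, and the
    direction of a chord expands to second order around the middle of its
    element ([chord_direction]), because the unit tangent is Lipschitz by the
    flow equation. The velocity is orthogonal to the tangent, which makes the
    tangential and the length errors small as well.

    Stability is measured by an energy: for each side the defect (length minus
    projection on the exact direction, that is half the length times the
    squared distance of the unit tangents) plus the squared length error
    divided by h. The defect is the natural relative energy of the length
    functional. Its rate of change produces the dissipation of the velocity
    error, and the tangential part of the nodal equation controls the rate of
    the length errors ([energy_inequality]). As the curve is only Lipschitz in time, its
    vertices are differentiable at almost every time; a Lipschitz function with
    almost everywhere nonpositive derivative decreases ([ae_nonincreasing]), and
    Gronwall's argument applies. It bounds the energy by a multiple of h^2,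
    hence each length error by a multiple of h^(3/2), which is below the fixed
    fraction of h allowed by the inequality: the argument closes by continuous
    induction ([energy_bootstrap]) and the sides stay of size h.

    Uniqueness follows since a second solution keeps sides bounded below as long
    as it agrees with the first ([nodal_flow_unique]). The energy controls the
    difference of the sides of the two polygons, its dissipation controls
    that of the velocities, and interpolation estimates transfer both to the
    norms of the statement ([curve_error]). *)

Set Implicit Arguments.
Unset Strict Implicit.
Unset Printing Implicit Defensive.

Local Open Scope classical_set_scope.
Local Open Scope ring_scope.

(** * The Euclidean plane *)

Section PlaneTheory.
Context {R : realType}.
Implicit Types (u v w : 'rV[R]_2) (a : R).

Lemma dotE u v : dot u v = u 0 0 * v 0 0 + u 0 1 * v 0 1.
Proof. by rewrite /dot !big_ord_recl big_ord0 addr0; congr (_ + u _ _ * v _ _); apply/val_inj. Qed.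

Lemma row2P u v : u 0 0 = v 0 0 -> u 0 1 = v 0 1 -> u = v.
Proof.
move=> h0 h1; apply/rowP => -[[|[|//]] i2].
  by rewrite (_ : Ordinal i2 = 0)//; apply/val_inj.
by rewrite (_ : Ordinal i2 = 1)//; apply/val_inj.
Qed.

Lemma dotC u v : dot u v = dot v u.
Proof. by rewrite !dotE; ring. Qed.

Lemma dotDl u v w : dot (u + v) w = dot u w + dot v w.
Proof. by rewrite !dotE !mxE; ring. Qed.

Lemma dotDr u v w : dot u (v + w) = dot u v + dot u w.
Proof. by rewrite !dotE !mxE; ring. Qed.

Lemma dotNl u v : dot (- u) v = - dot u v.
Proof. by rewrite !dotE !mxE; ring. Qed.

Lemma dotNr u v : dot u (- v) = - dot u v.
Proof. by rewrite !dotE !mxE; ring. Qed.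

Lemma dotBl u v w : dot (u - v) w = dot u w - dot v w.
Proof. by rewrite dotDl dotNl. Qed.

Lemma dotBr u v w : dot u (v - w) = dot u v - dot u w.
Proof. by rewrite dotDr dotNr. Qed.

Lemma dotZl a u v : dot (a *: u) v = a * dot u v.
Proof. by rewrite !dotE !mxE; ring. Qed.

Lemma dotZr a u v : dot u (a *: v) = a * dot u v.
Proof. by rewrite !dotE !mxE; ring. Qed.

Lemma dot0l u : dot 0 u = 0.
Proof. by rewrite dotE !mxE; ring. Qed.

Lemma dot0r u : dot u 0 = 0.
Proof. by rewrite dotE !mxE; ring. Qed.

Lemma dot_ge0 u : 0 <= dot u u.
Proof. by rewrite dotE -!expr2 addr_ge0// sqr_ge0. Qed.

Lemma enorm_ge0 u : 0 <= enorm u.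
Proof. exact: sqrtr_ge0. Qed.

Lemma enorm_sqr u : enorm u ^+ 2 = dot u u.
Proof. by rewrite sqr_sqrtr// dot_ge0. Qed.

Lemma enorm_sqrE u : enorm u ^+ 2 = u 0 0 ^+ 2 + u 0 1 ^+ 2.
Proof. by rewrite enorm_sqr dotE !expr2. Qed.

Lemma enorm0 : enorm (0 : 'rV[R]_2) = 0.
Proof. by rewrite /enorm dot0l sqrtr0. Qed.

Lemma enorm_eq0 u : (enorm u == 0) = (u == 0).
Proof.
apply/idP/idP => [/eqP u0|/eqP ->]; last by rewrite enorm0.
have := enorm_sqrE u; rewrite u0 expr0n/= => /esym/eqP.
rewrite paddr_eq0 ?sqr_ge0// !sqrf_eq0 => /andP[/eqP h0 /eqP h1].
by apply/eqP/row2P; rewrite !mxE.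
Qed.

Lemma enorm_gt0 u : (0 < enorm u) = (u != 0).
Proof. by rewrite lt_neqAle enorm_ge0 andbT eq_sym enorm_eq0. Qed.

Lemma dot_cauchy u v : `|dot u v| <= enorm u * enorm v.
Proof.
rewrite -(@ler_pXn2r _ 2)// ?nnegrE ?mulr_ge0 ?enorm_ge0 ?normr_ge0//.
rewrite exprMn !enorm_sqr real_normK ?num_real// !dotE.
rewrite -subr_ge0 (_ : _ - _ = (u 0 0 * v 0 1 - u 0 1 * v 0 0) ^+ 2) ?sqr_ge0//.
by ring.
Qed.

Lemma dot_le u v : dot u v <= enorm u * enorm v.
Proof. exact: le_trans (ler_norm _) (dot_cauchy _ _). Qed.

Lemma enormD u v : enorm (u + v) <= enorm u + enorm v.
Proof.
rewrite -(@ler_pXn2r _ 2)// ?nnegrE ?addr_ge0 ?enorm_ge0//.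
rewrite sqrrD !enorm_sqr dotDl !dotDr (dotC v u).
by have := dot_le u v; lra.
Qed.

Lemma enormZ a u : enorm (a *: u) = `|a| * enorm u.
Proof. by rewrite /enorm dotZl dotZr mulrA -expr2 sqrtrM ?sqr_ge0// sqrtr_sqr. Qed.

Lemma enormN u : enorm (- u) = enorm u.
Proof. by rewrite /enorm dotNl dotNr opprK. Qed.

Lemma enormB u v : enorm (u - v) <= enorm u + enorm v.
Proof. by rewrite -(enormN v) enormD. Qed.

Lemma enormBC u v : enorm (u - v) = enorm (v - u).
Proof. by rewrite -enormN opprB. Qed.

Lemma enorm_dist u v : `|enorm u - enorm v| <= enorm (u - v).
Proof.
rewrite ler_norml; apply/andP; split.
  by have := enormD u (v - u); rewrite addrC subrK (enormBC v u); lra.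
by have := enormD v (u - v); rewrite addrC subrK; lra.
Qed.

Lemma enorm_coord u (i : 'I_2) : `|u 0 i| <= enorm u.
Proof.
rewrite -(@ler_pXn2r _ 2)// ?nnegrE ?enorm_ge0 ?normr_ge0//.
rewrite real_normK ?num_real// enorm_sqrE.
case: i => -[|[|//]] i2.
  by rewrite (_ : Ordinal i2 = 0) ?lerDl ?sqr_ge0//; apply/val_inj.
by rewrite (_ : Ordinal i2 = 1) ?lerDr ?sqr_ge0//; apply/val_inj.
Qed.

Lemma enorm_le_coord u : enorm u <= `|u 0 0| + `|u 0 1|.
Proof.
rewrite -(@ler_pXn2r _ 2)// ?nnegrE ?addr_ge0 ?enorm_ge0//.
rewrite enorm_sqrE sqrrD !real_normK ?num_real//.
by have := normr_ge0 (u 0 0); have := normr_ge0 (u 0 1); nra.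
Qed.

Lemma enorm_perp u : enorm (perp u) = enorm u.
Proof. by rewrite /enorm !dotE !mxE/=; congr Num.sqrt; ring. Qed.

Lemma perpD u v : perp (u + v) = perp u + perp v.
Proof. by apply: row2P; rewrite !mxE/=; ring. Qed.

Lemma perpN u : perp (- u) = - perp u.
Proof. by apply: row2P; rewrite !mxE/=; ring. Qed.

Lemma perpB u v : perp (u - v) = perp u - perp v.
Proof. by rewrite perpD perpN. Qed.

Lemma perpZ a u : perp (a *: u) = a *: perp u.
Proof. by apply: row2P; rewrite !mxE/=; ring. Qed.

Lemma dot_perp u : dot (perp u) u = 0.
Proof. by rewrite dotE !mxE/=; ring. Qed.

Lemma dot_perpC u v : dot (perp u) v = - dot u (perp v).
Proof. by rewrite !dotE !mxE/=; ring. Qed.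

Definition dir u : 'rV[R]_2 := (enorm u)^-1 *: u.

Lemma dir0 : dir 0 = 0.
Proof. by rewrite /dir scaler0. Qed.

Lemma enorm_dir u : u != 0 -> enorm (dir u) = 1.
Proof.
move=> u0; have := u0; rewrite -enorm_gt0 => p.
by rewrite enormZ gtr0_norm ?invr_gt0// mulVf// gt_eqF.
Qed.

Lemma enorm_dir_le1 u : enorm (dir u) <= 1.
Proof. by have [->|/enorm_dir ->//] := eqVneq u 0; rewrite dir0 enorm0. Qed.

Lemma dirK u : enorm u *: dir u = u.
Proof.
have [->|] := eqVneq u 0; first by rewrite dir0 scaler0.
by rewrite -enorm_gt0 => p; rewrite scalerA mulfV ?scale1r// gt_eqF.
Qed.

Lemma dirZ a u : 0 < a -> dir (a *: u) = dir u.
Proof.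
move=> a0; rewrite /dir enormZ gtr0_norm// scalerA invfM -mulrA mulrCA.
by rewrite mulVf ?mulr1// gt_eqF.
Qed.

Lemma dot_dir u : dot (dir u) u = enorm u.
Proof.
have [->|u0] := eqVneq u 0; first by rewrite dir0 dot0l enorm0.
by rewrite dotZl -enorm_sqr expr2 mulKf// enorm_eq0.
Qed.

(** A vector is bounded by its components along two orthonormal directions. *)
Lemma unit_decomp (e u : 'rV[R]_2) : enorm e = 1 ->
  u = dot u e *: e + dot u (perp e) *: perp e.
Proof.
move=> e1; have /eqP := enorm_sqrE e; rewrite e1 expr1n => /eqP/esym he.
apply: row2P; rewrite !mxE !dotE !mxE/=.
  rewrite -[LHS]mulr1 -he; ring.
rewrite -[LHS]mulr1 -he; ring.
Qed.

End PlaneTheory.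

(** * Real induction and monotonicity *)

Section RealInduction.
Context {R : realType}.
Implicit Types (a b : R).

(** The principle is applied to invariants that are open to the right and
    pass to limits from the left: monotonicity from one-sided slopes,
    uniqueness for the system, and the bootstrap of the error estimate. *)
Lemma real_induction (P : R -> Prop) a b : a <= b -> P a ->
  (forall t, a <= t < b -> (forall s, a <= s <= t -> P s) ->
     exists2 e, 0 < e & forall s, t < s < t + e -> s <= b -> P s) ->
  (forall t, a < t <= b -> (forall s, a <= s < t -> P s) -> P t) ->
  forall t, a <= t <= b -> P t.
Proof.
move=> ab Pa Pright Pleft.
pose S := [set t | a <= t <= b /\ forall s, a <= s <= t -> P s].
have Sa : S a.
  by split; [rewrite lexx ab|move=> s; rewrite -eq_le => /eqP <-].
have Sub : ubound S b by move=> t [/andP[]].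
have hS : has_sup S by split; [exists a|exists b].
set c := sup S.
have ac : a <= c by apply: sup_upper_bound.
have cb : c <= b by apply: ge_sup => //; exists a.
have Plt s : a <= s < c -> P s.
  move=> /andP[as_ sc].
  have [t St st] := sup_adherent (ltac:(by rewrite subr_gt0) : 0 < c - s) hS.
  move: st; rewrite -/c opprB addrC subrK => st.
  by apply: St.2; rewrite as_ ltW.
have Pc : P c.
  have [<-//|] := eqVneq a c => anc.
  by apply: Pleft => //; rewrite lt_neqAle anc ac.
have Ple s : a <= s <= c -> P s.
  by rewrite [s <= c]le_eqVlt => /andP[as_ /orP[/eqP ->//|sc]]; apply: Plt; rewrite as_.
have [cb'|bc] := ltP c b; last first.
  move=> t /andP[at_ tb]; apply: Ple.
  by rewrite at_ (le_trans tb).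
have [e e0 He] := Pright c (ltac:(by rewrite ac cb')) Ple.
pose d := Num.min (c + e / 2) b.
have cd : c < d by rewrite lt_min cb' andbT ltrDl divr_gt0.
have : S d.
  split; first by rewrite (le_trans ac (ltW cd))/= ge_min lexx orbT.
  move=> s /andP[as_ sd]; have [sc|cs] := leP s c; first by apply: Ple; rewrite as_.
  move: sd; rewrite le_min => /andP[s1 s2].
  by apply: He => //; rewrite cs (le_lt_trans s1)// ltrD2l; lra.
by move/(sup_upper_bound hS); rewrite leNgt cd.
Qed.

Lemma within_continuousP (V : normedModType R) (f : R -> V) (A : set R) :
  {within A, continuous f} <->
  (forall t e, A t -> 0 < e ->
     exists2 d, 0 < d & forall s, A s -> `|t - s| < d -> `|f t - f s| < e).
Proof.
split=> [/subspace_continuousP cf t e At e0|H].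
  have /cvgrPdist_lt/(_ e e0) [d /= d0 Hd] := cf t At.
  by exists d => // s As ts; apply: Hd.
apply/subspace_continuousP => t At; apply/cvgrPdist_lt => e e0.
have [d d0 Hd] := H t e At e0.
by exists d => //= s ts As; apply: Hd.
Qed.

Lemma nonincreasing_right_slope (f : R -> R) a b : a <= b ->
  {within `[a, b], continuous f} ->
  (forall t e, a <= t < b -> 0 < e -> exists2 d, 0 < d &
     forall s, t < s < t + d -> s <= b -> f s - f t <= e * (s - t)) ->
  f b <= f a.
Proof.
move=> ab cf slope; apply/ler_addgt0Pr => e e0.
have [->|anb] := eqVneq a b; first by rewrite lerDl ltW.
have ab' : a < b by rewrite lt_neqAle anb.
pose k := e / (b - a); have k0 : 0 < k by rewrite divr_gt0// subr_gt0.
suff H t : a <= t <= b -> f t - f a <= k * (t - a).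
  have := H b; rewrite ab lexx => /(_ isT).
  by rewrite /k divfK ?subr_eq0 1?eq_sym//; lra.
move: t; apply: real_induction => //.
- by rewrite !subrr mulr0.
- move=> t /andP[at_ tb] IH; have [d d0 Hd] := slope t k (ltac:(by rewrite at_ tb)) k0.
  exists d => // s sd sb; have := Hd s sd sb; have := IH t; rewrite at_ lexx => /(_ isT).
  by lra.
- move=> t /andP[at_ tb] IH; apply/ler_addgt0Pr => g g0.
  have tab : `[a, b]%classic t by rewrite /= in_itv/= (ltW at_).
  have [d d0 Hd] := (within_continuousP f _).1 cf t (g / 2) tab (divr_gt0 g0 (ltr0n _ 2)).
  pose s := Num.max a (t - d / 2).
  have st : s < t by rewrite gt_max at_ ltrBlDr ltrDl divr_gt0.
  have as_ : a <= s by rewrite le_max lexx.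
  have := IH s; rewrite as_ st => /(_ isT) IHs.
  have td : `|t - s| < d.
    rewrite gtr0_norm ?subr_gt0//.
    have : t - d / 2 <= s by rewrite le_max lexx orbT.
    by lra.
  have sI : `[a, b]%classic s by rewrite /= in_itv/= as_ (le_trans (ltW st)).
  have := Hd s sI td; rewrite ltr_norml => /andP[h1 h2].
  have : k * (s - a) <= k * (t - a) by rewrite ler_pM2l//; lra.
  by lra.
Qed.

End RealInduction.

Section Slopes.
Context {R : realType}.
Local Notation mu := (@lebesgue_measure R).

Lemma is_deriveP (V : normedModType R) (f : R -> V) (t : R) (df : V) :
  is_derive t 1 f df <->
  (forall e, 0 < e -> exists2 d, 0 < d & forall s, `|s - t| < d ->
     `|f s - f t - (s - t) *: df| <= e * `|s - t|).
Proof.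
have E : (fun h : R => h^-1 *: ((f \o shift t) (h *: 1) - f t)) =
    (fun h => h^-1 *: (f (h + t) - f t)).
  by apply/funext => h /=; rewrite [_ *: 1]mulr1.
split=> [[dv dE] e e0|H].
  have : h^-1 *: (f (h + t) - f t) @[h --> 0^'] --> df.
    by rewrite -dE; move: dv; rewrite /derivable /derive E => H; exact: H.
  move/cvgrPdist_le => /(_ e e0) [d /= d0 Hd].
  exists d => // s; have [->|st] := eqVneq s t.
    by rewrite !subrr scale0r subrr !normr0 mulr0.
  move=> sd; have s0 : s - t != 0 by rewrite subr_eq0.
  have := Hd (s - t); rewrite /= sub0r normrN => /(_ sd s0).
  rewrite subrK => h.
  rewrite -[X in `|X - _|](@scalerKV _ _ (s - t)) // -scalerBr normrZ mulrC.
  by apply: ler_wpM2r => //; rewrite distrC.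
have Hc : h^-1 *: (f (h + t) - f t) @[h --> 0^'] --> df.
  apply/cvgrPdist_le => e e0; have [d d0 Hd] := H e e0.
  exists d => //= h; rewrite /= sub0r normrN => hd h0.
  have := Hd (h + t); rewrite addrK => /(_ hd) hh.
  rewrite -(ler_pM2r (_ : 0 < `|h|)) ?normr_gt0//; apply: le_trans hh.
  rewrite mulrC -normrZ scalerBr scalerA mulfV// scale1r distrC.
  by [].
split; first by apply/cvg_ex; exists df; rewrite E.
by rewrite /derive E; exact: cvg_lim.
Qed.

Lemma is_derive_near (V : normedModType R) (f g : R -> V) (t d : R) (df : V) :
  0 < d -> (forall s, `|s - t| < d -> f s = g s) ->
  is_derive t 1 f df -> is_derive t 1 g df.
Proof.
move=> d0 fg /is_deriveP H; apply/is_deriveP => e e0.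
have [d' d'0 Hd] := H e e0; exists (Num.min d d'); first by rewrite lt_min d0.
move=> s; rewrite lt_min => /andP[s1 s2]; rewrite -!fg ?subrr ?normr0//.
exact: Hd.
Qed.

Lemma is_derive_continuous (V : normedModType R) (f : R -> V) (t : R) (df : V) :
  is_derive t 1 f df -> {for t, continuous f}.
Proof. by case=> df' _; apply/differentiable_continuous/derivable1_diffP. Qed.

Lemma derC (t c : R) : is_derive t 1 (fun _ : R => c) 0.
Proof. exact: is_derive_cst. Qed.

Lemma derX (t : R) : is_derive t 1 (fun s : R => s) 1.
Proof. exact: is_derive_id. Qed.

Lemma derD (f g : R -> R) (t df dg : R) : is_derive t 1 f df ->
  is_derive t 1 g dg -> is_derive t 1 (fun s => f s + g s) (df + dg).
Proof. by move=> ? ?; apply: is_deriveD. Qed.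

Lemma derB (f g : R -> R) (t df dg : R) : is_derive t 1 f df ->
  is_derive t 1 g dg -> is_derive t 1 (fun s => f s - g s) (df - dg).
Proof. by move=> ? ?; apply: is_deriveB. Qed.

Lemma derN (f : R -> R) (t df : R) : is_derive t 1 f df ->
  is_derive t 1 (fun s => - f s) (- df).
Proof. by move=> ?; apply: is_deriveN. Qed.

Lemma derM (f g : R -> R) (t df dg : R) : is_derive t 1 f df ->
  is_derive t 1 g dg -> is_derive t 1 (fun s => f s * g s) (df * g t + f t * dg).
Proof.
move=> h1 h2; have := @is_deriveM _ _ f g t 1 df dg h1 h2.
by move=> h; apply: is_derive_eq h _; rewrite addrC; congr (_ + _); rewrite [LHS]mulrC.
Qed.

Lemma derZ (f : R -> R) (t c df : R) : is_derive t 1 f df ->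
  is_derive t 1 (fun s => c * f s) (c * df).
Proof. by move=> h; have := derM (derC t c) h; rewrite mul0r add0r. Qed.

Lemma der_comp (f g : R -> R) (t df dg : R) : is_derive (g t) 1 f df ->
  is_derive t 1 g dg -> is_derive t 1 (fun s => f (g s)) (df * dg).
Proof. by move=> h1 h2; apply: (@is_derive1_comp _ f g). Qed.

Lemma derV (f : R -> R) (t df : R) : f t != 0 -> is_derive t 1 f df ->
  is_derive t 1 (fun s => (f s)^-1) (- (f t) ^- 2 * df).
Proof. by move=> f0 h; exact: is_deriveV. Qed.

Lemma der_sqrt (f : R -> R) (t df : R) : 0 < f t -> is_derive t 1 f df ->
  is_derive t 1 (fun s => Num.sqrt (f s)) ((2 * Num.sqrt (f t))^-1 * df).
Proof. by move=> f0; apply: der_comp; exact: is_derive1_sqrt. Qed.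

Lemma der_sum (I : Type) (r : seq I) (f : I -> R -> R) (df : I -> R) (t : R) :
  (forall i, is_derive t 1 (f i) (df i)) ->
  is_derive t 1 (fun s => \sum_(i <- r) f i s) (\sum_(i <- r) df i).
Proof.
move=> h; elim: r => [|i r IH].
  by under eq_fun do rewrite big_nil; rewrite big_nil; exact: derC.
by under eq_fun do rewrite big_cons; rewrite big_cons; exact: derD.
Qed.

Lemma der_expR (k t : R) : is_derive t 1 (fun s => expR (k * s)) (k * expR (k * t)).
Proof.
have h := derZ k (derX t); rewrite mulr1 in h.
by rewrite mulrC; exact: (@der_comp expR _ _ _ _ (is_derive_expR _) h).
Qed.

(** A null set is caught in an open set of small measure; subtracting [L]
    times the measure of the part of that set to the left of the current point
    pays for the slope of [f] at the exceptional points. *)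
Lemma ae_nonincreasing (f : R -> R) (a b L : R) : a <= b -> 0 <= L ->
  (forall s t, a <= s <= b -> a <= t <= b -> `|f s - f t| <= L * `|s - t|) ->
  {ae mu, forall t, a < t < b -> exists2 df, is_derive t 1 f df & df <= 0} ->
  f b <= f a.
Proof.
move=> ab L0 fL [A [mA A0 HA]].
apply/ler_addgt0Pr => e e0.
pose A' := A `|` [set a].
have mA' : measurable A' by apply: measurableU.
have A'0 : mu A' = 0%E.
  apply/eqP; rewrite -measure_le0 -(adde0 0%E) (le_trans (measureU2 _ _ _))//.
  by rewrite leeD//; [rewrite [leLHS]A0|rewrite [leLHS](lebesgue_measure_set1 a)].
pose e1 := e / (L + 1).
have L1 : 0 < L + 1 by lra.
have e10 : 0 < e1 by rewrite divr_gt0.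
have A'fin : (mu A' < +oo)%E by rewrite A'0.
have [U [oU AU muU]] := lebesgue_regularity_outer mA' A'fin e10.
have mU : measurable U by exact: open_measurable.
have muUe : (mu U <= e1%:E)%E.
  have -> : U = A' `|` (U `\` A') by rewrite setDUK.
  apply: (le_trans (measureU2 _ _ _)) => //; first exact: measurableD.
  by rewrite [X in (X + _)%E]A'0 add0e ltW.
have mono (B C : set R) : measurable B -> measurable C -> B `<=` C -> (mu B <= mu C)%E.
  by move=> mB mC BC; apply: le_measure => //; rewrite inE.
pose psi t := fine (mu (U `&` `[a, t])).
have mI (i : interval R) : measurable (U `&` [set` i]) by exact: measurableI.
have psifin t : mu (U `&` `[a, t]) \is a fin_num.
  rewrite ge0_fin_numE//; apply: le_lt_trans (ltry e1).
  by apply: le_trans muUe; apply: mono => // x [].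
have psiD s t : a <= s -> s <= t -> (mu (U `&` `[a, t]) = mu (U `&` `[a, s]) + mu (U `&` `]s, t]))%E.
  move=> as_ st; rewrite -[RHS](measureU mu (mI `[a, s]) (mI `]s, t])).
    by rewrite -setIUr -itv_bndbnd_setU// bnd_simp.
  rewrite -subset0 => x [] [_ /=]; rewrite !in_itv/= => /andP[_ xs] [_ /andP[]].
  by rewrite ltNge xs.
have psimono s t : a <= s -> s <= t -> psi s <= psi t.
  move=> as_ st; rewrite /psi fine_le//.
  by apply: mono => //; apply: setIS => x /=; rewrite !in_itv/= => /andP[-> /le_trans]; apply.
have psi_lip s t : a <= s -> s <= t -> psi t - psi s <= t - s.
  move=> as_ st; rewrite lerBlDl -lee_fin EFinD !fineK// (psiD s t)// leeD2l//.
  have := lebesgue_measure_itv `]s, t]; rewrite /= lte_fin => h.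
  apply: (@le_trans _ _ (mu `]s, t])); first by apply: mono => // x [].
  by rewrite h; case: ifPn => //; rewrite lee_fin subr_ge0.
have psi_U s t : a <= s -> s <= t -> `]s, t] `<=` U -> psi t - psi s = t - s.
  move=> as_ st stU; have E : U `&` `]s, t] = `]s, t]%classic by apply/setIidPr.
  have Emu : mu `]s, t] = (t - s)%:E.
    have := lebesgue_measure_itv `]s, t]; rewrite /= lte_fin => ->; case: ltP => // ts.
    have -> : t = s by apply/le_anti; rewrite ts st.
    by rewrite subrr.
  have := psiD s t as_ st; rewrite E Emu /psi => ->.
  by rewrite fineD//= addrAC subrr add0r.
pose g t := f t - L * psi t.
have gb : g b <= g a.
  apply: nonincreasing_right_slope => //.
    apply/within_continuousP => t d; rewrite /= in_itv/= => tab d0.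
    exists (d / (2 * L + 1)); first by rewrite divr_gt0//; lra.
    move=> s; rewrite /= in_itv/= => sab; rewrite ltr_pdivlMr; last by lra.
    move=> ts; rewrite /g.
    have -> : f t - L * psi t - (f s - L * psi s) = (f t - f s) - L * (psi t - psi s) by ring.
    apply: le_lt_trans ts; apply: (le_trans (ler_normB _ _)).
    rewrite normrM (ger0_norm L0).
    have h2 : `|psi t - psi s| <= `|t - s|.
      move/andP: tab => [at_ _]; move/andP: sab => [as_ _].
      wlog st : s t at_ as_ / s <= t.
        move=> H; have [st|/ltW st] := leP s t; first exact: H.
        by rewrite distrC [leRHS]distrC; exact: H.
      by rewrite !ger0_norm ?subr_ge0// ?psi_lip ?psimono.
    have := fL t s tab sab; have := ler_wpM2l L0 h2; have := normr_ge0 (t - s).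
    by nra.
  move=> t d /andP[at_ tb] d0.
  have [A't|nA't] := pselect (A' t).
    have [r /= r0 Hr] := oU t (AU t A't).
    exists r => // s /andP[ts sr] sb; rewrite /g.
    have h1 : psi s - psi t = s - t.
      apply: psi_U => //; first exact: ltW.
      move=> x /=; rewrite in_itv/= => /andP[tx xs]; apply: Hr.
      rewrite /ball/= distrC gtr0_norm ?subr_gt0//; lra.
    have := fL s t; rewrite (le_trans at_ (ltW ts)) sb at_ (ltW tb) => /(_ isT isT).
    rewrite (gtr0_norm (_ : 0 < s - t)) ?subr_gt0// => h2.
    have := ler_norm (f s - f t).
    have : 0 <= d * (s - t) by apply: mulr_ge0; [exact: ltW|rewrite subr_ge0 ltW].
    have := congr1 ( *%R L) h1; lra.
  have at' : a < t.
    rewrite lt_neqAle at_ andbT; apply: contra_notN nA't => /eqP <-.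
    by right.
  have : ~ ~ (a < t < b -> exists2 df, is_derive t 1 f df & df <= 0).
    by move=> H; apply: nA't; left; apply: HA.
  move=> /contrapT; rewrite at' tb => /(_ isT) [df /is_deriveP Hdf df0].
  have [r r0 Hr] := Hdf d d0.
  exists r => // s /andP[ts sr] sb; rewrite /g.
  have := Hr s; rewrite gtr0_norm ?subr_gt0// ltrBlDl => /(_ sr) h.
  have := le_trans (ler_norm _) h; rewrite [_ *: _]/GRing.scale/= => h1.
  have h2 : 0 <= L * (psi s - psi t) by rewrite mulr_ge0// subr_ge0 psimono// ltW.
  have h3 : (s - t) * df <= 0 by rewrite mulr_ge0_le0// subr_ge0 ltW.
  by lra.
have h1 : psi b <= e1.
  rewrite -lee_fin fineK//; apply: le_trans muUe.
  by apply: mono => // x [].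
have h2 : 0 <= psi a by rewrite fine_ge0.
have : L * psi b <= e.
  apply: (@le_trans _ _ ((L + 1) * e1)).
    by apply: ler_pM => //; [rewrite fine_ge0|lra].
  by rewrite /e1 mulrC divfK// gt_eqF.
have := mulr_ge0 L0 h2.
by move: gb; rewrite /g; lra.
Qed.

End Slopes.

(** * Ordinary differential equations with a Lipschitz field *)

Section MeanValue.
Context {R : realType}.
Local Notation mu := (@lebesgue_measure R).

Lemma derive_le (f df : R -> R) (a b c : R) : a <= b ->
  {within `[a, b], continuous f} ->
  (forall t, a < t < b -> is_derive t 1 f (df t)) ->
  (forall t, a < t < b -> df t <= c) -> f b - f a <= c * (b - a).
Proof.
move=> ab cf dfE dfc; have [<-|anb] := eqVneq a b; first by rewrite !subrr mulr0.
have ab' : a < b by rewrite lt_neqAle anb.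
have dfE' x : x \in `]a, b[%R -> is_derive x 1 f (df x).
  by rewrite in_itv; exact: dfE.
have [z + ->] := MVT ab' dfE' cf.
by rewrite in_itv/= => /dfc h; apply: ler_wpM2r => //; rewrite subr_ge0.
Qed.

Lemma derive_norm_le (f df : R -> R) (a b c : R) : a <= b ->
  {within `[a, b], continuous f} ->
  (forall t, a < t < b -> is_derive t 1 f (df t)) ->
  (forall t, a < t < b -> `|df t| <= c) -> `|f b - f a| <= c * (b - a).
Proof.
move=> ab cf dfE dfc; rewrite ler_norml; apply/andP; split.
  rewrite lerNl; have := @derive_le (\- f) (\- df) a b c ab.
  rewrite /= -opprD; apply => //.
  - by move=> x; apply: continuousN; apply: cf.
  - by move=> t tab; apply: is_deriveN; exact: dfE.
  - by move=> t /dfc; rewrite ler_norml lerNl => /andP[].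
apply: (derive_le ab cf dfE) => t /dfc; rewrite ler_norml.
by move=> /andP[].
Qed.

Lemma ex_primitive (g : R -> R) : continuous g ->
  exists G : R -> R, G 0 = 0 /\ forall t : R, -1 < t -> is_derive t 1 G (g t).
Proof.
move=> cg.
pose F (t : R) : R := \int[mu]_(s in `[-1, t]) g s.
exists (fun t => F t - F 0); split; first by rewrite subrr.
move=> t t1.
have [dF dFE] : derivable F t 1 /\ derive1 F t = g t.
  apply: (@continuous_FTC1_closed _ _ _ _ (t + 1)) => //.
  - by rewrite ltrDl.
  - apply: continuous_compact_integrable; first exact: segment_compact.
    exact: continuous_subspaceT.
  - exact: cg.
have : is_derive t 1 F (g t) by split; [exact: dF|rewrite -dFE derive1E].
by move=> ?; rewrite -[g t]subr0; apply: is_deriveB.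
Qed.

Lemma geometric_limit (u : nat -> R) (c : R) :
  (forall k, `|u k.+1 - u k| <= c / 2 ^+ k) ->
  exists l, forall k, `|u k - l| <= 2 * c / 2 ^+ k.
Proof.
move=> uc.
have e2 k : 2 * c / 2 ^+ k = 2 * (c / 2 ^+ k) by rewrite mulrA.
have e3 k : c / 2 ^+ k = 2 * (c / 2 ^+ k.+1).
  by rewrite exprS invfM [in RHS]mulrCA [in RHS](mulrA 2) mulfV ?mul1r// pnatr_eq0.
have inc k m : u k - 2 * (c / 2 ^+ k) <= u (k + m)%N - 2 * (c / 2 ^+ (k + m)).
  elim: m => [|m IH]; first by rewrite addn0.
  apply: (le_trans IH); rewrite addnS; have := uc (k + m)%N.
  by rewrite ler_norml e3 => /andP[]; lra.
have dec k m : u (k + m)%N + 2 * (c / 2 ^+ (k + m)) <= u k + 2 * (c / 2 ^+ k).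
  elim: m => [|m IH]; first by rewrite addn0.
  apply: le_trans IH; rewrite addnS; have := uc (k + m)%N.
  by rewrite ler_norml e3 => /andP[]; lra.
have c0 k : 0 <= c / 2 ^+ k by apply: le_trans (uc k).
pose S := [set u k - 2 * (c / 2 ^+ k) | k in [set: nat]].
have ub k : ubound S (u k + 2 * (c / 2 ^+ k)).
  move=> _ [m _ <-].
  by have := inc m k; have := dec k m; have := c0 (k + m)%N; rewrite addnC; lra.
exists (sup S) => k; rewrite e2.
have h1 : u k - 2 * (c / 2 ^+ k) <= sup S.
  apply: sup_upper_bound; last by exists k.
  by split; [exists (u 0%N - 2 * (c / 2 ^+ 0)), 0%N|exists (u 0%N + 2 * (c / 2 ^+ 0)); exact: ub].
have h2 : sup S <= u k + 2 * (c / 2 ^+ k).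
  by apply: ge_sup; [exists (u 0%N - 2 * (c / 2 ^+ 0)), 0%N|exact: ub].
by rewrite ler_norml; lra.
Qed.

Lemma half_pow_small (c e : R) : 0 <= c -> 0 < e -> exists k, c / 2 ^+ k < e.
Proof.
move=> c0 e0; have [n hn] : exists n : nat, c / e < n%:R.
  by exists (Num.bound (c / e)); rewrite (archi_boundP _)// divr_ge0// ltW.
exists n; rewrite ltr_pdivrMr ?exprn_gt0// mulrC -ltr_pdivrMr//.
apply: (lt_le_trans hn); rewrite -natrX ler_nat; apply: ltnW.
exact: ltn_expl.
Qed.

End MeanValue.

Section Picard.
Context {R : realType}.
Variables (I : finType) (F : I -> (I -> R) -> R) (L T : R) (x0 : I -> R).
Implicit Types (s t r c e : R).
Hypothesis L0 : 0 <= L.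
Hypothesis T0 : 0 < T.
Hypothesis FL : forall i x y, `|F i x - F i y| <= L * \sum_k `|x k - y k|.

Let clamp (s : R) := Num.max 0 (Num.min s T).

Let clamp_ge0 s : 0 <= clamp s. Proof. by rewrite le_max lexx. Qed.

Let clamp_leT s : clamp s <= T.
Proof. by rewrite ge_max ltW//= ge_min lexx orbT. Qed.

Let clamp_id s : 0 <= s <= T -> clamp s = s.
Proof.
by rewrite /clamp => /andP[s0 sT]; rewrite min_l// max_r.
Qed.

Let clamp_lip s t : `|clamp s - clamp t| <= `|s - t|.
Proof. by rewrite /clamp /Num.max /Num.min; do ![case: ifPn]; rewrite -?leNgt; rewrite /Order.min; do ?[case: ifPn]; rewrite -?leNgt => *; rewrite ?subrr ?normr0// ?ler_norml; case: (ger0P (s - t)); lra. Qed.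

Let sumLip (x y : I -> R) c : (forall k, `|x k - y k| <= c) ->
  \sum_k `|x k - y k| <= #|I|%:R * c.
Proof.
move=> h; apply: (@le_trans _ _ (\sum_(k : I) c)); first exact: ler_sum.
by rewrite sumr_const mulr_natl.
Qed.

Let F_le i (x y : I -> R) c : (forall k, `|x k - y k| <= c) ->
  `|F i x - F i y| <= L * #|I|%:R * c.
Proof.
move=> h; apply: (le_trans (FL i x y)); rewrite -mulrA.
by apply: ler_wpM2l => //; exact: sumLip.
Qed.

Let F_cont i (z : I -> R -> R) : (forall k, continuous (z k)) ->
  continuous (fun s => F i (fun k => z k s)).
Proof.
move=> cz s; apply/cvgrPdist_lt => e e0.
pose K := L * #|I|%:R + 1.
have K0 : 0 < K by rewrite ltr_wpDl// mulr_ge0.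
have h k : \forall t \near s, `|z k s - z k t| < e / K.
  by have /cvgrPdist_lt := cz k s; apply; rewrite divr_gt0.
have : \forall t \near s, forall k, `|z k s - z k t| < e / K.
  exact: filter_forall h.
apply: filterS => t ht.
apply: le_lt_trans (F_le i (c := e / K) _) _; first by move=> k; exact/ltW/ht.
by rewrite -ltr_pdivlMr ?divr_gt0// invf_div mulrCA mulfV ?gt_eqF// mulr1 ltrDl.
Qed.

Let prim (g : R -> R) : R -> R :=
  xget (fun=> 0) [set G : R -> R | G 0 = 0 /\ forall t : R, -1 < t -> is_derive t 1 G (g t)].

Let primP (g : R -> R) : continuous g ->
  prim g 0 = 0 /\ forall t : R, -1 < t -> is_derive t 1 (prim g) (g t).
Proof.
by move=> /ex_primitive cg; have := xgetPex (fun=> 0) cg.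
Qed.

Let prim_cont (g : R -> R) s : continuous g -> -1 < s -> {for s, continuous (prim g)}.
Proof.
by move=> /primP[_ h] s1; apply: is_derive_continuous; exact: h.
Qed.

Let clamp_cont : continuous clamp.
Proof.
move=> s; apply/cvgrPdist_lt => e e0; exists e => //= t st.
by apply: le_lt_trans (clamp_lip s t) _.
Qed.

Let primc_cont (g : R -> R) (c : R) : continuous g ->
  continuous (fun s => c + prim g (clamp s)).
Proof.
move=> cg s; apply: (@continuousD _ _ _ (cst c) (prim g \o clamp)); first exact: cst_continuous.
apply: continuous_comp; first exact: clamp_cont.
by apply: prim_cont => //; apply: lt_le_trans (clamp_ge0 s); rewrite oppr_lt0.
Qed.

(* Weighting the differences of iterates by exp(kappa t) makes the Picard map
   a contraction of ratio 1/2 on the whole of [0, T]. *)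
Let kappa := 2 * (L * #|I|%:R) + 1.

Let kappa0 : 0 < kappa.
Proof. by rewrite ltr_wpDl// mulr_ge0// mulr_ge0. Qed.

Let prim_le (g1 g2 : R -> R) (c : R) : continuous g1 -> continuous g2 -> 0 <= c ->
  (forall s, 0 <= s <= T -> `|g1 s - g2 s| <= L * #|I|%:R * (c * expR (kappa * s))) ->
  forall t, 0 <= t <= T -> `|prim g1 t - prim g2 t| <= c / 2 * expR (kappa * t).
Proof.
move=> c1 c2 c0 h t /andP[t0 tT].
have [p10 p1] := primP c1; have [p20 p2] := primP c2.
have key (a1 a2 : R -> R) : continuous a1 -> continuous a2 ->
    (forall s, 0 <= s <= T -> a1 s - a2 s <= L * #|I|%:R * (c * expR (kappa * s))) ->
    prim a1 t - prim a2 t <= c / 2 * expR (kappa * t).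
  move=> ca1 ca2 ha; have [q10 q1] := primP ca1; have [q20 q2] := primP ca2.
  pose f (s : R) : R := prim a1 s - prim a2 s - c / 2 * expR (kappa * s).
  have df (s : R) : -1 < s -> is_derive s 1 f (a1 s - a2 s - c / 2 * (kappa * expR (kappa * s))).
    move=> s1; have i1 := q1 s s1; have i2 := q2 s s1.
    exact: (derB (derB i1 i2) (derZ _ (der_expR kappa s))).
  have dfI s : 0 < s < t -> is_derive s 1 f (a1 s - a2 s - c / 2 * (kappa * expR (kappa * s))).
    by move=> /andP[s0 _]; apply: df; apply: lt_trans s0; rewrite oppr_lt0.
  have := @derive_le _ f _ 0 t 0 t0 _ dfI.
  rewrite mul0r /f q10 q20 mulr0 expR0 mulr1; move=> H.
  have := expR_gt0 (kappa * t); have : 0 <= c / 2 by rewrite divr_ge0.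
  suff : prim a1 t - prim a2 t - c / 2 * expR (kappa * t) - (0 - 0 - c / 2) <= 0 by lra.
  apply: H.
  - apply: derivable_within_continuous => s; rewrite in_itv/= => /andP[s0 _].
    by have [] := df s (lt_le_trans (ltac:(by rewrite oppr_lt0) : -1 < 0 :> R) s0).
  - move=> s /andP[s0 st]; rewrite subr_le0.
    apply: (le_trans (ha s _)); first by rewrite !ltW// (lt_le_trans st).
    rewrite [leRHS](_ : _ = kappa / 2 * (c * expR (kappa * s))); last by lra.
    apply: ler_wpM2r; first by rewrite mulr_ge0// expR_ge0.
    by rewrite /kappa; lra.
rewrite ler_norml; apply/andP; split.
  rewrite lerNl opprB; apply: key => // s hs.
  by have := h s hs; rewrite distrC ler_norml => /andP[].
by apply: key => // s /h; rewrite ler_norml => /andP[].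
Qed.

Fixpoint picard k : I -> R -> R :=
  if k is k'.+1 then
    fun i s => x0 i + prim (fun r => F i (fun j => picard k' j r)) (clamp s)
  else fun i _ => x0 i.

Let picard_cont k i : continuous (picard k i).
Proof.
elim: k i => [|k IH] i /=; first by move=> s; exact: cst_continuous.
exact/primc_cont/F_cont.
Qed.

Let picard_step (M : R) : (forall i s, `|picard 1 i s - picard 0 i s| <= M) -> 0 <= M ->
  forall k i s, `|picard k.+1 i s - picard k i s| <= M / 2 ^+ k * expR (kappa * clamp s).
Proof.
move=> hM M0; elim=> [|k IH] i s.
  rewrite expr0 divr1; apply: (le_trans (hM i s)).
  rewrite ler_peMr// -expR0 ler_expR mulr_ge0//; exact/ltW.
rewrite /= opprD addrACA subrr add0r.
have -> : M / 2 ^+ k.+1 = M / 2 ^+ k / 2 by rewrite exprS invfM; ring.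
apply: prim_le => //.
- exact: (F_cont (@picard_cont k.+1)).
- exact: (F_cont (@picard_cont k)).
- by rewrite divr_ge0// exprn_ge0.
- move=> r /clamp_id hr; apply: F_le => j; have := IH j r; rewrite /= hr; exact.

- by rewrite clamp_ge0 clamp_leT.
Qed.

Theorem lipschitz_ode : exists x : I -> R -> R,
  (forall i, x i 0 = x0 i) /\
  forall i t, 0 <= t <= T -> is_derive t 1 (x i) (F i (fun j => x j t)).
Proof.
have [M [M0 hM]] : exists M, 0 <= M /\ forall i s, `|picard 1 i s - picard 0 i s| <= M.
  have h i : exists M, 0 <= M /\ forall s, `|picard 1 i s - picard 0 i s| <= M.
    have cz : continuous (fun _ : R => F i x0) by move=> s; exact: cst_continuous.
    have [p0 p] := primP cz.
    exists (`|F i x0| * T); split; first by rewrite mulr_ge0// ltW.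
    move=> s; rewrite /= addrC addKr -[prim _ _]subr0 -[X in _ - X]p0.
    have pI r : 0 < r < clamp s -> is_derive r 1 (prim (fun _ => F i x0)) (F i x0).
      by move=> /andP[r0 _]; apply: p; apply: lt_trans r0; rewrite oppr_lt0.
    have pc : {within `[0, clamp s], continuous (prim (fun _ => F i x0))}.
      apply: derivable_within_continuous => r; rewrite in_itv/= => /andP[r0 _].
      by have [] := p r (lt_le_trans (ltac:(by rewrite oppr_lt0) : -1 < 0 :> R) r0).
    apply: (le_trans (derive_norm_le (clamp_ge0 s) pc pI (fun r _ => lexx `|F i x0|))).
    by rewrite subr0; apply: ler_wpM2l.
  have [M hM] := choice h.
  exists (\sum_i M i); split; first by apply: sumr_ge0 => i _; case: (hM i).
  move=> i s; apply: (le_trans ((hM i).2 s)); rewrite (bigD1 i)//= lerDl.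
  by apply: sumr_ge0 => j _; case: (hM j).
pose M' := M * expR (kappa * T).
have M'0 : 0 <= M' by rewrite mulr_ge0// expR_ge0.
have step k i s : `|picard k.+1 i s - picard k i s| <= M' / 2 ^+ k.
  apply: (le_trans (picard_step hM M0 k i s)); rewrite /M' -mulrA mulrAC mulrA.
  apply: ler_wpM2l; first by rewrite divr_ge0// exprn_ge0.
  by rewrite ler_expR ler_pM2l.
have lim i s : exists l, forall k, `|picard k i s - l| <= 2 * M' / 2 ^+ k.
  by apply: geometric_limit => k; exact: step.
have [z hz] : exists z : I -> R -> R, forall i s k, `|picard k i s - z i s| <= 2 * M' / 2 ^+ k.
  have [z hz] := choice (fun p : I * R => lim p.1 p.2).
  by exists (fun i s => z (i, s)) => i s k; exact: (hz (i, s)).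
have M'20 : 0 <= 2 * M' by rewrite mulr_ge0.
have cz i : continuous (z i).
  move=> s; apply/cvgrPdist_lt => e e0.
  have [k hk] := half_pow_small M'20 (divr_gt0 e0 (ltr0n _ 3)).
  have /cvgrPdist_lt/(_ (e / 3) (divr_gt0 e0 (ltr0n _ 3))) := @picard_cont k i s.
  apply: filterS => t ht; have h1 := hz i s k; have h2 := hz i t k.
  rewrite distrC in h1.
  have := le_lt_trans h1 hk; have := le_lt_trans h2 hk; move: ht.
  rewrite !ltr_norml => /andP[? ?] /andP[? ?] /andP[? ?].
  by apply/andP; split; lra.
have cF i : continuous (fun s => F i (fun k => z k s)) by exact: (F_cont cz).
have zE i t : 0 <= t <= T -> z i t = x0 i + prim (fun r => F i (fun j => z j r)) t.
  move=> tT; apply/eqP; rewrite -subr_eq0 -normr_le0; apply/ler_addgt0Pr => e e0.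
  rewrite add0r.
  pose A := 2 * M' + M' * expR (kappa * T).
  have A0 : 0 <= A by rewrite addr_ge0// mulr_ge0// expR_ge0.
  have [k hk] := half_pow_small A0 e0.
  have h1 := hz i t k.+1.
  have h2 : `|prim (fun r => F i (fun j => picard k j r)) t -
             prim (fun r => F i (fun j => z j r)) t| <=
            2 * M' / 2 ^+ k / 2 * expR (kappa * t).
    apply: prim_le => //; [exact: (F_cont (@picard_cont k))|by rewrite divr_ge0// exprn_ge0|].
    move=> s /andP[s0 _]; apply: F_le => j; apply: (le_trans (hz j s k)).
    rewrite ler_peMr// ?divr_ge0 ?exprn_ge0// -expR0 ler_expR mulr_ge0//; exact/ltW.
  move: h1; rewrite /= clamp_id// => h1.
  have e1 : 2 * M' / 2 ^+ k.+1 <= 2 * M' / 2 ^+ k.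
    apply: ler_wpM2l => //; rewrite lef_pV2 ?posrE ?exprn_gt0// exprS.
    by rewrite ler_peMl ?exprn_ge0// ler1n.
  have e2 : 2 * M' / 2 ^+ k / 2 * expR (kappa * t) <= M' * expR (kappa * T) / 2 ^+ k.
    have -> : 2 * M' / 2 ^+ k / 2 * expR (kappa * t) = M' / 2 ^+ k * expR (kappa * t) by field; rewrite expf_neq0.
    rewrite [leRHS]mulrAC; apply: ler_wpM2l; first by rewrite divr_ge0// exprn_ge0.
    by rewrite ler_expR ler_pM2l//; case/andP: tT.
  have e3 : 2 * M' / 2 ^+ k + M' * expR (kappa * T) / 2 ^+ k < e.
    by rewrite -mulrDl.
  move: h1 h2; rewrite !ler_norml => /andP[? ?] /andP[? ?].
  by apply/andP; split; lra.
exists (fun i t => x0 i + prim (fun r => F i (fun j => z j r)) t); split.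
  by move=> i; rewrite (primP (cF i)).1 addr0.
move=> i t tT.
have -> : (fun j => x0 j + prim (fun r => F j (fun j => z j r)) t) = (fun j => z j t).
  by apply/funext => j; rewrite zE.
have t1 : -1 < t by case/andP: tT => t0 _; apply: lt_le_trans t0.
have := (primP (cF i)).2 t t1.
by move=> ?; rewrite -[F i _]add0r; apply: is_deriveD.
Qed.

End Picard.

(** * Polygons and the stability estimate *)

Lemma sum_tangent_identity {R : realType} (c c' m : R) (t t' v : 'rV[R]_2) :
  dot t t = 1 -> dot t' t' = 1 ->
  ((c + c') / 2) *: v - (t' - t) + m *: perp (c *: t + c' *: t') = 0 ->
  (c + c') / 2 * dot (t + t') v = m * ((c' - c) * dot (perp t) t').
Proof.
move=> t1 t2 /(congr1 (dot (t + t'))); move: t1 t2.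
by rewrite dot0r !dotE !mxE/=; lra.
Qed.

Section LocalEstimates.
Context {R : realType}.
Local Notation E2 := 'rV[R]_2.
Variables (M h E ell mx my : R) (p p' r r' u V : E2).
Local Notation Q := (enorm p). Local Notation Q' := (enorm p').
Local Notation q := (enorm r). Local Notation q' := (enorm r').
Local Notation d := `|q - Q|. Local Notation d' := `|q' - Q'|.
Local Notation th := (enorm (dir r - dir p)).
Local Notation th' := (enorm (dir r' - dir p')).
Local Notation a := (d + h * th). Local Notation a' := (d' + h * th').
Local Notation e := (u - V).
Local Notation delta := (dir r' - dir r - (dir p' - dir p)).
Local Notation b := (a + a' + h * ell + E).
Hypotheses (M1 : 1 <= M) (h0 : 0 < h) (E0 : 0 <= E) (ell0 : 0 <= ell).
Hypotheses (HQ : h / M <= Q <= M * h) (HQ' : h / M <= Q' <= M * h).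
Hypotheses (hd : d <= h / (64 * M ^+ 2)) (hd' : d' <= h / (64 * M ^+ 2)).
Hypotheses (Hmx : 0 <= mx <= M) (Hmy : 0 <= my <= M).
Hypothesis (Hmxy : `|my - mx| <= M ^+ 2 * ell).
Hypothesis (Hu : enorm u <= M).
Hypothesis (HR : enorm (((Q + Q') / 2) *: u - (dir p' - dir p) + mx *: perp (p + p')) <= E).
Hypothesis (HY : ((q + q') / 2) *: V - (dir r' - dir r) + my *: perp (r + r') = 0).
Hypothesis (HT : enorm (dir p' - dir p) <= M * h).
Hypothesis (HTu : `|dot (dir p + dir p') u| <= E).
Hypothesis (HdQ : `|Q' - Q| <= E).

Let M0 : 0 < M. Proof. by apply: lt_le_trans M1. Qed.

Let M2 : M <= M ^+ 2. Proof. by rewrite expr2 ler_peMr// ltW. Qed.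

Let hM : 0 < h / M. Proof. exact: divr_gt0. Qed.

Lemma small_gap : h / (64 * M ^+ 2) <= h / M / 2.
Proof.
rewrite -!mulrA ler_pM2l// -!invfM lef_pV2 ?posrE ?mulr_gt0 ?exprn_gt0//.
by have := M2; have := M0; lra.
Qed.

Lemma small_gap' : h / (64 * M ^+ 2) <= M * h.
Proof.
apply: (le_trans small_gap); have : h / M <= M * h; last by have := hM; lra.
by rewrite ler_pdivrMr// mulrC mulrA -expr2 ler_peMl ?(ltW h0)// (le_trans M1).
Qed.

Lemma q_bounds : h / M / 2 <= q <= 2 * M * h.
Proof.
have := HQ; have := small_gap; have := small_gap'; have := hd.
by rewrite ler_norml => /andP[? ?] ? ? /andP[? ?]; apply/andP; split; lra.
Qed.

Lemma q'_bounds : h / M / 2 <= q' <= 2 * M * h.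
Proof.
have := HQ'; have := small_gap; have := small_gap'; have := hd'.
by rewrite ler_norml => /andP[? ?] ? ? /andP[? ?]; apply/andP; split; lra.
Qed.

Lemma edge_gap (s v : E2) : s != 0 -> enorm v <= M * h ->
  enorm (s - v) <= M * (`|enorm s - enorm v| + h * enorm (dir s - dir v)).
Proof.
move=> s0 vM.
have -> : s - v = (enorm s - enorm v) *: dir s + enorm v *: (dir s - dir v).
  by rewrite scalerBr !scalerBl !dirK addrA subrK.
apply: (le_trans (enormD _ _)); rewrite (enormZ (_ - _)) (enormZ (enorm v)).
rewrite enorm_dir// mulr1 (ger0_norm (enorm_ge0 v)).
rewrite mulrDr lerD//; first by rewrite ler_peMl.
by rewrite mulrA ler_wpM2r// enorm_ge0.
Qed.

Lemma r_neq0 : r != 0.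
Proof. by rewrite -enorm_gt0; have /andP[? _] := q_bounds; have := hM; lra. Qed.

Lemma r'_neq0 : r' != 0.
Proof. by rewrite -enorm_gt0; have /andP[? _] := q'_bounds; have := hM; lra. Qed.

Let th0 : 0 <= th. Proof. exact: enorm_ge0. Qed.
Let th'0 : 0 <= th'. Proof. exact: enorm_ge0. Qed.
Let hth0 : 0 <= h * th. Proof. by apply: mulr_ge0 => //; exact: ltW. Qed.
Let hth'0 : 0 <= h * th'. Proof. by apply: mulr_ge0 => //; exact: ltW. Qed.
Let hell0 : 0 <= h * ell. Proof. by apply: mulr_ge0 => //; exact: ltW. Qed.
Let d0 : 0 <= d. Proof. exact: normr_ge0. Qed.
Let d'0 : 0 <= d'. Proof. exact: normr_ge0. Qed.
Let b0 : 0 <= b. Proof. by rewrite !addr_ge0. Qed.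
Let e0 : 0 <= enorm e. Proof. exact: enorm_ge0. Qed.
Let M3 : M ^+ 2 <= M ^+ 3. Proof. by rewrite [M ^+ 3]exprS ler_peMl// exprn_ge0// ltW. Qed.
Let M4 : M ^+ 3 <= M ^+ 4. Proof. by rewrite [M ^+ 4]exprS ler_peMl// exprn_ge0// ltW. Qed.

(** Subtracting the two nodal equations leaves consistency error and
    geometric differences only. *)
Lemma error_equation :
  enorm (((q + q') / 2) *: e + delta) <= 3 * M ^+ 3 * b.
Proof.
pose Rs := ((Q + Q') / 2) *: u - (dir p' - dir p) + mx *: perp (p + p').
have hR : enorm Rs <= E := HR.
have -> : ((q + q') / 2) *: e + delta =
    Rs + ((q - Q + (q' - Q')) / 2) *: u + my *: perp (r - p + (r' - p'))
    + (my - mx) *: perp (p + p').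
  have -> : ((q + q') / 2) *: e = ((q + q') / 2) *: u - ((dir r' - dir r) - my *: perp (r + r')).
    rewrite scalerBr; congr (_ - _); apply/eqP; rewrite -subr_eq0 opprB addrA -HY.
    by apply/eqP; rewrite addrAC.
  by rewrite /Rs; apply: row2P; rewrite !mxE/=; ring.
apply: (le_trans (enormD _ _)).
apply: (le_trans (lerD (enormD _ _) (lexx _))).
apply: (le_trans (lerD (lerD (enormD _ _) (lexx _)) (lexx _))).
rewrite (enormZ (_ / _)) (enormZ my) (enormZ (my - _)) !enorm_perp.
have h1 : `|(q - Q + (q' - Q')) / 2| * enorm u <= (d + d') / 2 * M.
  apply: ler_pM => //; first exact: enorm_ge0.
  rewrite normrM (ger0_norm (_ : 0 <= 2^-1)) ?invr_ge0// ler_wpM2r ?invr_ge0//.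
  exact: ler_normD.
have h2 : `|my| * enorm (r - p + (r' - p')) <= M * (M * a + M * a').
  apply: ler_pM => //; first exact: enorm_ge0.
    by rewrite ger0_norm; case/andP: Hmy.
  apply: (le_trans (enormD _ _)); apply: lerD; apply: edge_gap => //.
  - exact: r_neq0.
  - by case/andP: HQ.
  - exact: r'_neq0.
  - by case/andP: HQ'.
have h3 : `|my - mx| * enorm (p + p') <= M ^+ 2 * ell * (M * h + M * h).
  apply: ler_pM => //; first exact: enorm_ge0.
  apply: (le_trans (enormD _ _)); apply: lerD.
    by case/andP: HQ.
  by case/andP: HQ'.
have h4 : (d + d') / 2 * M <= M ^+ 3 * (a + a').
  have : (d + d') / 2 <= a + a'.
    by have := d0; have := d'0; have := hth0; have := hth'0; lra.
  move=> /(ler_wpM2l (ltW M0)) hh; rewrite [leLHS]mulrC.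
  apply: (le_trans hh); apply: ler_wpM2r; first by rewrite !addr_ge0.
  exact: le_trans M3.
have h5 : M * (M * a + M * a') <= M ^+ 3 * (a + a').
  rewrite -mulrDr mulrA -expr2; apply: ler_wpM2r => //.
  by rewrite !addr_ge0.
have h6 : M ^+ 2 * ell * (M * h + M * h) = 2 * M ^+ 3 * (h * ell) by ring.
have h7 : E <= M ^+ 3 * E by rewrite ler_peMl// (le_trans M1)// (le_trans M2).
have := hR; have : 0 <= M ^+ 3 * E by rewrite mulr_ge0// exprn_ge0// ltW.
have : 0 <= M ^+ 3 * (h * ell) by rewrite mulr_ge0// exprn_ge0// ltW.
have : 0 <= M ^+ 3 * (a + a') by rewrite mulr_ge0 ?addr_ge0// exprn_ge0// ltW.
have -> : 3 * M ^+ 3 * b = 3 * (M ^+ 3 * (a + a')) + 3 * (M ^+ 3 * (h * ell)) + 3 * (M ^+ 3 * E) by ring.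
by lra.
Qed.

Lemma delta_bound : enorm delta <= 2 * M * h * enorm e + 3 * M ^+ 3 * b.
Proof.
have -> : delta = ((q + q') / 2) *: e + delta - ((q + q') / 2) *: e.
  by rewrite [RHS]addrAC subrr add0r.
apply: (le_trans (enormB _ _)); rewrite addrC; apply: lerD; last exact: error_equation.
rewrite enormZ; apply: ler_wpM2r; first exact: enorm_ge0.
have /andP[l1 l2] := q_bounds; have /andP[l3 l4] := q'_bounds.
by rewrite ger0_norm; have := hM; lra.
Qed.

(** The right-hand side of the flow is almost normal to the polygon: up to the
    length defect of neighbouring edges, a vertex moves orthogonally to the
    sum of the two adjacent unit tangents. *)
Lemma sum_tangent_bound :
  `|dot (dir r + dir r') V| <= 2 * M * enorm delta + 2 * M ^+ 3 * b.
Proof.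
have /andP[l1 l2] := q_bounds; have /andP[l3 l4] := q'_bounds.
have qs0 : 0 < q + q' by have := hM; lra.
pose z := dot (perp (dir r)) (dir r').
have t1 : dot (dir r) (dir r) = 1 by rewrite -enorm_sqr enorm_dir ?expr1n// r_neq0.
have t2 : dot (dir r') (dir r') = 1 by rewrite -enorm_sqr enorm_dir ?expr1n// r'_neq0.
have key : (q + q') / 2 * dot (dir r + dir r') V = my * ((q' - q) * z).
  apply: sum_tangent_identity => //.
  by rewrite !dirK.
have zb : `|z| <= enorm delta + M * h.
  have -> : z = dot (perp (dir r)) (dir r' - dir r) by rewrite dotBr dot_perp subr0.
  apply: (le_trans (dot_cauchy _ _)).
  rewrite enorm_perp enorm_dir ?mul1r ?r_neq0//.
  have hE : dir r' - dir r = delta + (dir p' - dir p) by rewrite subrK.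
  rewrite [leLHS](congr1 (@enorm R) hE).
  by apply: (le_trans (enormD delta _)); apply: lerD.
have dq : `|q' - q| <= d + d' + E.
  have -> : q' - q = (q' - Q') + (Q' - Q) - (q - Q) by ring.
  apply: (le_trans (ler_normB _ _)); apply: (le_trans (lerD (ler_normD _ _) (lexx _))).
  by have := HdQ; lra.
have dq2 : `|q' - q| <= q + q'.
  by rewrite ler_norml; have := enorm_ge0 r; have := enorm_ge0 r'; lra.
have hD0 : 0 <= enorm delta by exact: enorm_ge0.
have dq3 : `|q' - q| <= M / h * b * (q + q').
  apply: (le_trans dq); have : d + d' + E <= b by have := hth0; have := hth'0; have := hell0; lra.
  move/le_trans; apply; rewrite -[leLHS]mul1r mulrAC; apply: ler_wpM2r => //.
  by rewrite -ler_pdivrMl ?divr_gt0// mulr1 invf_div; lra.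
have zb0 : `|my * ((q' - q) * z)| <= M * ((q + q') * enorm delta + M / h * b * (q + q') * (M * h)).
  rewrite !normrM; apply: ler_pM => //.
    by rewrite ger0_norm; case/andP: Hmy.
  apply: (@le_trans _ _ (`|q' - q| * (enorm delta + M * h))); first exact: ler_wpM2l.
  rewrite mulrDr; apply: lerD; apply: ler_wpM2r => //.
  by rewrite mulr_ge0 // ltW.
rewrite -(ler_pM2l (_ : 0 < (q + q') / 2)); last by rewrite divr_gt0.
rewrite -[X in X * `|_|]gtr0_norm ?divr_gt0// -normrM key.
apply: (le_trans zb0); rewrite le_eqVlt; apply/orP; left; apply/eqP.
by field; rewrite gt_eqF.
Qed.

Definition tangential_bound :=
  2 * M * h * enorm e ^+ 2 + 5 * M ^+ 2 * h * enorm e + 3 * M ^+ 3 * b * enorm e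
  + 8 * M ^+ 4 * b.

Lemma half_diff_bound :
  `|dot (dir r' - dir r) V - dot (dir p' - dir p) u| <=
  enorm delta * (M + enorm e) + M * h * enorm e.
Proof.
have -> : dot (dir r' - dir r) V - dot (dir p' - dir p) u =
    dot delta V - dot (dir p' - dir p) e.
  by rewrite !dotBl !dotBr; ring.
apply: (le_trans (ler_normB _ _)); apply: lerD; apply: (le_trans (dot_cauchy _ _)).
  apply: ler_wpM2l; first exact: enorm_ge0.
  have VE : V = u - e by rewrite opprB addrC subrK.
  rewrite [leLHS](congr1 (@enorm R) VE).
  by apply: (le_trans (enormB u e)); apply: lerD.
by apply: ler_wpM2r => //.
Qed.

Lemma tangential_le :
  `|dot (dir r) V - dot (dir p) u| <= tangential_bound /\
  `|dot (dir r') V - dot (dir p') u| <= tangential_bound.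
Proof.
set S := dot (dir r + dir r') V - dot (dir p + dir p') u.
set B := dot (dir r' - dir r) V - dot (dir p' - dir p) u.
have hS : `|S| <= 2 * M * enorm delta + 2 * M ^+ 3 * b + E.
  by apply: (le_trans (ler_normB _ _)); apply: lerD => //; exact: sum_tangent_bound.
have hB := half_diff_bound; rewrite -/B in hB.
have hD := delta_bound.
have hD0 : 0 <= enorm delta by exact: enorm_ge0.
suff key : (`|S| + `|B|) / 2 <= tangential_bound.
  have -> : dot (dir r) V - dot (dir p) u = (S - B) / 2.
    by rewrite /S /B !dotBl !dotDl; lra.
  have -> : dot (dir r') V - dot (dir p') u = (S + B) / 2.
    by rewrite /S /B !dotBl !dotDl; lra.
  by split; apply: le_trans key; rewrite normrM (ger0_norm (_ : 0 <= 2^-1)) ?invr_ge0//;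
    apply: ler_wpM2r; rewrite ?invr_ge0// ?ler_normB ?ler_normD.
have k1 : enorm delta * (2 * M + enorm e) <=
    (2 * M * h * enorm e + 3 * M ^+ 3 * b) * (2 * M + enorm e).
  by apply: ler_wpM2r => //; rewrite addr_ge0// mulr_ge0// ltW.
have hb : E <= b by rewrite lerDr !addr_ge0.
have k2 : b <= M ^+ 3 * b by rewrite ler_peMl// (le_trans M1)// (le_trans M2).
have k3 : M ^+ 3 * b <= M ^+ 4 * b by exact: ler_wpM2r.
have k4 : M * (h * enorm e) <= M ^+ 2 * (h * enorm e).
  by apply: ler_wpM2r => //; rewrite mulr_ge0// ltW.
rewrite /tangential_bound.
have k5 : 0 <= enorm delta * M by rewrite mulr_ge0// ltW.
have k6 : 0 <= enorm delta * enorm e by rewrite mulr_ge0.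
have k7 : 0 <= M * (h * enorm e) by rewrite !mulr_ge0// ltW.
have k8 : 0 <= M ^+ 3 * b * enorm e by rewrite !mulr_ge0// ltW.
have k9 : 0 <= M * h * enorm e ^+ 2 by rewrite !mulr_ge0// ltW.
have E1 : (2 * M * h * enorm e + 3 * M ^+ 3 * b) * (2 * M + enorm e) =
  4 * (M ^+ 2 * (h * enorm e)) + 2 * (M * h * enorm e ^+ 2) + 6 * (M ^+ 4 * b) + 3 * (M ^+ 3 * b * enorm e) by ring.
rewrite E1 in k1.
by lra.
Qed.

Lemma weighted_tangential_le :
  2 / h * (d + d') * tangential_bound <=
  h / (8 * M) * enorm e ^+ 2 + 11 * M ^+ 3 * b * enorm e + 16 * M ^+ 4 * (b ^+ 2 / h).
Proof.
have ds : d + d' <= b.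
  by have := hth0; have := hth'0; have := hell0; have := E0; lra.
have dh : 2 / h * (d + d') <= (16 * M ^+ 2)^-1.
  rewrite mulrAC ler_pdivrMr//.
  have -> : (16 * M ^+ 2)^-1 * h = 2 * (h / (64 * M ^+ 2) + h / (64 * M ^+ 2)).
    by field; rewrite gt_eqF.
  by rewrite ler_pM2l// lerD.
have ds0 : 0 <= 2 / h * (d + d') by rewrite mulr_ge0 ?addr_ge0// divr_ge0// ltW.
have dsb : 2 / h * (d + d') <= 2 / h * b by apply: ler_wpM2l => //; rewrite divr_ge0// ltW.
rewrite /tangential_bound !mulrDr.
have M0' : M != 0 by rewrite gt_eqF.
have h0' : h != 0 by rewrite gt_eqF.
have k1 : 2 / h * (d + d') * (2 * M * h * enorm e ^+ 2) <= h / (8 * M) * enorm e ^+ 2.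
  have -> : h / (8 * M) * enorm e ^+ 2 = (16 * M ^+ 2)^-1 * (2 * M * h * enorm e ^+ 2).
    by field.
  by apply: ler_wpM2r => //; rewrite !mulr_ge0 ?exprn_ge0// ltW.
have k2 : 2 / h * (d + d') * (5 * M ^+ 2 * h * enorm e) <= 10 * M ^+ 2 * b * enorm e.
  have -> : 10 * M ^+ 2 * b * enorm e = 2 / h * b * (5 * M ^+ 2 * h * enorm e) by field.
  by apply: ler_wpM2r => //; rewrite !mulr_ge0 ?exprn_ge0// ltW.
have k3 : 2 / h * (d + d') * (3 * M ^+ 3 * b * enorm e) <= M * b * enorm e.
  apply: (@le_trans _ _ ((16 * M ^+ 2)^-1 * (3 * M ^+ 3 * b * enorm e))).
    by apply: ler_wpM2r => //; rewrite !mulr_ge0 ?exprn_ge0// ltW.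
  have -> : (16 * M ^+ 2)^-1 * (3 * M ^+ 3 * b * enorm e) = 3 / 16 * (M * b * enorm e) by field.
  have : 0 <= M * b * enorm e by rewrite !mulr_ge0// ltW.
  by lra.
have k4 : 2 / h * (d + d') * (8 * M ^+ 4 * b) <= 16 * M ^+ 4 * (b ^+ 2 / h).
  have -> : 16 * M ^+ 4 * (b ^+ 2 / h) = 2 / h * b * (8 * M ^+ 4 * b) by field.
  by apply: ler_wpM2r => //; rewrite !mulr_ge0 ?exprn_ge0// ltW.
have k5 : M * (b * enorm e) <= M ^+ 3 * (b * enorm e).
  by apply: ler_wpM2r; [rewrite mulr_ge0|exact: le_trans M3].
have k6 : M ^+ 2 * (b * enorm e) <= M ^+ 3 * (b * enorm e).
  by apply: ler_wpM2r; [rewrite mulr_ge0|].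
by lra.
Qed.

End LocalEstimates.

Lemma sqr_sum_le {R : realType} (I : finType) (F : I -> R) :
  (\sum_i F i) ^+ 2 <= #|I|%:R * \sum_i F i ^+ 2.
Proof.
have [I0|I0] := posnP #|I|.
  rewrite I0 mul0r big1 ?expr0n// => i _.
  by have := card0_eq I0 i; rewrite inE.
have I0' : 0 < #|I|%:R :> R by rewrite ltr0n.
set S := \sum_i F i; pose m := S / #|I|%:R.
have : 0 <= \sum_i (F i - m) ^+ 2 by apply: sumr_ge0 => i _; exact: sqr_ge0.
under eq_bigr do rewrite sqrrB.
rewrite !big_split/= sumr_const sumrN.
have -> : \sum_(i : I) F i * m *+ 2 = S * m *+ 2 by rewrite sumrMnl -mulr_suml.
have -> : S * m *+ 2 = 2 * (S ^+ 2 / #|I|%:R) by rewrite /m -mulr_natl; ring.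
have -> : m ^+ 2 *+ #|I| = S ^+ 2 / #|I|%:R.
  by rewrite -mulr_natr /m; field; rewrite gt_eqF.
by move=> h; rewrite -ler_pdivrMl// mulrC; lra.
Qed.

Section Polygons.
Context {R : realType} {N : nat}.
Local Notation E2 := 'rV[R]_2.
Implicit Types (Z V x u Y : 'I_N -> E2).

Lemma sum_ordS (V : nmodType) (F : 'I_N -> V) : \sum_j F (ordS j) = \sum_j F j.
Proof. by rewrite [RHS](reindex_inj (@ordS_inj N)). Qed.

Definition edge Z j : E2 := Z j - Z (ord_pred j).

Definition perimeter Z : R := \sum_j enorm (edge Z j).

(** Residual of the lumped nodal system to which the semidiscrete scheme
    reduces. *)
Definition nodal_residual Z V j : E2 :=
  ((enorm (edge Z j) + enorm (edge Z (ordS j))) / 2) *: V j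
  - (dir (edge Z (ordS j)) - dir (edge Z j))
  + (pi / perimeter Z) *: perp (edge Z j + edge Z (ordS j)).

(** [x] is a polygon inscribed in the exact curve and [u] its velocity. The
    three kinds of consistency errors are those of the nodal equation, of the
    normality of the velocity and of the equidistribution of the lengths. *)
Definition consistent (M h : R) x u (E : 'I_N -> R) : Prop :=
  (forall j, 0 <= E j /\ h / M <= enorm (edge x j) <= M * h) /\
  (forall j, enorm (u j) <= M /\ enorm (edge u j) <= M * h) /\
  (forall j, enorm (dir (edge x (ordS j)) - dir (edge x j)) <= M * h) /\
  (forall j, enorm (nodal_residual x u j) <= E j) /\
  (forall j, `|dot (dir (edge x j) + dir (edge x (ordS j))) (u j)| <= E j) /\
  (forall j, `|enorm (edge x (ordS j)) - enorm (edge x j)| <= E j) /\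
  \sum_j E j ^+ 2 <= M * h ^+ 3.

(** The defect equals half the edge length times the squared distance of the
    unit tangents. *)
Definition defect x Y j : R :=
  enorm (edge Y j) - dot (edge Y j) (dir (edge x j)).

Definition energy (h : R) x Y : R :=
  \sum_j (defect x Y j + (enorm (edge Y j) - enorm (edge x j)) ^+ 2 / h).

Definition defect_rate x u Y V j : R :=
  dot (dir (edge Y j) - dir (edge x j)) (edge V j) -
  dot (edge Y j) ((enorm (edge x j))^-1 *:
    (edge u j - dot (dir (edge x j)) (edge u j) *: dir (edge x j))).

Definition length_rate Z V j : R := dot (dir (edge Z j)) (edge V j).

Definition energy_rate (h : R) x u Y V : R :=
  \sum_j (defect_rate x u Y V j + 2 / h * (enorm (edge Y j) - enorm (edge x j))
            * (length_rate Y V j - length_rate x u j)).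

Lemma defectE x Y j : edge x j != 0 -> edge Y j != 0 ->
  defect x Y j = enorm (edge Y j) / 2 * enorm (dir (edge Y j) - dir (edge x j)) ^+ 2.
Proof.
move=> p0 r0; rewrite enorm_sqr !dotBl !dotBr -!enorm_sqr !enorm_dir// !expr1n.
rewrite (dotC (dir (edge x j))) /defect -{2}(dirK (edge Y j)) (dotZl (enorm _)).
by lra.
Qed.

Lemma defect_rate_le (M h : R) x u Y V j : 1 <= M -> 0 < h ->
  h / M <= enorm (edge x j) -> enorm (edge u j) <= M * h -> edge Y j != 0 ->
  defect_rate x u Y V j <=
  dot (dir (edge x j) - dir (edge Y j)) (edge u j - edge V j) +
  M ^+ 2 * ((`|enorm (edge Y j) - enorm (edge x j)|
             + h * enorm (dir (edge Y j) - dir (edge x j))) ^+ 2 / h).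
Proof.
move=> M1 h0; set p := edge x j; set r := edge Y j.
set pd := edge u j; set rd := edge V j; move=> hQ hu r0.
set d := `|enorm r - enorm p|; set t := dir r; set t' := dir p; set th := enorm (t - t').
have M0 : 0 < M by apply: lt_le_trans M1.
have Q0 : 0 < enorm p by apply: lt_le_trans hQ; exact: divr_gt0.
have p0 : p != 0 by rewrite -enorm_gt0.
pose c := dot t t'.
have tt : dot t t = 1 by rewrite -enorm_sqr enorm_dir ?expr1n.
have tt' : dot t' t' = 1 by rewrite -enorm_sqr enorm_dir ?expr1n.
have th2 : th ^+ 2 = 2 - 2 * c.
  by rewrite enorm_sqr !dotBl !dotBr tt tt' (dotC t') /c; ring.
have th0 : 0 <= th by exact: enorm_ge0.
have d0 : 0 <= d by exact: normr_ge0.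
have proj : enorm (t - c *: t') <= th.
  rewrite -(@ler_pXn2r _ 2)// ?nnegrE ?enorm_ge0// th2 enorm_sqr.
  rewrite !dotBl !dotBr !(dotZl c) !(dotZr c) (dotC t') -/c tt tt'.
  by have := sqr_ge0 (1 - c); rewrite expr2; lra.
have -> : defect_rate x u Y V j = dot (t' - t) (pd - rd) +
    ((1 - enorm r / enorm p) * dot (t - c *: t') pd - (1 - c) * dot t' pd).
  rewrite /defect_rate -/p -/r -/pd -/rd -/t -/t' -{1}(dirK r) -/t.
  clearbody pd rd.
  rewrite !dotBl !dotBr !(dotZl (enorm r)) !(dotZr (enorm p)^-1) !dotBr.
  rewrite (dotZr (dot t' pd)) (dotZl c) -/c.
  by field; rewrite gt_eqF.
rewrite lerD2l.
have pd1 : `|dot (t - c *: t') pd| <= th * (M * h).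
  apply: (le_trans (dot_cauchy _ _)); apply: ler_pM => //; exact: enorm_ge0.
have pd2 : `|dot t' pd| <= M * h.
  by apply: (le_trans (dot_cauchy _ _)); rewrite enorm_dir ?mul1r.
have ratio : `|1 - enorm r / enorm p| <= d * (M / h).
  have -> : 1 - enorm r / enorm p = (enorm p - enorm r) / enorm p by field; rewrite gt_eqF.
  rewrite normrM distrC -/d; apply: ler_wpM2l => //.
  by rewrite gtr0_norm ?invr_gt0// -(invf_div h M) lef_pV2 ?posrE ?divr_gt0.
have k1 : (1 - enorm r / enorm p) * dot (t - c *: t') pd <= d * (M / h) * (th * (M * h)).
  by apply: (le_trans (ler_norm _)); rewrite normrM; apply: ler_pM.
have c1 : 0 <= 1 - c by have := sqr_ge0 th; rewrite th2; lra.
have k2 : - ((1 - c) * dot t' pd) <= (1 - c) * (M * h).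
  rewrite -mulrN; apply: ler_wpM2l => //.
  by apply: le_trans pd2; rewrite -normrN ler_norm.
have -> : M ^+ 2 * ((d + h * th) ^+ 2 / h) =
   M ^+ 2 * (d ^+ 2 / h) + 2 * (M ^+ 2 * (d * th)) + M ^+ 2 * (h * th ^+ 2).
  by field; rewrite gt_eqF.
have k3 : d * (M / h) * (th * (M * h)) = M ^+ 2 * (d * th) by field; rewrite gt_eqF.
have M2 : M <= M ^+ 2 by rewrite expr2 ler_peMr// ltW.
have k4 : (1 - c) * (M * h) <= M ^+ 2 * (h * th ^+ 2).
  rewrite th2 (_ : 2 - 2 * c = 2 * (1 - c)); last by ring.
  have : M * (h * (1 - c)) <= M ^+ 2 * (h * (1 - c)).
    by apply: ler_wpM2r => //; rewrite mulr_ge0// ltW.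
  have : 0 <= M * (h * (1 - c)) by rewrite !mulr_ge0// ltW.
  by lra.
have k5 : 0 <= M ^+ 2 * (d ^+ 2 / h) by rewrite mulr_ge0 ?exprn_ge0 ?divr_ge0 ?exprn_ge0// ltW.
have k6 : 0 <= M ^+ 2 * (d * th) by rewrite mulr_ge0 ?exprn_ge0 ?mulr_ge0// ltW.
rewrite k3 in k1; lra.
Qed.

Section EnergyInequality.
Variables (M h : R) (x u Y V : 'I_N -> E2) (E : 'I_N -> R).
Hypotheses (M1 : 1 <= M) (h0 : 0 < h).
Hypothesis Nh : 2 * pi <= N%:R * h <= M.
Hypothesis cons : consistent M h x u E.
Hypothesis close : forall j,
  `|enorm (edge Y j) - enorm (edge x j)| <= h / (64 * M ^+ 2).
Hypothesis HY : forall j, nodal_residual Y V j = 0.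

Let d j := `|enorm (edge Y j) - enorm (edge x j)|.
Let th j := enorm (dir (edge Y j) - dir (edge x j)).
Let a j := d j + h * th j.
Let ell := `|perimeter Y - perimeter x|.
Let b j := a j + a (ordS j) + h * ell + E j.
Let e j := enorm (u j - V j).

Let M0 : 0 < M. Proof. exact: lt_le_trans M1. Qed.

Let x_len j : h / M <= enorm (edge x j) <= M * h.
Proof. by have [H _] := cons; case: (H j). Qed.

Let E0 j : 0 <= E j.
Proof. by have [H _] := cons; case: (H j). Qed.

Lemma Y_len j : h / M / 2 <= enorm (edge Y j) <= 2 * M * h.
Proof. exact: (q_bounds M1 h0 (x_len j) (close j)). Qed.

Lemma Y_neq0 j : edge Y j != 0.
Proof. exact: (r_neq0 M1 h0 (x_len j) (close j)). Qed.

Let x_neq0 j : edge x j != 0.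
Proof.
by rewrite -enorm_gt0; apply: (lt_le_trans (divr_gt0 h0 M0)); case/andP: (x_len j).
Qed.

Let sum_ge (F : 'I_N -> R) c : (forall j, c <= F j) -> c * N%:R <= \sum_j F j.
Proof.
move=> h1; rewrite mulr_natr -[X in _ *+ X]card_ord -sumr_const.
exact: ler_sum.
Qed.

Lemma per_x_ge : 2 * pi / M <= perimeter x.
Proof.
apply: (@le_trans _ _ (h / M * N%:R)); last by apply: sum_ge => j; case/andP: (x_len j).
have -> : h / M * N%:R = N%:R * h * M^-1 by ring.
by apply: ler_wpM2r; [rewrite invr_ge0 ltW|case/andP: Nh].
Qed.

Lemma per_Y_ge : pi / M <= perimeter Y.
Proof.
apply: (@le_trans _ _ (h / M / 2 * N%:R)); last by apply: sum_ge => j; case/andP: (Y_len j).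
have -> : h / M / 2 * N%:R = N%:R * h / 2 * M^-1 by ring.
by apply: ler_wpM2r; [rewrite invr_ge0 ltW|case/andP: Nh; lra].
Qed.

Let ppi : 0 < pi :> R. Proof. exact: pi_gt0. Qed.
Let per_x0 : 0 < perimeter x.
Proof. by apply: lt_le_trans per_x_ge; rewrite !mulr_gt0// invr_gt0. Qed.
Let per_Y0 : 0 < perimeter Y.
Proof. by apply: lt_le_trans per_Y_ge; rewrite !mulr_gt0// invr_gt0. Qed.

Let mx_le : 0 <= pi / perimeter x <= M.
Proof.
apply/andP; split; first by rewrite divr_ge0// ltW.
rewrite ler_pdivrMr// mulrC -ler_pdivrMr//.
by apply: le_trans per_x_ge; apply: ler_wpM2r; [rewrite invr_ge0 ltW|have := ppi; lra].
Qed.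

Let my_le : 0 <= pi / perimeter Y <= M.
Proof.
apply/andP; split; first by rewrite divr_ge0// ltW.
by rewrite ler_pdivrMr// mulrC -ler_pdivrMr// per_Y_ge.
Qed.

Let mxy_le : `|pi / perimeter Y - pi / perimeter x| <= M ^+ 2 * ell.
Proof.
have -> : pi / perimeter Y - pi / perimeter x =
  (perimeter x - perimeter Y) * (pi / perimeter Y / perimeter x).
  by field; rewrite !gt_eqF.
rewrite normrM distrC -/ell mulrC; apply: ler_wpM2r; first exact: normr_ge0.
rewrite ger0_norm; last by rewrite !divr_ge0// ltW.
rewrite expr2; apply: ler_pM => //.
- by case/andP: my_le.
- by rewrite invr_ge0 ltW.
- by case/andP: my_le.
rewrite -[leRHS]invrK lef_pV2 ?posrE ?invr_gt0//.
apply: le_trans per_x_ge; rewrite ler_peMl ?invr_ge0 ?ltW//.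
by have := @pi_ge2 R; lra.
Qed.

Let local_eq j : ((enorm (edge Y j) + enorm (edge Y (ordS j))) / 2) *: V j -
  (dir (edge Y (ordS j)) - dir (edge Y j)) +
  (pi / perimeter Y) *: perp (edge Y j + edge Y (ordS j)) = 0.
Proof. exact: HY. Qed.

Let ell0 : 0 <= ell. Proof. exact: normr_ge0. Qed.

Let Bd j := tangential_bound M h (E j) ell (edge x j) (edge x (ordS j))
  (edge Y j) (edge Y (ordS j)) (u j) (V j).

Let tang j : `|dot (dir (edge Y j)) (V j) - dot (dir (edge x j)) (u j)| <= Bd j /\
  `|dot (dir (edge Y (ordS j))) (V j) - dot (dir (edge x (ordS j))) (u j)| <= Bd j.
Proof.
have [_ [/(_ j)[h1 _] [h2 [h3 [h4 [h5 _]]]]]] := cons.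
by apply: (@tangential_le _ _ _ _ _ (pi / perimeter x) (pi / perimeter Y)) => //;
  exact: h3.
Qed.

Let weighted j : 2 / h * (d j + d (ordS j)) * Bd j <=
  h / (8 * M) * e j ^+ 2 + 11 * M ^+ 3 * b j * e j + 16 * M ^+ 4 * (b j ^+ 2 / h).
Proof. exact: weighted_tangential_le. Qed.

Let err_eq j : enorm (((enorm (edge Y j) + enorm (edge Y (ordS j))) / 2) *: (u j - V j)
   + (dir (edge Y (ordS j)) - dir (edge Y j) - (dir (edge x (ordS j)) - dir (edge x j))))
   <= 3 * M ^+ 3 * b j.
Proof.
have [_ [/(_ j)[h1 _] [h2 [h3 _]]]] := cons.
by apply: (@error_equation _ _ _ _ _ (pi / perimeter x) (pi / perimeter Y)) => //;
  exact: h3.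
Qed.

Let edge_pred (Z : 'I_N -> E2) j : edge Z (ordS j) = Z (ordS j) - Z j.
Proof. by rewrite /edge ordSK. Qed.

Let length_part : \sum_j 2 / h * (enorm (edge Y j) - enorm (edge x j))
            * (length_rate Y V j - length_rate x u j) <=
  \sum_j (h / (8 * M) * e j ^+ 2 + 11 * M ^+ 3 * b j * e j + 16 * M ^+ 4 * (b j ^+ 2 / h)).
Proof.
pose D j := `|dot (dir (edge Y j)) (V j) - dot (dir (edge x j)) (u j)|.
pose D' j := `|dot (dir (edge Y (ordS j))) (V j) - dot (dir (edge x (ordS j))) (u j)|.
have h20 : 0 <= 2 / h by rewrite divr_ge0// ltW.
apply: (@le_trans _ _ (\sum_j (2 / h * d j * D j + 2 / h * d j * D' (ord_pred j)))).
  apply: ler_sum => j _; apply: (le_trans (ler_norm _)).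
  rewrite normrM (normrM (2 / h)) (ger0_norm h20) -/(d j) -mulrDr; apply: ler_wpM2l.
    exact: mulr_ge0 h20 (normr_ge0 _).
  rewrite /D /D' /length_rate /edge -/(edge Y j) -/(edge x j) ord_predK.
  rewrite !dotBr; apply: le_trans (ler_normB _ _).
  rewrite le_eqVlt; apply/orP; left; apply/eqP; congr (`|_|); ring.
rewrite big_split/= -[X in _ + X]sum_ordS -big_split/=; apply: ler_sum => j _.
apply: le_trans (weighted j); rewrite ordSK.
rewrite [leRHS](_ : _ = 2 / h * d j * Bd j + 2 / h * d (ordS j) * Bd j); last by ring.
have [t1 t2] := tang j.
by apply: lerD; apply: ler_wpM2l => //; exact: mulr_ge0 h20 (normr_ge0 _).
Qed.

Let defect_part : \sum_j defect_rate x u Y V j <=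
  \sum_j (3 * M ^+ 3 * b j * e j - h / (2 * M) * e j ^+ 2 + M ^+ 2 * (a j ^+ 2 / h)).
Proof.
pose w j := u j - V j.
apply: (@le_trans _ _ (\sum_j (dot (dir (edge x j) - dir (edge Y j)) (edge w j)
    + M ^+ 2 * (a j ^+ 2 / h)))).
  apply: ler_sum => j _.
  have -> : edge w j = edge u j - edge V j by rewrite /edge /w; apply: row2P; rewrite !mxE; ring.
  have [_ [/(_ j)[_ h1] _]] := cons.
  by apply: defect_rate_le => //; [case/andP: (x_len j)|exact: Y_neq0].
rewrite !big_split/= lerD2r.
have -> : \sum_j dot (dir (edge x j) - dir (edge Y j)) (edge w j) =
  \sum_j dot (dir (edge Y (ordS j)) - dir (edge Y j) - (dir (edge x (ordS j)) - dir (edge x j))) (w j).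
  under eq_bigr do rewrite /edge -/(edge x _) -/(edge Y _) dotBr.
  rewrite sumrB -[X in _ - X]sum_ordS -sumrB; apply: eq_bigr => j _.
  by rewrite ordSK !dotBl; ring.
rewrite -big_split/=; apply: ler_sum => j _.
set dl := (X in dot X _); pose qs := (enorm (edge Y j) + enorm (edge Y (ordS j))) / 2.
have gen (z : E2) : dot z (w j) = dot (qs *: w j + z) (w j) - qs * e j ^+ 2.
  by rewrite dotDl dotZl /e enorm_sqr /w; ring.
rewrite (gen dl).
apply: lerD.
  apply: (le_trans (dot_le _ _)); apply: ler_wpM2r; first exact: enorm_ge0.
  exact: err_eq.
rewrite lerN2; apply: ler_wpM2r; first exact: sqr_ge0.
have := Y_len j; have := Y_len (ordS j); rewrite /qs invfM mulrA mulrAC.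
by move=> /andP[? _] /andP[? _]; lra.
Qed.

Let a_ge0 j : 0 <= a j.
Proof.
by rewrite addr_ge0 ?normr_ge0//; apply: mulr_ge0; [exact: ltW|exact: enorm_ge0].
Qed.

Let hell0 : 0 <= h * ell.
Proof. by apply: mulr_ge0; [exact: ltW|exact: ell0]. Qed.

Let ab0 j : a j <= b j.
Proof.
by have := a_ge0 (ordS j); have := hell0; have := E0 j; rewrite /b; lra.
Qed.

Let b_ge0 j : 0 <= b j.
Proof. exact: le_trans (a_ge0 j) (ab0 j). Qed.

Let ab j : a j ^+ 2 <= b j ^+ 2.
Proof. by rewrite ler_pXn2r ?nnegrE ?a_ge0 ?b_ge0 ?ab0. Qed.

Let sum_b : \sum_j b j ^+ 2 / h <= 64 * M ^+ 2 * (energy h x Y + h ^+ 2).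
Proof.
have h0' : h != 0 by rewrite gt_eqF.
have M2 : M <= M ^+ 2 by rewrite expr2 ler_peMr// ltW.
have bb j : b j ^+ 2 / h <= 4 * (a j ^+ 2 / h) + 4 * (a (ordS j) ^+ 2 / h)
      + 4 * (h * ell ^+ 2) + 4 * (E j ^+ 2 / h).
  have -> : 4 * (a j ^+ 2 / h) + 4 * (a (ordS j) ^+ 2 / h)
      + 4 * (h * ell ^+ 2) + 4 * (E j ^+ 2 / h) =
     (4 * (a j ^+ 2 + a (ordS j) ^+ 2 + (h * ell) ^+ 2 + E j ^+ 2)) / h.
    by field.
  apply: ler_wpM2r; first by rewrite invr_ge0 ltW.
  rewrite /b; move: (a j) (a (ordS j)) (h * ell) (E j) => z1 z2 z3 z4.
  have := sqr_ge0 (z1 - z2); have := sqr_ge0 (z1 - z3); have := sqr_ge0 (z1 - z4).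
  have := sqr_ge0 (z2 - z3); have := sqr_ge0 (z2 - z4); have := sqr_ge0 (z3 - z4).
  by rewrite !expr2; lra.
have sa : \sum_j a j ^+ 2 / h <= \sum_j (2 * (d j ^+ 2 / h) + 8 * M * defect x Y j).
  apply: ler_sum => j _.
  have k1 : a j ^+ 2 / h <= 2 * (d j ^+ 2 / h) + 2 * (h * th j ^+ 2).
    have -> : 2 * (d j ^+ 2 / h) + 2 * (h * th j ^+ 2) =
      (2 * (d j ^+ 2 + (h * th j) ^+ 2)) / h by field.
    apply: ler_wpM2r; first by rewrite invr_ge0 ltW.
    rewrite /a; move: (d j) (h * th j) => z1 z2; have := sqr_ge0 (z1 - z2).
    by rewrite !expr2; lra.
  apply: (le_trans k1); rewrite lerD2l (defectE (x_neq0 j) (Y_neq0 j)) -/(th j).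
  have -> : 8 * M * (enorm (edge Y j) / 2 * th j ^+ 2) = (4 * M * enorm (edge Y j)) * th j ^+ 2.
    by field.
  rewrite mulrA; apply: ler_wpM2r; first exact: sqr_ge0.
  have /andP[hh _] := Y_len j.
  have := ler_wpM2l (_ : 0 <= 4 * M) hh.
  rewrite (_ : 4 * M * (h / M / 2) = 2 * h); last by field; rewrite gt_eqF.
  by apply; rewrite mulr_ge0// ltW.
have sl : N%:R * (h * ell ^+ 2) <= M ^+ 2 * \sum_j d j ^+ 2 / h.
  have ell_le : ell <= \sum_j d j.
    by rewrite /ell /perimeter -sumrB; exact: ler_norm_sum.
  have : ell ^+ 2 <= N%:R * \sum_j d j ^+ 2.
    rewrite -[X in X%:R * _]card_ord.
    apply: le_trans (sqr_sum_le _); rewrite ler_pXn2r ?nnegrE//.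
    by apply: sumr_ge0 => j _; exact: normr_ge0.
  move/(ler_wpM2l (_ : 0 <= N%:R * h)) => /(_ (mulr_ge0 (ler0n _ _) (ltW h0))).
  move=> hh; rewrite mulrA; apply: (le_trans hh).
  rewrite -mulr_suml.
  have -> : N%:R * h * (N%:R * \sum_j d j ^+ 2) = (N%:R * h) ^+ 2 * ((\sum_j d j ^+ 2) / h) by field.
  apply: ler_wpM2r.
    by rewrite divr_ge0 ?(ltW h0)// sumr_ge0// => j _; exact: sqr_ge0.
  rewrite ler_pXn2r ?nnegrE//; [by case/andP: Nh|by rewrite mulr_ge0 ?(ltW h0)|exact: ltW].
have sE : \sum_j E j ^+ 2 / h <= M * h ^+ 2.
  have [_ [_ [_ [_ [_ [_ hE]]]]]] := cons.
  by rewrite -mulr_suml ler_pdivrMr// -mulrA -exprSr.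
have -> : energy h x Y = \sum_j defect x Y j + \sum_j d j ^+ 2 / h.
  rewrite /energy big_split/=; congr (_ + _); apply: eq_bigr => j _.
  by rewrite /d real_normK ?num_real.
apply: (le_trans (ler_sum _ (fun j _ => bb j))).
have -> : \sum_j (4 * (a j ^+ 2 / h) + 4 * (a (ordS j) ^+ 2 / h)
    + 4 * (h * ell ^+ 2) + 4 * (E j ^+ 2 / h)) =
  8 * (\sum_j a j ^+ 2 / h) + 4 * (N%:R * (h * ell ^+ 2)) + 4 * (\sum_j E j ^+ 2 / h).
  have hS := sum_ordS (fun j => a j ^+ 2 / h).
  rewrite !big_split/= sumr_const card_ord -(mulr_natl (4 * _)) -!(mulr_sumr _ _ _ 4) hS.
  by ring.
rewrite big_split/= -!mulr_sumr in sa.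
have D0 : 0 <= \sum_j defect x Y j.
  apply: sumr_ge0 => j _; rewrite (defectE (x_neq0 j) (Y_neq0 j)).
  by rewrite mulr_ge0 ?sqr_ge0// divr_ge0// enorm_ge0.
have L0 : 0 <= \sum_j d j ^+ 2 / h.
  by apply: sumr_ge0 => j _; rewrite divr_ge0 ?sqr_ge0// ltW.
have H0 : 0 <= h ^+ 2 by exact: sqr_ge0.
have m1 := ler_wpM2r D0 M2; have m2 := ler_wpM2r L0 M2; have m3 := ler_wpM2r H0 M2.
have m4 := ler_wpM2r L0 M1; have m5 := ler_wpM2r D0 M1; have m6 := ler_wpM2r H0 M1.
rewrite !mul1r in m4 m5 m6.
have n1 := mulr_ge0 (ltW M0) D0; have n2 := mulr_ge0 (ltW M0) L0; have n3 := mulr_ge0 (ltW M0) H0.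
by lra.
Qed.

(** The bootstrap assumption [close] bounds the quadratic velocity terms
    produced by the length equation by a small part of the dissipation. *)
Theorem energy_inequality :
  energy_rate h x u Y V + h / (4 * M) * \sum_j enorm (u j - V j) ^+ 2 <=
  512 * 64 * M ^+ 9 * (energy h x Y + h ^+ 2).
Proof.
have h0' : h != 0 by rewrite gt_eqF.
have M0' : M != 0 by rewrite gt_eqF.
have M2 : M <= M ^+ 2 by rewrite expr2 ler_peMr// ltW.
have Mmono n m : (n <= m)%N -> M ^+ n <= M ^+ m by move=> nm; exact: ler_weXn2l.
rewrite /energy_rate big_split/=.
apply: (le_trans (lerD (lerD defect_part length_part) (lexx _))).
rewrite -/e mulr_sumr -!big_split/=.
apply: (@le_trans _ _ (\sum_j 512 * M ^+ 7 * (b j ^+ 2 / h))).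
  apply: ler_sum => j _.
  have B0 : 0 <= b j ^+ 2 / h by rewrite divr_ge0 ?sqr_ge0// ltW.
  have k1 : 14 * M ^+ 3 * b j * e j <= h / (8 * M) * e j ^+ 2 + 392 * M ^+ 7 * (b j ^+ 2 / h).
    have -> : h / (8 * M) * e j ^+ 2 + 392 * M ^+ 7 * (b j ^+ 2 / h) =
      (h / (8 * M)) * (e j - 56 * M ^+ 4 * b j / h) ^+ 2 + 14 * M ^+ 3 * b j * e j.
      by field; rewrite h0' M0'.
    by rewrite lerDr mulr_ge0 ?sqr_ge0// divr_ge0 ?mulr_ge0// ltW.
  have k2 : M ^+ 2 * (a j ^+ 2 / h) <= M ^+ 7 * (b j ^+ 2 / h).
    apply: ler_pM; rewrite ?exprn_ge0 ?(ltW M0)//.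
    - by rewrite divr_ge0 ?sqr_ge0// ltW.
    - exact: Mmono.
    - by apply: ler_wpM2r (ab j); rewrite invr_ge0 ltW.
  have k3 : M ^+ 4 * (b j ^+ 2 / h) <= M ^+ 7 * (b j ^+ 2 / h).
    by apply: ler_wpM2r => //; exact: Mmono.
  have k4 : h / (2 * M) * e j ^+ 2 = 4 * (h / (8 * M) * e j ^+ 2) by field.
  have k5 : h / (4 * M) * e j ^+ 2 = 2 * (h / (8 * M) * e j ^+ 2) by field.
  have k6 : enorm (u j - V j) = e j by [].
  have k7 : 0 <= M ^+ 7 * (b j ^+ 2 / h) by rewrite mulr_ge0// exprn_ge0// ltW.
  rewrite ?k6 k4 k5; lra.
rewrite -mulr_sumr.
have M70 : 0 <= 512 * M ^+ 7 := mulr_ge0 (ler0n _ 512) (exprn_ge0 7 (ltW M0)).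
apply: (le_trans (ler_wpM2l M70 sum_b)).
by rewrite mulrA (mulrACA 512) -exprD.
Qed.

End EnergyInequality.

End Polygons.

(** * Bounded Lipschitz functions *)

Section BoundedLipschitz.
Context {R : realType} {S : Type}.
Variables (D : set S) (dist : S -> S -> R).
Hypothesis dist_ge0 : forall x y, 0 <= dist x y.
Implicit Types (f g : S -> R) (c : R).

(** Used twice: on the state space, where the truncated vector field is built
    from such functions, and on the time interval, where it makes the energy
    Lipschitz. *)
Definition blip f : Prop := exists B L, [/\ 0 <= B, 0 <= L,
  (forall x, D x -> `|f x| <= B) &
  forall x y, D x -> D y -> `|f x - f y| <= L * dist x y].

Lemma blip_cst c : blip (fun _ => c).
Proof.
exists `|c|, 0; split=> // x y _ _.
by rewrite subrr normr0 mul0r.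
Qed.

Lemma blip_ext f g : (forall x, D x -> f x = g x) -> blip f -> blip g.
Proof.
move=> fg [B [L [B0 L0 fB fL]]]; exists B, L; split=> // [x Dx|x y Dx Dy].
  by rewrite -fg// fB.
by rewrite -!fg// fL.
Qed.

Lemma blipD f g : blip f -> blip g -> blip (fun x => f x + g x).
Proof.
move=> [B [L [B0 L0 fB fL]]] [B' [L' [B'0 L'0 gB gL]]].
exists (B + B'), (L + L'); split=> [||x Dx|x y Dx Dy]; try exact: addr_ge0.
  by apply: (le_trans (ler_normD _ _)); apply: lerD; [exact: fB|exact: gB].
rewrite opprD addrACA mulrDl.
by apply: (le_trans (ler_normD _ _)); apply: lerD; [exact: fL|exact: gL].
Qed.

Lemma blipN f : blip f -> blip (fun x => - f x).
Proof.
move=> [B [L [B0 L0 fB fL]]]; exists B, L; split=> // [x Dx|x y Dx Dy].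
  by rewrite normrN fB.
by rewrite -opprD normrN fL.
Qed.

Lemma blipB f g : blip f -> blip g -> blip (fun x => f x - g x).
Proof. by move=> ? /blipN; exact: blipD. Qed.

Lemma blipM f g : blip f -> blip g -> blip (fun x => f x * g x).
Proof.
move=> [B [L [B0 L0 fB fL]]] [B' [L' [B'0 L'0 gB gL]]].
exists (B * B'), (B * L' + B' * L); split=> [||x Dx|x y Dx Dy].
- exact: mulr_ge0.
- by rewrite addr_ge0// mulr_ge0.
- by rewrite normrM ler_pM// ?fB ?gB.
have -> : f x * g x - f y * g y = f x * (g x - g y) + g y * (f x - f y) by ring.
apply: (le_trans (ler_normD _ _)); rewrite !normrM mulrDl -!mulrA.
by apply: lerD; apply: ler_pM => //; rewrite ?fB ?gB ?fL ?gL.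
Qed.

Lemma blipV f c : 0 < c -> (forall x, D x -> c <= f x) -> blip f ->
  blip (fun x => (f x)^-1).
Proof.
move=> c0 cf [B [L [B0 L0 fB fL]]].
have f0 x : D x -> 0 < f x by move=> /cf; exact: lt_le_trans.
have fV x : D x -> `|(f x)^-1| <= c^-1.
  by move=> Dx; rewrite gtr0_norm ?invr_gt0 ?f0// lef_pV2 ?posrE ?f0 ?cf.
exists c^-1, (c^-1 * c^-1 * L); split=> // [||x y Dx Dy].
- by rewrite invr_ge0 ltW.
- by rewrite !mulr_ge0// invr_ge0 ltW.
have -> : (f x)^-1 - (f y)^-1 = (f x)^-1 * (f y)^-1 * (f y - f x).
  by field; rewrite !gt_eqF ?f0.
rewrite !normrM distrC -!mulrA; apply: ler_pM; rewrite ?fV ?mulr_ge0 ?normr_ge0//.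
by apply: ler_pM; rewrite ?fV ?fL ?normr_ge0.
Qed.

Lemma blip_sum (I : Type) (r : seq I) (f : I -> S -> R) :
  (forall i, blip (f i)) -> blip (fun x => \sum_(i <- r) f i x).
Proof.
move=> h; elim: r => [|i r IH].
  by under eq_fun do rewrite big_nil; exact: blip_cst.
by under eq_fun do rewrite big_cons; exact: blipD.
Qed.

Lemma blip_max f c : blip f -> blip (fun x => Num.max c (f x)).
Proof.
move=> [B [L [B0 L0 fB fL]]]; exists (`|c| + B), L; split=> //.
- by rewrite addr_ge0.
- move=> x Dx; have := fB x Dx; have := normr_ge0 c.
  by case: (leP c (f x)) => _ *; lra.
- move=> x y Dx Dy; apply: le_trans (fL x y Dx Dy).
  case: (leP c (f x)) => h1; case: (leP c (f y)) => h2 //.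
  + by rewrite ger0_norm ?subr_ge0// ger0_norm; lra.
  + by rewrite distrC ger0_norm ?subr_ge0// distrC ger0_norm; lra.
  + by rewrite subrr normr0.
Qed.

Lemma blip_enorm (v : S -> 'rV[R]_2) : (forall i, blip (fun x => v x 0 i)) ->
  blip (fun x => enorm (v x)).
Proof.
move=> h; have [B [L [B0 L0 fB fL]]] := h 0; have [B' [L' [B'0 L'0 gB gL]]] := h 1.
exists (B + B'), (L + L'); split=> [||x Dx|x y Dx Dy]; try exact: addr_ge0.
  rewrite ger0_norm ?enorm_ge0//; apply: (le_trans (enorm_le_coord _)).
  by apply: lerD; [exact: fB|exact: gB].
apply: (le_trans (enorm_dist _ _)); apply: (le_trans (enorm_le_coord _)).
by rewrite !mxE mulrDl; apply: lerD; [exact: fL|exact: gL].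
Qed.

End BoundedLipschitz.

(** * The nodal system *)

Section OdeUniqueness.
Context {R : realType}.

Lemma ode_unique (I : finType) (F : I -> (I -> R) -> R) (L a b : R)
    (x y : I -> R -> R) : a <= b -> 0 <= L ->
  (forall i x y, `|F i x - F i y| <= L * \sum_k `|x k - y k|) ->
  (forall i t, a <= t <= b -> is_derive t 1 (x i) (F i (fun j => x j t))) ->
  (forall i t, a <= t <= b -> is_derive t 1 (y i) (F i (fun j => y j t))) ->
  (forall i, x i a = y i a) -> forall i, x i b = y i b.
Proof.
move=> ab L0 FL dx dy xya.
pose f (t : R) := \sum_i (x i t - y i t) ^+ 2.
have f0 t : 0 <= f t by apply: sumr_ge0 => i _; exact: sqr_ge0.
pose c := 2 * L * #|I|%:R.
pose df (t : R) := \sum_i (F i (fun j => x j t) - F i (fun j => y j t)) * (x i t - y i t) *+ 2.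
have dfP t : a <= t <= b -> is_derive t 1 f (df t).
  move=> tab; apply: der_sum => i.
  have h := derB (dx i t tab) (dy i t tab); have := derM h h.
  by rewrite [X in _ + X]mulrC -mulr2n.
have df_le t : df t <= c * f t.
  apply: (@le_trans _ _ (2 * (L * (\sum_k `|x k t - y k t|) ^+ 2))).
    set S := \sum_k _.
    have -> : 2 * (L * S ^+ 2) = \sum_i 2 * (L * S * `|x i t - y i t|).
      by rewrite -!mulr_sumr -/S; ring.
    apply: ler_sum => i _.
    have : (F i (fun j => x j t) - F i (fun j => y j t)) * (x i t - y i t) <=
        L * S * `|x i t - y i t|.
      by apply: (le_trans (ler_norm _)); rewrite normrM; apply: ler_wpM2r => //; exact: FL.
    by lra.
  rewrite /c -!mulrA; do 2 apply: ler_wpM2l => //.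
  apply: (le_trans (sqr_sum_le _)); apply: ler_wpM2l => //.
  by rewrite le_eqVlt; apply/orP; left; apply/eqP; apply: eq_bigr => i _; rewrite real_normK ?num_real.
pose g (t : R) := expR (- c * t) * f t.
have dg t : a <= t <= b -> is_derive t 1 g (- c * expR (- c * t) * f t + expR (- c * t) * df t).
  by move=> tab; apply: derM; [exact: der_expR|exact: dfP].
have cg : {within `[a, b], continuous g}.
  by apply: derivable_within_continuous => t; rewrite in_itv/= => /dg [].
have dgI t : a < t < b -> is_derive t 1 g (- c * expR (- c * t) * f t + expR (- c * t) * df t).
  by move=> /andP[at_ tb]; apply: dg; rewrite !ltW.
have dg0 t : a < t < b -> - c * expR (- c * t) * f t + expR (- c * t) * df t <= 0.
  move=> _; have -> : - c * expR (- c * t) * f t + expR (- c * t) * df t =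
      expR (- c * t) * (df t - c * f t) by ring.
  by rewrite mulr_ge0_le0 ?expR_ge0// subr_le0.
have gba := derive_le ab cg dgI dg0.
have ga : g a = 0 by rewrite /g /f big1 ?mulr0// => i _; rewrite xya subrr expr0n.
have fb : f b <= 0.
  by move: gba; rewrite ga mul0r subr0 /g pmulr_rle0// expR_gt0.
move=> i; have : (x i b - y i b) ^+ 2 <= 0.
  apply: le_trans fb; rewrite /f (bigD1 i)//= lerDl.
  by apply: sumr_ge0 => j _; exact: sqr_ge0.
move=> h; apply/eqP; rewrite -subr_eq0 -sqrf_eq0; apply/eqP/le_anti.
by rewrite h sqr_ge0.
Qed.

End OdeUniqueness.

Section TruncatedField.
Context {R : realType} {N : nat}.
Local Notation E2 := 'rV[R]_2.
Local Notation I := ('I_N * 'I_2)%type.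
Variables (B delta : R).
Hypotheses (B0 : 0 <= B) (delta0 : 0 < delta).
Implicit Types (Z V : 'I_N -> E2) (x : I -> R).

Definition of_coords x : 'I_N -> E2 := fun j => \row_i x (j, i).

Definition coords Z : I -> R := fun k => Z k.1 0 k.2.

Lemma coordsK Z : of_coords (coords Z) = Z.
Proof. by apply/funext => j; apply/rowP => i; rewrite mxE. Qed.

Definition clamp (r : R) : R := Num.max (- B) (Num.min B r).

Definition trunc (v : E2) : E2 := \row_i clamp (v 0 i).

Definition tlen Z j : R := Num.max delta (enorm (trunc (edge Z j))).

Definition ttan Z j : E2 := (tlen Z j)^-1 *: trunc (edge Z j).

(** The velocity solving the nodal system, with lengths cut off below and edges
    cut off above so that it is a bounded Lipschitz function of the polygon. *)
Definition field Z j : E2 :=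
  (2 / (tlen Z j + tlen Z (ordS j))) *:
    (ttan Z (ordS j) - ttan Z j
     - (pi / \sum_k tlen Z k) *: perp (trunc (edge Z j) + trunc (edge Z (ordS j)))).

Definition admissible Z := forall j, delta <= enorm (edge Z j) <= B.

Lemma trunc_id (v : E2) : enorm v <= B -> trunc v = v.
Proof.
move=> vB; apply/rowP => i; rewrite mxE /clamp.
have := le_trans (enorm_coord v i) vB; rewrite ler_norml => /andP[h1 h2].
by rewrite min_r// max_r.
Qed.

Lemma field_residual Z V : (0 < N)%N -> admissible Z ->
  ((forall j, nodal_residual Z V j = 0) <-> forall j, V j = field Z j).
Proof.
move=> N0 adm.
have tE j : trunc (edge Z j) = edge Z j by apply: trunc_id; case/andP: (adm j).
have lE j : tlen Z j = enorm (edge Z j).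
  by rewrite /tlen tE max_r//; case/andP: (adm j).
have tanE j : ttan Z j = dir (edge Z j) by rewrite /ttan tE lE.
have pE : \sum_k tlen Z k = perimeter Z by apply: eq_bigr => k _.
have key j : field Z j = V j <-> nodal_residual Z V j = 0.
  rewrite /field /nodal_residual !tE !lE !tanE pE.
  set m := enorm _ + enorm _.
  have m0 : m != 0.
    have := adm j; have := adm (ordS j); rewrite /m => /andP[? _] /andP[? _].
    by rewrite gt_eqF//; have := delta0; lra.
  set A := dir _ - dir _; set P := _ *: perp _.
  split=> [<-|].
    by rewrite scalerA (_ : m / 2 * (2 / m) = 1) ?scale1r ?subrK; [|field];
       rewrite // addrAC subrK subrr.
  move=> h; have -> : A - P = (m / 2) *: V j.
    by apply/eqP; rewrite eq_sym -subr_eq0 opprB addrA addrAC h.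
  by rewrite scalerA (_ : 2 / m * (m / 2) = 1) ?scale1r//; field.
by split=> h j; [apply/esym/key|apply/key/esym].
Qed.

Let dist (x y : I -> R) : R := \sum_k `|x k - y k|.

Let dist_ge0 x y : 0 <= dist x y.
Proof. by apply: sumr_ge0. Qed.

Let dist_coord x y k : `|x k - y k| <= dist x y.
Proof. by rewrite /dist (bigD1 k)//= lerDl sumr_ge0. Qed.

Let bl (f : (I -> R) -> R) := blip setT dist f.

Let clamp_lip (r s : R) : `|clamp r - clamp s| <= `|r - s|.
Proof.
have := B0; rewrite /clamp /Order.max /Order.min.
do ![case: ifPn]; rewrite -?leNgt; do ?[case: ifPn]; rewrite -?leNgt => *;
  rewrite ?subrr ?normr0// ?ler_norml; case: (ger0P (r - s)); lra.
Qed.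

Let clamp_le (r : R) : `|clamp r| <= B.
Proof.
rewrite ler_norml /clamp le_max lexx/= ge_max ge_min lexx/= andbT.
by have := B0; lra.
Qed.

Let bl_trunc j i : bl (fun x => trunc (edge (of_coords x) j) 0 i).
Proof.
exists B, 2; split=> // [x _|x y _ _]; rewrite !mxE; first exact: clamp_le.
apply: (le_trans (clamp_lip _ _)); rewrite opprD opprK addrACA.
have -> : - x (ord_pred j, i) + y (ord_pred j, i) = - (x (ord_pred j, i) - y (ord_pred j, i)).
  by rewrite opprB addrC.
apply: (le_trans (ler_normD _ _)); rewrite normrN.
by have := dist_coord x y (j, i); have := dist_coord x y (ord_pred j, i); lra.
Qed.

Let bl_tlen j : bl (fun x => tlen (of_coords x) j).
Proof. by apply: blip_max => //; apply: blip_enorm => // i; exact: bl_trunc. Qed.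

Let tlen_ge Z j : delta <= tlen Z j.
Proof. by rewrite le_max lexx. Qed.

Let bl_field j i : (0 < N)%N -> bl (fun x => field (of_coords x) j 0 i).
Proof.
move=> N0.
have bttan k l : bl (fun x => ttan (of_coords x) k 0 l).
  apply: (@blip_ext _ _ _ _ (fun x => (tlen (of_coords x) k)^-1 * trunc (edge (of_coords x) k) 0 l)).
    by move=> x _; rewrite /ttan [RHS]mxE.
  apply: blipM => //; last exact: bl_trunc.
  exact: (blipV delta0 (fun x _ => tlen_ge (of_coords x) k) (bl_tlen k)).
have bper : bl (fun x => (\sum_k tlen (of_coords x) k)^-1).
  apply: (blipV delta0) => [x _|]; last by apply: blip_sum => // k; exact: bl_tlen.
  rewrite (bigD1 (Ordinal N0))//=; apply: (le_trans (tlen_ge (of_coords x) (Ordinal N0))).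
  by rewrite lerDl sumr_ge0// => k _; apply: le_trans (tlen_ge _ _); exact: ltW.
have bperp l : bl (fun x => perp (trunc (edge (of_coords x) j) + trunc (edge (of_coords x) (ordS j))) 0 l).
  have [l0|l0] := eqVneq l 0.
    apply: (@blip_ext _ _ _ _ (fun x => - (trunc (edge (of_coords x) j) 0 1 + trunc (edge (of_coords x) (ordS j)) 0 1))).
      by move=> x _; rewrite !mxE l0/= ?mxE.
    by apply: blipN; apply: blipD => //; exact: bl_trunc.
  apply: (@blip_ext _ _ _ _ (fun x => (trunc (edge (of_coords x) j) 0 0 + trunc (edge (of_coords x) (ordS j)) 0 0))).
    by move=> x _; rewrite !mxE (negbTE l0)/= ?mxE.
  by apply: blipD => //; exact: bl_trunc.
apply: (@blip_ext _ _ _ _ (fun x =>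
  2 * (tlen (of_coords x) j + tlen (of_coords x) (ordS j))^-1 *
  (ttan (of_coords x) (ordS j) 0 i - ttan (of_coords x) j 0 i
   - pi * (\sum_k tlen (of_coords x) k)^-1 *
     perp (trunc (edge (of_coords x) j) + trunc (edge (of_coords x) (ordS j))) 0 i))).
  by move=> x _; rewrite /field [in RHS]mxE [X in _ * X = _]/GRing.add/= !mxE.
apply: blipM => //.
  apply: blipM => //; first exact: blip_cst.
  apply: (blipV (c := delta + delta)); [by rewrite addr_gt0|by move=> x _; apply: lerD|].
  by apply: blipD => //; exact: bl_tlen.
apply: blipB => //; first by apply: blipB => //; exact: bttan.
apply: blipM => //; last exact: bperp.
by apply: blipM => //; exact: blip_cst.
Qed.

Lemma field_lipschitz : (0 < N)%N -> exists2 L, 0 <= L &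
  forall (k : I) x y, `|coords (field (of_coords x)) k - coords (field (of_coords y)) k| <=
     L * \sum_l `|x l - y l|.
Proof.
move=> N0.
have h k : exists L, 0 <= L /\ forall x y,
    `|coords (field (of_coords x)) k - coords (field (of_coords y)) k| <= L * dist x y.
  by have [_ [L [_ L0 _ H]]] := bl_field k.1 k.2 N0; exists L; split=> // x y; exact: H.
have [L hL] := choice h.
exists (\sum_k L k); first by apply: sumr_ge0 => k _; case: (hL k).
move=> k x y; apply: (le_trans ((hL k).2 x y)); apply: ler_wpM2r => //.
by rewrite (bigD1 k)//= lerDl sumr_ge0// => l _; case: (hL l).
Qed.

Lemma field_bounded : (0 < N)%N -> exists2 C, 0 <= C &
  forall Z j i, `|field Z j 0 i| <= C.
Proof.
move=> N0.
have h k : exists C, 0 <= C /\ forall x, `|coords (field (of_coords x)) k| <= C.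
  by have [C [_ [C0 _ H _]]] := bl_field k.1 k.2 N0; exists C; split=> // x; exact: H.
have [C hC] := choice h.
exists (\sum_k C k); first by apply: sumr_ge0 => k _; case: (hC k).
move=> Z j i; have := (hC (j, i)).2 (coords Z); rewrite coordsK => k; apply: (le_trans k).
by rewrite (bigD1 (j, i))//= lerDl sumr_ge0// => l _; case: (hC l).
Qed.

Lemma field_flow (T : R) (Z0 : 'I_N -> E2) : (0 < N)%N -> 0 < T ->
  exists Y : 'I_N -> R -> E2, (forall j, Y j 0 = Z0 j) /\
   forall j i t, 0 <= t <= T ->
     is_derive t 1 (fun s => Y j s 0 i) (field (fun k => Y k t) j 0 i).
Proof.
move=> N0 T0; have [L L0 FL] := field_lipschitz N0.
have [x [x0 dx]] := @lipschitz_ode R _ (fun k x => coords (field (of_coords x)) k) L T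
  (coords Z0) L0 T0 FL.
exists (fun j t => of_coords (fun k => x k t) j); split.
  by move=> j; apply/rowP => i; rewrite mxE x0.
move=> j i t tT; have := dx (j, i) t tT.
by congr (is_derive _ _ _ _); apply/funext => s; rewrite mxE.
Qed.

End TruncatedField.

(** * Integrals over segments *)

Section SegmentIntegrals.
Context {R : realType}.
Local Notation mu := (@lebesgue_measure R).
Implicit Types (f g : R -> R) (a b c : R).

Lemma aeW (P Q : R -> Prop) : {ae mu, forall x, P x} ->
  (forall x, P x -> Q x) -> {ae mu, forall x, Q x}.
Proof.
by move=> [A [mA A0 HA]] PQ; exists A; split=> // x nQ; apply: HA => Px; apply/nQ/PQ.
Qed.

Lemma ae_true : {ae mu, forall x : R, True}.
Proof. by exists set0; split=> // x /=. Qed.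

Lemma aeI (P Q : R -> Prop) : {ae mu, forall x, P x} -> {ae mu, forall x, Q x} ->
  {ae mu, forall x, P x /\ Q x}.
Proof.
move=> [A [mA A0 HA]] [B [mB B0 HB]]; exists (A `|` B); split.
- exact: measurableU.
- by rewrite null_set_setU.
- move=> x /= nPQ; have [Px|nPx] := pselect (P x); last by left; apply: HA.
  by right; apply: HB => Qx; apply: nPQ.
Qed.

Lemma ae_fin_forall (I : finType) (P : I -> R -> Prop) :
  (forall i, {ae mu, forall x, P i x}) -> {ae mu, forall x, forall i, P i x}.
Proof.
move=> hP; suff : {ae mu, forall x, forall i, i \in enum I -> P i x}.
  by move=> h; apply: (aeW h) => x Hx i; apply: Hx; rewrite mem_enum.
elim: (enum I) => [|i s IH]; first by apply: (aeW ae_true).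
apply: (aeW (aeI (hP i) IH)) => x [h1 h2] j; rewrite inE => /predU1P[->//|].
exact: h2.
Qed.

Definition integrable_on a b f := mu.-integrable `[a, b] (EFin \o f).

Definition sint a b f : R := \int[mu]_(x in `[a, b]) f x.

Lemma integrable_on_measurable a b f : integrable_on a b f -> measurable_fun `[a, b] f.
Proof. by move=> /integrableP[/measurable_EFinP]. Qed.

Lemma integrable_onP a b f : measurable_fun `[a, b] f ->
  (\int[mu]_(x in `[a, b]) `|(f x)%:E| < +oo)%E -> integrable_on a b f.
Proof. by move=> mf h; apply/integrableP; split=> //; exact/measurable_EFinP. Qed.

Lemma mu_itv_cc a b : a <= b -> mu `[a, b] = (b - a)%:E.
Proof.
move=> ab; have := lebesgue_measure_itv `[a, b]; rewrite /= lte_fin => ->.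
case: ltP => // ba; have -> : b = a by apply/le_anti; rewrite ba ab.
by rewrite subrr.
Qed.

Lemma mu_itv_lty (i : interval R) a b : [set` i] `<=` `[a, b] -> (mu [set` i] < +oo)%E.
Proof.
move=> h; apply: (@le_lt_trans _ _ (mu `[a, b])).
  by apply: le_measure => //; rewrite inE; exact: measurable_itv.
by have := lebesgue_measure_itv `[a, b]; rewrite /= => ->; case: ifP => // _; rewrite -EFinB ltry.
Qed.

Lemma integrable_on_cont a b f : {within `[a, b], continuous f} -> integrable_on a b f.
Proof.
move=> cf; apply: continuous_compact_integrable => //; exact: segment_compact.
Qed.

Lemma integrable_onS a b c d f : a <= c -> d <= b -> integrable_on a b f ->
  integrable_on c d f.
Proof.
move=> ac db; apply: integrableS => // x /=; rewrite !in_itv/= => /andP[cx xd].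
by rewrite (le_trans ac cx) (le_trans xd db).
Qed.

Lemma integrable_on_bounded a b f B : measurable_fun `[a, b] f ->
  {ae mu, forall x, a <= x <= b -> `|f x| <= B} -> integrable_on a b f.
Proof.
move=> mf fB; apply: integrable_onP => //.
apply: (@le_lt_trans _ _ (\int[mu]_(x in `[a, b]) (Num.max B 0)%:E)%E).
  apply: ae_ge0_le_integral => //.
  - exact/measurableT_comp/measurable_EFinP.
  - by move=> x _; rewrite lee_fin le_max lexx orbT.
  - apply: (aeW fB) => x h /=; rewrite in_itv/= => /h; rewrite lee_fin => /le_trans; apply.
    by rewrite le_max lexx.
rewrite integral_cst//= lte_mul_pinfty ?lee_fin ?le_max ?lexx ?orbT//.
exact: (@mu_itv_lty _ a b).
Qed.

Lemma integrable_onD a b f g : integrable_on a b f -> integrable_on a b g ->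
  integrable_on a b (fun x => f x + g x).
Proof. by move=> hf hg; apply: (integrableD _ hf hg). Qed.

Lemma integrable_onN a b f : integrable_on a b f -> integrable_on a b (fun x => - f x).
Proof. by move=> hf; exact: (integrableN hf). Qed.

Lemma integrable_onB a b f g : integrable_on a b f -> integrable_on a b g ->
  integrable_on a b (fun x => f x - g x).
Proof. by move=> hf hg; apply: integrable_onD => //; exact: integrable_onN. Qed.

Lemma integrable_onZ a b f c : integrable_on a b f -> integrable_on a b (fun x => c * f x).
Proof. by move=> hf; apply: (integrableZl _ c hf). Qed.

Lemma integrable_on_norm a b f : integrable_on a b f -> integrable_on a b (fun x => `|f x|).
Proof. by move=> hf; exact: (integrable_norm hf). Qed.

Lemma integrable_on_le a b f g : measurable_fun `[a, b] f ->
  (forall x, a <= x <= b -> `|f x| <= g x) -> integrable_on a b g -> integrable_on a b f.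
Proof.
move=> mf fg; apply: le_integrable => //; first exact/measurable_EFinP.
move=> x /=; rewrite in_itv/= => xab; rewrite lee_fin.
by apply: (le_trans (fg x xab)); exact: ler_norm.
Qed.

Lemma integrable_onM_bounded a b f g B : measurable_fun `[a, b] g ->
  (forall x, a <= x <= b -> `|g x| <= B) -> integrable_on a b f ->
  integrable_on a b (fun x => f x * g x).
Proof.
move=> mg gB hf.
apply: (@integrable_on_le _ _ _ (fun x => B * `|f x|)).
- by apply: measurable_funM => //; exact: integrable_on_measurable.
- by move=> x xab; rewrite normrM mulrC; apply: ler_wpM2r => //; exact: gB.
- exact/integrable_onZ/integrable_on_norm.
Qed.

Lemma sintD a b f g : integrable_on a b f -> integrable_on a b g ->
  sint a b (fun x => f x + g x) = sint a b f + sint a b g.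
Proof. by move=> hf hg; exact: RintegralD. Qed.

Lemma sintB a b f g : integrable_on a b f -> integrable_on a b g ->
  sint a b (fun x => f x - g x) = sint a b f - sint a b g.
Proof. by move=> hf hg; exact: RintegralB. Qed.

Lemma sintZ a b f c : integrable_on a b f ->
  sint a b (fun x => c * f x) = c * sint a b f.
Proof. by move=> hf; exact: RintegralZl. Qed.

Lemma eq_sint a b f g : (forall x, a <= x <= b -> f x = g x) -> sint a b f = sint a b g.
Proof. by move=> fg; apply: eq_Rintegral => x; rewrite inE/= in_itv/=; exact: fg. Qed.

Lemma sint_cst a b c : a <= b -> sint a b (fun _ => c) = c * (b - a).
Proof.
move=> ab; rewrite /sint Rintegral_cst//; congr (_ * _).
by transitivity (fine (b - a)%:E) => //; congr fine; exact: mu_itv_cc.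
Qed.

Lemma le_sint a b f g : integrable_on a b f -> integrable_on a b g ->
  (forall x, a <= x <= b -> f x <= g x) -> sint a b f <= sint a b g.
Proof. by move=> hf hg fg; apply: le_Rintegral => // x /=; rewrite in_itv; exact: fg. Qed.

Lemma sint_ge0 a b f : (forall x, a <= x <= b -> 0 <= f x) -> 0 <= sint a b f.
Proof. by move=> h; apply: Rintegral_ge0 => x /=; rewrite in_itv; exact: h. Qed.

Lemma le_norm_sint a b f : integrable_on a b f ->
  `|sint a b f| <= sint a b (fun x => `|f x|).
Proof. by move=> hf; exact: le_normr_Rintegral. Qed.

Lemma sint_point a f : sint a a f = 0.
Proof. by rewrite /sint set_itv1 Rintegral_set1. Qed.

Lemma sint_chasles a b c f : a <= b -> b <= c -> integrable_on a c f ->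
  sint a c f = sint a b f + sint b c f.
Proof.
move=> ab bc hf; have := @Rintegral_itvB _ f (BLeft a) (BRight c) b hf.
rewrite !bnd_simp => /(_ ab bc) h; have := Rintegral_itv_obnd_cbnd (r := b) (b := BRight c) (f := f).
rewrite -/(sint b c f) => h2; rewrite -h2; last first.
  apply: integrableS hf => // x /=; rewrite !in_itv/= => /andP[bx xc].
  by rewrite xc (le_trans ab (ltW bx)).
by rewrite -h /sint addrC subrK.
Qed.

Lemma integrable_on_glue a b c f : a <= b -> b <= c ->
  integrable_on a b f -> integrable_on b c f -> integrable_on a c f.
Proof.
move=> ab bc h1 h2.
have E : `[a, c]%classic = `[a, b] `|` `]b, c].
  by rewrite -itv_bndbnd_setU// bnd_simp.
have m2 : measurable_fun `]b, c] f.
  by apply: measurable_funS (integrable_on_measurable h2) => // x /=; rewrite !in_itv/= => /andP[/ltW-> ->].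
have mf : measurable_fun `[a, c] f.
  by rewrite E; apply/measurable_funU => //; split=> //; exact: integrable_on_measurable.
apply: integrable_onP => //; rewrite E ge0_integral_setU//.
- apply: lte_add_pinfty; first by case/integrableP: h1.
  have /integrableP[_] : mu.-integrable `]b, c] (EFin \o f); last by [].
  by apply: integrableS h2 => // x /=; rewrite !in_itv/= => /andP[/ltW-> ->].
- by rewrite -E; apply/measurableT_comp => //; exact/measurable_EFinP.
- by rewrite disj_set2E; apply/eqP; rewrite -subset0 => x [] /=; rewrite !in_itv/= => /andP[_ xb] /andP[]; rewrite ltNge xb.
Qed.

Lemma integrable_on_open a b f g : integrable_on a b g ->
  (forall x, a < x < b -> f x = g x) -> integrable_on a b f /\ sint a b f = sint a b g.
Proof.
move=> hg fg; have mg := integrable_on_measurable hg.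
have mgo : measurable_fun `]a, b[ g.
  by apply: measurable_funS mg => // x /=; rewrite !in_itv/= => /andP[/ltW-> /ltW->].
have mfo : measurable_fun `]a, b[ f.
  by apply: eq_measurable_fun mgo => x; rewrite inE/= in_itv/= => /fg.
have mf : measurable_fun `[a, b] f := measurable_fun_itv_cc mfo.
split.
  apply: integrable_onP => //.
  rewrite integral_itv_bndoo; last exact/measurableT_comp/measurable_EFinP.
  have /integrableP[_] := hg; rewrite integral_itv_bndoo; last exact/measurableT_comp/measurable_EFinP.
  apply: le_lt_trans; rewrite le_eqVlt; apply/orP; left; apply/eqP.
  by apply: eq_integral => x; rewrite inE/= in_itv/= => /fg ->.
rewrite /sint /Rintegral integral_itv_bndoo; last exact/measurable_EFinP.
rewrite [in RHS]integral_itv_bndoo; last exact/measurable_EFinP.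
by congr fine; apply: eq_integral => x; rewrite inE/= in_itv/= => /fg ->.
Qed.

Lemma sint_ae a b f g : measurable_fun `[a, b] f -> measurable_fun `[a, b] g ->
  {ae mu, forall x, a <= x <= b -> f x = g x} -> sint a b f = sint a b g.
Proof.
move=> mf mg fg; rewrite /sint /Rintegral; congr fine.
apply: ae_eq_integral => //; try exact/measurable_EFinP.
by apply: (aeW fg) => x h /=; rewrite in_itv/= => /h ->.
Qed.

Lemma sint_FTC a b f F : a <= b -> {within `[a, b], continuous f} ->
  {within `[a, b], continuous F} ->
  (forall x, a < x < b -> is_derive x 1 F (f x)) -> sint a b f = F b - F a.
Proof.
rewrite le_eqVlt => /predU1P[-> _ _ _|ab cf cF dF]; first by rewrite sint_point subrr.
rewrite /sint /Rintegral (@continuous_FTC2 _ _ F)//.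
- have [_ h1 h2] := (continuous_within_itvP _ ab).1 cF.
  by split=> // x; rewrite in_itv/= => /dF [].
- by move=> x; rewrite in_itv/= => /dF [_ <-]; rewrite derive1E.
Qed.

(** Cauchy-Schwarz against the constant function, from the variance being
    nonnegative. *)
Lemma sint_sqr_le a b f : a <= b -> integrable_on a b f ->
  integrable_on a b (fun x => f x ^+ 2) ->
  sint a b f ^+ 2 <= (b - a) * sint a b (fun x => f x ^+ 2).
Proof.
move=> ab0 hf hf2; have [<-|anb] := eqVneq a b.
  by rewrite !sint_point expr0n/= mulr0.
have ab : a < b by rewrite lt_neqAle anb.
have ba0 : 0 < b - a by rewrite subr_gt0.
pose m := sint a b f / (b - a).
have hc : integrable_on a b (fun _ : R => m ^+ 2).
  by apply: integrable_on_cont => x; exact: cst_continuous.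
have : 0 <= sint a b (fun x => f x ^+ 2 - 2 * m * f x + m ^+ 2).
  apply: sint_ge0 => x _; have := sqr_ge0 (f x - m); rewrite !expr2; lra.
rewrite sintD//; last by apply: integrable_onB => //; exact: integrable_onZ.
rewrite sintB//; last exact: integrable_onZ.
rewrite sintZ// sint_cst// => h.
have E : sint a b f = m * (b - a) by rewrite /m divfK// gt_eqF.
rewrite E in h *; rewrite exprMn expr2 [(b - a) ^+ 2]expr2.
have : 0 <= (b - a) * (sint a b (fun x => f x ^+ 2) - 2 * m * (m * (b - a)) + m ^+ 2 * (b - a)).
  by apply: mulr_ge0 => //; exact: ltW.
by rewrite expr2; lra.
Qed.

End SegmentIntegrals.

(** * Derivatives of plane curves *)

Section CurveDerivatives.
Context {R : realType}.
Local Notation E2 := 'rV[R]_2.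

Lemma norm_le_enorm (v : E2) : `|v| <= enorm v.
Proof.
have [->|/mx_norm_neq0 [[i j] /= h]] := eqVneq `|v| 0; first exact: enorm_ge0.
rewrite [leLHS]h (_ : i = 0) ?enorm_coord//.
by apply/val_inj; case: i {h} => -[].
Qed.

Lemma coord_le_norm (v : E2) (i : 'I_2) : `|v 0 i| <= `|v|.
Proof.
rewrite [leRHS]mx_normrE.
exact: (le_bigmax_cond _ (fun ij : 'I_1 * 'I_2 => `|v ij.1 ij.2|) (j := (0, i))).
Qed.

Lemma enorm_le_norm (v : E2) : enorm v <= 2 * `|v|.
Proof.
apply: (le_trans (enorm_le_coord v)).
by have := coord_le_norm v 0; have := coord_le_norm v 1; lra.
Qed.

Lemma continuous_coord (f : R -> E2) (i : 'I_2) : continuous f ->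
  continuous (fun x => f x 0 i).
Proof.
move=> cf x; apply/cvgrPdist_lt => e e0.
have /cvgrPdist_lt/(_ e e0) := cf x; apply: filterS => y.
by apply: le_lt_trans; have := coord_le_norm (f x - f y) i; rewrite !mxE.
Qed.

Lemma is_derive_coord (f : R -> E2) (t : R) (df : E2) :
  is_derive t 1 f df <-> forall i, is_derive t 1 (fun s => f s 0 i) (df 0 i).
Proof.
split=> [/is_deriveP H i|H].
  apply/is_deriveP => e e0; have [d d0 Hd] := H e e0.
  exists d => // s sd; apply: le_trans (Hd s sd).
  by have := coord_le_norm (f s - f t - (s - t) *: df) i; rewrite !mxE.
apply/is_deriveP => e e0; have e20 : 0 < e / 2 by rewrite divr_gt0.
have [d d0 Hd] := (is_deriveP _ _ _).1 (H 0) (e / 2) e20.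
have [d' d'0 Hd'] := (is_deriveP _ _ _).1 (H 1) (e / 2) e20.
exists (Num.min d d'); first by rewrite lt_min d0.
move=> s; rewrite lt_min => /andP[sd sd'].
apply: (le_trans (norm_le_enorm _)); apply: (le_trans (enorm_le_coord _)).
have := Hd s sd; have := Hd' s sd'; rewrite !mxE /GRing.scale/=.
by lra.
Qed.

Lemma is_derive_affine (V : normedModType R) (a b : V) (x : R) :
  is_derive x 1 (fun s : R => a + s *: b) b.
Proof.
apply/is_deriveP => e e0; exists 1 => // s _.
rewrite opprD addrACA subrr add0r -scalerBl subrr normr0.
by rewrite mulr_ge0// ltW.
Qed.

Lemma is_derive_derive1 (V : normedModType R) (f : R -> V) (x : R) (df : V) :
  is_derive x 1 f df -> derive1 f x = df.
Proof. by case=> _ <-; rewrite derive1E. Qed.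

Lemma is_derive_dot (f : R -> E2) (df v : E2) (t : R) :
  is_derive t 1 f df -> is_derive t 1 (fun s => dot (f s) v) (dot df v).
Proof.
move=> /is_derive_coord h.
have -> : (fun s => dot (f s) v) = (fun s => f s 0 0 * v 0 0 + f s 0 1 * v 0 1).
  by apply/funext => s; rewrite dotE.
have h0 := derM (h 0) (derC t (v 0 0)); have h1 := derM (h 1) (derC t (v 0 1)).
have := derD h0 h1; rewrite !mulr0 !addr0.
by rewrite dotE.
Qed.

Variable T : R.
Hypothesis T0 : 0 < T.

Let proper_within t : 0 <= t <= T -> ProperFilter (within `[0, T] t^').
Proof.
move=> /andP[t0 tT]; apply: Build_ProperFilter_ex => P.
rewrite /within/= => -[d /= d0 Hd].
pose e := Num.min (d / 2) (T / 2).
have e0 : 0 < e by rewrite lt_min !divr_gt0.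
have [h|h] := leP t (T / 2).
  exists (t + e); apply: Hd => /=.
  - rewrite opprD addrA subrr add0r normrN gtr0_norm// gt_min.
    by rewrite ltr_pdivrMr// ltr_pMr// ltr1n.
  - by rewrite -subr_eq0 addrAC subrr add0r gt_eqF.
  - rewrite in_itv/= addr_ge0// ?(ltW e0)//.
    have : e <= T / 2 by rewrite ge_min lexx orbT.
    by lra.
exists (t - e); apply: Hd => /=.
- rewrite opprB addrC subrK gtr0_norm// gt_min.
  by rewrite ltr_pdivrMr// ltr_pMr// ltr1n.
- by rewrite -subr_eq0 addrAC subrr add0r oppr_eq0 gt_eqF.
- rewrite in_itv/=.
  have : e <= T / 2 by rewrite ge_min lexx orbT.
  by have := e0; lra.
Qed.

Lemma tderivP (f : R -> E2) (t : R) (df : E2) : 0 <= t <= T ->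
  (tderivable T f t /\ tderiv T f t = df) <->
  (forall e, 0 < e -> exists2 d, 0 < d & forall s, 0 <= s <= T -> `|s - t| < d ->
     enorm (f s - f t - (s - t) *: df) <= e * `|s - t|).
Proof.
move=> tT; have PF := proper_within tT.
have key : (diff_quotient f t @ within `[0, T] t^' --> df) <->
  (forall e, 0 < e -> exists2 d, 0 < d & forall s, 0 <= s <= T -> `|s - t| < d ->
     enorm (f s - f t - (s - t) *: df) <= e * `|s - t|).
  split=> [/cvgrPdist_le H e e0|H].
    have [d /= d0 Hd] := H (e / 2) (divr_gt0 e0 (ltr0n _ 2)).
    exists d => // s sT sd; have [->|st] := eqVneq s t.
      by rewrite !subrr scale0r subrr enorm0 normr0 mulr0.
    have s0 : s - t != 0 by rewrite subr_eq0.
    have := Hd s; rewrite /= distrC => /(_ sd st); rewrite in_itv => /(_ sT) h.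
    have h2 := enorm_le_norm (df - diff_quotient f t s).
    have -> : f s - f t - (s - t) *: df = (s - t) *: - (df - diff_quotient f t s).
      by rewrite opprB scalerBr /diff_quotient scalerA mulfV// scale1r.
    rewrite enormZ enormN mulrC; apply: ler_wpM2r => //.
    by apply: (le_trans h2); lra.
  apply/cvgrPdist_le => e e0; have [d d0 Hd] := H e e0.
  exists d => //= s; rewrite /= distrC => sd st; rewrite in_itv/= => sT.
  have s0 : s - t != 0 by rewrite subr_eq0.
  apply: (le_trans (norm_le_enorm _)).
  rewrite -(ler_pM2r (_ : 0 < `|s - t|)) ?normr_gt0//; apply: le_trans (Hd s sT sd).
  rewrite mulrC -enormZ scalerBr /diff_quotient scalerA mulfV// scale1r.
  by rewrite enormBC.
rewrite -key; split=> [[c <-]|c]; first exact: c.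
split; first by apply/cvg_ex; exists df.
exact: cvg_lim.
Qed.

Lemma tderiv_sum (I : Type) (r : seq I) (c : I -> R) (f : I -> R -> E2) (t : R) :
  0 <= t <= T -> (forall i, tderivable T (f i) t) ->
  tderiv T (fun s => \sum_(i <- r) c i *: f i s) t = \sum_(i <- r) c i *: tderiv T (f i) t.
Proof.
move=> tT df; suff [] : tderivable T (fun s => \sum_(i <- r) c i *: f i s) t /\
  tderiv T (fun s => \sum_(i <- r) c i *: f i s) t = \sum_(i <- r) c i *: tderiv T (f i) t by [].
apply/tderivP => // e e0; elim: r e e0 => [|i r IH] e e0.
  exists 1 => // s _ _; rewrite !big_nil scaler0 !subrr enorm0.
  by rewrite mulr_ge0// ltW.
pose k := e / 2 / (`|c i| + 1).
have c1 : 0 < `|c i| + 1 by rewrite ltr_wpDl.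
have k0 : 0 < k by rewrite !divr_gt0.
have [d d0 Hd] := IH (e / 2) (divr_gt0 e0 (ltr0n _ 2)).
have [d' d'0 Hd'] := (tderivP (f i) (tderiv T (f i) t) tT).1 (conj (df i) erefl) k k0.
exists (Num.min d d'); first by rewrite lt_min d0.
move=> s sT; rewrite lt_min => /andP[sd sd'].
rewrite !big_cons.
set A := \sum_(j <- r) _; set B := \sum_(j <- r) _; set C := \sum_(j <- r) _.
have -> : c i *: f i s + A - (c i *: f i t + B) - (s - t) *: (c i *: tderiv T (f i) t + C)
  = c i *: (f i s - f i t - (s - t) *: tderiv T (f i) t) + (A - B - (s - t) *: C).
  by apply: row2P; rewrite !mxE; ring.
apply: (le_trans (enormD _ _)); have h1 := Hd s sT sd.
rewrite (_ : e = e / 2 + e / 2); last by lra.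
rewrite mulrDl; apply: lerD => //.
rewrite enormZ; apply: (@le_trans _ _ ((`|c i| + 1) * (k * `|s - t|))).
  apply: ler_pM => //; [exact: enorm_ge0|by rewrite lerDl|exact: Hd'].
by rewrite mulrA /k [_ * (_ / _)]mulrC divfK// gt_eqF.
Qed.

Lemma tderiv_is_derive (f : R -> E2) (t : R) (df : E2) : 0 <= t <= T ->
  is_derive t 1 f df -> tderivable T f t /\ tderiv T f t = df.
Proof.
move=> tT /is_deriveP H; apply/tderivP => // e e0.
have [d d0 Hd] := H (e / 2) (divr_gt0 e0 (ltr0n _ 2)).
exists d => // s sT sd; apply: (le_trans (enorm_le_norm _)).
by have := Hd s sd; lra.
Qed.

(** Continuing a curve affinely beyond the end points turns one-sided time
    derivatives into ordinary ones. *)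
Lemma tderiv_extend (f : R -> E2) : (forall t, 0 <= t <= T -> tderivable T f t) ->
  exists g : R -> E2, (forall t, 0 <= t <= T -> g t = f t) /\
    forall t, 0 <= t <= T -> is_derive t 1 g (tderiv T f t).
Proof.
move=> df.
have T00 : 0 <= (0 : R) <= T by rewrite lexx (ltW T0).
have TT : 0 <= T <= T by rewrite (ltW T0) lexx.
pose g (t : R) : E2 := if t < 0 then f 0 + t *: tderiv T f 0
  else if T < t then f T + (t - T) *: tderiv T f T else f t.
have gf t : 0 <= t <= T -> g t = f t.
  by move=> /andP[t0 tT]; rewrite /g ltNge t0/= ltNge tT.
exists g; split=> // t tT; apply/is_deriveP => e e0.
have [d d0 Hd] := (tderivP f (tderiv T f t) tT).1 (conj (df t tT) erefl) e e0.
have [t00 tTT] := andP tT.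
have [d1 d10 Hd1] : exists2 d1, 0 < d1 & forall s, `|s - t| < d1 ->
    0 <= s <= T \/ g s - g t - (s - t) *: tderiv T f t = 0.
  have [d1 d10 Hd1] : exists2 d1, 0 < d1 & forall s, `|s - t| < d1 ->
     0 <= s \/ g s - g t - (s - t) *: tderiv T f t = 0.
    have [t0|t0] := eqVneq t 0.
      exists 1 => // s _; have [s0|s0] := leP 0 s; [by left|right].
      by rewrite t0 (gf 0 T00) /g s0 subr0 [f 0 + _]addrC addrK subrr.
    exists t; first by rewrite lt_neqAle eq_sym t0.
    by move=> s; rewrite ltr_norml => /andP[h _]; left; lra.
  have [d2 d20 Hd2] : exists2 d2, 0 < d2 & forall s, `|s - t| < d2 ->
     s <= T \/ g s - g t - (s - t) *: tderiv T f t = 0.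
    have [t0|t0] := eqVneq t T.
      exists 1 => // s _; have [s0|s0] := leP s T; [by left|right].
      rewrite t0 (gf T TT) /g s0 ltNge (ltW (lt_trans T0 s0))/=.
      by rewrite [f T + _]addrC addrK subrr.
    exists (T - t); first by rewrite subr_gt0 lt_neqAle t0.
    by move=> s; rewrite ltr_norml => /andP[_ h]; left; lra.
  exists (Num.min d1 d2); first by rewrite lt_min d10.
  move=> s; rewrite lt_min => /andP[/Hd1 h1 /Hd2 h2].
  by case: h1 => [->|]; [case: h2 => [->|]; [left|right]|right].
exists (Num.min d d1); first by rewrite lt_min d0.
move=> s; rewrite lt_min => /andP[sd /Hd1[sT|->]].
  by rewrite !gf//; apply: (le_trans (norm_le_enorm _)); exact: Hd.
by rewrite normr0 mulr_ge0// ltW.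
Qed.

End CurveDerivatives.

(** * The scheme as a nodal system *)

Section FiniteElementIdentities.
Context {R : realType} (N : nat) (xi : nat -> R) (phi : 'I_N -> R -> R).
Local Notation E2 := 'rV[R]_2.
Local Notation mu := (@lebesgue_measure R).
Hypothesis part : partition_of_S1 N xi.
Implicit Types (Z V : 'I_N -> E2).

Lemma partition_gt0 : (0 < N)%N.
Proof.
case: part => h0 hN _; rewrite lt0n; apply/eqP => N0.
by move: hN; rewrite N0 h0 => h; have := @pi_gt0 R; lra.
Qed.

Lemma node_lt (j : 'I_N) : xi j < xi j.+1.
Proof. by case: part. Qed.

Lemma node_le i j : (i <= j <= N)%N -> xi i <= xi j.
Proof.
elim: j => [|j IH]; first by rewrite leqn0 => /andP[/eqP ->].
rewrite leq_eqVlt => /andP[/predU1P[->//|ij jN]].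
apply: (@le_trans _ _ (xi j)); first by apply: IH; rewrite -ltnS ij ltnW.
exact: ltW (node_lt (Ordinal jN)).
Qed.

Lemma node_S1 j : (j <= N)%N -> 0 <= xi j <= 2 * pi.
Proof.
by move=> jN; case: part => <- <- _; rewrite !node_le ?jN ?leqnn.
Qed.

Lemma elem_size_gt0 (j : 'I_N) : 0 < elem_size xi j.
Proof. by rewrite subr_gt0 node_lt. Qed.

Lemma sum_elem_size : \sum_(j < N) elem_size xi j = 2 * pi.
Proof.
rewrite /elem_size -(big_mkord xpredT (fun j => xi j.+1 - xi j)).
by rewrite telescope_sumr//; case: part => -> -> _; rewrite subr0.
Qed.

Lemma sint_elements (f : R -> R) (g : 'I_N -> R -> R) :
  (forall j : 'I_N, integrable_on (xi j) (xi j.+1) (g j)) ->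
  (forall (j : 'I_N) x, xi j < x < xi j.+1 -> f x = g j x) ->
  integrable_on 0 (2 * pi) f /\
  sint 0 (2 * pi) f = \sum_(j < N) sint (xi j) (xi j.+1) (g j).
Proof.
move=> ig fg.
have fel (j : 'I_N) := integrable_on_open (ig j) (fg j).
have key n : (n <= N)%N -> integrable_on (xi 0) (xi n) f /\
    sint (xi 0) (xi n) f = \sum_(0 <= k < n) sint (xi k) (xi k.+1) f.
  elim: n => [_|n IH nN].
    rewrite big_geq// sint_point; split=> //.
    by apply: integrable_on_cont; rewrite set_itv1; exact: continuous_subspace1.
  have [i1 e1] := IH (ltnW nN); have [i2 e2] := fel (Ordinal nN).
  have le1 : xi 0 <= xi n by apply: node_le; rewrite leq0n ltnW.
  have le2 : xi n <= xi n.+1 := ltW (node_lt (Ordinal nN)).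
  have i3 : integrable_on (xi 0) (xi n.+1) f := integrable_on_glue le1 le2 i1 i2.
  by split=> //; rewrite (sint_chasles le1 le2 i3) e1 big_nat_recr.
have [] := key N (leqnn N); case: part => -> -> _ i e; split=> //.
by rewrite e big_mkord; apply: eq_bigr => j _; case: (fel j).
Qed.

Lemma S1E : @S1 R = `[0, 2 * pi]%classic. Proof. by []. Qed.

Definition local_coord (j : 'I_N) (x : R) : R := (x - xi j) / elem_size xi j.

Lemma local_size_elem (j : 'I_N) x : xi j < x < xi j.+1 -> local_size N xi x = elem_size xi j.
Proof.
move=> /andP[jx xj]; rewrite /local_size (bigD1 j)//= big1 ?addr0.
  by rewrite indicE mem_set ?mulr1//= in_itv/= jx ltW.
move=> i ij; rewrite indicE memNset ?mulr0//= in_itv/= => /andP[ix xi'].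
have [lt_ij|lt_ji|/val_inj eij] := ltngtP i j.
- have := @node_le i.+1 j; rewrite lt_ij (ltnW (ltn_ord j)) => /(_ isT).
  by move: xi' jx; lra.
- have := @node_le j.+1 i; rewrite lt_ji (ltnW (ltn_ord i)) => /(_ isT).
  by move: xj ix; lra.
- by move: ij; rewrite eij eqxx.
Qed.

Lemma node_left (V : zmodType) (v : R -> V) (j : 'I_N) : periodic v (2 * pi) ->
  v (xi j) = v (xi (ord_pred j).+1).
Proof.
move=> pv; have [j0|j0] := posnP (j : nat).
  have -> : (ord_pred j).+1 = N.
    have N0 := partition_gt0.
    by rewrite /= j0 add0n modn_small ?ltn_predL// prednK.
  by case: part => h0 hN _; rewrite hN j0 h0 -[in RHS](add0r (2 * pi)) pv.
have -> // : (ord_pred j).+1 = j :> nat.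
have jN := ltn_ord j.
have -> : ord_pred j = ((j.-1 + N) %% N)%N :> nat by rewrite /= -{1}(prednK j0).
have j1 : (j.-1 < N)%N := leq_ltn_trans (leq_pred j) jN.
by rewrite modnDr modn_small// prednK.
Qed.

Lemma P1_elem (V : normedModType R) (v : R -> V) (j : 'I_N) x : periodic_P1 N xi v ->
  xi j <= x <= xi j.+1 ->
  v x = v (xi (ord_pred j).+1) +
    local_coord j x *: (v (xi j.+1) - v (xi (ord_pred j).+1)).
Proof.
move=> [pv _ /(_ j) [a [b vE]]] xj; rewrite -(node_left j pv).
have jl := node_lt j.
rewrite !vE ?in_itv/= ?lexx ?(ltW jl)//.
rewrite opprD addrACA subrr add0r -scalerBl scalerA /local_coord /elem_size.
rewrite divfK ?subr_eq0 ?gt_eqF// -addrA -scalerDl.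
by rewrite [xi j + _]addrC subrK.
Qed.

Hypothesis basis : nodal_basis xi phi.

Lemma sum_phi_elem (Z : 'I_N -> E2) (j : 'I_N) x : xi j <= x <= xi j.+1 ->
  \sum_i phi i x *: Z i = Z (ord_pred j) + local_coord j x *: edge Z j.
Proof.
move=> xj.
have sum_delta (k : 'I_N) : \sum_i (k == i)%:R *: Z i = Z k.
  rewrite (bigD1 k)//= eqxx scale1r big1 ?addr0// => i ik.
  by rewrite eq_sym (negbTE ik) scale0r.
have phiE i : phi i x = (ord_pred j == i)%:R + local_coord j x * ((j == i)%:R - (ord_pred j == i)%:R).
  have [pP1 pn] := basis i.
  by have := P1_elem (j := j) pP1 xj; rewrite !pn.
under eq_bigr do rewrite phiE scalerDl -scalerA scalerBl.
by rewrite big_split/= -scaler_sumr sumrB !sum_delta.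
Qed.

Lemma sum_phi_node (Z : 'I_N -> E2) (j : 'I_N) : \sum_i phi i (xi j.+1) *: Z i = Z j.
Proof.
rewrite (bigD1 j)//= (basis j).2 eqxx scale1r big1 ?addr0// => i ij.
by rewrite (basis i).2 eq_sym (negbTE ij) scale0r.
Qed.

Lemma continuous_sum_phi (Z : 'I_N -> E2) : continuous (fun x => \sum_i phi i x *: Z i).
Proof.
suff key (r : seq 'I_N) : continuous (fun x => \sum_(i <- r) phi i x *: Z i) by exact: key.
elim: r => [|i r IH] x.
  by under eq_fun do rewrite big_nil; exact: cst_continuous.
have -> : (fun x => \sum_(k <- i :: r) phi k x *: Z k) =
    (fun x => phi i x *: Z i) + (fun x => \sum_(k <- r) phi k x *: Z k).
  by apply/funext => y; rewrite big_cons.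
apply: continuousD; last exact: IH.
by apply: continuousZr_tmp; have [[_ c _] _] := basis i; exact: c.
Qed.

Lemma nodal_test_P1 (j : 'I_N) (e : E2) : periodic_P1 N xi (fun x => phi j x *: e).
Proof.
have [[pp cp ap] _] := basis j; split.
- by move=> x; rewrite pp.
- by move=> x; apply: cvgZr_tmp; exact: cp.
- move=> i; have [a [b H]] := ap i; exists (a *: e), (b *: e) => x xi'.
  by rewrite H// scalerDl scalerA.
Qed.

Lemma derive1_elem (f : R -> E2) (a b : E2) (j : 'I_N) x :
  (forall y, xi j <= y <= xi j.+1 -> f y = a + local_coord j y *: b) ->
  xi j < x < xi j.+1 -> is_derive x 1 f ((elem_size xi j)^-1 *: b).
Proof.
move=> fE /andP[jx xj]; set s := elem_size xi j.
apply: (@is_derive_near _ _ (fun y => (a - (xi j / s) *: b) + y *: (s^-1 *: b)) f x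
  (Num.min (x - xi j) (xi j.+1 - x))).
- by rewrite lt_min !subr_gt0 jx.
- move=> y; rewrite lt_min => /andP[]; rewrite !ltr_norml => /andP[h1 h2] /andP[h3 h4].
  rewrite fE; last by apply/andP; split; lra.
  by rewrite /local_coord -/s scalerA mulrBl scalerBl -addrA [- _ + _]addrC.
- exact: is_derive_affine.
Qed.

Lemma sint_quadratic (j : 'I_N) (c0 c1 c2 : R) :
  let f (x : R) := c0 + c1 * local_coord j x + c2 * local_coord j x ^+ 2 in
  integrable_on (xi j) (xi j.+1) f /\
  sint (xi j) (xi j.+1) f = elem_size xi j * (c0 + c1 / 2 + c2 / 3).
Proof.
set s := elem_size xi j; have s0 : s != 0 by rewrite gt_eqF// elem_size_gt0.
move=> f; pose F (x : R) := (x - xi j) * c0 + (x - xi j) * (x - xi j) * (c1 / (2 * s))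
  + (x - xi j) * (x - xi j) * (x - xi j) * (c2 / (3 * s ^+ 2)).
have dx (x : R) : is_derive x 1 (fun y => y - xi j) 1.
  by have := derB (derX x) (derC x (xi j)); rewrite subr0.
have dF (x : R) : is_derive x 1 F (f x).
  have d2 := derM (dx x) (dx x); have d3 := derM d2 (dx x).
  have := derD (derD (derM (dx x) (derC x c0)) (derM d2 (derC x (c1 / (2 * s)))))
    (derM d3 (derC x (c2 / (3 * s ^+ 2)))).
  move=> h; apply: (is_derive_eq h); rewrite /f /local_coord -/s.
  by field.
have df (x : R) : derivable f x 1.
  have dl := derM (dx x) (derC x s^-1).
  by have [] := derD (derD (derC x c0) (derZ c1 dl)) (derZ c2 (derM dl dl)).
have cf : {within `[xi j, xi j.+1], continuous f}.
  by apply: derivable_within_continuous => x _; exact: df.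
have cF : {within `[xi j, xi j.+1], continuous F}.
  by apply: derivable_within_continuous => x _; have [] := dF x.
split; first exact: integrable_on_cont.
rewrite (sint_FTC (ltW (node_lt j)) cf cF) // /F -/(elem_size xi j) -/s subrr.
by field.
Qed.

Lemma dot_affine (a b c d : E2) (y : R) : dot (a + y *: b) (c + y *: d) =
  dot a c + (dot a d + dot b c) * y + dot b d * y ^+ 2.
Proof. by rewrite dotDl !dotDr !dotZl !dotZr; ring. Qed.

Lemma dot_affine_r (a c d : E2) (y : R) : dot a (c + y *: d) = dot a c + dot a d * y.
Proof. by rewrite dotDr dotZr mulrC. Qed.

(** Element by element, the lumping term completes the consistent mass matrix
    to a diagonal one, so that only nodal values are coupled to themselves. *)
Lemma weak_form_nodal (U W v : R -> E2) (L : R) (Z V w : 'I_N -> E2) :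
  L = perimeter Z ->
  (forall (j : 'I_N) x, xi j <= x <= xi j.+1 -> U x = Z (ord_pred j) + local_coord j x *: edge Z j) ->
  (forall (j : 'I_N) x, xi j <= x <= xi j.+1 -> W x = V (ord_pred j) + local_coord j x *: edge V j) ->
  (forall (j : 'I_N) x, xi j <= x <= xi j.+1 -> v x = w (ord_pred j) + local_coord j x *: edge w j) ->
  \int[mu]_(x in S1) (enorm (derive1 U x) * dot (W x) (v x))
  + \int[mu]_(x in S1) dot (tangent U x) (derive1 v x)
  + \int[mu]_(x in S1) (local_size N xi x ^+ 2 * enorm (derive1 U x) / 6
                        * dot (derive1 W x) (derive1 v x))
  + \int[mu]_(x in S1) (2 * pi / L * dot (perp (derive1 U x)) (v x)) =
  \sum_j dot (nodal_residual Z V j) (w j).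
Proof.
move=> LE UE WE vE; rewrite S1E -/(sint 0 (2 * pi) _) -!/(sint 0 (2 * pi) _).
have dU (j : 'I_N) x : xi j < x < xi j.+1 -> derive1 U x = (elem_size xi j)^-1 *: edge Z j.
  by move=> xj; exact/is_derive_derive1/(derive1_elem (UE j)).
have dW (j : 'I_N) x : xi j < x < xi j.+1 -> derive1 W x = (elem_size xi j)^-1 *: edge V j.
  by move=> xj; exact/is_derive_derive1/(derive1_elem (WE j)).
have dv (j : 'I_N) x : xi j < x < xi j.+1 -> derive1 v x = (elem_size xi j)^-1 *: edge w j.
  by move=> xj; exact/is_derive_derive1/(derive1_elem (vE j)).
have s0 (j : 'I_N) : 0 < (elem_size xi j)^-1 by rewrite invr_gt0 elem_size_gt0.
have sn0 (j : 'I_N) : elem_size xi j != 0 by rewrite gt_eqF// elem_size_gt0.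
have cc (j : 'I_N) x : xi j < x < xi j.+1 -> xi j <= x <= xi j.+1.
  by move=> /andP[/ltW-> /ltW->].
pose q j := enorm (edge Z j).
have nU (j : 'I_N) x : xi j < x < xi j.+1 -> enorm (derive1 U x) = (elem_size xi j)^-1 * q j.
  by move=> xj; rewrite (dU j x xj) enormZ gtr0_norm.
pose I1 j := q j * (dot (V (ord_pred j)) (w (ord_pred j)) +
    (dot (V (ord_pred j)) (edge w j) + dot (edge V j) (w (ord_pred j))) / 2 +
    dot (edge V j) (edge w j) / 3).
have -> : sint 0 (2 * pi) (fun x => enorm (derive1 U x) * dot (W x) (v x)) = \sum_j I1 j.
  have qi (j : 'I_N) := sint_quadratic j
    ((elem_size xi j)^-1 * q j * dot (V (ord_pred j)) (w (ord_pred j)))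
    ((elem_size xi j)^-1 * q j * (dot (V (ord_pred j)) (edge w j) + dot (edge V j) (w (ord_pred j))))
    ((elem_size xi j)^-1 * q j * dot (edge V j) (edge w j)).
  rewrite (sint_elements (fun j => (qi j).1) _).2.
    by apply: eq_bigr => j _; rewrite (qi j).2 /I1; field.
  move=> j x xj; rewrite (nU j x xj) (WE j x (cc j x xj)) (vE j x (cc j x xj)).
  by rewrite dot_affine; ring.
pose I2 j := dot (dir (edge Z j)) (edge w j).
have -> : sint 0 (2 * pi) (fun x => dot (tangent U x) (derive1 v x)) = \sum_j I2 j.
  have qi (j : 'I_N) := sint_quadratic j ((elem_size xi j)^-1 * I2 j) 0 0.
  rewrite (sint_elements (fun j => (qi j).1) _).2.
    by apply: eq_bigr => j _; rewrite (qi j).2 /I2; field.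
  move=> j x xj; rewrite /tangent -/(dir _) (dU j x xj) (dv j x xj) dirZ// /I2.
  by rewrite (dotZr (elem_size _ _)^-1); ring.
pose I3 j := q j / 6 * dot (edge V j) (edge w j).
have -> : sint 0 (2 * pi) (fun x => local_size N xi x ^+ 2 * enorm (derive1 U x) / 6
                        * dot (derive1 W x) (derive1 v x)) = \sum_j I3 j.
  have qi (j : 'I_N) := sint_quadratic j ((elem_size xi j)^-1 * I3 j) 0 0.
  rewrite (sint_elements (fun j => (qi j).1) _).2.
    by apply: eq_bigr => j _; rewrite (qi j).2 /I3; field.
  move=> j x xj; rewrite (nU j x xj) (dW j x xj) (dv j x xj) (local_size_elem xj) /I3.
  by rewrite (dotZl (elem_size _ _)^-1) (dotZr (elem_size _ _)^-1); field.
pose I4 j := 2 * pi / L * (dot (perp (edge Z j)) (w (ord_pred j)) + dot (perp (edge Z j)) (edge w j) / 2).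
have -> : sint 0 (2 * pi) (fun x => 2 * pi / L * dot (perp (derive1 U x)) (v x)) = \sum_j I4 j.
  have qi (j : 'I_N) := sint_quadratic j
    (2 * pi / L * ((elem_size xi j)^-1 * dot (perp (edge Z j)) (w (ord_pred j))))
    (2 * pi / L * ((elem_size xi j)^-1 * dot (perp (edge Z j)) (edge w j))) 0.
  rewrite (sint_elements (fun j => (qi j).1) _).2.
    by apply: eq_bigr => j _; rewrite (qi j).2 /I4; move: (2 * pi / L) => c4; field.
  move=> j x xj; rewrite (dU j x xj) (vE j x (cc j x xj)) perpZ (dotZl (elem_size _ _)^-1) dot_affine_r.
  by ring.
pose A j := q j / 2 * dot (V j) (w j) + dot (dir (edge Z j)) (w j) + pi / L * dot (perp (edge Z j)) (w j).
pose B j := q j / 2 * dot (V (ord_pred j)) (w (ord_pred j)) - dot (dir (edge Z j)) (w (ord_pred j))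
  + pi / L * dot (perp (edge Z j)) (w (ord_pred j)).
rewrite -!big_split/= (eq_bigr (fun j => A j + B j)); last first.
  move=> j _; rewrite /I1 /I2 /I3 /I4 /A /B /edge -/(edge Z j) !dotBl !dotBr.
  rewrite [2 * pi / L](_ : _ = 2 * (pi / L)); last by rewrite mulrA.
  by move: (pi / L) => c4; field.
rewrite big_split/= -[X in _ + X]sum_ordS -big_split/=.
apply: eq_bigr => j _; rewrite /A /B ordSK /nodal_residual -LE -!/(q _).
by rewrite !dotDl !dotNl !dotDl !dotNl !(dotZl (pi / L)) !(dotZl (_ / 2)) perpD !dotDl; move: (pi / L) => c4; field.
Qed.

Variable T : R.
Hypothesis T0 : 0 < T.

Lemma discrete_velocityE (Xn : 'I_N -> R -> E2) t x : 0 <= t <= T ->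
  (forall j, tderivable T (Xn j) t) ->
  discrete_velocity phi T Xn t x = \sum_j phi j x *: tderiv T (Xn j) t.
Proof. by move=> tT dX; rewrite /discrete_velocity /discrete_curve tderiv_sum. Qed.

Lemma weak_equationP (Xn : 'I_N -> R -> E2) t : 0 <= t <= T ->
  (forall j, tderivable T (Xn j) t) ->
  (forall v, periodic_P1 N xi v -> weak_equation xi phi T Xn t v) <->
  forall j, nodal_residual (fun k => Xn k t) (fun k => tderiv T (Xn k) t) j = 0.
Proof.
move=> tT dX.
have key v : periodic_P1 N xi v -> weak_equation xi phi T Xn t v <->
    \sum_j dot (nodal_residual (fun k => Xn k t) (fun k => tderiv T (Xn k) t) j) (v (xi j.+1)) = 0.
  move=> pv; rewrite /weak_equation.
  rewrite (@weak_form_nodal _ _ _ _ (fun k => Xn k t) (fun k => tderiv T (Xn k) t) (fun k => v (xi k.+1)))//.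
  - by move=> j x xj; rewrite /discrete_curve (sum_phi_elem (fun k => Xn k t) xj).
  - by move=> j x xj; rewrite discrete_velocityE// (sum_phi_elem (fun k => tderiv T (Xn k) t) xj).
  - by move=> j x xj; rewrite (P1_elem pv xj).
split=> [H j|H v pv]; last by apply/key => //; apply: big1 => j _; rewrite H dot0l.
pose r := nodal_residual (fun k => Xn k t) (fun k => tderiv T (Xn k) t).
have := (key _ (nodal_test_P1 j (r j))).1 (H _ (nodal_test_P1 j (r j))).
rewrite (bigD1 j)//= (basis j).2 eqxx scale1r big1 ?addr0.
  by rewrite -/(r j) -enorm_sqr => /eqP; rewrite sqrf_eq0 enorm_eq0 => /eqP.
by move=> i ij; rewrite (basis j).2 (negbTE ij) scale0r dot0r.
Qed.

(** The scheme decouples into the lumped nodal system. *)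
Theorem semidiscrete_nodal (X0 : R -> E2) (Xn : 'I_N -> R -> E2) :
  semidiscrete_solution xi phi T X0 Xn <->
  [/\ forall j t, 0 <= t <= T -> tderivable T (Xn j) t,
      forall j, Xn j 0 = X0 (xi j.+1) &
      forall t, 0 <= t <= T -> forall j,
        nodal_residual (fun k => Xn k t) (fun k => tderiv T (Xn k) t) j = 0].
Proof.
split=> -[h1 h2 h3]; split.
- by move=> j t tT; apply: h1; rewrite in_itv.
- move=> j; have := h2 (xi j.+1); rewrite /discrete_curve /interpolate.
  by rewrite (sum_phi_node (fun k => Xn k 0)) (sum_phi_node (fun k => X0 (xi k.+1))).
- move=> t tT; apply/weak_equationP => // [j|]; first by apply: h1; rewrite in_itv.
  by apply: h3; rewrite in_itv.
- by move=> j t; rewrite in_itv; exact: h1.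
- by move=> x; rewrite /discrete_curve /interpolate; apply: eq_bigr => j _; rewrite h2.
- move=> t; rewrite in_itv/= => tT; apply/weak_equationP => // [j|]; first exact: h1.
  exact: h3.
Qed.

End FiniteElementIdentities.

(** * Weak derivatives on an interval *)

Section SmoothStep.
Context {R : realType}.
Implicit Types (s t x a b d : R).

Definition pospart t : R := Num.max 0 t.

Lemma is_derive_pospart_sqr t : is_derive t 1 (fun s => pospart s ^+ 2) (2 * pospart t).
Proof.
apply/is_deriveP => e e0; exists e => // s st.
rewrite [_ *: _]/GRing.scale/=.
suff h : `|pospart s ^+ 2 - pospart t ^+ 2 - (s - t) * (2 * pospart t)| <= (s - t) ^+ 2.
  apply: (le_trans h); rewrite -real_normK ?num_real// expr2.
  by apply: ler_wpM2r => //; exact: ltW.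
have h := sqr_ge0 (s - t); rewrite expr2 in h.
rewrite /pospart; case: (leP 0 s) => s0; case: (leP 0 t) => t0;
  rewrite ler_norml !expr2; apply/andP; split; nra.
Qed.

Lemma continuous_pospart : continuous pospart.
Proof.
move=> t; apply/cvgrPdist_lt => e e0; exists e => //= s; apply: le_lt_trans.
rewrite /pospart; case: (leP 0 s) => s0; case: (leP 0 t) => t0; rewrite ler_norml;
  case: (ger0P (t - s)); lra.
Qed.

(** A C1 step from 0 to 1 over [0, 1], piecewise quadratic. *)
Definition step t : R :=
  2 * (pospart t ^+ 2 - 2 * pospart (t - 1 / 2) ^+ 2 + pospart (t - 1) ^+ 2).

Definition dstep t : R := 4 * (pospart t - 2 * pospart (t - 1 / 2) + pospart (t - 1)).

Lemma is_derive_step t : is_derive t 1 step (dstep t).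
Proof.
have sh c : is_derive t 1 (fun s => pospart (s - c) ^+ 2) (2 * pospart (t - c)).
  have := @der_comp _ (fun s => pospart s ^+ 2) (fun s => s - c) _ _ _
    (is_derive_pospart_sqr (t - c)) (derB (derX t) (derC t c)).
  by rewrite subr0 mulr1.
have := derZ 2 (derD (derB (is_derive_pospart_sqr t) (derZ 2 (sh (1 / 2)))) (sh 1)).
by move=> h; apply: (is_derive_eq h); rewrite /dstep; ring.
Qed.

Lemma continuous_dstep : continuous dstep.
Proof.
have sh c : continuous (fun s => pospart (s - c)).
  move=> t; apply: (@continuous_comp _ _ _ (fun s => s - c) pospart); last exact: continuous_pospart.
  by apply: continuousB => //; exact: cst_continuous.
move=> t; apply: (@continuousM _ _ (cst 4) (fun t => pospart t - 2 * pospart (t - 1 / 2) + pospart (t - 1))).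
  exact: cst_continuous.
apply: (@continuousD _ _ _ (fun t => pospart t - 2 * pospart (t - 1 / 2))); last exact: sh.
apply: (@continuousB _ _ _ pospart (fun t => 2 * pospart (t - 1 / 2))); first exact: continuous_pospart.
by apply: (@continuousM _ _ (cst 2) (fun t => pospart (t - 1 / 2))); [exact: cst_continuous|exact: sh].
Qed.

Lemma step_le0 t : t <= 0 -> step t = 0.
Proof.
by move=> t0; rewrite /step /pospart !max_l; [ring|lra|lra|lra].
Qed.

Lemma step_ge1 t : 1 <= t -> step t = 1.
Proof.
by move=> t0; rewrite /step /pospart !max_r; [field|lra|lra|lra].
Qed.

Lemma step_bounds t : 0 <= step t <= 1.
Proof.
rewrite /step /pospart; case: (leP 0 t) => h1; case: (leP 0 (t - 1 / 2)) => h2;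
  case: (leP 0 (t - 1)) => h3; rewrite ?expr0n/= ?expr2; apply/andP; split; nra.
Qed.

Lemma dstep_bounds t : 0 <= dstep t <= 2.
Proof.
rewrite /dstep /pospart; case: (leP 0 t) => h1; case: (leP 0 (t - 1 / 2)) => h2;
  case: (leP 0 (t - 1)) => h3; apply/andP; split; lra.
Qed.

Lemma dstep_out t : ~~ (0 < t < 1) -> dstep t = 0.
Proof.
rewrite negb_and -!leNgt /dstep /pospart.
by case: (leP 0 t) => h1; case: (leP 0 (t - 1 / 2)) => h2;
  case: (leP 0 (t - 1)) => h3; case/orP => h; lra.
Qed.

Definition ramp a d x : R := step ((x - a) / d).

Definition dramp a d x : R := dstep ((x - a) / d) / d.

Lemma is_derive_ramp a d x : is_derive x 1 (ramp a d) (dramp a d x).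
Proof.
have := @der_comp _ step (fun x => (x - a) / d) _ _ _
  (is_derive_step ((x - a) / d)) (derM (derB (derX x) (derC x a)) (derC x d^-1)).
by rewrite subr0 mul1r mulr0 addr0.
Qed.

Lemma continuous_dramp a d : continuous (dramp a d).
Proof.
move=> x; apply: (@continuousM _ _ (fun x => dstep ((x - a) / d)) (cst d^-1)); last exact: cst_continuous.
apply: (@continuous_comp _ _ _ (fun x => (x - a) / d) dstep); last exact: continuous_dstep.
apply: (@continuousM _ _ (fun x => x - a) (cst d^-1)); last exact: cst_continuous.
by apply: continuousB => //; exact: cst_continuous.
Qed.

Lemma ramp_left a d x : 0 < d -> x <= a -> ramp a d x = 0.
Proof. by move=> d0 xa; apply: step_le0; rewrite pmulr_lle0 ?invr_gt0// subr_le0. Qed.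

Lemma ramp_right a d x : 0 < d -> a + d <= x -> ramp a d x = 1.
Proof. by move=> d0 xa; apply: step_ge1; rewrite ler_pdivlMr// mul1r; lra. Qed.

Lemma dramp_bounds a d x : 0 < d -> 0 <= dramp a d x <= 2 / d.
Proof.
move=> d0; have /andP[h1 h2] := dstep_bounds ((x - a) / d).
apply/andP; split; first by rewrite divr_ge0// ltW.
by apply: ler_wpM2r => //; rewrite invr_ge0 ltW.
Qed.

Lemma dramp_out a d x : 0 < d -> ~~ (a < x < a + d) -> dramp a d x = 0.
Proof.
move=> d0 h; rewrite /dramp dstep_out ?mul0r//.
by apply: contra h; rewrite pmulr_lgt0 ?invr_gt0// subr_gt0 ltr_pdivrMr// mul1r ltrBlDl.
Qed.

End SmoothStep.

Section WeakDerivative.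
Context {R : realType}.
Local Notation mu := (@lebesgue_measure R).
Implicit Types (f g : R -> R) (s t x a b c d : R).

Lemma integrable_on_continuous f : continuous f -> forall a b, integrable_on a b f.
Proof. by move=> cf a b; apply: integrable_on_cont; exact: continuous_subspaceT. Qed.

Lemma ae_exists (P : R -> Prop) c d : c < d -> {ae mu, forall x, P x} ->
  exists2 x, c < x < d & P x.
Proof.
move=> cd [A [mA A0 HA]]; apply: contrapT => hn.
have sub : `]c, d[ `<=` A.
  move=> x /=; rewrite in_itv/= => xcd; apply: HA => Px; apply: hn.
  by exists x.
have : (mu `]c, d[ <= mu A)%E by apply: le_measure => //; rewrite inE.
have := lebesgue_measure_itv `]c, d[; rewrite /= lte_fin cd => ->.
by move=> h; move: h; rewrite A0 -EFinB lee_fin; lra.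
Qed.

Lemma ae_eq_within f g a b : a < b -> {within `[a, b], continuous f} ->
  {within `[a, b], continuous g} ->
  {ae mu, forall x, a < x < b -> f x = g x} -> forall x, a <= x <= b -> f x = g x.
Proof.
move=> ab cf cg fg x /andP[ax xb]; apply/eqP; rewrite -subr_eq0 -normr_le0.
apply/ler_addgt0Pr => e e0; rewrite add0r.
have xab : `[a, b]%classic x by rewrite /= in_itv/= ax.
have e20 : 0 < e / 2 by rewrite divr_gt0.
have [d1 d10 H1] := (within_continuousP f _).1 cf x (e / 2) xab e20.
have [d2 d20 H2] := (within_continuousP g _).1 cg x (e / 2) xab e20.
pose d := Num.min d1 d2; have d0 : 0 < d by rewrite lt_min d10.
pose l := Num.max a (x - d); pose r := Num.min b (x + d).
have lr : l < r.
  by rewrite lt_min !gt_max ab/=; apply/andP; split; [|apply/andP; split]; lra.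
have [y /andP[ly yr] fgy] := ae_exists lr fg.
move: ly yr; rewrite gt_max lt_min => /andP[ay yl] /andP[yb yr].
have yab : `[a, b]%classic y by rewrite /= in_itv/= !ltW.
have xy : `|x - y| < d by rewrite ltr_norml; lra.
have := H1 y yab; have := H2 y yab; move: xy; rewrite lt_min => /andP[h1 h2].
move=> /(_ h2) k2 /(_ h1) k1.
have -> : f x - g x = (f x - f y) - (g x - g y).
  by rewrite fgy ?ay ?yb//; ring.
by apply: (le_trans (ler_normB _ _)); lra.
Qed.

Lemma continuous_sint f a b : a <= b -> integrable_on a b f ->
  {within `[a, b], continuous (fun x => sint a x f)}.
Proof. by move=> ab hf; exact: parameterized_integral_continuous. Qed.

Lemma ae_lebesgue_pt f a b : integrable_on a b f ->
  {ae mu, forall x, lebesgue_pt (f \_ `[a, b]) x}.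
Proof.
move=> hf; apply: lebesgue_differentiation.
exact: integrable_locally_restrict.
Qed.

Lemma ae_is_derive_sint f a b : integrable_on a b f ->
  {ae mu, forall x, a < x < b -> is_derive x 1 (fun y => sint a y f) (f x)}.
Proof.
move=> hf; apply: (aeW (ae_lebesgue_pt hf)) => x hx /andP[ax xb].
pose fb : R -> R := f \_ `[a, b].
have ifb : mu.-integrable [set` Interval (BLeft a) (BRight b)] (EFin \o fb).
  by rewrite /fb -restrict_EFin; apply/integrable_restrict => //=; rewrite setIid.
have abx : (BLeft a < BRight x)%E by rewrite lte_fin.
have [dF dFE] := @FTC1_lebesgue_pt R fb (BLeft a) x b xb ifb abx hx.
have fbE y : a <= y <= b -> fb y = f y.
  by move=> yab; rewrite /fb patchE mem_set//= in_itv.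
have D : is_derive x 1 (fun y => sint a y fb) (f x).
  have xab : a <= x <= b by rewrite !ltW.
  rewrite -(fbE x xab); split; first exact: dF.
  by rewrite -dFE derive1E.
apply: (is_derive_near (d := b - x) _ _ D); first by rewrite subr_gt0.
move=> y; rewrite ltr_norml => /andP[_ h]; apply: eq_sint => z /andP[az zy].
by apply: fbE; rewrite az/=; lra.
Qed.

Lemma sint_eq_ae f g a b : integrable_on a b f -> integrable_on a b g ->
  (forall x, a <= x <= b -> sint a x f = sint a x g) ->
  {ae mu, forall x, a < x < b -> f x = g x}.
Proof.
move=> hf hg fg; apply: (aeW (aeI (ae_is_derive_sint hf) (ae_is_derive_sint hg))) => x [d1 d2] xab.
have D1 := d1 xab; have D2 := d2 xab.
have D3 : is_derive x 1 (fun y => sint a y f) (g x).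
  apply: (is_derive_near (d := Num.min (x - a) (b - x)) _ _ D2).
    by rewrite lt_min !subr_gt0.
  move=> y; rewrite lt_min !ltr_norml => /andP[/andP[? ?] /andP[? ?]].
  by rewrite fg//; lra.
by case: D1 => _ <-; case: D3 => _ <-.
Qed.

Definition weak_on T f g : Prop := forall phi dphi : R -> R,
  (forall x, is_derive x 1 phi (dphi x)) -> continuous dphi ->
  (exists a b, [/\ 0 < a, b < T & forall x, ~ (a <= x <= b) -> phi x = 0]) ->
  sint 0 T (fun x => f x * dphi x) = - sint 0 T (fun x => g x * phi x).

Let lebesgue_avg f x e : lebesgue_pt f x -> 0 < e ->
  exists2 d, 0 < d & forall r, 0 < r < d ->
    (\int[mu]_(y in ball x r) `|(f y - f x)%:E| <= (e * (2 * r))%:E)%E.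
Proof.
move=> /fine_cvgP [fin] /cvgrPdist_le /(_ e) h e0.
have [d1 /= d10 H1] := h e0; have [d2 /= d20 H2] := fin.
exists (Num.min d1 d2); first by rewrite lt_min d10.
move=> r /andP[r0]; rewrite lt_min => /andP[rd1 rd2].
have hr : `|0 - r| = r by rewrite sub0r normrN gtr0_norm.
have := H1 r; rewrite /= hr => /(_ rd1 r0).
have := H2 r; rewrite /= hr => /(_ rd2 r0) fn.
rewrite sub0r normrN => hle.
have : (davg f x r <= e%:E)%E.
  by rewrite -(fineK fn) lee_fin; exact: le_trans (ler_norm _) hle.
rewrite /davg /iavg.
have mb : mu (ball x r) = (r *+ 2)%:E by exact: (lebesgue_measure_ball x (ltW r0)).
rewrite [X in (X^-1)%E]mb inver gt_eqF ?pmulrn_lgt0// muleC.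
rewrite lee_pdivrMr ?pmulrn_lgt0// -EFinM mulr_natl /=.
by apply: le_trans; rewrite le_eqVlt; apply/orP; left; apply/eqP; apply: eq_integral => y _; rewrite addrC.
Qed.

Let ramp_average f T a : integrable_on 0 T f -> 0 < a < T ->
  lebesgue_pt (f \_ `[0, T]) a -> forall e, 0 < e -> exists2 d, 0 < d &
  forall r, 0 < r < d -> `|sint 0 T (fun x => f x * dramp a r x) - f a| <= e.
Proof.
move=> hf /andP[a0 aT] la e e0.
have [d d0 Hd] := lebesgue_avg la (divr_gt0 e0 (ltr0n _ 4)).
exists (Num.min d (T - a)); first by rewrite lt_min d0 subr_gt0.
move=> r /andP[r0]; rewrite lt_min => /andP[rd rT].
have arT : a + r <= T by rewrite -lerBrDl ltW.
have T0 : 0 <= T by rewrite ltW// (lt_trans a0).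
have bd x : 0 <= x <= T -> `|dramp a r x| <= 2 / r.
  by move=> _; have /andP[h1 h2] := dramp_bounds a x r0; rewrite ger0_norm.
have md : measurable_fun `[0, T] (dramp a r).
  exact: integrable_on_measurable (integrable_on_continuous (@continuous_dramp R a r) 0 T).
have ifd : integrable_on 0 T (fun x => f x * dramp a r x) by exact: integrable_onM_bounded md bd hf.
have id : integrable_on 0 T (dramp a r).
  exact: (integrable_on_continuous (@continuous_dramp R a r) 0 T).
have one : sint 0 T (dramp a r) = 1.
  rewrite (@sint_FTC _ _ _ _ (ramp a r) T0 _ _ (fun x _ => is_derive_ramp a r x)).
  - by rewrite ramp_right// ramp_left ?subr0// ltW.
  - by apply: continuous_subspaceT; exact: continuous_dramp.
  - by apply: derivable_within_continuous => x _; have [] := is_derive_ramp a r x.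
have -> : sint 0 T (fun x => f x * dramp a r x) - f a =
  sint 0 T (fun x => (f x - f a) * dramp a r x).
  have E : f a = sint 0 T (fun x => f a * dramp a r x) by rewrite sintZ// one mulr1.
  rewrite [X in _ - X = _]E.
  rewrite -sintB//; last exact: integrable_onZ.
  by apply: eq_sint => x _; rewrite mulrBl.
have ig : integrable_on 0 T (fun x => (f x - f a) * dramp a r x).
  have := integrable_onB ifd (integrable_onZ (f a) id).
  by congr (is_true (_.-integrable _ _)); apply/funext => x /=; rewrite mulrBl.
apply: (le_trans (le_norm_sint ig)).
have ia : integrable_on 0 T (fun x => `|f x - f a|).
  apply/integrable_on_norm/integrable_onB => //.
  by apply: integrable_on_cont => x; exact: cst_continuous.
have ar : integrable_on a (a + r) (fun x => `|f x - f a|) by apply: (integrable_onS _ _ ia) => //; exact: ltW.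
apply: (@le_trans _ _ (2 / r * sint a (a + r) (fun x => `|f x - f a|))).
  have ign := integrable_on_norm ig.
  have i2 : integrable_on a T (fun x => `|(f x - f a) * dramp a r x|).
    by apply: (integrable_onS _ _ ign) => //; exact: ltW.
  have ar0 : a <= a + r by rewrite lerDl ltW.
  rewrite (sint_chasles (ltW a0) (ltW aT) ign) (sint_chasles ar0 arT i2).
  have z1 : sint 0 a (fun x => `|(f x - f a) * dramp a r x|) = 0.
    rewrite (@eq_sint _ _ _ _ (fun _ => 0)) ?(sint_cst _ (ltW a0)) ?mul0r// => x /andP[_ xa].
    by rewrite dramp_out ?mulr0 ?normr0// ltNge xa.
  have z2 : sint (a + r) T (fun x => `|(f x - f a) * dramp a r x|) = 0.
    rewrite (@eq_sint _ _ _ _ (fun _ => 0)) ?(sint_cst _ arT) ?mul0r// => x /andP[xa _].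
    by rewrite dramp_out ?mulr0 ?normr0// negb_and -!leNgt xa orbT.
  rewrite z1 z2 add0r addr0 -sintZ//; apply: le_sint.
  - by apply: (integrable_onS _ _ ign) => //; exact: ltW.
  - exact: integrable_onZ.
  - move=> x /andP[ax xr]; rewrite normrM mulrC; apply: ler_wpM2r => //.
    by apply: bd; rewrite (le_trans (ltW a0) ax) (le_trans xr arT).
have : ((sint a (a + r) (fun x => `|f x - f a|))%:E <= (e / 4 * (2 * r))%:E)%E.
  apply: le_trans (Hd r (ltac:(by rewrite r0))).
  have ir := ar; move: ir => /integrableP [mr _].
  rewrite /sint /Rintegral fineK; last exact: integrable_fin_num ar.
  have sub : `[a, a + r[ `<=` ball a r.
    move=> x; rewrite /= in_itv/= /ball/= => /andP[ax xr].
    by rewrite ler0_norm ?subr_le0// opprB ltrBlDl.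
  rewrite -(@integral_itv_bndo_bndc _ (BLeft a)); last first.
    apply: measurable_funS mr => // x /=; rewrite !in_itv/= => /andP[-> /ltW ->//].
  have fE : forall x, a <= x < a + r -> (f \_ `[0, T]) x = f x.
    move=> x /andP[ax xr]; rewrite patchE mem_set//= in_itv/=.
    by rewrite (le_trans (ltW a0) ax) (le_trans (ltW xr) arT).
  have faE : (f \_ `[0, T]) a = f a by apply: fE; rewrite lexx ltrDl.
  apply: le_trans; last first.
    apply: (@ge0_subset_integral _ _ _ mu _ _ _ _ _ _ _ sub) => //.
    - exact: measurable_ball.
    - apply/measurableT_comp => //; apply/measurable_EFinP/measurable_funB => //.
      have mf : measurable_fun setT (f \_ `[0, T]).
        by apply/(measurable_restrictT _ _).1 => //; exact: integrable_on_measurable hf.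
      exact: measurable_funTS.
  rewrite le_eqVlt; apply/orP; left; apply/eqP; apply: eq_integral => x.
  by rewrite inE/= in_itv/= => xr; rewrite fE// faE.
rewrite lee_fin => h.
have h2 : 0 <= 2 / r by rewrite divr_ge0// ltW.
apply: (le_trans (ler_wpM2l h2 h)); rewrite le_eqVlt; apply/orP; left; apply/eqP.
by field; rewrite gt_eqF.
Qed.

Let small_sint g T a e : integrable_on 0 T g -> 0 <= a < T -> 0 < e ->
  exists2 d, 0 < d & forall r, 0 < r < d -> a + r <= T /\ sint a (a + r) (fun x => `|g x|) <= e.
Proof.
move=> hg /andP[a0 aT] e0; have T0 : 0 <= T by rewrite ltW// (le_lt_trans a0).
have hn := integrable_on_norm hg.
have ca := continuous_sint T0 hn.
have aI : `[0, T]%classic a by rewrite /= in_itv/= a0 ltW.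
have [d d0 Hd] := (within_continuousP _ _).1 ca a e aI e0.
exists (Num.min d (T - a)); first by rewrite lt_min d0 subr_gt0.
move=> r /andP[r0]; rewrite lt_min => /andP[rd rT].
have arT : a + r <= T by rewrite -lerBrDl ltW.
split=> //.
have ar0 : a <= a + r by rewrite lerDl ltW.
have := Hd (a + r); rewrite /= in_itv/= (le_trans a0 ar0) arT => /(_ isT).
rewrite opprD addrA subrr add0r normrN gtr0_norm// => /(_ rd).
have h0r : integrable_on 0 (a + r) (fun x => `|g x|) by apply: integrable_onS hn.
by rewrite (sint_chasles a0 ar0 h0r) ltr_norml => /andP[h _]; lra.
Qed.

(** Testing with the difference of two ramps of vanishing width yields the
    increments of [f] between Lebesgue points. *)
Let weak_increment T f g a b : integrable_on 0 T f -> integrable_on 0 T g ->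
  weak_on T f g -> 0 < a -> a < b -> b < T ->
  lebesgue_pt (f \_ `[0, T]) a -> lebesgue_pt (f \_ `[0, T]) b ->
  f b - f a = sint a b g.
Proof.
move=> hf hg W a0 ab bT la lb.
have aT := lt_trans ab bT; have b0 := lt_trans a0 ab.
apply/eqP; rewrite -subr_eq0 -normr_le0; apply/ler_addgt0Pr => e e0; rewrite add0r.
have e4 : 0 < e / 4 by rewrite divr_gt0.
have [d1 d10 H1] := ramp_average hf (ltac:(by rewrite a0) : 0 < a < T) la e4.
have [d2 d20 H2] := ramp_average hf (ltac:(by rewrite b0) : 0 < b < T) lb e4.
have [d3 d30 H3] := small_sint hg (ltac:(by rewrite ltW) : 0 <= a < T) e4.
have [d4 d40 H4] := small_sint hg (ltac:(by rewrite ltW) : 0 <= b < T) e4.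
pose m := Num.min (Num.min (Num.min d1 d2) (Num.min d3 d4)) (Num.min (b - a) (T - b)).
have m0 : 0 < m by rewrite !lt_min d10 d20 d30 d40 !subr_gt0 ab bT.
pose r := m / 2; have r0 : 0 < r by rewrite divr_gt0.
have : r < m by rewrite ltr_pdivrMr// ltr_pMr// ltr1n.
rewrite !lt_min => /andP[/andP[/andP[r1 r2] /andP[r3 r4]] /andP[r5 r6]].
have {}H1 := H1 r (ltac:(by rewrite r0)); have {}H2 := H2 r (ltac:(by rewrite r0)).
have [arT {}H3] := H3 r (ltac:(by rewrite r0)); have [brT {}H4] := H4 r (ltac:(by rewrite r0)).
have arb : a + r <= b by rewrite -lerBrDl ltW.
have brT' : b + r < T by rewrite -ltrBrDl.
pose phi x := ramp a r x - ramp b r x.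
pose dphi x := dramp a r x - dramp b r x.
have cphi : continuous phi.
  move=> x; apply: is_derive_continuous.
  exact: (derB (is_derive_ramp a r x) (is_derive_ramp b r x)).
have cdphi : continuous dphi.
  by move=> x; apply: (@continuousB _ _ _ (dramp a r) (dramp b r)); exact: continuous_dramp.
have supp : exists a' b', [/\ 0 < a', b' < T & forall x, ~ (a' <= x <= b') -> phi x = 0].
  exists a, (b + r); split=> // x /negP; rewrite negb_and -!ltNge /phi => /orP[xa|xb].
    by rewrite !ramp_left ?subrr// ltW// (lt_trans xa).
  rewrite !ramp_right ?subrr// ltW//; apply: lt_trans xb.
  by rewrite ltrD2r.
have ic (z : R -> R) : continuous z -> integrable_on 0 T z.
  by move=> cz; exact: integrable_on_continuous.
have T0 : 0 <= T by rewrite ltW// (lt_trans a0).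
have pb x : `|phi x| <= 1.
  have /andP[h1 h2] := step_bounds ((x - a) / r); have /andP[h3 h4] := step_bounds ((x - b) / r).
  by rewrite /phi /ramp ler_norml; apply/andP; split; lra.
have dI c : integrable_on 0 T (fun x => f x * dramp c r x).
  apply: (@integrable_onM_bounded _ _ _ _ _ (2 / r)) => //.
    exact: integrable_on_measurable (ic _ (@continuous_dramp R c r)).
  by move=> x _; have /andP[h1 h2] := dramp_bounds c x r0; rewrite ger0_norm.
have mphi : measurable_fun `[0, T] phi by exact: integrable_on_measurable (ic _ cphi).
have gI : integrable_on 0 T (fun x => g x * phi x).
  by apply: (@integrable_onM_bounded _ _ _ _ _ 1).
have := W phi dphi (fun x => derB (is_derive_ramp a r x) (is_derive_ramp b r x)) cdphi supp.
rewrite (eq_sint (g := fun x => f x * dramp a r x - f x * dramp b r x)); last first.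
  by move=> x _; rewrite mulrBr.
rewrite sintB//; set A := sint _ _ _ in H1 *; set B := sint _ _ _ in H2 *.
set G := sint 0 T _ => WE.
have aab : a <= a + r by rewrite lerDl ltW.
have bbr : b <= b + r by rewrite lerDl ltW.
have sub c d : 0 <= c -> d <= T -> integrable_on c d (fun x => g x * phi x) /\ integrable_on c d g.
  by move=> c0 dT; split; [exact: integrable_onS gI|exact: integrable_onS hg].
have GE : G = sint a (a + r) (fun x => g x * phi x) + sint (a + r) b g
    + sint b (b + r) (fun x => g x * phi x).
  have [j1 _] := sub a T (ltW a0) (lexx T).
  have [j2 _] := sub (a + r) T (le_trans (ltW a0) aab) (lexx T).
  have [j3 _] := sub b T (ltW b0) (lexx T).
  rewrite /G (sint_chasles (ltW a0) (ltW aT) gI) (sint_chasles aab arT j1).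
  rewrite (sint_chasles arb (ltW bT) j2) (sint_chasles bbr brT j3).
  rewrite (@eq_sint _ 0 a _ (fun _ => 0)); last first.
    move=> x /andP[_ xa]; rewrite /phi !ramp_left ?subrr ?mulr0//.
    exact: le_trans xa (ltW ab).
  rewrite (@eq_sint _ (b + r) T _ (fun _ => 0)); last first.
    move=> x /andP[xb _]; rewrite /phi !ramp_right ?subrr ?mulr0//.
    by apply: le_trans xb; rewrite lerD2r ltW.
  rewrite (@eq_sint _ (a + r) b _ g); last first.
    by move=> x /andP[xa xb]; rewrite /phi ramp_right// ramp_left// subr0 mulr1.
  by rewrite (sint_cst _ (ltW a0)) (sint_cst _ brT) !mul0r add0r addr0 addrA.
have SE : sint a b g = sint a (a + r) g + sint (a + r) b g.
  by apply: sint_chasles => //; have [] := sub a b (ltW a0) (ltW bT).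
have gn c d : 0 <= c -> d <= T -> integrable_on c d (fun x => `|g x|).
  by move=> c0 dT; apply/integrable_on_norm; have [] := sub c d c0 dT.
have K1 : `|sint a (a + r) (fun x => g x * phi x) - sint a (a + r) g| <= e / 4.
  have [i1 i2] := sub a (a + r) (ltW a0) arT.
  rewrite -sintB//; apply: (le_trans (le_norm_sint (integrable_onB i1 i2))).
  apply: le_trans H3; apply: le_sint; [exact/integrable_on_norm/integrable_onB|exact: gn (ltW a0) arT|].
  move=> x /andP[xa xr]; rewrite -[X in _ - X]mulr1 -mulrBr normrM ler_piMr//.
  rewrite /phi (@ramp_left _ b)//; last exact: le_trans xr arb.
  have /andP[h1 h2] := step_bounds ((x - a) / r).
  by rewrite /ramp ler_norml; apply/andP; split; lra.
have K2 : `|sint b (b + r) (fun x => g x * phi x)| <= e / 4.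
  have [i1 i2] := sub b (b + r) (ltW b0) brT.
  apply: (le_trans (le_norm_sint i1)); apply: le_trans H4.
  apply: le_sint; [exact/integrable_on_norm|exact: gn (ltW b0) brT|].
  by move=> x _; rewrite normrM ler_piMr.
move: H1 H2 K1 K2 WE; rewrite GE SE; rewrite !ler_norml.
by move=> /andP[? ?] /andP[? ?] /andP[? ?] /andP[? ?] ?; apply/andP; split; lra.
Qed.

Theorem weak_primitive T f g : 0 < T -> integrable_on 0 T f -> integrable_on 0 T g ->
  weak_on T f g ->
  exists c, {ae mu, forall x, 0 < x < T -> f x = c + sint 0 x g}.
Proof.
move=> T0 hf hg W; have lp := ae_lebesgue_pt hf.
have [a /andP[a0 aT] la] := ae_exists T0 lp.
exists (f a - sint 0 a g); apply: (aeW lp) => x lx /andP[x0 xT].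
have gx c : c <= T -> integrable_on 0 c g by move=> cT; exact: integrable_onS hg.
have [ax|xa|->] := ltgtP a x; last by rewrite subrK.
  have := weak_increment hf hg W a0 ax xT la lx.
  by rewrite (sint_chasles (ltW a0) (ltW ax) (gx x (ltW xT))); lra.
have := weak_increment hf hg W x0 xa aT lx la.
by rewrite (sint_chasles (ltW x0) (ltW xa) (gx a (ltW aT))); lra.
Qed.

Corollary weak_primitive_continuous T f g : 0 < T -> {within `[0, T], continuous f} ->
  integrable_on 0 T g -> weak_on T f g ->
  forall x, 0 <= x <= T -> f x = f 0 + sint 0 x g.
Proof.
move=> T0 cf hg W; have [c hc] := weak_primitive T0 (integrable_on_cont cf) hg W.
have cs : {within `[0, T], continuous (fun x => c + sint 0 x g)}.
  apply/within_continuousP => x e xT e0.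
  have [d d0 Hd] := (within_continuousP _ _).1 (continuous_sint (ltW T0) hg) x e xT e0.
  by exists d => // y yT xy; rewrite opprD addrACA subrr add0r; exact: Hd.
have fE := ae_eq_within T0 cf cs hc.
have := fE 0; rewrite lexx ltW// sint_point addr0 => /(_ isT) f0.
by move=> x xT; rewrite (fE x xT) f0.
Qed.

End WeakDerivative.

(** * Sobolev curves on the circle *)

Section Periodization.
Context {R : realType}.
Local Notation P := (2 * pi : R).
Implicit Types (f : R -> R) (x y a b : R).

Let P0 : 0 < P. Proof. by rewrite mulr_gt0// pi_gt0. Qed.

Definition periodize f x : R := f (x - P * (Num.floor (x / P))%:~R).

Lemma floor_cell x : P * (Num.floor (x / P))%:~R <= x < P * (Num.floor (x / P))%:~R + P.
Proof.
have h1 := Num.Theory.floor_le (x / P); have h2 := Num.Theory.floorD1_gt (x / P).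
rewrite ler_pdivlMr// in h1; rewrite ltr_pdivrMr// intrD mulrDl mul1r in h2.
by rewrite mulrC h1.
Qed.

Lemma periodic_periodize f : periodic (periodize f) P.
Proof.
move=> x; rewrite /periodize.
have -> : (x + P) / P = x / P + 1 by rewrite [LHS]mulrDl mulfV// gt_eqF.
have -> : Num.floor (x / P + 1) = (Num.floor (x / P) + 1)%R by rewrite floorDrz ?floor1.
have -> : (Num.floor (x / P) + 1)%:~R = (Num.floor (x / P))%:~R + 1 :> R by rewrite intrD.
by congr f; ring.
Qed.

Lemma periodize_local f a b x : 0 < a -> b < P ->
  (forall z, ~ (a <= z <= b) -> f z = 0) -> forall y, `|y - x| < P ->
  periodize f y = f (y - P * (Num.floor (x / P))%:~R)
    + f (y - P * (Num.floor (x / P))%:~R + P) + f (y - P * (Num.floor (x / P))%:~R - P).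
Proof.
move=> a0 bP f0 y; rewrite ltr_norml => /andP[yx1 yx2].
have /andP[] := floor_cell x; have /andP[] := floor_cell y; rewrite /periodize.
set k := Num.floor (x / P); set m := Num.floor (y / P) => m1 m2 k1 k2; have p0 := P0.
set z := y - P * k%:~R.
have z0 u : u <= 0 \/ P <= u -> f u = 0.
  by move=> h; apply: f0 => /andP[]; case: h => *; lra.
have i2 (n : int) : (n + 2)%:~R = n%:~R + 2 :> R by rewrite intrD.
have i1 (n : int) : (n + 1)%:~R = n%:~R + 1 :> R by rewrite intrD.
have iN1 (n : int) : (n - 1)%:~R = n%:~R - 1 :> R by rewrite intrD.
have mk : (m < k + 2)%R.
  by rewrite -(ltr_int R) i2 -(ltr_pM2l P0); lra.
have km : (k < m + 2)%R.
  by rewrite -(ltr_int R) i2 -(ltr_pM2l P0); lra.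
have : m = k \/ m = k + 1 \/ m = k - 1 by lia.
have zE : z = y - P * k%:~R by [].
move=> [mE|[mE|mE]]; rewrite mE ?i1 ?iN1 in m1 m2 *.
- have e1 : f (z + P) = 0 by apply: z0; right; rewrite zE; lra.
  have e2 : f (z - P) = 0 by apply: z0; left; rewrite zE; lra.
  by rewrite e1 e2 !addr0.
- have e1 : f z = 0 by apply: z0; right; rewrite zE; lra.
  have e2 : f (z + P) = 0 by apply: z0; right; rewrite zE; lra.
  by rewrite e1 e2 !add0r; congr f; rewrite zE; ring.
- have e1 : f z = 0 by apply: z0; left; rewrite zE; lra.
  have e2 : f (z - P) = 0 by apply: z0; left; rewrite zE; lra.
  by rewrite e1 e2 add0r addr0; congr f; rewrite zE; ring.
Qed.

Lemma periodize_id f a b x : 0 < a -> b < P ->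
  (forall z, ~ (a <= z <= b) -> f z = 0) -> 0 <= x <= P -> periodize f x = f x.
Proof.
move=> a0 bP f0 /andP[x0 xP].
have z0 u : u <= 0 \/ P <= u -> f u = 0.
  by move=> h; apply: f0 => /andP[]; case: h => *; lra.
have h := @periodize_local f a b x a0 bP f0 x; rewrite subrr normr0 in h.
have [xP'|xP'] := ltP x P.
  have fl : Num.floor (x / P) = 0.
    by apply: floor_def; rewrite add0r divr_ge0 ?(ltW P0)//= ltr_pdivrMr// mul1r.
  by rewrite /periodize fl mulr0 subr0.
have -> : x = P by apply/le_anti; rewrite xP xP'.
by rewrite /periodize mulfV ?gt_eqF// floor1 mulr1 subrr !z0//; [right|left].
Qed.

Lemma is_derive_periodize (f df : R -> R) a b x : 0 < a -> b < P ->
  (forall z, ~ (a <= z <= b) -> f z = 0) -> (forall z, ~ (a <= z <= b) -> df z = 0) ->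
  (forall z : R, is_derive z 1 f (df z)) -> is_derive x 1 (periodize f) (periodize df x).
Proof.
move=> a0 bP f0 df0 fdf.
have xx : `|x - x| < P by rewrite subrr normr0.
rewrite (periodize_local a0 bP df0 xx).
set c := P * _; set z := x - c.
have sh u : is_derive x 1 (fun y => f (y - c + u)) (df (z + u)).
  have := @der_comp _ f (fun y => y - c + u) x _ _ (fdf _) (derD (derB (derX x) (derC x c)) (derC x u)).
  by rewrite subr0 addr0 mulr1.
have h := derD (derD (sh 0) (sh P)) (sh (- P)); rewrite addr0 in h.
apply: (is_derive_near P0 _ h) => y yx; rewrite addr0.
by rewrite (periodize_local a0 bP f0 yx).
Qed.

Lemma continuous_periodize f a b : 0 < a -> b < P ->
  (forall z, ~ (a <= z <= b) -> f z = 0) -> continuous f -> continuous (periodize f).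
Proof.
move=> a0 bP f0 cf x.
pose c := P * (Num.floor (x / P))%:~R.
have cs u : {for x, continuous (fun y => f (y - c + u))}.
  apply: (@continuous_comp _ _ _ (fun y => y - c + u) f); last exact: cf.
  apply: (@continuousD _ _ _ (fun y => y - c) (cst u)); last exact: cst_continuous.
  by apply: continuousB => //; exact: cst_continuous.
have cg : {for x, continuous (fun y => f (y - c + 0) + f (y - c + P) + f (y - c + - P))}.
  apply: (@continuousD _ _ _ (fun y => f (y - c + 0) + f (y - c + P))); last exact: cs.
  by apply: (@continuousD _ _ _ (fun y => f (y - c + 0))); exact: cs.
have E y : `|y - x| < P -> periodize f y = f (y - c + 0) + f (y - c + P) + f (y - c + - P).
  by move=> yx; rewrite addr0 (periodize_local a0 bP f0 yx).
apply/cvgrPdist_lt => e e0; have /cvgrPdist_lt/(_ e e0) [d /= d0 Hd] := cg.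
exists (Num.min d P); first by rewrite /= lt_min d0.
move=> y /=; rewrite lt_min distrC => /andP[h1 h2].
rewrite !E ?subrr ?normr0//; apply: Hd; by rewrite /= distrC.
Qed.

End Periodization.

Section SobolevCurves.
Context {R : realType}.
Local Notation P := (2 * pi : R).
Local Notation E2 := 'rV[R]_2.
Local Notation mu := (@lebesgue_measure R).
Implicit Types (v w g : R -> E2) (x y : R).

Let P0 : 0 < P. Proof. by rewrite mulr_gt0// pi_gt0. Qed.

Definition e_ (i : 'I_2) : E2 := delta_mx 0 i.

Lemma dot_e (u : E2) (a : R) i : dot u (a *: e_ i) = a * u 0 i.
Proof.
rewrite dotZr /dot (bigD1 i)//= big1 ?addr0.
  by rewrite /e_ mxE !eqxx mulr1.
by move=> k ki; rewrite /e_ mxE eqxx (negbTE ki) mulr0.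
Qed.

Lemma is_derive_scale (f : R -> R) (df : R) x (u : E2) : is_derive x 1 f df ->
  is_derive x 1 (fun y => f y *: u) (df *: u).
Proof.
move=> h; apply/is_derive_coord => i; rewrite mxE.
have := derM h (derC x (u 0 i)); rewrite mulr0 addr0.
by congr (is_derive _ _ _ _); apply/funext => y; rewrite mxE.
Qed.

Lemma C1per_scale (f df : R -> R) (u : E2) : periodic f P ->
  (forall x, is_derive x 1 f (df x)) -> continuous df ->
  C1per (fun x => f x *: u) /\ forall x, derive1 (fun y => f y *: u) x = df x *: u.
Proof.
move=> pf fdf cdf.
have d1 x : derive1 (fun y => f y *: u) x = df x *: u.
  exact/is_derive_derive1/is_derive_scale.
split=> //; split; last by move=> x; rewrite /= pf.
split; first by move=> x; have [] := is_derive_scale u (fdf x).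
rewrite (_ : derive1 _ = fun x => df x *: u); last exact/funext.
by move=> x; apply: continuousZr_tmp; exact: cdf.
Qed.

Lemma weak_derivative_coord v g i : weak_derivative S1 C1per v g ->
  weak_on P (fun x => v x 0 i) (fun x => g x 0 i).
Proof.
move=> W phi dphi dP cdphi [a [b [a0 bP s0]]].
have ds0 z : ~ (a <= z <= b) -> dphi z = 0.
  move=> /negP zab; have [d d0 Hd] : exists2 d, 0 < d & forall y, `|y - z| < d -> ~ (a <= y <= b).
    move: zab; rewrite negb_and -!ltNge => /orP[za|zb].
      exists (a - z); first by rewrite subr_gt0.
      by move=> y; rewrite ltr_norml => /andP[_ h] /andP[]; lra.
    exists (z - b); first by rewrite subr_gt0.
    by move=> y; rewrite ltr_norml => /andP[h _] /andP[]; lra.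
  have h : is_derive z 1 phi 0.
    by apply: (is_derive_near d0 _ (derC z 0)) => y /Hd /s0.
  by case: (dP z) => _ <-; case: h => _ <-.
have [C1 D1] := C1per_scale (e_ i) (periodic_periodize phi)
  (fun x => is_derive_periodize x a0 bP s0 ds0 dP) (continuous_periodize a0 bP ds0 cdphi).
have := W _ C1; rewrite -!/(sint 0 P _).
rewrite (eq_sint (g := fun x => v x 0 i * dphi x)); last first.
  by move=> x xP; rewrite D1 dot_e (periodize_id a0 bP ds0 xP) mulrC.
by move=> ->; congr (- _); apply: eq_sint => x xP; rewrite dot_e (periodize_id a0 bP s0 xP) mulrC.
Qed.

Lemma weak_derivative_mean v g i : weak_derivative S1 C1per v g ->
  sint 0 P (fun x => g x 0 i) = 0.
Proof.
move=> W; have c0 : continuous (fun _ : R => 0 : R) by move=> x; exact: cst_continuous.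
have pc : periodic (fun _ : R => 1 : R) P by [].
have [C1 D1] := C1per_scale (e_ i) pc (fun x => derC x 1) c0.
have := W _ C1; rewrite -!/(sint 0 P _).
rewrite (eq_sint (g := fun _ => 0)); last by move=> x _; rewrite D1 scale0r dot0r.
rewrite sint_cst ?(ltW P0)// mul0r => /esym/eqP; rewrite oppr_eq0 => /eqP h.
by rewrite -[RHS]h; apply: eq_sint => x _; rewrite dot_e mul1r.
Qed.

Lemma measurable_enorm_sqr v : (forall i, measurable_fun `[0, P] (fun x => v x 0 i)) ->
  measurable_fun `[0, P] (fun x => enorm (v x) ^+ 2).
Proof.
move=> mv; rewrite (_ : (fun x => _) = (fun x => v x 0 0 ^+ 2 + v x 0 1 ^+ 2)).
  by apply: measurable_funD; apply: measurable_funX.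
by apply/funext => x; rewrite enorm_sqrE.
Qed.

Lemma L2_sqr v : L2 v -> integrable_on 0 P (fun x => enorm (v x) ^+ 2) /\
  L2sq v = (sint 0 P (fun x => enorm (v x) ^+ 2))%:E.
Proof.
move=> [mv fv]; have i : integrable_on 0 P (fun x => enorm (v x) ^+ 2).
  apply: integrable_onP; first exact: measurable_enorm_sqr.
  apply: le_lt_trans fv; rewrite le_eqVlt; apply/orP; left; apply/eqP.
  by apply: eq_integral => x _; rewrite /= ger0_norm// sqr_ge0.
split=> //; rewrite /sint /Rintegral fineK//; exact: integrable_fin_num i.
Qed.

Lemma L2_coord_sqr v i : L2 v -> integrable_on 0 P (fun x => v x 0 i ^+ 2).
Proof.
move=> Lv; have [iv _] := L2_sqr Lv.
apply: (integrable_on_le _ _ iv); first by apply: measurable_funX; case: Lv.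
move=> x _; rewrite ger0_norm ?sqr_ge0//.
by rewrite -[leLHS]real_normK ?num_real// ler_pXn2r ?nnegrE ?enorm_ge0// enorm_coord.
Qed.

Lemma L2_coord v i : L2 v -> integrable_on 0 P (fun x => v x 0 i).
Proof.
move=> Lv; have i1 : integrable_on 0 P (fun _ : R => 1 : R).
  by apply: integrable_on_continuous => x; exact: cst_continuous.
have [iv _] := L2_sqr Lv.
apply: (integrable_on_le _ _ (integrable_onD i1 iv)); first by case: Lv.
move=> x _; have h := enorm_coord (v x) i; apply: (le_trans h).
by have := sqr_ge0 (enorm (v x) - 1); rewrite !expr2; have := enorm_ge0 (v x); nra.
Qed.

Lemma L2_continuous v : (forall i, {within `[0, P], continuous (fun x => v x 0 i)}) -> L2 v.
Proof.
move=> cv; have mv i : measurable_fun `[0, P] (fun x => v x 0 i).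
  exact: integrable_on_measurable (integrable_on_cont (cv i)).
split=> //.
have iv : integrable_on 0 P (fun x => v x 0 0 ^+ 2 + v x 0 1 ^+ 2).
  by apply: integrable_onD; apply: integrable_on_cont => x; apply: continuousM; exact: cv.
have /integrableP[_] := iv; apply: le_lt_trans; rewrite le_eqVlt; apply/orP; left; apply/eqP.
by apply: eq_integral => x _; rewrite enorm_sqrE/= ger0_norm// addr_ge0// sqr_ge0.
Qed.

Lemma wderivP v g : L2 g -> weak_derivative S1 C1per v g ->
  L2 (wderiv v) /\ weak_derivative S1 C1per v (wderiv v).
Proof.
move=> Lg W.
by have := @xgetPex _ (fun=> 0) [set g | L2 g /\ weak_derivative S1 C1per v g] (ex_intro _ g (conj Lg W)).
Qed.

Lemma H1_wderiv v : H1 v -> L2 (wderiv v) /\ weak_derivative S1 C1per v (wderiv v).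
Proof. by case=> _ [g [Lg W]]; exact: wderivP Lg W. Qed.

Lemma weak_continuous_primitive v g : L2 g -> weak_derivative S1 C1per v g ->
  (forall i, {within `[0, P], continuous (fun x => v x 0 i)}) ->
  forall i x, 0 <= x <= P -> v x 0 i = v 0 0 i + sint 0 x (fun y => g y 0 i).
Proof.
move=> Lg W cv i; apply: (weak_primitive_continuous P0 (cv i) (L2_coord i Lg)).
exact: weak_derivative_coord.
Qed.

Lemma wderiv_unique v g : L2 g -> weak_derivative S1 C1per v g ->
  (forall i, {within `[0, P], continuous (fun x => v x 0 i)}) ->
  {ae mu, forall x, 0 < x < P -> wderiv v x = g x}.
Proof.
move=> Lg W cv; have [Lw Ww] := wderivP Lg W.
have key i : {ae mu, forall x, 0 < x < P -> wderiv v x 0 i = g x 0 i}.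
  apply: sint_eq_ae; [exact: L2_coord|exact: L2_coord|] => x xP.
  have := weak_continuous_primitive Lg W cv i xP.
  by rewrite (weak_continuous_primitive Lw Ww cv i xP) => /addrI.
by apply: (aeW (ae_fin_forall key)) => x hx xP; apply/rowP => i; exact: hx.
Qed.

(** An H2 curve is continuously differentiable away from the base point, and
    its derivative is the primitive of a square integrable function. *)
Lemma H2_profile v : H2 v -> exists w,
  [/\ forall i, {within `[0, P], continuous (fun x => w x 0 i)},
      w 0 = w P,
      forall x, 0 < x < P -> is_derive x 1 v (w x),
      {ae mu, forall x, 0 < x < P -> wderiv v x = w x} &
      forall i x, 0 <= x <= P -> w x 0 i = w 0 0 i + sint 0 x (fun y => wderiv (wderiv v) y 0 i)].
Proof.
move=> [pv cv Hv Hw].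
have [L1 W1] := H1_wderiv Hv; have [L2' W2] := H1_wderiv Hw.
have h i : exists c, {ae mu, forall x, 0 < x < P -> wderiv v x 0 i = c + sint 0 x (fun y => wderiv (wderiv v) y 0 i)}.
  exact: weak_primitive P0 (L2_coord i L1) (L2_coord i L2') (weak_derivative_coord i W2).
have [c hc] := choice h.
pose w x : E2 := \row_i (c i + sint 0 x (fun y => wderiv (wderiv v) y 0 i)).
have cw i : {within `[0, P], continuous (fun x => w x 0 i)}.
  apply/within_continuousP => x e xT e0.
  have [d d0 Hd] := (within_continuousP _ _).1 (continuous_sint (ltW P0) (L2_coord i L2')) x e xT e0.
  by exists d => // y yT xy; rewrite !mxE opprD addrACA subrr add0r; exact: Hd.
have wae : {ae mu, forall x, 0 < x < P -> wderiv v x = w x}.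
  by apply: (aeW (ae_fin_forall hc)) => x hx xP; apply/rowP => i; rewrite mxE hx.
have cvi i : {within `[0, P], continuous (fun x => v x 0 i)}.
  by apply: continuous_subspaceT; exact: continuous_coord.
have vE i x : 0 <= x <= P -> v x 0 i = v 0 0 i + sint 0 x (fun y => w y 0 i).
  move=> xP; rewrite (weak_continuous_primitive L1 W1 cvi i xP); congr (_ + _).
  have /andP[x0 xP'] := xP.
  have iw := integrable_on_cont (cw i).
  apply: sint_ae.
  - by apply: integrable_on_measurable; apply: (integrable_onS _ _ (L2_coord i L1)).
  - by apply: integrable_on_measurable; apply: (integrable_onS _ _ iw).
  have nP : {ae mu, forall x, x != 0 /\ x != P}.
    exists ([set 0] `|` [set P]); split.
    - exact: measurableU.
    - by rewrite null_set_setU//; exact: lebesgue_measure_set1.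
    - move=> y /=; have [->|y0] := eqVneq y 0; first by left.
      have [->|yP] := eqVneq y P; first by right.
      by move=> h'; exfalso; exact: h'.
  apply: (aeW (aeI wae nP)) => y [hy [y0 yP]] /andP[y0' yx].
  by rewrite hy// !lt_neqAle eq_sym y0 y0' yP (le_trans yx).
exists w; split=> //.
- by apply/rowP => i; rewrite !mxE sint_point (weak_derivative_mean i W2).
- move=> x /andP[x0 xP]; apply/is_derive_coord => i.
  have iw := integrable_on_cont (cw i).
  have cwx : {for x, continuous (fun y => w y 0 i)}.
    by have [h' _ _] := (continuous_within_itvP _ P0).1 (cw i); apply: h'; rewrite in_itv/= x0.
  have [dF dFE] := @continuous_FTC1_closed _ _ 0 x P xP iw x0 cwx.
  have D : is_derive x 1 (fun y => sint 0 y (fun z => w z 0 i)) (w x 0 i).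
    by split; [exact: dF|rewrite -dFE derive1E].
  have := derD (derC x (v 0 0 i)) D; rewrite add0r.
  apply: (is_derive_near (d := Num.min x (P - x))); first by rewrite lt_min x0 subr_gt0.
  move=> y; rewrite lt_min !ltr_norml => /andP[/andP[h1 _] /andP[_ h2]].
  by rewrite [RHS]vE//; apply/andP; split; lra.
- by move=> i x xP; rewrite !mxE sint_point addr0.
Qed.

Lemma primitive_increment v g : L2 g ->
  (forall i x, 0 <= x <= P -> v x 0 i = v 0 0 i + sint 0 x (fun y => g y 0 i)) ->
  forall x y, 0 <= x -> x <= y -> y <= P ->
  enorm (v y - v x) ^+ 2 <= (y - x) * sint x y (fun z => enorm (g z) ^+ 2).
Proof.
move=> Lg vE x y x0 xy yP.
have sq i : (v y 0 i - v x 0 i) ^+ 2 <= (y - x) * sint x y (fun z => g z 0 i ^+ 2).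
  have y0 := le_trans x0 xy; have xP := le_trans xy yP.
  rewrite (vE i y) ?y0// (vE i x) ?x0//.
  rewrite (@sint_chasles _ 0 x y)//; last exact: (integrable_onS _ _ (L2_coord i Lg)).
  rewrite opprD addrACA subrr add0r addrAC subrr add0r.
  apply: sint_sqr_le => //; first exact: (integrable_onS _ _ (L2_coord i Lg)).
  exact: (integrable_onS _ _ (L2_coord_sqr i Lg)).
rewrite enorm_sqrE !mxE.
have -> : sint x y (fun z => enorm (g z) ^+ 2) = sint x y (fun z => g z 0 0 ^+ 2) + sint x y (fun z => g z 0 1 ^+ 2).
  rewrite -sintD; first by apply: eq_sint => z _; rewrite enorm_sqrE.
  - exact: (integrable_onS _ _ (L2_coord_sqr 0 Lg)).
  - exact: (integrable_onS _ _ (L2_coord_sqr 1 Lg)).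
by rewrite mulrDr; apply: lerD; exact: sq.
Qed.

Lemma primitive_bound v g (K : R) : 0 <= K -> L2 v -> L2 g ->
  (forall i x, 0 <= x <= P -> v x 0 i = v 0 0 i + sint 0 x (fun y => g y 0 i)) ->
  (L2sq v <= (K ^+ 2)%:E)%E -> (L2sq g <= (K ^+ 2)%:E)%E ->
  forall x, 0 <= x <= P -> enorm (v x) <= 5 * K.
Proof.
move=> K0 Lv Lg vE; have [iv ->] := L2_sqr Lv; have [ig ->] := L2_sqr Lg.
rewrite !lee_fin => vK gK x /andP[x0 xP].
have inc y : 0 <= y <= P -> enorm (v x - v y) ^+ 2 <= P * K ^+ 2.
  move=> /andP[y0 yP].
  have sub a b : 0 <= a -> a <= b -> b <= P -> (b - a) * sint a b (fun z => enorm (g z) ^+ 2) <= P * K ^+ 2.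
    move=> a0 ab bP; have sg c d : 0 <= sint c d (fun z => enorm (g z) ^+ 2) by apply: sint_ge0 => z _; exact: sqr_ge0.
    apply: ler_pM => //; [by rewrite subr_ge0|by lra|].
    apply: le_trans gK.
    have i2 : integrable_on a P (fun z => enorm (g z) ^+ 2) := integrable_onS a0 (lexx _) ig.
    rewrite (sint_chasles a0 (le_trans ab bP) ig) (sint_chasles ab bP i2).
    by have := sg 0 a; have := sg b P; lra.
  have [yx|/ltW xy] := leP y x.
    by apply: (le_trans (primitive_increment Lg vE y0 yx xP)); exact: sub.
  by rewrite enormBC; apply: (le_trans (primitive_increment Lg vE x0 xy yP)); exact: sub.
have pt y : 0 <= y <= P -> enorm (v x) ^+ 2 - 2 * P * K ^+ 2 <= 2 * enorm (v y) ^+ 2.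
  move=> yP; have := inc y yP.
  have h : enorm (v x) <= enorm (v x - v y) + enorm (v y).
    by have := enormD (v x - v y) (v y); rewrite subrK.
  have := sqr_ge0 (enorm (v x - v y) - enorm (v y)).
  have : enorm (v x) ^+ 2 <= (enorm (v x - v y) + enorm (v y)) ^+ 2.
    by rewrite ler_pXn2r ?nnegrE ?addr_ge0 ?enorm_ge0.
  by rewrite !expr2; lra.
have : sint 0 P (fun _ => enorm (v x) ^+ 2 - 2 * P * K ^+ 2) <= sint 0 P (fun y => 2 * enorm (v y) ^+ 2).
  apply: le_sint => //; last exact: integrable_onZ.
  by apply: integrable_on_continuous => y; exact: cst_continuous.
rewrite sint_cst ?(ltW P0)// sintZ// subr0 => h.
rewrite -(@ler_pXn2r _ 2)// ?nnegrE ?enorm_ge0 ?mulr_ge0//.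
have pi2 : 2 <= pi :> R by exact: pi_ge2.
have pi4 : pi <= 4 :> R by have := @pihalf_lt2 R; lra.
have K2 : 0 <= K ^+ 2 by exact: sqr_ge0.
rewrite exprMn; move: h vK K2 pi2 pi4.
set A := enorm (v x) ^+ 2; set B := K ^+ 2; set S := sint _ _ _ => h vK K2 pi2 pi4.
rewrite -(ler_pM2r P0).
have : A * P <= 2 * B + 4 * pi * (B * P) by move: h; lra.
have : 4 * pi * (B * P) <= 16 * (B * P).
  by apply: ler_wpM2r; [rewrite mulr_ge0// ltW|lra].
have : 4 * B <= B * P by rewrite mulrC; apply: ler_wpM2l => //; lra.
have -> : 5 ^+ 2 = 25 :> R by ring.
by rewrite -mulrA; have : 0 <= B * P by [rewrite mulr_ge0// ltW]; lra.
Qed.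

End SobolevCurves.

(** * Regularity of a time slice *)

Section TimeSlices.
Context {R : realType}.
Local Notation P := (2 * pi : R).
Local Notation E2 := 'rV[R]_2.
Local Notation mu := (@lebesgue_measure R).

Let P0 : 0 < P. Proof. by rewrite mulr_gt0// pi_gt0. Qed.

Lemma ae_closed (Q : R -> Prop) : {ae mu, forall x, 0 < x < P -> Q x} ->
  {ae mu, forall x, 0 <= x <= P -> Q x}.
Proof.
have nP : {ae mu, forall x, x != 0 /\ x != P}.
  exists ([set 0] `|` [set P]); split.
  - exact: measurableU.
  - by rewrite null_set_setU//; exact: lebesgue_measure_set1.
  - move=> y /=; have [->|y0] := eqVneq y 0; first by left.
    have [->|yP] := eqVneq y P; first by right.
    by move=> h'; exfalso; exact: h'.
move=> h; apply: (aeW (aeI h nP)) => y [hy [y0 yP]] /andP[y0' yx].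
by apply: hy; rewrite !lt_neqAle eq_sym y0 y0' yP.
Qed.

Lemma within_cont_ext (V : normedModType R) (f g : R -> V) a b : (forall x, a <= x <= b -> f x = g x) ->
  {within `[a, b], continuous f} -> {within `[a, b], continuous g}.
Proof.
move=> fg /within_continuousP cf; apply/within_continuousP => t e tab e0.
have [d d0 Hd] := cf t e tab e0; exists d => // s sab st.
by rewrite -!fg; [exact: Hd| |]; move: sab tab; rewrite /= !in_itv.
Qed.

(** At the base point the two one-sided derivatives are those at the two ends of
    the period. *)
Lemma periodic_derive_ends (f g : R -> R) : periodic f P -> continuous f ->
  {within `[0, P], continuous g} -> g 0 = g P ->
  (forall x, 0 < x < P -> is_derive x 1 f (g x)) ->
  forall x, 0 <= x <= P -> is_derive x 1 f (g x).
Proof.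
move=> pf cf cg g0P fg.
have Pge : (0 <= P :> R) := ltW P0.
have D0 : is_derive (0 : R) 1 f (g 0).
  apply/is_deriveP => e e0.
  have [|d1 d10 H1] := (within_continuousP _ _).1 cg 0 e _ e0; first by rewrite /= in_itv/= lexx Pge.
  have [|d2 d20 H2] := (within_continuousP _ _).1 cg P e _ e0; first by rewrite /= in_itv/= lexx Pge.
  have cF a b c : {within `[a, b], continuous (fun y : R => f y - c * y)}.
    apply: continuous_subspaceT => y; apply: continuousB; first exact: cf.
    by apply: continuousM; [exact: cst_continuous|exact: cvg_id].
  have dF c y : 0 < y < P -> is_derive y 1 (fun y => f y - c * y) (g y - c).
    by move=> yP; have := derB (fg y yP) (derZ c (derX y)); rewrite mulr1.
  exists (Num.min (Num.min d1 d2) P); first by rewrite !lt_min d10 d20.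
  move=> s; rewrite subr0 !lt_min => /andP[/andP[s1 s2] sP].
  have [s0|s0] := leP 0 s.
    rewrite ger0_norm// in s1 s2 sP *.
    have := @derive_norm_le _ (fun y => f y - g 0 * y) (fun y => g y - g 0) 0 s e s0 (cF _ _ _).
    rewrite mulr0 !subr0 => h.
    have -> : f s - f 0 - s *: g 0 = f s - g 0 * s - f 0 by rewrite /GRing.scale/=; ring.
    apply: h => y /andP[y0 ys]; first by apply: dF; rewrite y0 (lt_trans ys).
    apply: ltW; rewrite distrC; apply: H1; first by rewrite /= in_itv/= (ltW y0) (ltW (lt_trans ys sP)).
    by rewrite sub0r normrN gtr0_norm// (lt_trans ys).
  rewrite ltr0_norm// in s1 s2 sP *.
  have sP' : s + P <= P by lra.
  have := @derive_norm_le _ (fun y => f y - g 0 * y) (fun y => g y - g 0) (s + P) P e sP' (cF _ _ _).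
  have fP : f P = f 0 by rewrite -[in LHS](add0r P) pf.
  move=> h; have {}h := h _ _.
  have -> : f s - f 0 - s *: g 0 = - (f P - g 0 * P - (f (s + P) - g 0 * (s + P))).
    by rewrite pf fP /GRing.scale/=; ring.
  rewrite normrN (_ : - s = P - (s + P)); last by ring.
  apply: h => y /andP[y0 ys]; first by apply: dF; apply/andP; split; lra.
  rewrite g0P; apply: ltW; rewrite distrC; apply: H2; first by rewrite /= in_itv/=; apply/andP; split; lra.
  by rewrite gtr0_norm; lra.
move=> x /andP[x0 xP].
have [->//|nx0] := eqVneq x 0.
have [->|nxP] := eqVneq x P; last by apply: fg; rewrite !lt_neqAle eq_sym nx0 x0 nxP.
apply/is_deriveP => e e0; have [d d0 Hd] := (is_deriveP _ _ _).1 D0 e e0.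
exists d => // s sd; have := Hd (s - P); rewrite subr0 => /(_ sd).
by rewrite -g0P -(pf (s - P)) subrK -[in X in X -> _](pf 0) add0r.
Qed.

Lemma H2_C1 v : H2 v ->
  [/\ forall x, 0 <= x <= P -> is_derive x 1 v (derive1 v x),
      forall i, {within `[0, P], continuous (fun x => derive1 v x 0 i)},
      derive1 v 0 = derive1 v P,
      {ae mu, forall x, 0 < x < P -> wderiv v x = derive1 v x} &
      forall i x, 0 <= x <= P ->
        derive1 v x 0 i = derive1 v 0 0 i + sint 0 x (fun y => wderiv (wderiv v) y 0 i)].
Proof.
move=> Hv; have [w [cw w0 dw wae wE]] := H2_profile Hv; have [pv cv _ _] := Hv.
have D x : 0 <= x <= P -> is_derive x 1 v (w x).
  move=> xP; apply/is_derive_coord => i.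
  apply: (@periodic_derive_ends (fun y => v y 0 i) (fun y => w y 0 i)) => //.
  - by move=> y; rewrite pv.
  - exact: continuous_coord.
  - by rewrite w0.
  - by move=> y yP; move: (dw y yP) => /is_derive_coord.
have DE x : 0 <= x <= P -> derive1 v x = w x by move=> /D/is_derive_derive1.
have b0 : 0 <= (0 : R) <= P by rewrite lexx ltW.
have bP : 0 <= P <= P by rewrite lexx ltW.
split.
- by move=> x xP; rewrite DE//; exact: D.
- by move=> i; apply: within_cont_ext (cw i) => x xP; rewrite DE.
- by rewrite !DE.
- apply: (aeW wae) => x h xP; have xP' : 0 <= x <= P by case/andP: xP => /ltW-> /ltW->.
  by rewrite h// DE.
- by move=> i x xP; rewrite !DE// wE.
Qed.

Lemma H2norm_le v (K : R) : 0 <= K -> (H2norm v <= K%:E)%E ->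
  [/\ (L2sq v <= (K ^+ 2)%:E)%E, (L2sq (wderiv v) <= (K ^+ 2)%:E)%E &
      (L2sq (wderiv (wderiv v)) <= (K ^+ 2)%:E)%E].
Proof.
move=> K0 h.
have nn (f : R -> E2) : (0 <= L2sq f)%E by apply: integral_ge0 => x _; rewrite lee_fin sqr_ge0.
have h' : (L2sq v + L2sq (wderiv v) + L2sq (wderiv (wderiv v)) <= (K ^+ 2)%:E)%E.
  have s0 : (0 <= L2sq v + L2sq (wderiv v) + L2sq (wderiv (wderiv v)))%E.
    by apply: adde_ge0 => //; exact: adde_ge0.
  have hs : (sqrte (L2sq v + L2sq (wderiv v) + L2sq (wderiv (wderiv v))) <= K%:E)%E := h.
  rewrite -(sqr_sqrte s0) expr2 EFinM expe2; apply: lee_pmul => //; exact: sqrte_ge0.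
split; apply: le_trans h'.
- by rewrite -addeA leeDl// adde_ge0.
- by rewrite addeAC leeDr// adde_ge0.
- by rewrite leeDr// adde_ge0.
Qed.

Lemma H2_bounds v (K : R) : 0 <= K -> H2 v -> (H2norm v <= K%:E)%E ->
  [/\ forall x, 0 <= x <= P -> enorm (v x) <= 5 * K,
      forall x, 0 <= x <= P -> enorm (derive1 v x) <= 5 * K &
      exists G : R -> R, [/\ forall x, 0 <= G x, integrable_on 0 P G, sint 0 P G <= K ^+ 2 &
        forall x y, 0 <= x -> x <= y -> y <= P ->
          enorm (derive1 v y - derive1 v x) ^+ 2 <= (y - x) * sint x y G]].
Proof.
move=> K0 Hv hK; have [b1 b2 b3] := H2norm_le K0 hK.
have [dv cdv _ wae wE] := H2_C1 Hv; have [pv cv Hv1 Hw1] := Hv.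
have [L1 W1] := H1_wderiv Hv1; have [L2' W2] := H1_wderiv Hw1.
have cvi i : {within `[0, P], continuous (fun x => v x 0 i)}.
  by apply: continuous_subspaceT; exact: continuous_coord.
have Lv := L2_continuous cvi; have Ld := L2_continuous cdv.
have vE := weak_continuous_primitive L1 W1 cvi.
have bd : (L2sq (derive1 v) <= (K ^+ 2)%:E)%E.
  apply: le_trans b2; rewrite le_eqVlt; apply/orP; left; apply/eqP.
  rewrite (L2_sqr Ld).2 (L2_sqr L1).2; congr _%:E; apply: sint_ae.
  - by apply: measurable_enorm_sqr; case: Ld.
  - by apply: measurable_enorm_sqr; case: L1.
  - by apply: ae_closed; apply: (aeW wae) => x h /h ->.
split.
- exact: primitive_bound K0 Lv L1 vE b1 b2.
- exact: primitive_bound K0 Ld L2' wE bd b3.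
have [iG sG] := L2_sqr L2'.
exists (fun x => enorm (wderiv (wderiv v) x) ^+ 2); split=> //.
- by move=> x; exact: sqr_ge0.
- by rewrite -lee_fin -sG.
- exact: primitive_increment L2' wE.
Qed.

End TimeSlices.

Section TangentField.
Context {R : realType}.
Local Notation P := (2 * pi : R).
Local Notation E2 := 'rV[R]_2.
Local Notation mu := (@lebesgue_measure R).

Let P0 : 0 < P. Proof. by rewrite mulr_gt0// pi_gt0. Qed.

Lemma dirE (u : E2) i : dir u 0 i = (enorm u)^-1 * u 0 i.
Proof. by rewrite /dir mxE. Qed.

Lemma perpE (u : E2) i : perp u 0 i = if i == 0 then - u 0 1 else u 0 0.
Proof. by rewrite /perp mxE. Qed.

Lemma perpK (u : E2) : perp (perp u) = - u.
Proof. by apply: row2P; rewrite !perpE/= ?perpE/= [in RHS]mxE. Qed.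

Lemma within_enorm (v : R -> E2) a b :
  (forall i, {within `[a, b], continuous (fun x => v x 0 i)}) ->
  {within `[a, b], continuous (fun x => enorm (v x))}.
Proof.
move=> cv.
have c2 : {within `[a, b], continuous (fun x => v x 0 0 ^+ 2 + v x 0 1 ^+ 2)}.
  move=> x; apply: (@continuousD _ _ _ (fun x : subspace `[a, b] => v x 0 0 ^+ 2) (fun x => v x 0 1 ^+ 2)).
    by apply: continuousM; exact: cv.
  by apply: continuousM; exact: cv.
have cs : {within `[a, b], continuous (fun x => Num.sqrt (v x 0 0 ^+ 2 + v x 0 1 ^+ 2))}.
  by move=> x; apply: (continuous_comp (c2 x)); exact: sqrt_continuous.
apply: within_cont_ext cs => x _; rewrite -enorm_sqrE sqrtr_sqr ger0_norm//; exact: enorm_ge0.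
Qed.

Lemma within_dir (v : R -> E2) a b : (forall x, a <= x <= b -> v x != 0) ->
  (forall i, {within `[a, b], continuous (fun x => v x 0 i)}) ->
  forall i, {within `[a, b], continuous (fun x => dir (v x) 0 i)}.
Proof.
move=> v0 cv i; have ce := within_enorm cv.
apply: (@within_cont_ext _ _ (fun x => (enorm (v x))^-1 * v x 0 i)); first by move=> x _; rewrite dirE.
rewrite continuous_subspace_in => x; rewrite inE/= in_itv/= => xab.
apply: (@continuousM _ _ (fun x : subspace `[a, b] => (enorm (v x))^-1)); last exact: cv.
by apply: continuousV; [rewrite enorm_eq0 v0|exact: ce].
Qed.


(** Rotating the test function instead of the curve. *)
Lemma weak_derivative_perp (u g : R -> E2) c : L2 g -> weak_derivative S1 C1per u g ->
  L2 (fun x => c *: perp (g x)) /\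
  weak_derivative S1 C1per (fun x => c *: perp (u x)) (fun x => c *: perp (g x)).
Proof.
move=> Lg W; split.
  have [mg fg] := Lg; have [ig sg] := L2_sqr Lg.
  have m i : measurable_fun S1 (fun x => (c *: perp (g x)) 0 i).
    have E : (fun x => (c *: perp (g x)) 0 i) = fun x => c * (if i == 0 then - g x 0 1 else g x 0 0).
      by apply/funext => x; rewrite mxE perpE.
    rewrite E; case: (i == 0); apply: measurable_funM => //.
    by apply: measurableT_comp => //; exact: mg.
  split=> //.
  have i2 := integrable_onZ (c ^+ 2) ig.
  have /integrableP[_] := i2; apply: le_lt_trans; rewrite le_eqVlt; apply/orP; left; apply/eqP.
  apply: eq_integral => x _ /=; congr _%:E.
  by rewrite enormZ exprMn real_normK ?num_real// enorm_perp ger0_norm// mulr_ge0// sqr_ge0.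
move=> phi [[dphi cphi] pphi].
have Dphi (x : R) : is_derive x 1 phi (derive1 phi x) by rewrite derive1E; exact/derivableP.
pose A := (- c) *: @e_ R 1; pose B := c *: @e_ R 0.
pose psi x := phi x 0 0 *: A + phi x 0 1 *: B.
have psiE (w : E2) : w 0 0 *: A + w 0 1 *: B = (- c) *: perp w.
  by apply: row2P; rewrite !mxE /=; ring.
have Dpsi (x : R) : is_derive x 1 psi ((- c) *: perp (derive1 phi x)).
  rewrite -psiE; apply/is_derive_coord => i.
  have h j : is_derive x 1 (fun y => phi y 0 j) (derive1 phi x 0 j) by move: (Dphi x) => /is_derive_coord.
  have := derD (derM (h 0) (derC x (A 0 i))) (derM (h 1) (derC x (B 0 i))).
  rewrite !mulr0 !addr0 !mxE.
  by congr (is_derive _ _ _ _); apply/funext => y; rewrite /psi !mxE.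
have tpsi : C1per psi.
  split; last by move=> x; rewrite /psi pphi.
  split; first by move=> x; have [] := Dpsi x.
  have -> : derive1 psi = fun x => derive1 phi x 0 0 *: A + derive1 phi x 0 1 *: B.
    by apply/funext => x; rewrite psiE; exact: is_derive_derive1.
  move=> x; apply: (@continuousD _ _ _ (fun x : R => derive1 phi x 0 0 *: A) (fun x : R => derive1 phi x 0 1 *: B)).
    by apply: continuousZr_tmp; exact: continuous_coord.
  by apply: continuousZr_tmp; exact: continuous_coord.
have pd (a b : E2) : dot (c *: perp a) b = dot a ((- c) *: perp b).
  by rewrite dotZr dotZl dot_perpC; ring.
have := W psi tpsi.
rewrite (_ : (fun x => dot (u x) (derive1 psi x)) = fun x => dot (c *: perp (u x)) (derive1 phi x)); last first.
  by apply/funext => x; rewrite pd (is_derive_derive1 (Dpsi x)).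
rewrite (_ : (fun x => dot (g x) (psi x)) = fun x => dot (c *: perp (g x)) (phi x)) //.
by apply/funext => x; rewrite pd /psi psiE.
Qed.


Section Velocity.
Variables (v u : R -> E2) (lam : R).
Hypotheses (Hv : H2 v) (Hu : H2 u).
Hypothesis v_neq0 : forall x : R, 0 <= x <= P -> derive1 v x != 0.
Hypothesis lam0 : lam != 0.
Hypothesis lamE : lam = P / curve_length v.
Hypothesis pde : {ae mu, forall x : R, 0 <= x <= P -> u x = flow_rhs v x}.

Definition turning (x : R) : E2 :=
  enorm (derive1 v x) *: (u x + lam *: perp (tangent v x)).

Let ctau i : {within `[0, P], continuous (fun x : R => tangent v x 0 i)}.
Proof. by have [_ cw _ _ _] := H2_C1 Hv; exact: within_dir. Qed.

Let cu i : {within `[0, P], continuous (fun x : R => u x 0 i)}.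
Proof. by case: Hu => _ c _ _; apply: continuous_subspaceT; exact: continuous_coord. Qed.

Let cperp i : {within `[0, P], continuous (fun x : R => u x 0 i + lam * perp (tangent v x) 0 i)}.
Proof.
have E : (fun x => u x 0 i + lam * perp (tangent v x) 0 i) =
    fun x => u x 0 i + lam * (if i == 0 then - tangent v x 0 1 else tangent v x 0 0).
  by apply/funext => x; rewrite perpE.
rewrite E => x; apply: (@continuousD _ _ _ (fun x : subspace `[0, P] => u x 0 i)); first exact: cu.
apply: continuousM; first exact: cst_continuous.
by case: (i == 0); [apply: continuousN|]; exact: ctau.
Qed.

Lemma turning_continuous i : {within `[0, P], continuous (fun x => turning x 0 i)}.
Proof.
have [_ cw _ _ _] := H2_C1 Hv.
have E : (fun x => turning x 0 i) =
    fun x => enorm (derive1 v x) * (u x 0 i + lam * perp (tangent v x) 0 i).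
  by apply/funext => x; rewrite /turning mxE [in LHS]mxE [X in _ + X]mxE.
rewrite E => x; apply: (@continuousM _ _ (fun x : subspace `[0, P] => enorm (derive1 v x))
    (fun x => u x 0 i + lam * perp (tangent v x) 0 i)); last exact: cperp.
exact: within_enorm.
Qed.

(** If the unit tangent had no weak derivative, its representative would be
    the conventional [0] and the equation would read [u = - lam *: perp tau]:
    but [perp u] does have a weak derivative. *)
Lemma tangent_weak_derivative : exists g, L2 g /\ weak_derivative S1 C1per (tangent v) g.
Proof.
apply: contrapT => hn.
have w0 x : wderiv (tangent v) x = 0.
  by rewrite /wderiv xgetPN// => g hg; apply: hn; exists g.
have [_ _ Hu1 _] := Hu; have [Lu Wu] := H1_wderiv Hu1.
have [Lg Wg] := weak_derivative_perp lam^-1 Lu Wu.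
have E i (x : R) : 0 <= x <= P -> u x 0 i + lam * perp (tangent v x) 0 i = 0.
  have c0 : {within `[0, P], continuous (fun _ : R => 0 : R)}.
    by apply: continuous_subspaceT => y; exact: cst_continuous.
  have H := @ae_eq_within _ (fun y => u y 0 i + lam * perp (tangent v y) 0 i) (fun=> 0) 0 P P0 (@cperp i) c0.
  move: x; apply: H; apply: (aeW pde) => y h /andP[y0 yP]; rewrite h ?ltW//.
  by rewrite /flow_rhs w0 scaler0 sub0r -lamE !mxE addNr.
apply: hn; exists (fun x => lam^-1 *: perp (wderiv u x)); split=> // phi tphi.
rewrite -Wg//; apply: eq_Rintegral => x; rewrite inE /S1/= in_itv/= => xP; congr dot.
have Eu : u x = - (lam *: perp (tangent v x)).
  by apply/rowP => i; have := E i x xP; rewrite !mxE => h; apply/eqP; rewrite -subr_eq0 opprK; apply/eqP.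
rewrite Eu perpN perpZ scalerN scalerA mulVf// scale1r.
by rewrite perpK opprK.
Qed.

Lemma tangent_primitive i x : 0 <= x <= P ->
  tangent v x 0 i = tangent v 0 0 i + sint 0 x (fun y => turning y 0 i).
Proof.
move=> xP; have [g [Lg Wg]] := tangent_weak_derivative.
have [Lt Wt] := wderivP Lg Wg.
rewrite (weak_continuous_primitive Lt Wt ctau i xP); congr (_ + _).
have /andP[x0 xP'] := xP.
apply: sint_ae.
- by apply: integrable_on_measurable; apply: (integrable_onS _ _ (L2_coord i Lt)).
- by apply: integrable_on_measurable; apply: (integrable_onS _ _ (integrable_on_cont (@turning_continuous i))).
apply: (aeW pde) => y h /andP[y0 yx]; have yP : 0 <= y <= P by rewrite y0 (le_trans yx).
rewrite /turning h// /flow_rhs -lamE subrK scalerA divff ?scale1r//.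
by rewrite enorm_eq0 v_neq0.
Qed.

(** The square of the unit tangent is constant, and its derivative is almost
    everywhere twice this product. *)
Lemma tangent_turning x : 0 <= x <= P -> dot (tangent v x) (turning x) = 0.
Proof.
have c1 : {within `[0, P], continuous (fun x => dot (tangent v x) (turning x))}.
  have c2 : {within `[0, P], continuous (fun x : R => tangent v x 0 0 * turning x 0 0 + tangent v x 0 1 * turning x 0 1)}.
    move=> y; apply: (@continuousD _ _ _ (fun x : subspace `[0, P] => tangent v x 0 0 * turning x 0 0)).
      by apply: continuousM; [exact: ctau|exact: turning_continuous].
    by apply: continuousM; [exact: ctau|exact: turning_continuous].
  by apply: within_cont_ext c2 => y _; rewrite dotE.
move: x; apply: (@ae_eq_within _ (fun y => dot (tangent v y) (turning y)) (fun=> 0) 0 P P0 c1); first by apply: continuous_subspaceT => y; exact: cst_continuous.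
have it i := integrable_on_cont (@turning_continuous i).
apply: (aeW (ae_fin_forall (fun i => ae_is_derive_sint (it i)))) => y hy yP.
have D i : is_derive y 1 (fun z => tangent v 0 0 i + sint 0 z (fun y => turning y 0 i)) (turning y 0 i).
  by have := derD (derC y (tangent v 0 0 i)) (hy i yP); rewrite add0r.
have D2 := derD (derM (D 0) (D 0)) (derM (D 1) (D 1)).
have /andP[y0 yP'] := yP.
have D1 : is_derive y 1 (fun _ : R => 1 : R) (turning y 0 0 * tangent v y 0 0 + tangent v y 0 0 * turning y 0 0
     + (turning y 0 1 * tangent v y 0 1 + tangent v y 0 1 * turning y 0 1)).
  have yc : 0 <= y <= P by rewrite !ltW.
  rewrite !(tangent_primitive _ yc).
  apply: (is_derive_near (d := Num.min y (P - y)) _ _ D2) => [|z].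
    by rewrite lt_min y0 subr_gt0.
  rewrite lt_min !ltr_norml => /andP[/andP[h1 _] /andP[_ h2]].
  have zP : 0 <= z <= P by apply/andP; split; lra.
  rewrite -!(tangent_primitive _ zP) -dotE -enorm_sqr enorm_dir ?expr1n//; exact: v_neq0.
have := is_derive_derive1 D1; rewrite (is_derive_derive1 (derC y 1)) dotE.
by lra.
Qed.

(** The nonlocal term of [turning] is normal, so that orthogonality of the unit
    tangent to its derivative is orthogonality of the velocity to the tangent. *)
Lemma velocity_normal x : 0 <= x <= P -> dot (u x) (tangent v x) = 0.
Proof.
move=> xP; have := tangent_turning xP; rewrite /turning dotZr dotDr dotZr.
rewrite [dot _ (perp _)]dotC dot_perp mulr0 addr0 dotC => /eqP.
by rewrite mulf_eq0 enorm_eq0 (negbTE (v_neq0 xP))/= => /eqP.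
Qed.

End Velocity.

End TangentField.

(** * Consistency of the inscribed polygon *)

Section Elements.
Context {R : realType}.
Local Notation P := (2 * pi : R).
Local Notation E2 := 'rV[R]_2.
Local Notation mu := (@lebesgue_measure R).

Lemma coordB (X Y : E2) i : (X - Y) 0 i = X 0 i - Y 0 i. Proof. by rewrite !mxE. Qed.

Lemma coordBZ (X Y Z : E2) c i : (X - Y - c *: Z) 0 i = X 0 i - Y 0 i - c * Z 0 i.
Proof. by rewrite !mxE. Qed.

Lemma dist_segment (a b x y : R) : a <= x <= b -> a <= y <= b -> `|y - x| <= b - a.
Proof. by move=> /andP[? ?] /andP[? ?]; rewrite ler_norml; apply/andP; split; lra. Qed.

Lemma unit_dot (e f : E2) : enorm e = 1 -> enorm f = 1 ->
  dot e f = 1 - enorm (e - f) ^+ 2 / 2.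
Proof.
move=> e1 f1; rewrite enorm_sqr dotBl !dotBr -!enorm_sqr e1 f1 [dot f e]dotC expr1n; lra.
Qed.

Lemma unit_dot_ge (e f : E2) : enorm e = 1 -> enorm f = 1 -> enorm (e - f) <= 1 ->
  2^-1 <= dot e f.
Proof.
move=> e1 f1 h; have h2 : enorm (e - f) ^+ 2 <= 1 by rewrite expr_le1// enorm_ge0.
by rewrite unit_dot//; lra.
Qed.

(** A unit vector close to [e] is determined by its normal component up to a
    quadratic term, because its length is fixed. *)
Lemma unit_expansion (e f g : E2) (c : R) : enorm e = 1 -> enorm f = 1 -> 0 <= dot f e ->
  dot e g = 0 ->
  enorm (f - e - c *: g) <= dot f (perp e) ^+ 2 + `|dot f (perp e) - c * dot g (perp e)|.
Proof.
move=> e1 f1 fe eg.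
have n1 : enorm (perp e) = 1 by rewrite enorm_perp.
set n := perp e in n1 *.
have gE : g = dot g n *: n by rewrite {1}(unit_decomp g e1) [dot g e]dotC eg scale0r add0r.
have fE := unit_decomp f e1; rewrite -/n in fE.
have -> : f - e - c *: g = (dot f e - 1) *: e + (dot f n - c * dot g n) *: n.
  by rewrite {1}gE {1}fE; apply/rowP => i; rewrite !mxE; ring.
apply: (le_trans (enormD _ _)); rewrite (@enormZ _ (dot f e - 1)) (@enormZ _ (dot f n - _)) e1 n1 !mulr1.
rewrite lerD2r.
have E : dot f e ^+ 2 + dot f n ^+ 2 = 1.
  have := enorm_sqr f; rewrite f1 {2}fE dotDr !dotZr expr1n; lra.
rewrite distrC ger0_norm; last by have := sqr_ge0 (dot f n); rewrite !expr2 in E *; nra.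
by have := sqr_ge0 (dot f n); rewrite !expr2 in E *; nra.
Qed.

Lemma scale_split (c d : R) (X Y : E2) : c *: X - d *: Y = (c - d) *: Y + c *: (X - Y).
Proof. by apply/rowP => i; rewrite !mxE; ring. Qed.

Lemma mean_value_le (f df : R -> R) (a b c : R) : a <= b ->
  (forall t, a <= t <= b -> is_derive t 1 f (df t)) ->
  (forall t, a <= t <= b -> `|df t| <= c) -> `|f b - f a| <= c * (b - a).
Proof.
move=> ab D H; apply: (derive_norm_le (df := df)) => //.
- apply: continuous_in_subspaceT => x; rewrite inE/= in_itv/= => xab.
  exact: is_derive_continuous (D x xab).
- by move=> t /andP[at_ tb]; apply: D; rewrite !ltW.
- by move=> t /andP[at_ tb]; apply: H; rewrite !ltW.
Qed.

Lemma mean_value_vec (f df : R -> E2) (a b c : R) : a <= b ->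
  (forall t, a <= t <= b -> is_derive t 1 f (df t)) ->
  (forall t, a <= t <= b -> enorm (df t) <= c) -> enorm (f b - f a) <= 2 * c * (b - a).
Proof.
move=> ab D H; apply: (le_trans (enorm_le_coord _)).
have h i : `|(f b - f a) 0 i| <= c * (b - a).
  have -> : (f b - f a) 0 i = f b 0 i - f a 0 i by rewrite !mxE.
  apply: (mean_value_le (f := fun x => f x 0 i) (df := fun x => df x 0 i)) => // t tab.
    by move: (D t tab) => /is_derive_coord.
  exact: le_trans (enorm_coord _ _) (H t tab).
by have := h 0; have := h 1; lra.
Qed.

(** Near-constancy of the integrand, in a form that does not care about the
    order of the end points of the interval. *)
Lemma sint_near_const (f F : R -> R) (a b B c : R) x y : {within `[a, b], continuous f} ->
  (forall x y, a <= x -> x <= y -> y <= b -> F y - F x = sint x y f) ->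
  (forall z, a <= z <= b -> `|f z - c| <= B) ->
  a <= x <= b -> a <= y <= b -> `|F y - F x - (y - x) * c| <= B * `|y - x|.
Proof.
move=> cf FE fB.
have key x' y' : a <= x' -> x' <= y' -> y' <= b ->
    `|F y' - F x' - (y' - x') * c| <= B * (y' - x').
  move=> ax xy yb; rewrite FE//.
  have i1 : integrable_on x' y' f := integrable_onS ax yb (integrable_on_cont cf).
  have i2 d : integrable_on x' y' (fun _ : R => d) by apply: integrable_on_continuous => z; exact: cst_continuous.
  rewrite [(y' - x') * c]mulrC -(sint_cst c xy) -sintB// -(sint_cst B xy).
  apply: le_trans (le_norm_sint _) _; first exact: integrable_onB.
  apply: le_sint => //; first exact/integrable_on_norm/integrable_onB.
  by move=> z /andP[xz zy]; apply: fB; rewrite (le_trans ax)// (le_trans zy).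
move=> /andP[ax xb] /andP[ay yb]; have [xy|/ltW yx] := leP x y.
  by rewrite [`|y - x|]ger0_norm ?subr_ge0//; exact: key.
have -> : F y - F x - (y - x) * c = - (F x - F y - (x - y) * c) by ring.
by rewrite normrN (distrC y) [`|x - y|]ger0_norm ?subr_ge0//; exact: key.
Qed.

(** The data of the flow at one instant: the curve [v], its velocity [u] and
    the factor [lam] of the nonlocal term. *)
Definition flow_slice (A : R) (v u : R -> E2) (lam : R) : Prop :=
  [/\ [/\ 1 <= A, periodic v P, periodic u P, derive1 v 0 = derive1 v P & `|lam| <= A],
      (forall x, 0 <= x <= P -> is_derive x 1 v (derive1 v x)),
      (forall x, 0 <= x <= P -> A^-1 <= enorm (derive1 v x) <= A),
      (forall x, 0 <= x <= P -> enorm (u x) <= A) /\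
      (forall x y, 0 <= x <= P -> 0 <= y <= P -> enorm (u y - u x) <= A * `|y - x|) &
      [/\ (forall x, 0 <= x <= P -> dot (u x) (tangent v x) = 0),
      (forall i, {within `[0, P], continuous (fun x : R => turning v u lam x 0 i)}) &
      (forall i x, 0 <= x <= P ->
         tangent v x 0 i = tangent v 0 0 i + sint 0 x (fun y => turning v u lam y 0 i))]].

Let chord_arith (A s om q rho m X Y : R) : 1 <= A -> 0 < s -> 0 <= om -> 0 < q ->
  s / (2 * A) <= q -> `|X| <= A * (4 * A ^+ 2 * s) * s -> `|Y| <= 2 * A ^+ 2 ->
  `|X - rho * Y * (s * m)| <= (om * (4 * A ^+ 2 * s) + A * (10 * A ^+ 4 * (om + s) * s)) * s ->
  `|q - s * rho| <= 2 * om * s -> `|m| <= s / 2 ->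
  (X / q) ^+ 2 + `|X / q - m * Y| <= 96 * A ^+ 8 * (s * (om + s)).
Proof.
move=> A1 s0 om0 q0 qs hX hY hM hq hm.
have A0 : 0 < A := lt_le_trans ltr01 A1.
have A00 := ltW A0; have s00 := ltW s0; have q00 := ltW q0.
have iq : 0 <= q^-1 by rewrite invr_ge0.
have sq : s <= 2 * A * q by move: qs; rewrite ler_pdivrMr ?mulr_gt0// [q * _]mulrC.
have h1 : `|X / q| <= 8 * A ^+ 4 * s.
  rewrite normrM (ger0_norm iq) ler_pdivrMr//; apply: (le_trans hX).
  have -> : A * (4 * A ^+ 2 * s) * s = 4 * A ^+ 3 * s * s by ring.
  have -> : 8 * A ^+ 4 * s * q = 4 * A ^+ 3 * s * (2 * A * q) by ring.
  by apply: ler_wpM2l => //; rewrite !mulr_ge0// ?exprn_ge0.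
have os0 : 0 <= om + s by rewrite addr_ge0.
have h2 : `|X - q * m * Y| <= 16 * A ^+ 5 * s * (om + s) * s.
  have -> : X - q * m * Y = X - rho * Y * (s * m) - (q - s * rho) * (m * Y) by ring.
  apply: (le_trans (ler_normB _ _)); rewrite !normrM.
  have k := ler_pM (normr_ge0 _) (normr_ge0 _) hm hY.
  have k2 := ler_pM (normr_ge0 _) (mulr_ge0 (normr_ge0 m) (normr_ge0 Y)) hq k.
  apply: (le_trans (lerD hM k2)).
  have -> : (om * (4 * A ^+ 2 * s) + A * (10 * A ^+ 4 * (om + s) * s)) * s + 2 * om * s * (s / 2 * (2 * A ^+ 2))
     = (6 * (A ^+ 2 * om) + 10 * (A ^+ 5 * (om + s))) * (s * s) by field.
  have -> : 16 * A ^+ 5 * s * (om + s) * s = (16 * (A ^+ 5 * (om + s))) * (s * s) by ring.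
  apply: ler_wpM2r; first exact: mulr_ge0.
  have : A ^+ 2 * om <= A ^+ 5 * (om + s).
    by apply: ler_pM; rewrite ?exprn_ge0 ?ler_weXn2l// lerDl.
  lra.
have h3 : `|X / q - m * Y| <= 32 * A ^+ 6 * s * (om + s).
  have -> : X / q - m * Y = (X - q * m * Y) / q by field; rewrite gt_eqF.
  rewrite normrM (ger0_norm iq) ler_pdivrMr//; apply: (le_trans h2).
  have -> : 32 * A ^+ 6 * s * (om + s) * q = 16 * A ^+ 5 * s * (om + s) * (2 * A * q) by ring.
  by apply: ler_wpM2l => //; rewrite !mulr_ge0// ?exprn_ge0.
have h4 : (X / q) ^+ 2 <= (8 * A ^+ 4 * s) ^+ 2.
  rewrite -[leLHS]real_normK ?num_real// ler_pXn2r// nnegrE.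
  by rewrite !mulr_ge0// ?exprn_ge0.
apply: (le_trans (lerD h4 h3)).
have -> : (8 * A ^+ 4 * s) ^+ 2 = 64 * A ^+ 8 * (s * s) by ring.
have -> : 32 * A ^+ 6 * s * (om + s) = 32 * (A ^+ 6 * (s * (om + s))) by ring.
have g1 : A ^+ 6 * (s * (om + s)) <= A ^+ 8 * (s * (om + s)).
  by apply: ler_wpM2r; [exact: mulr_ge0|rewrite ler_weXn2l].
have g2 : A ^+ 8 * (s * s) <= A ^+ 8 * (s * (om + s)).
  by rewrite ler_pM2l ?exprn_gt0// ler_pM2l// lerDr.
by rewrite -!mulrA; lra.
Qed.

Section OneElement.
Variables (A lam a b om : R) (v u : R -> E2).
Hypothesis slice : flow_slice A v u lam.
Hypotheses (a0 : 0 <= a) (ab : a < b) (bP : b <= P).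
Hypothesis osc : forall x y, a <= x <= b -> a <= y <= b ->
  enorm (derive1 v y - derive1 v x) <= om.
Hypothesis small : 4 * A ^+ 2 * (b - a) <= 1.

Local Notation w := (derive1 v).
Local Notation tau := (tangent v).
Local Notation sig := (turning v u lam).
Local Notation s := (b - a).
Local Notation p := (v b - v a).

Let A1 : 1 <= A. Proof. by case: slice => -[]. Qed.
Let A0 : 0 < A. Proof. exact: lt_le_trans A1. Qed.
Let s0 : 0 < s. Proof. by rewrite subr_gt0. Qed.
Let inP x : a <= x <= b -> 0 <= x <= P.
Proof. by move=> /andP[ax xb]; rewrite (le_trans a0)// (le_trans xb). Qed.
Let om0 : 0 <= om.
Proof. by apply: le_trans (osc (x := a) (y := a) _ _); rewrite ?enorm_ge0// lexx ltW. Qed.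
Let tau1 x : a <= x <= b -> enorm (tau x) = 1.
Proof.
move=> /inP xP; apply: enorm_dir; rewrite -enorm_gt0.
have [_ _ h _ _] := slice; have /andP[h1 _] := h x xP.
by apply: lt_le_trans h1; rewrite invr_gt0.
Qed.
Let tauK x : w x = enorm (w x) *: tau x. Proof. by rewrite dirK. Qed.

Lemma turning_bound x : a <= x <= b -> enorm (sig x) <= 2 * A ^+ 2.
Proof.
move=> xab; have [[_ _ _ _ hl] _ hw [hu _] _] := slice.
have xP := inP xab; have /andP[_ w2] := hw x xP; have u1 := hu x xP.
rewrite /turning enormZ ger0_norm ?enorm_ge0//.
have h : enorm (u x + lam *: perp (tau x)) <= A + A * 1.
  apply: (le_trans (enormD _ _)); apply: lerD => //.
  by rewrite (@enormZ _ lam) enorm_perp tau1//; apply: ler_wpM2r.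
have := ler_pM (enorm_ge0 _) (enorm_ge0 _) w2 h; rewrite expr2; lra.
Qed.

Lemma tangent_increment i x y : a <= x -> x <= y -> y <= b ->
  tau y 0 i - tau x 0 i = sint x y (fun z => sig z 0 i).
Proof.
move=> ax xy yb; have [_ _ _ _ [_ cs hs]] := slice.
have x0 : 0 <= x := le_trans a0 ax; have y0 : 0 <= y := le_trans x0 xy.
have yP : y <= P := le_trans yb bP.
have h1 := hs i y; rewrite y0 yP in h1; rewrite (h1 isT).
have h2 := hs i x; rewrite x0 (le_trans xy yP) in h2; rewrite (h2 isT).
rewrite (@sint_chasles _ 0 x y)//; first by ring.
exact: integrable_onS (lexx 0) yP (integrable_on_cont (cs i)).
Qed.

Let csig i : {within `[a, b], continuous (fun x : R => sig x 0 i)}.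
Proof.
have [_ _ _ _ [_ cs _]] := slice.
by apply: continuous_subspaceW (cs i) => x /=; rewrite !in_itv/= => /inP.
Qed.

Lemma tangent_lipschitz x y : a <= x <= b -> a <= y <= b ->
  enorm (tau y - tau x) <= 4 * A ^+ 2 * `|y - x|.
Proof.
move=> xab yab; apply: (le_trans (enorm_le_coord _)).
have h i : `|(tau y - tau x) 0 i| <= 2 * A ^+ 2 * `|y - x|.
  have -> : (tau y - tau x) 0 i = tau y 0 i - tau x 0 i - (y - x) * 0 by rewrite coordB mulr0 subr0.
  apply: (@sint_near_const (fun z => sig z 0 i) (fun z => tau z 0 i) a b) => //.
  - exact: tangent_increment.
  - by move=> z zab; rewrite subr0; apply: (le_trans (enorm_coord _ _)); exact: turning_bound.
by have := h 0; have := h 1; lra.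
Qed.

Lemma turning_osc x y : a <= x <= b -> a <= y <= b ->
  enorm (sig y - sig x) <= 5 * A ^+ 4 * (om + s).
Proof.
move=> xab yab; have [[_ _ _ _ hl] _ hw [hu lu] _] := slice.
have xP := inP xab; have yP := inP yab.
have /andP[_ w2] := hw y yP; have u1 := hu x xP.
have yx : `|y - x| <= s by exact: dist_segment.
pose B x := u x + lam *: perp (tau x).
have -> : sig y - sig x = (enorm (w y) - enorm (w x)) *: B x + enorm (w y) *: (B y - B x).
  exact: scale_split.
have hB : enorm (B x) <= 2 * A.
  have : enorm (B x) <= A + A * 1.
    apply: (le_trans (enormD _ _)); apply: lerD => //.
    by rewrite (@enormZ _ lam) enorm_perp tau1//; apply: ler_wpM2r.
  lra.
have hB2 : enorm (B y - B x) <= A * s + A * (4 * A ^+ 2 * s).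
  have -> : B y - B x = (u y - u x) + lam *: perp (tau y - tau x).
    by rewrite /B perpB scalerBr opprD addrACA.
  apply: (le_trans (enormD _ _)); apply: lerD.
    by apply: (le_trans (lu _ _ xP yP)); rewrite ler_pM2l.
  rewrite (@enormZ _ lam) enorm_perp; apply: ler_pM => //; first exact: enorm_ge0.
  apply: (le_trans (tangent_lipschitz xab yab)); apply: ler_wpM2l => //.
  by rewrite mulr_ge0// sqr_ge0.
apply: (le_trans (enormD _ _)); rewrite (@enormZ _ (_ - _)) (@enormZ _ (enorm _)) (ger0_norm (enorm_ge0 _)).
have h1 : `|enorm (w y) - enorm (w x)| <= om by apply: (le_trans (enorm_dist _ _)); exact: osc.
have k1 := ler_pM (normr_ge0 _) (enorm_ge0 _) h1 hB.
have k2 := ler_pM (enorm_ge0 _) (enorm_ge0 _) w2 hB2.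
apply: (le_trans (lerD k1 k2)).
have A2 : 1 <= A ^+ 2 by rewrite exprn_ege1.
have A4 : A ^+ 2 <= A ^+ 4 by rewrite ler_weXn2l.
have AA : A <= A ^+ 4 by rewrite ler_eXnr.
have e4 : A * (A * s + A * (4 * A ^+ 2 * s)) = A ^+ 2 * s + 4 * (A ^+ 4 * s) by ring.
have m1 : A ^+ 2 * s <= A ^+ 4 * s by rewrite ler_pM2r.
have m2 : A * om <= A ^+ 4 * om by apply: ler_wpM2r.
have m3 : 0 <= A ^+ 4 * om by rewrite mulr_ge0// exprn_ge0// ltW.
by rewrite e4 mulrDr; lra.
Qed.

Lemma tangent_taylor x y : a <= x <= b -> a <= y <= b ->
  enorm (tau y - tau x - (y - x) *: sig x) <= 10 * A ^+ 4 * (om + s) * `|y - x|.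
Proof.
move=> xab yab; apply: (le_trans (enorm_le_coord _)).
have h i : `|(tau y - tau x - (y - x) *: sig x) 0 i| <= 5 * A ^+ 4 * (om + s) * `|y - x|.
  have -> : (tau y - tau x - (y - x) *: sig x) 0 i = tau y 0 i - tau x 0 i - (y - x) * sig x 0 i.
    exact: coordBZ.
  apply: (@sint_near_const (fun z => sig z 0 i) (fun z => tau z 0 i) a b) => //.
  - exact: tangent_increment.
  - move=> z zab; have -> : sig z 0 i - sig x 0 i = (sig z - sig x) 0 i by rewrite coordB.
    by apply: (le_trans (enorm_coord _ _)); exact: turning_osc.
by have := h 0; have := h 1; lra.
Qed.

Lemma chord_linear c : a <= c <= b -> enorm (p - s *: w c) <= 2 * om * s.
Proof.
move=> cab; have [_ D _ _ _] := slice.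
have := @mean_value_vec (fun x => v x - x *: w c) (fun x => w x - w c) a b om (ltW ab).
have -> : v b - b *: w c - (v a - a *: w c) = p - s *: w c.
  by apply/rowP => i; rewrite !mxE; ring.
apply => t tab; last exact: osc.
apply/is_derive_coord => i; move: (D t (inP tab)) => /is_derive_coord Di.
have := derB (Di i) (derZ (w c 0 i) (derX t)); rewrite mulr1 !mxE.
by congr (is_derive _ _ _ _); apply/funext => y; rewrite !mxE mulrC.
Qed.

Let chord_derive nu t : a <= t <= b -> is_derive t 1 (fun x => dot (v x) nu) (dot (w t) nu).
Proof. by move=> /inP tP; have [_ D _ _ _] := slice; exact: is_derive_dot (D t tP). Qed.

(** On a short element the tangent turns by at most one in norm, so that at
    least half of the speed goes in any of its directions. *)
Lemma chord_dot_ge c : a <= c <= b -> s / (2 * A) <= dot p (tau c).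
Proof.
move=> cab; have [_ _ hw _ _] := slice.
have N1 : enorm (tau c) = 1 by exact: tau1.
rewrite dotBl.
have := @derive_le _ (fun x => - dot (v x) (tau c)) (fun x => - dot (w x) (tau c)) a b (- (2 * A)^-1) (ltW ab).
have c0 : {within `[a, b], continuous (fun x => - dot (v x) (tau c))}.
  apply: continuous_in_subspaceT => x; rewrite inE/= in_itv/= => xab.
  exact: is_derive_continuous (derN (chord_derive (tau c) xab)).
move=> /(_ c0) h; have {}h := h _ _; rewrite mulrC.
suff : - dot (v b) (tau c) - - dot (v a) (tau c) <= - (2 * A)^-1 * s by lra.
apply: h => t /andP[at_ tb]; have tab : a <= t <= b by rewrite !ltW.
  exact: (derN (chord_derive (tau c) tab)).
rewrite lerN2 (tauK t) dotZl.
have /andP[w1 _] := hw t (inP tab).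
have T1 := tau1 tab.
have L := tangent_lipschitz cab tab.
have L1 : enorm (tau t - tau c) <= 1.
  apply: (le_trans L); apply: le_trans small; apply: ler_wpM2l; first by rewrite mulr_ge0// sqr_ge0.
  exact: dist_segment.
have h2 := unit_dot_ge T1 N1 L1.
by rewrite invfM mulrC; apply: ler_pM => //; rewrite invr_ge0// ltW.
Qed.

Lemma chord_length_ge : s / (2 * A) <= enorm p.
Proof.
have aab : a <= a <= b by rewrite lexx ltW.
apply: (le_trans (chord_dot_ge aab)); apply: (le_trans (dot_le _ _)).
by rewrite tau1// mulr1.
Qed.

(** The direction of the chord expands like that of the curve around the
    middle of the element. *)
Theorem chord_direction c : a <= c <= b ->
  enorm (dir p - tau c - ((a + b) / 2 - c) *: sig c) <= 96 * A ^+ 8 * (s * (om + s)).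
Proof.
move=> cab; have [_ _ hw _ [hn _ _]] := slice.
set q := enorm p; set rho := enorm (w c); set nu := perp (tau c).
set m := (a + b) / 2 - c; set T := dir p.
have T1 := tau1 cab.
have nu1 : enorm nu = 1 by rewrite enorm_perp.
have q0 : 0 < q := lt_le_trans (divr_gt0 s0 (mulr_gt0 (ltr0Sn R 1) A0)) chord_length_ge.
have p0 : p != 0 by rewrite -enorm_gt0.
have Tq : q *: T = p := dirK p.
have os0 : 0 <= om + s by rewrite addr_ge0// ltW.
have wnu t : a <= t <= b -> dot (w t) nu = enorm (w t) * dot (tau t - tau c) nu.
  by move=> tab; rewrite {1}(tauK t) dotZl dotBl [dot (tau c) nu]dotC dot_perp subr0.
have wnu_le t : a <= t <= b -> `|dot (w t) nu| <= A * (4 * A ^+ 2 * s).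
  move=> tab; rewrite wnu// normrM (ger0_norm (enorm_ge0 _)).
  have /andP[_ w2] := hw t (inP tab).
  apply: ler_pM => //; first exact: enorm_ge0.
  apply: (le_trans (dot_cauchy _ _)); rewrite nu1 mulr1.
  apply: (le_trans (tangent_lipschitz cab tab)); apply: ler_wpM2l; last exact: dist_segment.
  by rewrite mulr_ge0// sqr_ge0.
have pnu : `|dot p nu| <= A * (4 * A ^+ 2 * s) * s.
  by rewrite dotBl; apply: (mean_value_le (ltW ab) (@chord_derive nu)).
have sn : `|dot (sig c) nu| <= 2 * A ^+ 2.
  by apply: (le_trans (dot_cauchy _ _)); rewrite nu1 mulr1; exact: turning_bound.
have main : `|dot p nu - rho * dot (sig c) nu * (s * m)| <=
    (om * (4 * A ^+ 2 * s) + A * (10 * A ^+ 4 * (om + s) * s)) * s.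
  pose k := rho * dot (sig c) nu.
  have := @mean_value_le (fun x => dot (v x) nu - k / 2 * ((x - c) * (x - c)))
    (fun x => dot (w x) nu - k * (x - c)) a b
    (om * (4 * A ^+ 2 * s) + A * (10 * A ^+ 4 * (om + s) * s)) (ltW ab).
  have -> : dot (v b) nu - k / 2 * ((b - c) * (b - c)) - (dot (v a) nu - k / 2 * ((a - c) * (a - c)))
     = dot p nu - k * (s * m) by rewrite dotBl /m; field.
  apply => t tab.
    have d1 := derB (derX t) (derC t c).
    have d2 := derB (chord_derive nu tab) (derZ (k / 2) (derM d1 d1)).
    move: d2; congr (is_derive _ _ _ _).
    by rewrite subr0 mul1r mulr1; field.
  have -> : dot (w t) nu - k * (t - c) =
     (enorm (w t) - rho) * dot (tau t - tau c) nu + rho * dot (tau t - tau c - (t - c) *: sig c) nu.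
    by rewrite wnu// (dotBl (tau t - tau c)) dotZl /k; ring.
  apply: (le_trans (ler_normD _ _)); rewrite !normrM (ger0_norm (enorm_ge0 (w c))).
  have /andP[_ w2] := hw c (inP cab).
  apply: lerD; apply: ler_pM => //.
  - by apply: (le_trans (enorm_dist _ _)); exact: osc.
  - apply: (le_trans (dot_cauchy _ _)); rewrite nu1 mulr1.
    apply: (le_trans (tangent_lipschitz cab tab)); apply: ler_wpM2l; last exact: dist_segment.
    by rewrite mulr_ge0// sqr_ge0.
  - exact: enorm_ge0.
  - apply: (le_trans (dot_cauchy _ _)); rewrite nu1 mulr1.
    apply: (le_trans (tangent_taylor cab tab)); apply: ler_wpM2l; last exact: dist_segment.
    by rewrite !mulr_ge0 ?exprn_ge0 ?(ltW A0).
have qr : `|q - s * rho| <= 2 * om * s.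
  have -> : s * rho = enorm (s *: w c) by rewrite (@enormZ _ s) ger0_norm// ltW.
  by apply: (le_trans (enorm_dist _ _)); exact: chord_linear.
have ms : `|m| <= s / 2.
  by rewrite /m ler_norml; move: cab => /andP[? ?]; apply/andP; split; lra.
have TE : dot T nu = dot p nu / q.
  by rewrite -Tq (@dotZl _ q) mulrAC divff ?mul1r// gt_eqF.
apply: (le_trans (unit_expansion _ T1 (enorm_dir p0) _ _)).
- have -> : dot T (tau c) = dot p (tau c) / q by rewrite -Tq (@dotZl _ q) mulrAC divff ?mul1r// gt_eqF.
  apply: divr_ge0; last exact: ltW.
  apply: le_trans (chord_dot_ge cab); exact: ltW (divr_gt0 s0 (mulr_gt0 (ltr0Sn R 1) A0)).
- rewrite /turning dotZr dotDr dotZr [dot _ (perp _)]dotC dot_perp mulr0 addr0 dotC.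
  by rewrite hn ?mulr0//; exact: inP.
rewrite -/nu TE; exact: (chord_arith A1 s0 om0 q0 chord_length_ge pnu sn main qr ms).
Qed.

End OneElement.
End Elements.

Section LocalConsistency.
Context {R : realType}.
Local Notation E2 := 'rV[R]_2.
Variables (A h s s' om om' k lam rho : R) (T T' tau sig u w p p' : E2).
Hypotheses (A1 : 1 <= A) (h0 : 0 < h) (h1 : h <= 1).
Hypotheses (s0 : 0 <= s <= h) (s0' : 0 <= s' <= h) (ss : `|s' - s| <= A * h ^+ 2).
Hypotheses (o0 : 0 <= om <= A) (o0' : 0 <= om' <= A).
Hypotheses (HT : enorm (T - tau - (- (s / 2)) *: sig) <= 96 * A ^+ 8 * (s * (om + s))).
Hypotheses (HT' : enorm (T' - tau - (s' / 2) *: sig) <= 96 * A ^+ 8 * (s' * (om' + s'))).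
Hypotheses (Hp : enorm (p - s *: w) <= 2 * om * s) (Hp' : enorm (p' - s' *: w) <= 2 * om' * s').
Hypotheses (wE : w = rho *: tau) (sE : sig = rho *: (u + lam *: perp tau)).
Hypotheses (r0 : 0 <= rho <= A) (wn : enorm w = rho) (un : enorm u <= A).
Hypotheses (ut : dot u tau = 0) (sn : enorm sig <= 2 * A ^+ 2).
Hypotheses (k0 : 0 <= k <= A) (kl : `|k - lam / 2| <= 15 * A ^+ 4 * h).

Let e := h * om + h * om' + h ^+ 2.
Let A0 : 0 <= A. Proof. exact: le_trans A1. Qed.
Let h00 := ltW h0.
Let A8 : 1 <= A ^+ 8. Proof. exact: exprn_ege1. Qed.
Let P1 : h * om <= e. Proof. by rewrite /e -addrA lerDl addr_ge0// ?sqr_ge0// mulr_ge0//; case/andP: o0'. Qed.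
Let P2 : h * om' <= e. Proof. by rewrite /e addrAC lerDr addr_ge0// ?sqr_ge0// mulr_ge0//; case/andP: o0. Qed.
Let P3 : h ^+ 2 <= e. Proof. by rewrite /e lerDr addr_ge0// mulr_ge0//; [case/andP: o0|case/andP: o0']. Qed.
Let e0 : 0 <= e. Proof. exact: le_trans (sqr_ge0 h) P3. Qed.

Let so : om * s <= h * om /\ om' * s' <= h * om'.
Proof.
have [/andP[? ?] /andP[? ?]] := (o0, o0'); have [/andP[? ?] /andP[? ?]] := (s0, s0').
by split; rewrite mulrC; apply: ler_wpM2r.
Qed.

Let both : 96 * A ^+ 8 * (s * (om + s)) + 96 * A ^+ 8 * (s' * (om' + s')) <= 192 * A ^+ 8 * e.
Proof.
have [so1 so2] := so; have [/andP[? ?] /andP[? ?]] := (s0, s0').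
have ss1 : s * s <= h ^+ 2 by rewrite expr2; apply: ler_pM.
have ss2 : s' * s' <= h ^+ 2 by rewrite expr2; apply: ler_pM.
rewrite -mulrDr.
have -> : 192 * A ^+ 8 * e = 96 * A ^+ 8 * (2 * e) by ring.
apply: ler_wpM2l; first by rewrite mulr_ge0// exprn_ge0.
by rewrite mulrDr [s' * _]mulrDr ![_ * om]mulrC ![_ * om']mulrC /e; move: P1 P2 P3; rewrite /e; lra.
Qed.

Let q1 : `|enorm p - s * rho| <= 2 * (h * om).
Proof.
have -> : s * rho = enorm (s *: w) by rewrite (@enormZ _ s) wn ger0_norm//; case/andP: s0.
by apply: (le_trans (enorm_dist _ _)); apply: (le_trans Hp); case: so; rewrite -mulrA; lra.
Qed.

Let q2 : `|enorm p' - s' * rho| <= 2 * (h * om').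
Proof.
have -> : s' * rho = enorm (s' *: w) by rewrite (@enormZ _ s') wn ger0_norm//; case/andP: s0'.
by apply: (le_trans (enorm_dist _ _)); apply: (le_trans Hp'); case: so; rewrite -mulrA; lra.
Qed.

(** The first order terms cancel by the flow equation at the node; what is left
    are the errors of the chords and that of the nonlocal factor. *)
Lemma local_residual :
  enorm (((enorm p + enorm p') / 2) *: u - (T' - T) + k *: perp (p + p')) <= 230 * A ^+ 9 * e.
Proof.
have -> : ((enorm p + enorm p') / 2) *: u - (T' - T) + k *: perp (p + p') =
   (((enorm p - s * rho) + (enorm p' - s' * rho)) / 2) *: u
   + ((T - tau - (- (s / 2)) *: sig) - (T' - tau - (s' / 2) *: sig))
   + k *: (perp (p - s *: w) + perp (p' - s' *: w))
   + ((s + s') * (k - lam / 2)) *: perp w.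
  rewrite wE sE !perpB !perpD !perpZ.
  by apply/rowP => i; move: (perp p) (perp p') (perp tau) => a1 a2 a3; rewrite !mxE; field.
have t1 : enorm ((((enorm p - s * rho) + (enorm p' - s' * rho)) / 2) *: u) <= 2 * e * A.
  rewrite (@enormZ _ (_ / 2)); apply: ler_pM; rewrite ?enorm_ge0//.
  move: q1 q2; rewrite !ler_norml => /andP[? ?] /andP[? ?].
  by apply/andP; split; move: P1 P2; lra.
have t2 : enorm ((T - tau - (- (s / 2)) *: sig) - (T' - tau - (s' / 2) *: sig)) <= 192 * A ^+ 8 * e.
  by apply: (le_trans (enormB _ _)); apply: le_trans both; exact: lerD.
have t3 : enorm (k *: (perp (p - s *: w) + perp (p' - s' *: w))) <= A * (4 * e).
  rewrite (@enormZ _ k) ger0_norm; last by case/andP: k0.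
  apply: ler_pM; rewrite ?enorm_ge0//; [by case/andP: k0|by case/andP: k0|].
  apply: (le_trans (enormD _ _)); rewrite !enorm_perp.
  by apply: (le_trans (lerD Hp Hp')); case: so => ? ?; rewrite -!mulrA; move: P1 P2; lra.
have t4 : enorm (((s + s') * (k - lam / 2)) *: perp w) <= 2 * h * (15 * A ^+ 4 * h) * A.
  rewrite (@enormZ _ (_ * _)) enorm_perp wn normrM.
  apply: ler_pM; rewrite ?mulr_ge0//; [by case/andP: r0| |by case/andP: r0].
  apply: ler_pM => //; move: s0 s0' => /andP[? ?] /andP[? ?].
  by rewrite ger0_norm; lra.
apply: (le_trans (enormD _ _)).
have t123 := le_trans (enormD _ _) (lerD (le_trans (enormD _ _) (lerD t1 t2)) t3).
apply: (le_trans (lerD t123 t4)).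
have -> : 2 * h * (15 * A ^+ 4 * h) * A = 30 * (A ^+ 5 * h ^+ 2) by ring.
have g1 : A ^+ 5 * h ^+ 2 <= A ^+ 9 * e.
  by apply: ler_pM; rewrite ?exprn_ge0 ?sqr_ge0 ?ler_weXn2l.
have g2 : A * e <= A ^+ 9 * e by apply: ler_wpM2r => //; rewrite ler_eXnr.
have g3 : A ^+ 8 * e <= A ^+ 9 * e by apply: ler_wpM2r => //; rewrite ler_weXn2l.
have -> : 2 * e * A + 192 * A ^+ 8 * e + A * (4 * e) = 6 * (A * e) + 192 * (A ^+ 8 * e) by ring.
by rewrite -[230 * _ * _]mulrA; have g0 : 0 <= A ^+ 9 * e by [rewrite mulr_ge0 ?exprn_ge0]; move: g1 g2 g3; lra.
Qed.

Lemma local_normality : `|dot (T + T') u| <= 230 * A ^+ 9 * e.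
Proof.
have -> : dot (T + T') u = dot (T - tau - (- (s / 2)) *: sig) u + dot (T' - tau - (s' / 2) *: sig) u
   + ((s' - s) / 2) * dot sig u.
  rewrite !dotDl !dotNl (@dotZl _ (- _)) (@dotZl _ (s' / 2)) [dot tau u]dotC ut.
  by ring.
have t1 : `|dot (T - tau - (- (s / 2)) *: sig) u + dot (T' - tau - (s' / 2) *: sig) u| <= 192 * A ^+ 8 * e * A.
  apply: (le_trans (ler_normD _ _)); apply: (@le_trans _ _ ((96 * A ^+ 8 * (s * (om + s)) + 96 * A ^+ 8 * (s' * (om' + s'))) * A)); last exact: ler_wpM2r.
  by rewrite mulrDl; apply: lerD; apply: (le_trans (dot_cauchy _ _)); apply: ler_pM; rewrite ?enorm_ge0.
have t2 : `|(s' - s) / 2 * dot sig u| <= A * h ^+ 2 * (2 * A ^+ 2 * A).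
  rewrite normrM; apply: ler_pM => //.
    by rewrite normrM [`|2^-1|]ger0_norm ?invr_ge0//; have := normr_ge0 (s' - s); move: ss; lra.
  by apply: (le_trans (dot_cauchy _ _)); apply: ler_pM; rewrite ?enorm_ge0.
apply: (le_trans (ler_normD _ _)); apply: (le_trans (lerD t1 t2)).
have -> : A * h ^+ 2 * (2 * A ^+ 2 * A) = 2 * (A ^+ 4 * h ^+ 2) by ring.
have -> : 192 * A ^+ 8 * e * A = 192 * (A ^+ 9 * e) by ring.
have g1 : A ^+ 4 * h ^+ 2 <= A ^+ 9 * e.
  by apply: ler_pM; rewrite ?exprn_ge0 ?sqr_ge0 ?ler_weXn2l.
by rewrite -[_ * e]mulrA; have : 0 <= A ^+ 9 * e by [rewrite mulr_ge0 ?exprn_ge0]; lra.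
Qed.

Lemma local_equidistribution : `|enorm p' - enorm p| <= 230 * A ^+ 9 * e.
Proof.
have g : 4 * (h * om) + 4 * (h * om') + A * h ^+ 2 * A <= 230 * A ^+ 9 * e.
  have -> : A * h ^+ 2 * A = A ^+ 2 * h ^+ 2 by ring.
  have g1 : A ^+ 2 * h ^+ 2 <= A ^+ 9 * e.
    by apply: ler_pM; rewrite ?exprn_ge0 ?sqr_ge0 ?ler_weXn2l.
  have g2 : e <= A ^+ 9 * e by apply: ler_peMl => //; exact: exprn_ege1.
  have g0 : 0 <= A ^+ 9 * e by rewrite mulr_ge0 ?exprn_ge0.
  by move: P1 P2; rewrite -[_ * e]mulrA; lra.
apply: le_trans g.
have t : `|(s' - s) * rho| <= A * h ^+ 2 * A.
  by case/andP: r0 => ? ?; rewrite normrM (ger0_norm (x := rho))//; apply: ler_pM.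
have -> : enorm p' - enorm p = (enorm p' - s' * rho) - (enorm p - s * rho) + (s' - s) * rho by ring.
apply: (le_trans (ler_normD _ _)); apply: lerD => //.
apply: (le_trans (ler_normB _ _)); have q1' := q1; have q2' := q2.
have [/andP[? ?] /andP[? ?]] := (o0, o0').
have : 0 <= h * om by apply: mulr_ge0.
have : 0 <= h * om' by apply: mulr_ge0.
move: q1' q2'; lra.
Qed.

Lemma local_turning : enorm (T' - T) <= 600 * A ^+ 9 * h.
Proof.
have -> : T' - T = (T' - tau - (s' / 2) *: sig) - (T - tau - (- (s / 2)) *: sig) + ((s + s') / 2) *: sig.
  by apply/rowP => i; rewrite !mxE; field.
apply: (le_trans (enormD _ _)).
have t1 : enorm ((T' - tau - (s' / 2) *: sig) - (T - tau - (- (s / 2)) *: sig)) <= 192 * A ^+ 8 * e.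
  by apply: (le_trans (enormB _ _)); apply: le_trans both; rewrite addrC; exact: lerD.
have t2 : enorm (((s + s') / 2) *: sig) <= h * (2 * A ^+ 2).
  rewrite (@enormZ _ (_ / 2)); apply: ler_pM; rewrite ?enorm_ge0//.
  by move: s0 s0' => /andP[? ?] /andP[? ?]; rewrite ger0_norm; lra.
apply: (le_trans (lerD t1 t2)).
have he : e <= h * (3 * A).
  have [/andP[? ?] /andP[? ?]] := (o0, o0').
  have -> : e = h * (om + om' + h) by rewrite /e; ring.
  by apply: ler_wpM2l => //; move: h1 A1; lra.
have := ler_wpM2l (exprn_ge0 8 A0) he.
have -> : A ^+ 8 * (h * (3 * A)) = 3 * (A ^+ 9 * h) by ring.
have g1 : A ^+ 2 * h <= A ^+ 9 * h by apply: ler_wpM2r => //; rewrite ler_weXn2l.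
have -> : h * (2 * A ^+ 2) = 2 * (A ^+ 2 * h) by ring.
have g0 : 0 <= A ^+ 9 * h by rewrite mulr_ge0 ?exprn_ge0.
rewrite -[192 * _ * _]mulrA -[600 * _ * _]mulrA; lra.
Qed.

Lemma local_length : enorm p <= 3 * A * h.
Proof.
have [/andP[? ?] /andP[? ?]] := (o0, r0); have /andP[? ?] := s0.
have k1 : s * rho <= h * A by apply: ler_pM.
have k2 : h * om <= h * A by apply: ler_wpM2l.
by move: q1; rewrite ler_norml -mulrA [A * h]mulrC => /andP[_]; lra.
Qed.

End LocalConsistency.

Section Consistency.
Context {R : realType}.
Local Notation P := (2 * pi : R).
Local Notation E2 := 'rV[R]_2.
Local Notation mu := (@lebesgue_measure R).

Lemma derive1_periodic (v : R -> E2) : periodic v P -> periodic (derive1 v) P.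
Proof.
move=> pv x; rewrite /derive1.
have -> // : (fun d : R => d^-1 *: (v (d + (x + P)) - v (x + P))) = (fun d => d^-1 *: (v (d + x) - v x)).
by apply/funext => d; rewrite addrA !pv.
Qed.

Lemma sint_near_cst (f : R -> R) a b B c : a <= b -> {within `[a, b], continuous f} ->
  (forall z, a <= z <= b -> `|f z - c| <= B) -> `|sint a b f - (b - a) * c| <= B * (b - a).
Proof.
move=> ab cf fB; have := @sint_near_const _ f (fun y => sint a y f) a b B c a b cf.
rewrite sint_point subr0 [`|b - a|]ger0_norm ?subr_ge0//; apply => //; try by rewrite lexx ab.
move=> x y ax xy yb; rewrite (sint_chasles ax xy); first by ring.
exact: integrable_onS (lexx a) yb (integrable_on_cont cf).
Qed.

Lemma sint_subset (G : R -> R) a b x y : (forall x, 0 <= G x) -> integrable_on a b G ->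
  a <= x -> x <= y -> y <= b -> sint x y G <= sint a b G.
Proof.
move=> G0 iG ax xy yb; have xb := le_trans xy yb.
rewrite (sint_chasles ax xb iG) (sint_chasles xy yb); last exact: integrable_onS ax (lexx b) iG.
have h1 : 0 <= sint a x G by apply: sint_ge0.
have h2 : 0 <= sint y b G by apply: sint_ge0.
lra.
Qed.

Variables (N : nat) (xi : nat -> R).
Hypothesis part : partition_of_S1 N xi.
Variables (A h lam : R) (v u : R -> E2) (G : R -> R).
Hypotheses (h0 : 0 < h) (h1 : h <= 1) (hA : 4 * A ^+ 2 * h <= 1).
Hypothesis sizes : forall j : 'I_N, h / A <= elem_size xi j <= h.
Hypothesis size_step : forall j : 'I_N, `|elem_size xi (ordS j) - elem_size xi j| <= A * h ^+ 2.
Hypothesis slice : flow_slice A v u lam.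
Hypothesis lamE : lam = P / curve_length v.
Hypothesis cw : forall i, {within `[0, P], continuous (fun x => derive1 v x 0 i)}.
Hypotheses (G0 : forall x, 0 <= G x) (iG : integrable_on 0 P G) (GA : sint 0 P G <= A ^+ 2).
Hypothesis incr : forall x y, 0 <= x -> x <= y -> y <= P ->
  enorm (derive1 v y - derive1 v x) ^+ 2 <= (y - x) * sint x y G.

Let A1 : 1 <= A. Proof. by case: slice => -[]. Qed.
Let A0 : 0 < A. Proof. exact: lt_le_trans A1. Qed.

Definition oscillation (j : 'I_N) : R := Num.sqrt (elem_size xi j * sint (xi j) (xi j.+1) G).
Local Notation om := oscillation.

Let ends (j : 'I_N) : [/\ 0 <= xi j, xi j < xi j.+1 & xi j.+1 <= P].
Proof.
have /andP[-> _] := node_S1 part (ltnW (ltn_ord j)).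
by have /andP[_ ->] := node_S1 part (ltn_ord j); split=> //; exact: node_lt part j.
Qed.

Let iGj (j : 'I_N) : integrable_on (xi j) (xi j.+1) G.
Proof. by have [? _ ?] := ends j; exact: integrable_onS iG. Qed.

Let oscE j : om j ^+ 2 = elem_size xi j * sint (xi j) (xi j.+1) G.
Proof. by rewrite sqr_sqrtr// mulr_ge0 ?sint_ge0// ltW// elem_size_gt0. Qed.

Let osc0 j : 0 <= om j. Proof. exact: sqrtr_ge0. Qed.

Lemma oscillation_le (j : 'I_N) x y : xi j <= x <= xi j.+1 -> xi j <= y <= xi j.+1 ->
  enorm (derive1 v y - derive1 v x) <= om j.
Proof.
wlog xy : x y / x <= y.
  move=> H; have [xy|/ltW yx] := leP x y; first exact: H.
  by move=> ? ?; rewrite enormBC; exact: H.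
move=> /andP[ax xb] /andP[ay yb]; have [a0 ab bP] := ends j.
rewrite -(@ler_pXn2r _ 2)// ?nnegrE ?enorm_ge0// oscE.
apply: (le_trans (incr (le_trans a0 ax) xy (le_trans yb bP))).
apply: ler_pM; rewrite ?subr_ge0//; [exact: sint_ge0|by rewrite lerB|].
exact: sint_subset (iGj j) ax xy yb.
Qed.

(** The only global information on the second derivative: the local L2 norms
    add up. *)
Lemma sum_oscillation : \sum_j om j ^+ 2 <= h * A ^+ 2.
Proof.
have [_ SE] := @sint_elements _ _ _ part G (fun _ => G) iGj (fun _ _ _ => erefl).
apply: (@le_trans _ _ (\sum_(j < N) h * sint (xi j) (xi j.+1) G)).
  apply: ler_sum => j _; rewrite oscE; apply: ler_wpM2r; first exact: sint_ge0.
  by case/andP: (sizes j).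
by rewrite -mulr_sumr -SE ler_pM2l.
Qed.

Lemma oscillation_bound j : om j <= A.
Proof.
rewrite -(@ler_pXn2r _ 2)// ?nnegrE ?osc0// ?(ltW A0)//.
have H : om j ^+ 2 <= \sum_j om j ^+ 2.
  by rewrite (bigD1 j)//= lerDl sumr_ge0// => i _; exact: sqr_ge0.
apply: (le_trans H); apply: (le_trans sum_oscillation).
by rewrite ler_piMl ?sqr_ge0.
Qed.

Let smallj (j : 'I_N) : 4 * A ^+ 2 * (xi j.+1 - xi j) <= 1.
Proof.
apply: le_trans hA; apply: ler_wpM2l; first by rewrite mulr_ge0// sqr_ge0.
by have /andP[_] := sizes j.
Qed.

Local Notation x_ := (fun j : 'I_N => v (xi j.+1)).
Local Notation u_ := (fun j : 'I_N => u (xi j.+1)).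

Lemma inscribed_edge j : edge x_ j = v (xi j.+1) - v (xi j).
Proof. by rewrite /edge (node_left part j (v := v))//; case: slice => -[]. Qed.

Lemma inscribed_edge_ge j : elem_size xi j / (2 * A) <= enorm (edge x_ j).
Proof.
have [a0 ab bP] := ends j; rewrite inscribed_edge.
exact: (chord_length_ge slice a0 ab bP (smallj j)).
Qed.

Lemma inscribed_edge_linear (j : 'I_N) x : xi j <= x <= xi j.+1 ->
  enorm (edge x_ j - elem_size xi j *: derive1 v x) <= 2 * om j * elem_size xi j.
Proof.
have [a0 ab bP] := ends j; rewrite inscribed_edge.
exact: (chord_linear slice a0 ab bP (@oscillation_le j)).
Qed.

Let pi8 : P <= 8. Proof. by have := @pihalf_lt2 R; lra. Qed.
Let pi1 : 1 <= @pi R. Proof. by have := pi_ge2 R; lra. Qed.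

Let sum_sizes : \sum_(j < N) elem_size xi j = P. Proof. exact: sum_elem_size part. Qed.

Lemma inscribed_perimeter_ge : pi / A <= perimeter x_.
Proof.
apply: (@le_trans _ _ (\sum_(j < N) elem_size xi j / (2 * A))).
  by rewrite -mulr_suml sum_sizes le_eqVlt; apply/orP; left; apply/eqP; field; rewrite gt_eqF.
by apply: ler_sum => j _; exact: inscribed_edge_ge.
Qed.

Let cenorm : {within `[0, P], continuous (fun x => enorm (derive1 v x))}.
Proof. exact: within_enorm. Qed.

Let cenormj (j : 'I_N) : {within `[xi j, xi j.+1], continuous (fun x => enorm (derive1 v x))}.
Proof.
have [a0 ab bP] := ends j.
by apply: continuous_subspaceW cenorm => x /=; rewrite !in_itv/= => /andP[? ?]; rewrite (le_trans a0)// (le_trans _ bP).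
Qed.

Lemma length_sum : curve_length v = \sum_(j < N) sint (xi j) (xi j.+1) (fun x => enorm (derive1 v x)).
Proof.
have [] := @sint_elements _ _ _ part (fun x => enorm (derive1 v x)) (fun _ x => enorm (derive1 v x)) => //.
by move=> j; exact: integrable_on_cont.
Qed.

Lemma length_ge : P / A <= curve_length v.
Proof.
have [_ _ hw _ _] := slice.
have -> : P / A = sint 0 P (fun _ => A^-1).
  by rewrite sint_cst ?subr0 1?mulrC// mulr_ge0// pi_ge0.
apply: le_sint => //.
- by apply: integrable_on_continuous => z; exact: cst_continuous.
- exact: integrable_on_cont.
by move=> x /hw/andP[].
Qed.

(** The error of one side is the product of its size and the oscillation, which
    Young's inequality splits into summable parts. *)
Lemma perimeter_error : `|curve_length v - perimeter x_| <= 15 * A ^+ 2 * h.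
Proof.
rewrite length_sum /perimeter -sumrB.
apply: (le_trans (ler_norm_sum _ _ _)).
apply: (@le_trans _ _ (\sum_(j < N) 3 / 2 * (h * elem_size xi j + om j ^+ 2))).
  apply: ler_sum => j _; have [a0 ab bP] := ends j.
  have aab : xi j <= xi j <= xi j.+1 by rewrite lexx ltW.
  have s0 := elem_size_gt0 part j; have /andP[_ sh] := sizes j.
  have k1 := @sint_near_cst _ _ _ (om j) (enorm (derive1 v (xi j))) (ltW ab) (@cenormj j).
  have {}k1 := k1 (fun z zab => le_trans (enorm_dist _ _) (oscillation_le aab zab)).
  have k2 := le_trans (enorm_dist _ _) (inscribed_edge_linear aab).
  rewrite (@enormZ _ (elem_size xi j)) (ger0_norm (ltW s0)) in k2.
  have k3 : om j * elem_size xi j <= (h * elem_size xi j + om j ^+ 2) / 2.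
    have := sqr_ge0 (om j - elem_size xi j); have : elem_size xi j ^+ 2 <= h * elem_size xi j by rewrite expr2 ler_pM2r.
    by rewrite !expr2; nra.
  rewrite -/(elem_size xi j) in k1.
  have := ler_normB (sint (xi j) (xi j.+1) (fun x => enorm (derive1 v x)) - elem_size xi j * enorm (derive1 v (xi j)))
    (enorm (edge x_ j) - elem_size xi j * enorm (derive1 v (xi j))).
  by rewrite opprB addrA subrK => k4; apply: (le_trans k4); move: k1 k2 k3; lra.
rewrite -mulr_sumr big_split/= -mulr_sumr sum_sizes.
have := sum_oscillation; have : h * P <= h * 8 by rewrite ler_pM2l.
have : h * 8 <= 8 * A ^+ 2 * h by rewrite mulrC ler_pM2r// ler_peMr// exprn_ege1.
by rewrite [h * A ^+ 2]mulrC -!mulrA; move: h0; lra.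
Qed.

Let kfact : 0 <= pi / perimeter x_ <= A.
Proof.
have g : 0 < perimeter x_ by apply: lt_le_trans inscribed_perimeter_ge; rewrite divr_gt0// pi_gt0.
apply/andP; split; first by rewrite divr_ge0 ?pi_ge0// ltW.
rewrite ler_pdivrMr//; have := inscribed_perimeter_ge; rewrite ler_pdivrMr//.
by rewrite mulrC.
Qed.

Let kdiff : `|pi / perimeter x_ - lam / 2| <= 15 * A ^+ 4 * h.
Proof.
have g : 0 < perimeter x_ by apply: lt_le_trans inscribed_perimeter_ge; rewrite divr_gt0// pi_gt0.
have L0 : 0 < curve_length v by apply: lt_le_trans length_ge; rewrite divr_gt0// mulr_gt0// pi_gt0.
have -> : pi / perimeter x_ - lam / 2 = (pi / perimeter x_) * ((curve_length v - perimeter x_) / curve_length v).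
  by rewrite lamE; field; rewrite !gt_eqF.
have /andP[k0 kA] := kfact; rewrite normrM (ger0_norm k0).
have -> : 15 * A ^+ 4 * h = A * (15 * A ^+ 2 * h * A) by ring.
apply: ler_pM => //; rewrite normrM; apply: ler_pM => //; first exact: perimeter_error.
have Li : 0 < (curve_length v)^-1 by rewrite invr_gt0.
rewrite (ger0_norm (ltW Li)) -[X in _ <= X]invrK lef_pV2 ?posrE ?invr_gt0//.
apply: le_trans length_ge; rewrite ler_peMl ?invr_ge0 ?(ltW A0)//.
by move: pi1; lra.
Qed.

Definition consistency_error j : R := 230 * A ^+ 9 * (h * om j + h * om (ordS j) + h ^+ 2).

Lemma number_of_elements : P <= N%:R * h <= 8 * A.
Proof.
have NE (c : R) : N%:R * c = \sum_(j < N) c by rewrite sumr_const card_ord mulr_natl.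
apply/andP; split.
  by rewrite -sum_sizes NE; apply: ler_sum => j _; case/andP: (sizes j).
have : N%:R * (h / A) <= P.
  by rewrite -sum_sizes NE; apply: ler_sum => j _; case/andP: (sizes j).
by rewrite mulrA ler_pdivrMr// => k; apply: (le_trans k); rewrite ler_pM2r.
Qed.

Lemma sum_consistency_error :
  \sum_j consistency_error j ^+ 2 <= 230 * 230 * 30 * A ^+ 20 * h ^+ 3.
Proof.
have h00 := ltW h0.
apply: (@le_trans _ _ (\sum_(j < N) (230 * A ^+ 9) ^+ 2 * (3 * (h ^+ 2 * om j ^+ 2 + h ^+ 2 * om (ordS j) ^+ 2 + h ^+ 4)))).
  apply: ler_sum => j _; rewrite /consistency_error exprMn; apply: ler_wpM2l; first exact: sqr_ge0.
  move: (om j) (om (ordS j)) => a b.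
  have -> : h ^+ 2 * a ^+ 2 + h ^+ 2 * b ^+ 2 + h ^+ 4 = (h * a) ^+ 2 + (h * b) ^+ 2 + (h ^+ 2) ^+ 2 by ring.
  move: (h * a) (h * b) (h ^+ 2) => x y z.
  have := sqr_ge0 (x - y); have := sqr_ge0 (y - z); have := sqr_ge0 (x - z).
  by rewrite !expr2; lra.
have -> : \sum_(j < N) (230 * A ^+ 9) ^+ 2 * (3 * (h ^+ 2 * om j ^+ 2 + h ^+ 2 * om (ordS j) ^+ 2 + h ^+ 4))
    = (230 * A ^+ 9) ^+ 2 * (3 * (h ^+ 2 * \sum_j om j ^+ 2 + h ^+ 2 * \sum_j om j ^+ 2 + N%:R * h ^+ 4)).
  have NE : N%:R * h ^+ 4 = \sum_(j < N) h ^+ 4 by rewrite sumr_const card_ord mulr_natl.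
  by rewrite NE -[X in _ + h ^+ 2 * X + _](sum_ordS (fun j => om j ^+ 2)) !mulr_sumr -!big_split/= !mulr_sumr.
have /andP[_ N2] := number_of_elements.
have -> : 230 * 230 * 30 * A ^+ 20 * h ^+ 3 = (230 * A ^+ 9) ^+ 2 * (30 * (A ^+ 2 * h ^+ 3)) by ring.
apply: ler_wpM2l; first exact: sqr_ge0.
have k1 : h ^+ 2 * \sum_j om j ^+ 2 <= A ^+ 2 * h ^+ 3.
  by have -> : A ^+ 2 * h ^+ 3 = h ^+ 2 * (h * A ^+ 2) by [ring]; apply: ler_wpM2l (sqr_ge0 _) _ _ sum_oscillation.
have k2 : N%:R * h ^+ 4 <= 8 * (A ^+ 2 * h ^+ 3).
  have -> : N%:R * h ^+ 4 = N%:R * h * h ^+ 3 by ring.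
  rewrite mulrA; apply: ler_wpM2r; first exact: exprn_ge0.
  by apply: (le_trans N2); rewrite ler_pM2l// ler_eXnr.
by move: k1 k2; lra.
Qed.

(** The errors are multiples of h times the oscillations on the two adjacent elements
    plus h^2, and hence square summable to order h^3. *)
Theorem slice_consistent (M : R) : 230 * 230 * 30 * A ^+ 20 <= M ->
  consistent M h x_ u_ consistency_error.
Proof.
move=> HM; have h00 := ltW h0; have A1' : 1 <= A := A1.
have MA n : (n <= 20)%N -> 1000 * A ^+ n <= M.
  move=> n20; apply: le_trans HM.
  have k : A ^+ n <= A ^+ 20 by rewrite ler_weXn2l.
  have k0 : 0 <= A ^+ 20 := exprn_ge0 20 (ltW A0).
  move: k k0; move: (A ^+ 20) (A ^+ n) => a b; lra.
have M9 := MA 9 isT; have M1 := MA 1%N isT; have M2 := MA 2 isT; rewrite expr1 in M1.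
have M0 : 0 < M by lra.
have [[_ pv pu _ hl] D hw [hu lu] [hn cs ts]] := slice.
have pw := derive1_periodic pv.
have pt : periodic (tangent v) P by move=> x; rewrite /tangent pw.
have ps : periodic (turning v u lam) P by move=> x; rewrite /turning /tangent pw pu.
have node (V : zmodType) (f : R -> V) (j : 'I_N) : periodic f P -> f (xi (ordS j)) = f (xi j.+1).
  by move=> pf; rewrite (node_left part (ordS j) pf) ordSK.
have inP (j : 'I_N) : 0 <= xi j.+1 <= P by exact: (node_S1 part (ltn_ord j)).
have local j :
  [/\ enorm (nodal_residual x_ u_ j) <= consistency_error j,
      `|dot (dir (edge x_ j) + dir (edge x_ (ordS j))) (u_ j)| <= consistency_error j,
      `|enorm (edge x_ (ordS j)) - enorm (edge x_ j)| <= consistency_error j,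
      enorm (dir (edge x_ (ordS j)) - dir (edge x_ j)) <= 600 * A ^+ 9 * h &
      enorm (edge x_ j) <= 3 * A * h].
  have [a0 ab bP] := ends j; have [a0' ab' bP'] := ends (ordS j).
  have cb : xi j <= xi j.+1 <= xi j.+1 by rewrite lexx ltW.
  have ca : xi (ordS j) <= xi (ordS j) <= xi (ordS j).+1 by rewrite lexx ltW.
  have HT := chord_direction slice a0 ab bP (@oscillation_le j) (smallj j) cb.
  have HT' := chord_direction slice a0' ab' bP' (@oscillation_le (ordS j)) (smallj (ordS j)) ca.
  have Hp := inscribed_edge_linear cb; have Hp' := inscribed_edge_linear ca.
  rewrite -!inscribed_edge (node _ (tangent v))// (node _ (turning v u lam))// in HT HT' Hp'.
  rewrite (node _ (derive1 v))// in Hp'.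
  have e1 : (xi j + xi j.+1) / 2 - xi j.+1 = - (elem_size xi j / 2) by rewrite /elem_size; field.
  have e2 : (xi (ordS j) + xi (ordS j).+1) / 2 - xi (ordS j) = elem_size xi (ordS j) / 2 by rewrite /elem_size; field.
  rewrite e1 in HT; rewrite e2 in HT'; rewrite -!/(elem_size xi _) in HT HT'.
  have s1 : 0 <= elem_size xi j <= h by rewrite (ltW (elem_size_gt0 part j)); case/andP: (sizes j).
  have s2 : 0 <= elem_size xi (ordS j) <= h by rewrite (ltW (elem_size_gt0 part _)); case/andP: (sizes (ordS j)).
  have o1 : 0 <= om j <= A by rewrite osc0 oscillation_bound.
  have o2 : 0 <= om (ordS j) <= A by rewrite osc0 oscillation_bound.
  have wE : derive1 v (xi j.+1) = enorm (derive1 v (xi j.+1)) *: tangent v (xi j.+1) by rewrite dirK.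
  have r0 : 0 <= enorm (derive1 v (xi j.+1)) <= A by rewrite enorm_ge0; case/andP: (hw _ (inP j)).
  have sn := turning_bound slice a0 bP cb.
  split.
  - exact: (local_residual A1 h0 s1 s2 o1 o2 HT HT' Hp Hp' wE erefl r0 erefl (hu _ (inP j)) kfact kdiff).
  - exact: (local_normality A1 h0 s1 s2 (size_step j) o1 o2 HT HT' (hu _ (inP j)) (hn _ (inP j)) sn).
  - exact: (local_equidistribution A1 h0 s1 s2 (size_step j) o1 o2 Hp Hp' r0 erefl).
  - exact: (local_turning A1 h0 h1 s1 s2 o1 o2 HT HT' sn).
  - exact: (local_length h0 s1 s2 o1 o2 Hp r0 erefl).
have E0 j : 0 <= consistency_error j by have [k _ _ _ _] := local j; apply: le_trans k; exact: enorm_ge0.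
split; [|split; [|split; [|split; [|split; [|split]]]]].
- move=> j; split=> //; have [_ _ _ _ k] := local j; apply/andP; split.
    apply: le_trans (inscribed_edge_ge j); have /andP[k1 _] := sizes j.
    apply: (@le_trans _ _ (h / A / (2 * A))); last by rewrite ler_pM2r ?invr_gt0 ?mulr_gt0.
    rewrite -!mulrA ler_pM2l// -invfM lef_pV2 ?posrE ?mulr_gt0//.
    by apply: le_trans M2; rewrite mulrCA -expr2 ler_wpM2r ?sqr_ge0//; lra.
  by apply: (le_trans k); apply: ler_wpM2r => //; lra.
- move=> j; split; first by apply: (le_trans (hu _ (inP j))); lra.
  rewrite /edge -(node_left part j pu).
  have [a0 ab bP] := ends j.
  have xjP : 0 <= xi j <= P by rewrite a0 (le_trans (ltW ab)).
  apply: (le_trans (lu _ _ xjP (inP j))).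
  apply: ler_pM => //; [exact: ltW|lra|].
  have k : 0 <= xi j.+1 - xi j by rewrite subr_ge0 ltW.
  by rewrite (ger0_norm k); case/andP: (sizes j).
- move=> j; have [_ _ _ k _] := local j; apply: (le_trans k); apply: ler_wpM2r => //.
  by have k0 : 0 <= A ^+ 9 := exprn_ge0 9 (ltW A0); lra.
- by move=> j; case: (local j).
- by move=> j; case: (local j).
- by move=> j; case: (local j).
- by apply: (le_trans sum_consistency_error); apply: ler_wpM2r => //; exact: exprn_ge0.
Qed.

End Consistency.

(** * Regularity in time *)

Section TimeRegularity.
Context {R : realType}.
Local Notation P := (2 * pi : R).
Local Notation E2 := 'rV[R]_2.
Local Notation mu := (@lebesgue_measure R).

Let P0 : 0 < P. Proof. by rewrite mulr_gt0// pi_gt0. Qed.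

Lemma C1c_coord (T : R) (v g : R -> E2) i : weak_derivative `[0, T] (C1c T) v g ->
  weak_on T (fun t => v t 0 i) (fun t => g t 0 i).
Proof.
move=> W phi dphi dP cdphi [a [b [a0 bT s0]]].
have d1 (x : R) : derive1 (fun y => phi y *: e_ i) x = dphi x *: @e_ R i.
  by apply: is_derive_derive1; exact: is_derive_scale.
have C : C1c T (fun x => phi x *: @e_ R i).
  split; last by exists a, b; split=> // t /s0 ->; rewrite scale0r.
  split; first by move=> x; have [] := is_derive_scale (@e_ R i) (dP x).
  rewrite (_ : derive1 _ = fun x => dphi x *: e_ i); last exact/funext.
  by move=> x; apply: continuousZr_tmp; exact: cdphi.
have := W _ C; rewrite -!/(sint 0 T _).
rewrite (eq_sint (g := fun x => v x 0 i * dphi x)); last by move=> x _; rewrite d1 dot_e mulrC.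
by move=> ->; congr (- _); apply: eq_sint => x _; rewrite dot_e mulrC.
Qed.

Lemma clamp_id (B r : R) : `|r| <= B -> clamp B r = r.
Proof. by rewrite ler_norml /clamp => /andP[h1 h2]; rewrite (min_idPr h2) (max_idPr h1). Qed.

Lemma clamp_le (B r : R) : 0 <= B -> `|clamp B r| <= B.
Proof.
move=> B0; rewrite /clamp ler_norml le_max lexx/= ge_max ge_min lexx/=.
by rewrite andbT; lra.
Qed.

Lemma clamp_integrable (T B : R) (g : R -> R) : 0 <= B -> measurable_fun `[0, T] g ->
  integrable_on 0 T (fun t => clamp B (g t)).
Proof.
move=> B0 mg; apply: (@integrable_on_bounded _ _ _ _ B); last first.
  by apply: (aeW (ae_true (R := R))) => x _ _; exact: clamp_le.
by apply: measurable_maxr => //; apply: measurable_minr.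
Qed.

(** A weak time derivative that is almost everywhere bounded makes the function
    the primitive of a bounded function, its truncation. *)
Lemma bounded_time_primitive (T B : R) (f g : R -> R) : 0 < T -> 0 <= B ->
  {within `[0, T], continuous f} -> measurable_fun `[0, T] g -> weak_on T f g ->
  {ae mu, forall t, 0 <= t <= T -> `|g t| <= B} ->
  forall s t, 0 <= s -> s <= t -> t <= T -> f t - f s = sint s t (fun r => clamp B (g r)).
Proof.
move=> T0 B0 cf mg W gB s t s0 st tT.
have ig := clamp_integrable B0 mg.
have W' : weak_on T f (fun r => clamp B (g r)).
  move=> phi dphi D c h; rewrite (W phi dphi D c h); congr (- _).
  have mphi : measurable_fun `[0, T] phi.
    apply: integrable_on_measurable; apply: integrable_on_continuous => x.
    exact: is_derive_continuous (D x).
  apply: sint_ae; [exact: measurable_funM| |].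
    by apply: measurable_funM => //; exact: integrable_on_measurable.
  by apply: (aeW gB) => r hr rT; rewrite clamp_id// hr.
have E := weak_primitive_continuous T0 cf ig W'.
have s' : 0 <= s <= T by rewrite s0 (le_trans st).
have t' : 0 <= t <= T by rewrite tT (le_trans s0).
rewrite (E s s') (E t t') (sint_chasles s0 st); first by ring.
exact: integrable_onS (lexx 0) tT ig.
Qed.

Lemma sint_bound (f : R -> R) a b B : a <= b -> integrable_on a b f ->
  {ae mu, forall x, a <= x <= b -> `|f x| <= B} -> `|sint a b f| <= B * (b - a).
Proof.
move=> ab hf fB.
have B0 (c : R) : {ae mu, forall x, a <= x <= b -> clamp `|B| (f x) = f x}.
  by apply: (aeW fB) => x h /h k; rewrite clamp_id// (le_trans k) ?ler_norm.
have [<-|anb] := eqVneq a b; first by rewrite sint_point normr0 subrr mulr0.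
have ab' : a < b by rewrite lt_neqAle anb.
have Bge : 0 <= B.
  by have [x /andP[ax xb] h] := ae_exists ab' fB; apply: le_trans (h _); rewrite ?normr_ge0// !ltW.
have mf := integrable_on_measurable hf.
have mc : measurable_fun `[a, b] (fun t => clamp B (f t)) by apply: measurable_maxr => //; apply: measurable_minr.
have ic : integrable_on a b (fun t => clamp B (f t)).
  apply: (@integrable_on_bounded _ _ _ _ B) => //.
  by apply: (aeW (ae_true (R := R))) => x _ _; exact: clamp_le.
have -> : sint a b f = sint a b (fun t => clamp B (f t)).
  by apply: sint_ae => //; apply: (aeW fB) => x h /h k; rewrite clamp_id.
apply: (le_trans (le_norm_sint ic)); rewrite -(sint_cst B ab).
apply: le_sint; [exact: integrable_on_norm| |by move=> x _; exact: clamp_le].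
by apply: integrable_on_continuous => z; exact: cst_continuous.
Qed.

Lemma derive_bound (f : R -> R) (d c x : R) : 0 <= x <= P -> is_derive x 1 f d ->
  (forall y, 0 <= y <= P -> `|f y - f x| <= c * `|y - x|) -> `|d| <= c.
Proof.
move=> /andP[x0 xP] D H; rewrite leNgt; apply/negP => cd.
have [e e0 He] := (is_deriveP _ _ _).1 D ((`|d| - c) / 2) ltac:(lra).
have [y [yP yx ye]] : exists y, [/\ 0 <= y <= P, y != x & `|y - x| < e].
  pose r := Num.min (e / 2) (P / 2).
  have r0 : 0 < r by rewrite lt_min !divr_gt0.
  have re : r < e by rewrite gt_min; apply/orP; left; lra.
  have rP : r <= P / 2 by rewrite ge_min lexx orbT.
  have [xl|xl] := leP x (P / 2).
    exists (x + r); split; first by apply/andP; split; lra.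
      by rewrite -subr_eq0 addrAC subrr add0r gt_eqF.
    by rewrite addrAC subrr add0r gtr0_norm.
  exists (x - r); split; first by apply/andP; split; lra.
    by rewrite -subr_eq0 addrAC subrr add0r oppr_eq0 gt_eqF.
  by rewrite addrAC subrr add0r normrN gtr0_norm.
have n0 : 0 < `|y - x| by rewrite normr_gt0 subr_eq0.
have := He y ye; have := H y yP.
have := ler_normB (f y - f x) (f y - f x - (y - x) *: d).
rewrite opprB addrC subrK normrZ => k1 k2 k3.
have k4 : `|y - x| * `|d| <= (c + (`|d| - c) / 2) * `|y - x|.
  by apply: (le_trans k1); rewrite mulrDl; exact: lerD.
by move: k4; rewrite mulrC ler_pM2r//; lra.
Qed.

Variables (T A K : R) (X Xt : R -> R -> E2).
Hypotheses (T0 : 0 < T) (K0 : 0 <= K) (KA : 20 * K <= A).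
Hypothesis HX : forall t, 0 <= t <= T -> H2 (X t) /\ H2 (Xt t).
Hypothesis cX : forall x, {within `[0, T], continuous (fun t => X t x)}.
Hypothesis mX : forall x i, measurable_fun `[0, T] (fun t => Xt t x 0 i).
Hypothesis wX : forall x, weak_derivative `[0, T] (C1c T) (X^~ x) (Xt^~ x).
Hypothesis bX : {ae mu, forall t, 0 <= t <= T -> (H2norm (X t) <= K%:E)%E /\ (H2norm (Xt t) <= K%:E)%E}.

(** The velocity cut off at the bound that holds at almost every time: it is
    bounded at every time and has the same integrals. *)
Definition cut_velocity x t : E2 := \row_i clamp (5 * K) (Xt t x 0 i).

Let K5 : 0 <= 5 * K. Proof. by rewrite mulr_ge0. Qed.

Let velocity_ae x : 0 <= x <= P -> {ae mu, forall t, 0 <= t <= T -> enorm (Xt t x) <= 5 * K}.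
Proof.
move=> xP; apply: (aeW bX) => t h tT; have [_ b] := h tT; have [_ H] := HX tT.
by have [h1 _ _] := H2_bounds K0 H b; exact: h1.
Qed.

Lemma cut_velocity_ae x : 0 <= x <= P ->
  {ae mu, forall t, 0 <= t <= T -> cut_velocity x t = Xt t x}.
Proof.
move=> xP; apply: (aeW (velocity_ae xP)) => t h tT; apply/rowP => i; rewrite mxE clamp_id//.
exact: le_trans (enorm_coord _ _) (h tT).
Qed.

Lemma cut_velocity_integrable x i : integrable_on 0 T (fun t => cut_velocity x t 0 i).
Proof.
rewrite (_ : (fun t => _) = fun t => clamp (5 * K) (Xt t x 0 i)); last by apply/funext => t; rewrite mxE.
exact: clamp_integrable.
Qed.

Lemma cut_velocity_le x t i : `|cut_velocity x t 0 i| <= 5 * K.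
Proof. by rewrite mxE clamp_le. Qed.

Lemma curve_time_primitive x i s t : 0 <= x <= P -> 0 <= s -> s <= t -> t <= T ->
  X t x 0 i - X s x 0 i = sint s t (fun r => cut_velocity x r 0 i).
Proof.
move=> xP s0 st tT.
rewrite (_ : (fun r => _) = fun r => clamp (5 * K) (Xt r x 0 i)); last by apply/funext => r; rewrite mxE.
apply: (@bounded_time_primitive T (5 * K) (fun t => X t x 0 i)) => //.
- apply/within_continuousP => r e rT e0.
  have [d d0 Hd] := (within_continuousP _ _).1 (@cX x) r e rT e0.
  exists d => // q qT rq; apply: le_lt_trans (Hd q qT rq).
  by have := coord_le_norm (X r x - X q x) i; rewrite coordB.
- exact: C1c_coord (@wX x).
- apply: (aeW (velocity_ae xP)) => r h rT; exact: le_trans (enorm_coord _ _) (h rT).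
Qed.

Lemma curve_time_lipschitz x s t : 0 <= x <= P -> 0 <= s <= T -> 0 <= t <= T ->
  enorm (X t x - X s x) <= A * `|t - s|.
Proof.
wlog st : s t / s <= t.
  move=> H; have [st|/ltW ts] := leP s t; first exact: H.
  by move=> ? ? ?; rewrite enormBC distrC; exact: H.
move=> xP /andP[s0 _] /andP[_ tT]; apply: (le_trans (enorm_le_coord _)).
have h i : `|(X t x - X s x) 0 i| <= 5 * K * (t - s).
  rewrite coordB (curve_time_primitive i xP s0 st tT); apply: sint_bound => //.
    exact: integrable_onS s0 tT (cut_velocity_integrable x i).
  by apply: (aeW (ae_true (R := R))) => r _ _; exact: cut_velocity_le.
rewrite [`|t - s|]ger0_norm ?subr_ge0//; have := h 0; have := h 1.
have : 20 * K * (t - s) <= A * (t - s) by rewrite ler_wpM2r// subr_ge0.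
have : 0 <= K * (t - s) by rewrite mulr_ge0// subr_ge0.
lra.
Qed.

(** Increments in space of the time primitive: the space derivative of the
    velocity is bounded at almost every time. *)
Lemma curve_increment_lipschitz x y s t : 0 <= x <= P -> 0 <= y <= P ->
  0 <= s <= T -> 0 <= t <= T -> forall i,
  `|(X t y - X t x - (X s y - X s x)) 0 i| <= 10 * K * `|y - x| * `|t - s|.
Proof.
wlog st : s t / s <= t.
  move=> H; have [st|/ltW ts] := leP s t; first exact: H.
  move=> xP yP sT tT i; have -> : X t y - X t x - (X s y - X s x) = - (X s y - X s x - (X t y - X t x)) by rewrite [RHS]opprB.
  by rewrite mxE normrN (distrC t); exact: H.
move=> xP yP /andP[s0 _] /andP[_ tT] i.
have -> : (X t y - X t x - (X s y - X s x)) 0 i = (X t y 0 i - X s y 0 i) - (X t x 0 i - X s x 0 i).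
  by rewrite !mxE; ring.
rewrite !(@curve_time_primitive _ i s t)//.
have ix := integrable_onS s0 tT (cut_velocity_integrable x i).
have iy := integrable_onS s0 tT (cut_velocity_integrable y i).
rewrite -sintB// [`|t - s|]ger0_norm ?subr_ge0//; apply: sint_bound => //; first exact: integrable_onB.
apply: (aeW (aeI bX (aeI (cut_velocity_ae xP) (cut_velocity_ae yP)))) => r [b [cx cy]] /andP[sr rt].
have rT : 0 <= r <= T by rewrite (le_trans s0) ?(le_trans rt).
rewrite cx// cy//; have [_ H] := HX rT; have [_ h2 _] := H2_bounds K0 H (b rT).2.
have [D _ _ _ _] := H2_C1 H.
wlog xy : x y xP yP ix iy cx cy / x <= y.
  move=> H'; have [xy|/ltW yx] := leP x y; first exact: H'.
  by rewrite distrC (distrC y); exact: H'.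
have /andP[x0 _] := xP; have /andP[_ yP'] := yP.
rewrite [`|y - x|]ger0_norm ?subr_ge0//.
have m : `|Xt r y 0 i - Xt r x 0 i| <= 5 * K * (y - x).
  apply: (mean_value_le (f := fun z => Xt r z 0 i) (df := fun z => derive1 (Xt r) z 0 i)) => // z /andP[xz zy].
    have zP : 0 <= z <= P by rewrite (le_trans x0) ?(le_trans zy).
    by move: (D z zP) => /is_derive_coord.
  have zP : 0 <= z <= P by rewrite (le_trans x0) ?(le_trans zy).
  exact: le_trans (enorm_coord _ _) (h2 z zP).
apply: (le_trans m); apply: ler_wpM2r; first by rewrite subr_ge0.
by move: K0; lra.
Qed.

Lemma edge_time_lipschitz x y s t : 0 <= x <= P -> 0 <= y <= P -> 0 <= s <= T -> 0 <= t <= T ->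
  enorm (X t y - X t x - (X s y - X s x)) <= A * `|y - x| * `|t - s|.
Proof.
move=> xP yP sT tT; apply: (le_trans (enorm_le_coord _)).
have h := curve_increment_lipschitz xP yP sT tT.
apply: (le_trans (lerD (h 0) (h 1))).
have : 20 * K * (`|y - x| * `|t - s|) <= A * (`|y - x| * `|t - s|) by rewrite ler_wpM2r// mulr_ge0.
by rewrite -!mulrA; lra.
Qed.

(** Difference quotients in space of [curve_increment_lipschitz] pass to the
    limit. *)
Lemma derivative_time_lipschitz x s t : 0 <= x <= P -> 0 <= s <= T -> 0 <= t <= T ->
  enorm (derive1 (X t) x - derive1 (X s) x) <= A * `|t - s|.
Proof.
move=> xP sT tT; apply: (le_trans (enorm_le_coord _)).
have [[Dt _ _ _ _] [Ds _ _ _ _]] := (H2_C1 (HX tT).1, H2_C1 (HX sT).1).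
have h i : `|(derive1 (X t) x - derive1 (X s) x) 0 i| <= 10 * K * `|t - s|.
  rewrite coordB.
  apply: (@derive_bound (fun y => X t y 0 i - X s y 0 i) _ _ x xP).
    apply: derB; [move: (Dt x xP)|move: (Ds x xP)]; by move=> /is_derive_coord.
  move=> y yP; have := curve_increment_lipschitz xP yP sT tT i.
  have -> : (X t y - X t x - (X s y - X s x)) 0 i = X t y 0 i - X s y 0 i - (X t x 0 i - X s x 0 i).
    by rewrite !mxE; ring.
  by rewrite mulrAC.
apply: (le_trans (lerD (h 0) (h 1))).
have : 20 * K * `|t - s| <= A * `|t - s| by rewrite ler_wpM2r.
by lra.
Qed.

Lemma curve_time_derivative x : 0 <= x <= P ->
  {ae mu, forall t, 0 < t < T -> is_derive t 1 (fun s => X s x) (Xt t x)}.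
Proof.
move=> xP.
have D i := ae_is_derive_sint (cut_velocity_integrable x i).
apply: (aeW (aeI (cut_velocity_ae xP) (ae_fin_forall D))) => t [ct Dt] /andP[t0 tT].
apply/is_derive_coord => i; rewrite -ct ?ltW//.
have tT' : 0 < t < T by rewrite t0.
have := derD (derC t (X 0 x 0 i)) (Dt i tT'); rewrite add0r.
apply: (is_derive_near (d := Num.min t (T - t))) => [|s]; first by rewrite lt_min t0 subr_gt0.
rewrite lt_min !ltr_norml => /andP[/andP[h1 _] /andP[_ h2]].
rewrite -(@curve_time_primitive x i 0 s xP (lexx 0)); [by ring|lra|lra].
Qed.

End TimeRegularity.

(** * The energy along the flow *)

Section EnergyDerivative.
Context {R : realType}.
Local Notation E2 := 'rV[R]_2.

Lemma der_dot (f g : R -> E2) (t : R) (df dg : E2) : is_derive t 1 f df -> is_derive t 1 g dg ->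
  is_derive t 1 (fun s => dot (f s) (g s)) (dot df (g t) + dot (f t) dg).
Proof.
move=> /is_derive_coord Df /is_derive_coord Dg.
have := derD (derM (Df 0) (Dg 0)) (derM (Df 1) (Dg 1)).
have -> : (fun s => dot (f s) (g s)) = (fun s => f s 0 0 * g s 0 0 + f s 0 1 * g s 0 1).
  by apply/funext => s; rewrite dotE.
by rewrite !dotE => D; apply: is_derive_eq D _; ring.
Qed.

Lemma der_enorm (f : R -> E2) (t : R) (df : E2) : f t != 0 -> is_derive t 1 f df ->
  is_derive t 1 (fun s => enorm (f s)) (dot (dir (f t)) df).
Proof.
move=> f0 D; have p0 : 0 < dot (f t) (f t) by rewrite -enorm_sqr exprn_gt0// enorm_gt0.
have := @der_sqrt _ (fun s => dot (f s) (f s)) t _ p0 (der_dot D D).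
rewrite -/(enorm (f t)) /dir dotZl [dot df _]dotC => D2; apply: is_derive_eq D2 _.
by rewrite -/(enorm (f t)); field; rewrite enorm_eq0.
Qed.

Lemma der_edge N (Z V : 'I_N -> E2) (F : 'I_N -> R -> E2) (t : R) j :
  (forall j, is_derive t 1 (F j) (V j)) ->
  is_derive t 1 (fun s => edge (F^~ s) j) (edge V j).
Proof.
move=> D; apply/is_derive_coord => i.
have h k : is_derive t 1 (fun s => F k s 0 i) (V k 0 i) by move: (D k) => /is_derive_coord.
have := derB (h j) (h (ord_pred j)); rewrite -coordB.
by congr (is_derive _ _ _ _); apply/funext => s; rewrite -coordB.
Qed.

Lemma energy_derivative N (h : R) (x Y : 'I_N -> R -> E2) (u V : 'I_N -> E2) (t : R) :
  (forall j, is_derive t 1 (x j) (u j)) -> (forall j, is_derive t 1 (Y j) (V j)) ->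
  (forall j, edge (x^~ t) j != 0) -> (forall j, edge (Y^~ t) j != 0) ->
  is_derive t 1 (fun s => energy h (x^~ s) (Y^~ s)) (energy_rate h (x^~ t) u (Y^~ t) V).
Proof.
move=> Dx DY x0 Y0; rewrite /energy /energy_rate; apply: der_sum => j.
have ex := der_edge u j Dx; have eY := der_edge V j DY.
have nx := der_enorm (x0 j) ex; have nY := der_enorm (Y0 j) eY.
have x0' : enorm (edge (x^~ t) j) != 0 by rewrite enorm_eq0.
have d1 := derB nY (derM (der_dot eY ex) (@derV _ (fun s => enorm (edge (x^~ s) j)) t _ x0' nx)).
have d2 := derB nY nx; have d3 := derZ (h^-1) (derM d2 d2).
have := derD d1 d3.
rewrite (_ : (fun s => _) = (fun s => defect (x^~ s) (Y^~ s) j +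
    (enorm (edge (Y^~ s) j) - enorm (edge (x^~ s) j)) ^+ 2 / h)); last first.
  by apply/funext => s; rewrite /defect /dir dotZr expr2; ring.
move=> D; apply: is_derive_eq D _.
rewrite /defect_rate /length_rate.
move: x0'; rewrite /dir; move: (edge (x^~ t) j) (edge (Y^~ t) j) (edge u j) (edge V j) => a b c d a0.
rewrite !(dotZl, dotZr, dotBl, dotBr).
rewrite [dot a d]dotC; set q := enorm a; set p := enorm b; rewrite -/q in a0.
move: (dot b d) (dot d a) (dot b c) (dot b a) (dot a c) (p^-1) (h^-1) => *; by field.
Qed.

End EnergyDerivative.

Section Bootstrap.
Context {R : realType}.
Local Notation E2 := 'rV[R]_2.
Local Notation mu := (@lebesgue_measure R).

Lemma integrable_on_sum (I : Type) (r : seq I) (f : I -> R -> R) a b :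
  (forall i, integrable_on a b (f i)) -> integrable_on a b (fun t => \sum_(i <- r) f i t).
Proof.
move=> H; elim: r => [|i r IH].
  rewrite (_ : (fun t => _) = fun _ => 0); last by apply/funext => t; rewrite big_nil.
  by apply: integrable_on_continuous => z; exact: cst_continuous.
rewrite (_ : (fun t => _) = fun t => f i t + \sum_(i <- r) f i t); last by apply/funext => t; rewrite big_cons.
exact: integrable_onD.
Qed.

(** The constant of Gronwall's inequality. *)
Definition growth (M : R) : R := 512 * 64 * M ^+ 9.

Variables (N : nat) (M h T Lx : R) (x g : 'I_N -> R -> E2).
Hypotheses (N0 : (0 < N)%N) (T0 : 0 < T) (M1 : 1 <= M) (h0 : 0 < h).
Hypothesis Nh : 2 * pi <= N%:R * h <= M.
Hypothesis Lx0 : 0 <= Lx.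
Hypothesis xlip : forall j i s t, 0 <= s <= T -> 0 <= t <= T ->
  `|x j t 0 i - x j s 0 i| <= Lx * `|t - s|.
Hypothesis xlen : forall j t, 0 <= t <= T -> h / M <= enorm (edge (x^~ t) j) <= M * h.
Hypothesis gint : forall j i, integrable_on 0 T (fun t => g j t 0 i).
Hypothesis gbound : forall j t i, `|g j t 0 i| <= Lx.
Hypothesis good : {ae mu, forall t, 0 < t < T ->
  (forall j, is_derive t 1 (x j) (g j t)) /\ exists E, consistent M h (x^~ t) (g^~ t) E}.
Hypothesis small : expR (growth M * T) * h <= (1 / (128 * M ^+ 2)) ^+ 2.

Let dist (s t : R) : R := `|s - t|.
Let dist0 s t : 0 <= dist s t. Proof. exact: normr_ge0. Qed.
Local Notation bl := (blip `[0, T]%classic dist).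
Let M0 : 0 < M. Proof. exact: lt_le_trans M1. Qed.
Let growth0 : 0 <= growth M. Proof.
rewrite /growth; apply: mulr_ge0; first by apply: mulr_ge0; exact: ler0n.
by apply: exprn_ge0; exact: ltW.
Qed.
Let h00 : 0 <= h. Proof. exact: ltW. Qed.

Lemma blip_lipschitz (f : R -> R) (L : R) : 0 <= L ->
  (forall s t, 0 <= s <= T -> 0 <= t <= T -> `|f t - f s| <= L * `|t - s|) -> bl f.
Proof.
move=> L0 H; exists (`|f 0| + L * T), L; split=> //.
- by rewrite addr_ge0// mulr_ge0// ltW.
- move=> t /=; rewrite in_itv/= => tT; have z : 0 <= (0 : R) <= T by rewrite lexx ltW.
  have := H 0 t z tT; rewrite subr0; have /andP[t0 tT'] := tT; rewrite (ger0_norm t0) => k.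
  have := ler_normD (f t - f 0) (f 0); rewrite subrK => k2; apply: (le_trans k2).
  by rewrite addrC lerD2l; apply: (le_trans k); apply: ler_wpM2l.
- by move=> s t /=; rewrite !in_itv/= => sT tT; exact: H.
Qed.

Let bl_coord (Z : 'I_N -> R -> E2) : (forall j i, bl (fun t => Z j t 0 i)) ->
  forall j i, bl (fun t => edge (Z^~ t) j 0 i).
Proof.
move=> H j i; apply: (@blip_ext _ _ _ _ (fun t => Z j t 0 i - Z (ord_pred j) t 0 i)).
  by move=> t _; rewrite /edge coordB.
exact: blipB.
Qed.

Let bl_sqr f : bl f -> bl (fun t => f t ^+ 2).
Proof. by move=> H; apply: (@blip_ext _ _ _ _ (fun t => f t * f t)) => //; exact: blipM. Qed.

Let bl_x j i : bl (fun t => x j t 0 i). Proof. by apply: (@blip_lipschitz _ Lx) => // s t; exact: xlip. Qed.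

Let bl_xlen j : bl (fun t => enorm (edge (x^~ t) j)).
Proof. by apply: blip_enorm => // i; apply: bl_coord. Qed.

Let delta := h / (4 * M).
Let B := 4 * M * h.
Let B0 : 0 <= B. Proof. by apply: mulr_ge0 => //; apply: mulr_ge0 => //; exact: ltW. Qed.
Let delta0 : 0 < delta. Proof. by rewrite divr_gt0// mulr_gt0. Qed.

Let gap (Y : 'I_N -> R -> E2) (t : R) : R :=
  \sum_j (enorm (edge (Y^~ t) j) - enorm (edge (x^~ t) j)) ^+ 2.

Let gap_close (Y : 'I_N -> R -> E2) t : gap Y t <= (h / (64 * M ^+ 2)) ^+ 2 ->
  forall j, `|enorm (edge (Y^~ t) j) - enorm (edge (x^~ t) j)| <= h / (64 * M ^+ 2).
Proof.
move=> H j; have e0 : 0 <= h / (64 * M ^+ 2) by apply: divr_ge0 => //; apply: mulr_ge0 => //; exact: sqr_ge0.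
rewrite -(@ler_pXn2r _ 2)// real_normK ?num_real//; apply: le_trans H.
by rewrite /gap (bigD1 j)//= lerDl sumr_ge0// => i _; exact: sqr_ge0.
Qed.

Let len_close (p q : R) : `|q - p| <= h / (64 * M ^+ 2) -> h / M <= p <= M * h ->
  h / (2 * M) <= q <= 2 * M * h.
Proof.
rewrite ler_norml => /andP[k1 k2] /andP[k3 k4].
have e1 : h / (64 * M ^+ 2) <= h / M / 2.
  rewrite -mulrA ler_pM2l// -invfM lef_pV2 ?posrE ?mulr_gt0 ?exprn_gt0//.
  by rewrite mulrC expr2 mulrA ler_pM2r//; have := M1; lra.
have e2 : h / M <= M * h.
  by rewrite ler_pdivrMr// mulrAC; apply: ler_peMl => //; rewrite -expr2; exact: exprn_ege1.
have -> : h / (2 * M) = h / M / 2 by rewrite invfM; ring.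
by apply/andP; split; lra.
Qed.

Lemma defect_ge0 (X Y : 'I_N -> E2) j : 0 <= defect X Y j.
Proof.
rewrite /defect subr_ge0; apply: (le_trans (dot_le _ _)).
by rewrite ler_piMr ?enorm_ge0// enorm_dir_le1.
Qed.

(** The defect is nonnegative, so that the energy controls the length errors
    alone. *)
Lemma energy_ge_gap (Y : 'I_N -> R -> E2) t : gap Y t <= h * energy h (x^~ t) (Y^~ t).
Proof.
rewrite /energy mulr_sumr; apply: ler_sum => j _.
by rewrite mulrDr [h * (_ / h)]mulrC divfK ?gt_eqF// lerDr mulr_ge0 ?defect_ge0// ltW.
Qed.

(** While the lengths are close, the truncated solution solves the nodal system and
    the energy inequality holds at almost every time, so that Gronwall's
    argument bounds the energy by a multiple of h^2. This makes the length errors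
    half of what was assumed, and continuity extends the time interval. The
    integrated dissipation comes along. *)
Theorem energy_bootstrap : exists Y V : 'I_N -> R -> E2,
  [/\ forall j, Y j 0 = x j 0,
      forall j t, 0 <= t <= T -> is_derive t 1 (Y j) (V j t),
      forall j t, 0 <= t <= T -> nodal_residual (Y^~ t) (V^~ t) j = 0 /\
        h / (2 * M) <= enorm (edge (Y^~ t) j) <= 2 * M * h,
      forall t, 0 <= t <= T ->
        energy h (x^~ t) (Y^~ t) <= expR (growth M * T) * h ^+ 2 &
      [/\ forall j i, integrable_on 0 T (fun t => V j t 0 i),
          forall j i t, 0 <= t <= T -> Y j t 0 i - Y j 0 0 i = sint 0 t (fun s => V j s 0 i),
          forall j, integrable_on 0 T (fun t => enorm (g j t - V j t) ^+ 2) &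
          sint 0 T (fun t => \sum_j enorm (g j t - V j t) ^+ 2) <=
             4 * M * expR (growth M * T) * h]].
Proof.
have [Y [Y0 DY]] := @field_flow _ _ _ _ B0 delta0 T (fun j => x j 0) N0 T0.
pose V j t := field B delta (Y^~ t) j.
have [Cf Cf0 HCf] := @field_bounded _ N _ _ B0 delta0 N0.
have [Lf Lf0 HLf] := @field_lipschitz _ N _ _ B0 delta0 N0.
have lipY j i s t : 0 <= s <= T -> 0 <= t <= T -> `|Y j t 0 i - Y j s 0 i| <= Cf * `|t - s|.
  wlog st : s t / s <= t.
    move=> H; have [st|/ltW ts] := leP s t; first exact: H.
    by move=> ? ?; rewrite distrC (distrC t); exact: H.
  move=> /andP[s0 _] /andP[_ tT]; rewrite [`|t - s|]ger0_norm ?subr_ge0//.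
  apply: (mean_value_le (f := fun r => Y j r 0 i) (df := fun r => V j r 0 i)) => // r /andP[sr rt].
    by apply: DY; rewrite (le_trans s0) ?(le_trans rt).
  exact: HCf.
have blY j i : bl (fun t => Y j t 0 i) by apply: (@blip_lipschitz _ Cf) => // s t; exact: lipY.
have blV j i : bl (fun t => V j t 0 i).
  apply: (@blip_lipschitz _ (Lf * (\sum_(k : 'I_N * 'I_2) Cf))).
    by rewrite mulr_ge0// sumr_ge0.
  move=> s t sT tT; have := HLf (j, i) (coords (Y^~ t)) (coords (Y^~ s)).
  rewrite !coordsK => k; apply: (le_trans k); rewrite -mulrA; apply: ler_wpM2l => //.
  by rewrite mulr_suml; apply: ler_sum => k' _; exact: lipY.
have bl_cont f : bl f -> {within `[0, T], continuous f}.
  move=> [Bf [L [_ L0 _ H]]]; apply/within_continuousP => r e rT e0.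
  exists (e / (L + 1)); first by rewrite divr_gt0// ltr_wpDl.
  move=> s sT; rewrite ltr_pdivlMr ?ltr_wpDl// => k; apply: (le_lt_trans (H r s rT sT)).
  apply: le_lt_trans k; rewrite mulrC /dist; apply: ler_wpM2l => //; lra.
have iV j i : integrable_on 0 T (fun t => V j t 0 i) by apply: integrable_on_cont; exact: bl_cont.
have blYlen j : bl (fun t => enorm (edge (Y^~ t) j)).
  by apply: blip_enorm => // i; apply: bl_coord.
pose G t := energy h (x^~ t) (Y^~ t).
have blG : bl G.
  apply: blip_sum => // j; apply: blipD => //.
    apply: (@blip_ext _ _ _ _ (fun t => enorm (edge (Y^~ t) j) - (enorm (edge (x^~ t) j))^-1 *
       (edge (Y^~ t) j 0 0 * edge (x^~ t) j 0 0 + edge (Y^~ t) j 0 1 * edge (x^~ t) j 0 1))).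
      by move=> t _; rewrite /defect /dir dotZr dotE.
    apply: blipB => //; apply: blipM => //.
      apply: (blipV (c := h / M)) => //; first by rewrite divr_gt0.
      by move=> t /=; rewrite in_itv/= => tT; have /andP[] := xlen j tT.
    by apply: blipD => //; apply: blipM => //; apply: bl_coord.
  by apply: blipM => //; [apply: bl_sqr; exact: blipB|exact: blip_cst].
have blgap : bl (gap Y) by apply: blip_sum => // j; apply: bl_sqr; exact: blipB.
pose D t := \sum_j enorm (g j t - V j t) ^+ 2.
have iDj j : integrable_on 0 T (fun t => enorm (g j t - V j t) ^+ 2).
  have c i : integrable_on 0 T (fun t => (g j t 0 i - V j t 0 i) * (g j t 0 i - V j t 0 i)).
    have k : integrable_on 0 T (fun t => g j t 0 i - V j t 0 i) by exact: integrable_onB.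
    apply: (@integrable_onM_bounded _ _ _ _ _ (Lx + Cf)) => //; first exact: integrable_on_measurable k.
    by move=> t _; apply: (le_trans (ler_normB _ _)); apply: lerD; [exact: gbound|exact: HCf].
  rewrite (_ : (fun t => _) = fun t => (g j t 0 0 - V j t 0 0) * (g j t 0 0 - V j t 0 0)
     + (g j t 0 1 - V j t 0 1) * (g j t 0 1 - V j t 0 1)); first exact: integrable_onD.
  by apply/funext => t; rewrite enorm_sqrE !coordB !expr2.
have iD : integrable_on 0 T D by exact: integrable_on_sum.
have D0 t : 0 <= D t by apply: sumr_ge0 => j _; exact: sqr_ge0.
pose BD : R := \sum_(j < N) (2 * (Lx + Cf)) ^+ 2.
have BD0 : 0 <= BD by apply: sumr_ge0 => j _; exact: sqr_ge0.
have DB t : `|D t| <= BD.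
  rewrite ger0_norm//; apply: ler_sum => j _.
  have k i : `|(g j t - V j t) 0 i| <= Lx + Cf.
    by rewrite coordB; apply: (le_trans (ler_normB _ _)); apply: lerD; [exact: gbound|exact: HCf].
  have LC : 0 <= Lx + Cf by rewrite addr_ge0.
  rewrite ler_pXn2r// ?nnegrE ?enorm_ge0// ?mulr_ge0//.
  by apply: (le_trans (enorm_le_coord _)); have := k 0; have := k 1; lra.
pose I t := sint 0 t D.
have blI : bl I.
  apply: (@blip_lipschitz _ BD) => // s t.
  wlog st : s t / s <= t.
    move=> H; have [st|/ltW ts] := leP s t; first exact: H.
    by move=> ? ?; rewrite distrC (distrC t); exact: H.
  move=> /andP[s0 _] /andP[_ tT].
  rewrite /I (sint_chasles s0 st); last exact: integrable_onS (lexx 0) tT iD.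
  rewrite addrAC subrr add0r [`|t - s|]ger0_norm ?subr_ge0//.
  apply: sint_bound => //; first exact: integrable_onS s0 tT iD.
  by apply: (aeW (ae_true (R := R))) => r _ _.
set C := growth M.
pose k0 := h / (4 * M).
have k00 : 0 <= k0 by exact: ltW.
pose F t := G t + k0 * I t + h ^+ 2.
pose f t := expR (- C * t) * F t.
have bl_exp : bl (fun t => expR (- C * t)).
  apply: (@blip_lipschitz _ C) => // s t.
  wlog st : s t / s <= t.
    move=> H; have [st|/ltW ts] := leP s t; first exact: H.
    by move=> ? ?; rewrite distrC (distrC t); exact: H.
  move=> /andP[s0 _] /andP[_ tT]; rewrite [`|t - s|]ger0_norm ?subr_ge0//.
  apply: (mean_value_le (f := fun r => expR (- C * r)) (df := fun r => - C * expR (- C * r))) => // r /andP[sr rt].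
    exact: der_expR.
  rewrite normrM normrN (ger0_norm growth0) ger0_norm ?expR_ge0// ler_piMr//.
  by rewrite -expR0 ler_expR mulNr oppr_le0 mulr_ge0// (le_trans s0).
have blF : bl F by apply: blipD => //; [apply: blipD => //; apply: blipM => //|]; exact: blip_cst.
have [Bf [L [_ L0 _ HL]]] : bl f by exact: blipM.
have G0 : G 0 = 0.
  rewrite /G /energy big1// => j _; rewrite /defect.
  have -> : edge (Y^~ 0) j = edge (x^~ 0) j by rewrite /edge !Y0.
  by rewrite [dot _ (dir _)]dotC dot_dir !subrr expr0n mul0r addr0.
have admis t : 0 <= t <= T -> gap Y t <= (h / (64 * M ^+ 2)) ^+ 2 ->
    (forall j, nodal_residual (Y^~ t) (V^~ t) j = 0) /\
    forall j, h / (2 * M) <= enorm (edge (Y^~ t) j) <= 2 * M * h.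
  move=> tT H; have len j := len_close (gap_close H j) (xlen j tT).
  have adm : admissible B delta (Y^~ t).
    move=> j; have /andP[k1 k2] := len j; apply/andP; split.
      apply: le_trans k1; rewrite /delta ler_pM2l// lef_pV2 ?posrE ?mulr_gt0//.
      by rewrite ler_pM2r// ler_nat.
    by apply: (le_trans k2); rewrite /B !ler_pM2r// ler_nat.
  by split=> //; exact: ((field_residual delta0 (V^~ t) N0 adm).2 (fun _ => erefl)).
have key b : 0 <= b <= T -> (forall t, 0 <= t < b -> gap Y t <= (h / (64 * M ^+ 2)) ^+ 2) ->
    F b <= expR (C * T) * h ^+ 2.
  move=> /andP[b0 bT] Hb.
  have mono : f b <= f 0.
    apply: (@ae_nonincreasing _ f 0 b L) => //.
      move=> s t /andP[s0 sb] /andP[t0 tb].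
      by apply: HL => /=; rewrite in_itv/=; [rewrite s0 (le_trans sb)|rewrite t0 (le_trans tb)].
    apply: (aeW (aeI good (ae_is_derive_sint iD))) => t [gt It] /andP[t0 tb].
    have tT : 0 < t < T by rewrite t0 (lt_le_trans tb).
    have tT' : 0 <= t <= T by case/andP: tT => *; rewrite !ltW.
    have [Dx [E cE]] := gt tT; have Hgap : gap Y t <= (h / (64 * M ^+ 2)) ^+ 2 by apply: Hb; rewrite ltW.
    have [resY lenY] := admis t tT' Hgap.
    have DG : is_derive t 1 G (energy_rate h (x^~ t) (g^~ t) (Y^~ t) (V^~ t)).
      apply: (@energy_derivative _ N h x Y (g^~ t) (V^~ t)) => // j.
      - by apply/is_derive_coord => i; exact: DY.
      - by rewrite -enorm_gt0; have /andP[k _] := xlen j tT'; apply: lt_le_trans k; rewrite divr_gt0.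
      - by rewrite -enorm_gt0; have /andP[k _] := lenY j; apply: lt_le_trans k; rewrite divr_gt0// mulr_gt0.
    have DF := derD (derD DG (derZ k0 (It tT))) (derC t (h ^+ 2)).
    have Df := derM (der_expR (- C) t) DF.
    eexists; first exact: Df.
    have EI := energy_inequality M1 h0 Nh cE (gap_close Hgap) resY.
    have It0 : 0 <= I t by apply: sint_ge0.
    rewrite -/(D t) -/(G t) -/C -/k0 in EI.
    set w := energy_rate _ _ _ _ _ in EI *.
    have -> : - C * expR (- C * t) * F t + expR (- C * t) * (w + k0 * D t + 0) =
      expR (- C * t) * (- (C * F t) + (w + k0 * D t)).
      by move: (F t) (D t) (expR _) => a1 a2 a3; ring.
    rewrite pmulr_rle0 ?expR_gt0//.
    have : 0 <= C * (k0 * I t) by apply: mulr_ge0 => //; exact: mulr_ge0.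
    have -> : C * F t = C * (G t + h ^+ 2) + C * (k0 * I t).
      by rewrite /F; move: (G t) (I t) => a1 a2; ring.
    move: EI; rewrite /C /growth.
    by move: (_ * (G t + h ^+ 2)) (_ * (k0 * I t)) => c1 c2; lra.
  have f0 : f 0 = h ^+ 2 by rewrite /f /F G0 /I sint_point mulr0 expR0 mul1r mulr0 !add0r.
  rewrite f0 /f in mono.
  have -> : F b = expR (C * b) * (expR (- C * b) * F b).
    by rewrite mulrA -expRD mulNr subrr expR0 mul1r.
  apply: ler_pM; [exact: expR_ge0| | |exact: mono].
    apply: mulr_ge0; first exact: expR_ge0.
    have : 0 <= I b by apply: sint_ge0.
    have : 0 <= G b.
      apply: sumr_ge0 => j _; rewrite addr_ge0 ?defect_ge0// divr_ge0 ?sqr_ge0// ltW.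
    by move=> ? ?; rewrite !addr_ge0 ?sqr_ge0// mulr_ge0.
  by rewrite ler_expR ler_wpM2l.
have Fge t : 0 <= t -> G t <= F t /\ k0 * I t <= F t.
  move=> t0; have i0 : 0 <= I t by apply: sint_ge0.
  have g0 : 0 <= G t.
    by apply: sumr_ge0 => j _; rewrite addr_ge0 ?defect_ge0// divr_ge0 ?sqr_ge0// ltW.
  have := sqr_ge0 h; have : 0 <= k0 * I t by apply: mulr_ge0.
  by move=> ? ?; rewrite /F; split; lra.
have half b : 0 <= b <= T -> (forall t, 0 <= t < b -> gap Y t <= (h / (64 * M ^+ 2)) ^+ 2) ->
    gap Y b <= (h / (128 * M ^+ 2)) ^+ 2.
  move=> bT Hb; have /andP[b0 _] := bT.
  apply: (le_trans (energy_ge_gap Y b)).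
  have k : G b <= expR (C * T) * h ^+ 2 := le_trans (Fge b b0).1 (key b bT Hb).
  apply: (@le_trans _ _ (h * (expR (C * T) * h ^+ 2))); first by rewrite ler_pM2l.
  have -> : h * (expR (C * T) * h ^+ 2) = expR (C * T) * h * h ^+ 2 by ring.
  have -> : (h / (128 * M ^+ 2)) ^+ 2 = (1 / (128 * M ^+ 2)) ^+ 2 * h ^+ 2.
    by rewrite -exprMn; congr (_ ^+ 2); ring.
  by apply: ler_wpM2r; [exact: sqr_ge0|exact: small].
have lt_half : (h / (128 * M ^+ 2)) ^+ 2 < (h / (64 * M ^+ 2)) ^+ 2.
  have -> : h / (128 * M ^+ 2) = h / (64 * M ^+ 2) / 2.
    by field; rewrite gt_eqF.
  have : 0 < h / (64 * M ^+ 2) by rewrite divr_gt0// mulr_gt0// exprn_gt0.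
  move: (h / (64 * M ^+ 2)) => z z0; rewrite exprMn exprVn.
  by have : 0 < z ^+ 2 by [rewrite exprn_gt0]; lra.
have close t : 0 <= t <= T -> gap Y t <= (h / (64 * M ^+ 2)) ^+ 2.
  move: t; apply: (@real_induction _ (fun t => gap Y t <= (h / (64 * M ^+ 2)) ^+ 2) 0 T); first exact: ltW.
  - have := half 0; rewrite lexx ltW// => /(_ isT) k; apply: ltW; apply: le_lt_trans lt_half; apply: k.
    by move=> r /andP[r0 r1]; move: (le_lt_trans r0 r1); rewrite ltxx.
  - move=> r /andP[r0 rT] Hr.
    have rT' : 0 <= r <= T by rewrite r0 ltW.
    have hr : gap Y r <= (h / (128 * M ^+ 2)) ^+ 2.
      by apply: half => // s /andP[s0 sr]; apply: Hr; rewrite s0 ltW.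
    have lt0 := le_lt_trans hr lt_half; rewrite -subr_gt0 in lt0.
    have rin : `[0, T]%classic r by rewrite /= in_itv/= r0 ltW.
    have [d d0 Hd] := (within_continuousP _ _).1 (bl_cont _ blgap) r _ rin lt0.
    exists d => // s /andP[rs srd] sT; have := Hd s; rewrite /= in_itv/= sT (le_trans r0 (ltW rs)) => /(_ isT).
    rewrite distrC gtr0_norm ?subr_gt0// ltrBlDl => /(_ srd).
    by rewrite ltr_norml => /andP[k _]; move: k hr lt_half; lra.
  - move=> r /andP[r0 rT] Hr; apply: ltW; apply: le_lt_trans lt_half; apply: half => //.
    by rewrite ltW.
have FT t : 0 <= t <= T -> F t <= expR (C * T) * h ^+ 2.
  by move=> tT; apply: key => // s /andP[s0 st]; apply: close; rewrite s0 (ltW (lt_le_trans st _))//; case/andP: tT.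
exists Y, V; split=> //.
- by move=> j t tT; apply/is_derive_coord => i; exact: DY.
- by move=> j t tT; have [k1 k2] := admis t tT (close t tT).
- by move=> t tT; have /andP[t0 _] := tT; apply: le_trans (Fge t t0).1 (FT t tT).
split=> //.
- move=> j i t /andP[t0 tT]; symmetry; apply: (@sint_FTC _ 0 t _ (fun s => Y j s 0 i)) => //.
  + by apply: continuous_subspaceW (bl_cont _ (blV j i)) => s /=; rewrite !in_itv/= => /andP[-> st]; rewrite (le_trans st).
  + by apply: continuous_subspaceW (bl_cont _ (blY j i)) => s /=; rewrite !in_itv/= => /andP[-> st]; rewrite (le_trans st).
  + by move=> s /andP[s0 st]; apply: DY; rewrite ltW//= (le_trans (ltW st)).
have TT : 0 <= T <= T by rewrite lexx ltW.
have := le_trans (Fge T (ltW T0)).2 (FT T TT); rewrite -/(I T) /k0 => k.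
have -> : 4 * M * expR (C * T) * h = (expR (C * T) * h ^+ 2) / (h / (4 * M)).
  by field; rewrite !gt_eqF.
by rewrite ler_pdivlMr ?divr_gt0 ?mulr_gt0// mulrC.
Qed.

End Bootstrap.

(** * From nodal errors to the norms of the theorem *)

Section ErrorNorms.
Context {R : realType}.
Local Notation P := (2 * pi : R).
Local Notation E2 := 'rV[R]_2.
Local Notation mu := (@lebesgue_measure R).

Let P0 : 0 < P. Proof. by rewrite mulr_gt0// pi_gt0. Qed.

Lemma within_dot (f g : R -> E2) a b : (forall i, {within `[a, b], continuous (fun x : R => f x 0 i)}) ->
  (forall i, {within `[a, b], continuous (fun x : R => g x 0 i)}) ->
  {within `[a, b], continuous (fun x : R => dot (f x) (g x))}.
Proof.
move=> cf cg; have c2 : {within `[a, b], continuous (fun x : R => f x 0 0 * g x 0 0 + f x 0 1 * g x 0 1)}.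
  move=> x; apply: (@continuousD _ _ _ (fun x : subspace `[a, b] => f x 0 0 * g x 0 0)).
    by apply: continuousM; [exact: cf|exact: cg].
  by apply: continuousM; [exact: cf|exact: cg].
by apply: within_cont_ext c2 => x _; rewrite dotE.
Qed.

(** Measurability in time of the L2 norm of the error is not clear. The integral,
    being a supremum over simple functions, is still monotone. *)
Lemma le_integral_majorant (T : R) (f : R -> \bar R) (g : R -> R) :
  (forall t, 0 <= t <= T -> (0 <= f t)%E) -> (forall t, 0 <= g t) -> integrable_on 0 T g ->
  {ae mu, forall t, 0 <= t <= T -> (f t <= (g t)%:E)%E} ->
  (\int[mu]_(t in `[0%R, T]) f t <= (sint 0 T g)%:E)%E.
Proof.
move=> f0 g0 ig [A [mA A0 HA]].
pose H t : \bar R := if t \in A then +oo%E else (g t)%:E.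
have mg := integrable_on_measurable ig.
have mH : measurable_fun `[0, T] H.
  apply: measurable_fun_if => //.
  - apply: (measurable_fun_bool true) => //.
    rewrite (_ : (fun t => t \in A) @^-1` [set true] = A); first exact: measurableI.
    by apply/seteqP; split=> [y /set_mem//|y /mem_set//].
  - by apply: measurable_funS; [|exact: subIsetl|exact/measurable_EFinP].
have H0 t : (0 <= H t)%E by rewrite /H; case: ifP => // _; rewrite lee_fin.
have fH t : `[0, T]%classic t -> (f t <= H t)%E.
  rewrite /= in_itv/= => tT; rewrite /H; case: ifPn; first by rewrite leey.
  move=> tA; apply: contrapT => k; move/negP: tA; apply; apply/mem_set/HA => /=.
  by move=> /(_ tT).
apply: (@le_trans _ _ (\int[mu]_(t in `[0%R, T]) H t)%E).
  rewrite [leLHS]integral_mkcond [leRHS]integral_mkcond.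
  have e0 : forall t, (0 <= (f \_ `[0%R, T]) t)%E.
    by apply: erestrict_ge0 => t /=; rewrite in_itv/=; exact: f0.
  have e1 : forall t, (0 <= (H \_ `[0%R, T]) t)%E by exact: erestrict_ge0.
  rewrite !ge0_integralTE//; apply: le_ereal_sup => _ /= [k kf <-]; exists k => // t.
  apply: le_trans (kf t) _; rewrite /patch; case: ifPn => // /set_mem; exact: fH.
have -> : (\int[mu]_(t in `[0%R, T]) H t = \int[mu]_(t in `[0%R, T]) (g t)%:E)%E.
  apply: ge0_ae_eq_integral => //.
  - exact/measurable_EFinP.
  - by move=> t _; rewrite lee_fin.
  - have h : {ae mu, forall t, t \notin A}.
      by exists A; split=> // t /= /negP; rewrite negbK => /set_mem.
    by apply: (aeW h) => t tA _; rewrite /H (negbTE tA).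
rewrite /sint /Rintegral fineK//.
by apply: integrable_fin_num => //; exact: ig.
Qed.

Variables (N : nat) (xi : nat -> R) (phi : 'I_N -> R -> R).
Hypothesis part : partition_of_S1 N xi.

Lemma L2sq_le_elements (f : R -> E2) (G : 'I_N -> R -> E2) (Bd : 'I_N -> R) :
  (forall (j : 'I_N) i, {within `[xi j, xi j.+1], continuous (fun x : R => G j x 0 i)}) ->
  (forall (j : 'I_N) x, xi j < x < xi j.+1 -> f x = G j x) ->
  (forall (j : 'I_N) x, xi j <= x <= xi j.+1 -> enorm (G j x) ^+ 2 <= Bd j) ->
  L2 f /\ (L2sq f <= (\sum_j elem_size xi j * Bd j)%:E)%E.
Proof.
move=> cG fG GB.
have m i : measurable_fun `[0, P] (fun x => f x 0 i).
  apply: integrable_on_measurable.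
  have [||k _] := @sint_elements _ _ _ part (fun x => f x 0 i) (fun j x => G j x 0 i); last exact: k.
    by move=> j; apply: integrable_on_cont; exact: cG.
  by move=> j x xj; rewrite (fG j x xj).
have cn (j : 'I_N) : {within `[xi j, xi j.+1], continuous (fun x : R => enorm (G j x) ^+ 2)}.
  by apply: within_cont_ext (within_dot (cG j) (cG j)) => x _; rewrite enorm_sqr.
have [||ie se] := @sint_elements _ _ _ part (fun x => enorm (f x) ^+ 2) (fun j x => enorm (G j x) ^+ 2).
- by move=> j; apply: integrable_on_cont; exact: cn.
- by move=> j x xj; rewrite (fG j x xj).
have Lf : L2 f.
  split; first exact: m.
  have /integrableP[_] := ie; apply: le_lt_trans; rewrite le_eqVlt; apply/orP; left; apply/eqP.
  by apply: eq_integral => x _ /=; rewrite ger0_norm// sqr_ge0.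
split=> //; rewrite (L2_sqr Lf).2 lee_fin se; apply: ler_sum => j _.
have jj := ltW (node_lt part j); rewrite mulrC -(sint_cst _ jj).
apply: le_sint; [exact: integrable_on_cont| |exact: GB].
by apply: integrable_on_continuous => z; exact: cst_continuous.
Qed.

Hypothesis basis : nodal_basis xi phi.
Variables (v : R -> E2) (Z : 'I_N -> E2).
Hypothesis Hv : H2 v.
Let U (x : R) : E2 := \sum_i phi i x *: Z i.

Let cvU : continuous (fun x => v x - U x).
Proof.
by case: Hv => _ cv _ _ x; apply: (@continuousB _ _ _ v U); [exact: cv|exact: continuous_sum_phi].
Qed.

Let slope_elem (j : 'I_N) x : xi j < x < xi j.+1 -> is_derive x 1 U ((elem_size xi j)^-1 *: edge Z j).
Proof.
move=> xj.
have k y : xi j <= y <= xi j.+1 -> U y = Z (ord_pred j) + local_coord xi j y *: edge Z j.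
  by move=> yj; exact: (sum_phi_elem part basis Z yj).
exact: (derive1_elem k xj).
Qed.

Let inS1 (j : 'I_N) x : xi j <= x <= xi j.+1 -> 0 <= x <= P.
Proof.
have /andP[k1 _] := node_S1 part (ltnW (ltn_ord j)); have /andP[_ k2] := node_S1 part (ltn_ord j).
by move=> /andP[h1 h2]; rewrite (le_trans k1)// (le_trans h2).
Qed.

Let cslope (j : 'I_N) i : {within `[xi j, xi j.+1],
  continuous (fun x : R => (derive1 v x - (elem_size xi j)^-1 *: edge Z j) 0 i)}.
Proof.
have [_ cw _ _ _] := H2_C1 Hv; set c := _ *: _.
have cw' : {within `[xi j, xi j.+1], continuous (fun x : R => derive1 v x 0 i)}.
  by apply: continuous_subspaceW (cw i) => x /=; rewrite !in_itv/= => /inS1.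
have c2 : {within `[xi j, xi j.+1], continuous (fun x : R => derive1 v x 0 i - c 0 i)}.
  move=> x; apply: (@continuousB _ _ _ (fun x : subspace `[xi j, xi j.+1] => derive1 v x 0 i)); first exact: cw'.
  exact: cst_continuous.
by apply: within_cont_ext c2 => x _; rewrite coordB.
Qed.

(** Integration by parts on each element; the boundary terms cancel around the
    circle because the difference is continuous and periodic. *)
Lemma difference_weak_derivative :
  weak_derivative S1 C1per (fun x => v x - U x) (fun x => derive1 v x - derive1 U x).
Proof.
move=> f [[df cdf] pf].
have Df (x : R) : is_derive x 1 f (derive1 f x) by rewrite derive1E; exact/derivableP.
have cf : continuous f by move=> x; exact: is_derive_continuous (Df x).
have [Dv _ _ _ _] := H2_C1 Hv; have [pv _ _ _] := Hv.
pose F x := dot (v x - U x) (f x).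
pose a x := dot (v x - U x) (derive1 f x).
pose b (j : 'I_N) x := dot (derive1 v x - (elem_size xi j)^-1 *: edge Z j) (f x).
have cc (k : R -> E2) c d i : continuous k -> {within `[c, d], continuous (fun x : R => k x 0 i)}.
  by move=> ck; apply: continuous_subspaceT; exact: continuous_coord.
have ca c d : {within `[c, d], continuous a} by apply: within_dot => i; exact: cc.
have cF c d : {within `[c, d], continuous F} by apply: within_dot => i; exact: cc.
have cb (j : 'I_N) : {within `[xi j, xi j.+1], continuous (b j)}.
  by apply: within_dot => i; [exact: cslope|exact: cc].
have [||_ Sa] := @sint_elements _ _ _ part a (fun _ => a) => [j|//|]; first exact: integrable_on_cont.
have [||_ Sb] := @sint_elements _ _ _ part (fun x => dot (derive1 v x - derive1 U x) (f x)) b.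
- by move=> j; exact: integrable_on_cont.
- by move=> j x xj; rewrite (is_derive_derive1 (slope_elem xj)).
rewrite -!/(sint 0 P _) Sb -/a Sa; apply/eqP; rewrite -addr_eq0 -big_split/=; apply/eqP.
have E (j : 'I_N) : sint (xi j) (xi j.+1) a + sint (xi j) (xi j.+1) (b j) = F (xi j.+1) - F (xi (ord_pred j).+1).
  have jj := ltW (node_lt part j).
  have ia := integrable_on_cont (ca (xi j) (xi j.+1)); have ib := integrable_on_cont (cb j).
  have pF : periodic F P.
    move=> x; rewrite /F pf pv; congr (dot (_ - _) _); rewrite /U.
    by apply: eq_bigr => k _; have [[pk _ _] _] := basis k; rewrite pk.
  rewrite -(node_left part j pF) -sintD//.
  apply: (@sint_FTC _ _ _ _ F jj); [|exact: cF|].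
    move=> x; apply: (@continuousD _ _ _ (a : subspace `[xi j, xi j.+1] -> R)); [exact: ca|exact: cb].
  move=> x xj; have xj' : xi j <= x <= xi j.+1 by case/andP: xj => /ltW-> /ltW->.
  have D1 : is_derive x 1 (fun y => v y - U y) (derive1 v x - (elem_size xi j)^-1 *: edge Z j).
    apply/is_derive_coord => i; rewrite coordB.
    have d1 : is_derive x 1 (fun y => v y 0 i) (derive1 v x 0 i) by move: (Dv x (inS1 xj')) => /is_derive_coord.
    have d2 : is_derive x 1 (fun y => U y 0 i) (((elem_size xi j)^-1 *: edge Z j) 0 i).
      by move: (slope_elem xj) => /is_derive_coord.
    by have := derB d1 d2; congr (is_derive _ _ _ _); apply/funext => y; rewrite coordB.
  by have := der_dot D1 (Df x); rewrite addrC.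
rewrite (eq_bigr _ (fun j _ => E j)) sumrB.
rewrite -[X in _ - X](sum_ordS (fun j => F (xi (ord_pred j).+1))).
apply/eqP; rewrite subr_eq0; apply/eqP.
by apply: eq_bigr => j _; rewrite ordSK.
Qed.

(** The representative of the weak derivative is almost everywhere the
    elementwise derivative of the difference. *)
Theorem curve_error (B0 B1 : 'I_N -> R) :
  (forall (j : 'I_N) x, xi j <= x <= xi j.+1 -> enorm (v x - U x) ^+ 2 <= B0 j) ->
  (forall (j : 'I_N) x, xi j <= x <= xi j.+1 ->
     enorm (derive1 v x - (elem_size xi j)^-1 *: edge Z j) ^+ 2 <= B1 j) ->
  (H1sq (fun x => v x - U x)%R <= (\sum_j elem_size xi j * (B0 j + B1 j))%:E)%E.
Proof.
move=> h0 h1.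
have cU i a b : {within `[a, b], continuous (fun x : R => (v x - U x) 0 i)}.
  by apply: continuous_subspaceT; exact: continuous_coord.
have [_ k0] := L2sq_le_elements (fun (j : 'I_N) i => cU i (xi j) (xi j.+1)) (fun _ _ _ => erefl) h0.
have [L1 k1] := L2sq_le_elements (f := fun x => derive1 v x - derive1 U x) cslope
  (fun j x xj => congr1 (fun c => derive1 v x - c) (is_derive_derive1 (slope_elem xj))) h1.
have W := difference_weak_derivative.
have [Lw _] := wderivP L1 W.
have ae := wderiv_unique L1 W (fun i => cU i 0 P).
have E : L2sq (wderiv (fun x => v x - U x)) = L2sq (fun x => derive1 v x - derive1 U x).
  rewrite (L2_sqr Lw).2 (L2_sqr L1).2; congr _%:E; apply: sint_ae.
  - by apply: measurable_enorm_sqr; case: Lw.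
  - by apply: measurable_enorm_sqr; case: L1.
  - by apply: ae_closed; apply: (aeW ae) => x k /k ->.
rewrite /H1sq E (eq_bigr (fun j => elem_size xi j * B0 j + elem_size xi j * B1 j)); last by move=> j _; rewrite mulrDr.
by rewrite big_split/= EFinD; exact: leeD.
Qed.

End ErrorNorms.

(** * Uniqueness of the discrete flow *)

Section NodalUniqueness.
Context {R : realType} (N : nat).
Local Notation E2 := 'rV[R]_2.
Variables (T l B : R) (Y V Z W : 'I_N -> R -> E2).
Hypotheses (N0 : (0 < N)%N) (T0 : 0 < T) (l0 : 0 < l).
Hypothesis DY : forall j t, 0 <= t <= T -> is_derive t 1 (Y j) (V j t).
Hypothesis DZ : forall j t, 0 <= t <= T -> is_derive t 1 (Z j) (W j t).
Hypothesis resY : forall j t, 0 <= t <= T -> nodal_residual (Y^~ t) (V^~ t) j = 0.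
Hypothesis resZ : forall j t, 0 <= t <= T -> nodal_residual (Z^~ t) (W^~ t) j = 0.
Hypothesis lenY : forall j t, 0 <= t <= T -> l <= enorm (edge (Y^~ t) j) <= B.
Hypothesis init : forall j, Z j 0 = Y j 0.

(** As long as the two flows agree, the sides of the second stay bounded below,
    so that both solve the truncated system a little longer. *)
Theorem nodal_flow_unique t : 0 <= t <= T -> forall j, Z j t = Y j t.
Proof.
have B0 : 0 <= B + l.
  have z : 0 <= (0 : R) <= T by rewrite lexx ltW.
  have /andP[k1 k2] := lenY (Ordinal N0) z; rewrite addr_ge0 ?(ltW l0)//.
  exact: le_trans (ltW l0) (le_trans k1 k2).
have d0 : 0 < l / 2 by rewrite divr_gt0.
have [Lf Lf0 HLf] := @field_lipschitz _ N _ _ B0 d0 N0.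
have ode (F F' : 'I_N -> R -> E2) (r : R) : (forall j, is_derive r 1 (F j) (F' j r)) ->
    (forall j, nodal_residual (F^~ r) (F'^~ r) j = 0) -> admissible (B + l) (l / 2) (F^~ r) ->
    forall k : 'I_N * 'I_2, is_derive r 1 (fun s => F k.1 s 0 k.2)
      (coords (field (B + l) (l / 2) (of_coords (fun k' => F k'.1 r 0 k'.2))) k).
  move=> D res adm [j i]; rewrite -[of_coords _]/(of_coords (coords (F^~ r))) coordsK.
  rewrite /coords/= -((field_residual d0 (F'^~ r) N0 adm).1 res j).
  by move: (D j) => /is_derive_coord.
move: t; apply: (@real_induction _ (fun t => forall j, Z j t = Y j t) 0 T); first exact: ltW.
- exact: init.
- move=> r /andP[r0 rT] Hr; have rT' : 0 <= r <= T by rewrite r0 ltW.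
  have Er : forall j, Z j r = Y j r by apply: Hr; rewrite r0 lexx.
  have [e e0 He] : exists2 e, 0 < e & forall s, `|s - r| < e -> forall j,
      `|enorm (edge (Z^~ s) j) - enorm (edge (Z^~ r) j)| < l / 2.
    have Hj j : exists d, 0 < d /\ forall s, `|s - r| < d ->
        `|enorm (edge (Z^~ s) j) - enorm (edge (Z^~ r) j)| < l / 2.
      have Ze : edge (Z^~ r) j != 0.
        rewrite -enorm_gt0 /edge !Er; have /andP[k _] := lenY j rT'; exact: lt_le_trans k.
      have D := der_enorm Ze (der_edge (W^~ r) j (fun j' => DZ j' rT')).
      set c := dot _ _ in D.
      have [d dd Hd] := (is_deriveP _ _ _).1 D 1 ltr01.
      have q0 : 0 < l / 2 / (1 + `|c| + 1) by rewrite divr_gt0// ltr_wpDl// addr_ge0.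
      exists (Num.min d (l / 2 / (1 + `|c| + 1))); split; first by rewrite lt_min dd.
      move=> s; rewrite lt_min => /andP[/Hd k1 k2].
      have p0 : 0 < 1 + `|c| + 1 by rewrite ltr_wpDl// addr_ge0.
      rewrite ltr_pdivlMr// in k2; apply: le_lt_trans k2.
      set a := _ - enorm (edge (Z^~ r) j) in k1 *.
      have k3 := ler_normD (a - (s - r) *: c) ((s - r) *: c); rewrite subrK in k3.
      apply: (le_trans k3); apply: (le_trans (lerD k1 (lexx _))).
      by rewrite normrZ mul1r !mulrDr !mulr1; have := normr_ge0 (s - r); lra.
    have [d Hd] := choice Hj.
    have S0 : 0 < \sum_j (d j)^-1.
      rewrite (bigD1 (Ordinal N0))//= ltr_pwDl ?invr_gt0 ?(Hd _).1//.
      by apply: sumr_ge0 => j _; rewrite invr_ge0 ltW// (Hd j).1.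
    exists (\sum_j (d j)^-1)^-1; first by rewrite invr_gt0.
    move=> s k j; apply: (Hd j).2; apply: (lt_le_trans k).
    rewrite -[leRHS]invrK lef_pV2 ?posrE ?invr_gt0 ?(Hd _).1//.
    by rewrite (bigD1 j)//= lerDl sumr_ge0// => i _; rewrite invr_ge0 ltW// (Hd i).1.
  exists e => // s /andP[rs sre] sT.
  have admZ t : r <= t <= s -> admissible (B + l) (l / 2) (Z^~ t).
    move=> /andP[rt ts] j; have tr : `|t - r| < e by rewrite ger0_norm ?subr_ge0//; lra.
    have := He t tr j; have -> : edge (Z^~ r) j = edge (Y^~ r) j by rewrite /edge !Er.
    have /andP[k1 k2] := lenY j rT'; rewrite ltr_norml => /andP[k3 k4].
    by apply/andP; split; move: (l0) k1 k2 k3 k4; lra.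
  have tin t : r <= t <= s -> 0 <= t <= T by move=> /andP[rt ts]; rewrite (le_trans r0 rt) (le_trans ts).
  have admY t : r <= t <= s -> admissible (B + l) (l / 2) (Y^~ t).
    move=> /tin tT j; have /andP[k1 k2] := lenY j tT.
    by apply/andP; split; move: (l0) k1 k2; lra.
  have U := @ode_unique _ ('I_N * 'I_2)%type _ Lf r s (fun k t => Z k.1 t 0 k.2) (fun k t => Y k.1 t 0 k.2)
    (ltW rs) Lf0 HLf.
  move=> j; apply/rowP => i; apply: (U _ _ _ (j, i)).
  + move=> k t ts; apply: (@ode Z W t _ _ (admZ t ts)) => j'; first exact: (DZ j' (tin t ts)).
    exact: (resZ j' (tin t ts)).
  + move=> k t ts; apply: (@ode Y V t _ _ (admY t ts)) => j'; first exact: (DY j' (tin t ts)).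
    exact: (resY j' (tin t ts)).
  + by move=> k; rewrite /= Er.
- move=> r /andP[r0 rT] Hr j; apply/rowP => i.
  have c (F F' : 'I_N -> R -> E2) : (forall j (t : R), 0 <= t <= T -> is_derive t 1 (F j) (F' j t)) ->
      {within `[0, r], continuous (fun t => F j t 0 i)}.
    move=> D; apply: continuous_in_subspaceT => t; rewrite inE/= in_itv/= => /andP[t0 tr].
    have tT : 0 <= t <= T by rewrite t0 (le_trans tr).
    by move: (D j t tT) => /is_derive_coord Di; exact: is_derive_continuous (Di i).
  apply: (ae_eq_within r0 (c Z W DZ) (c Y V DY)); last by rewrite lexx ltW.
  by apply: (aeW (ae_true (R := R))) => t _ /andP[t0 tr]; rewrite Hr// ltW.
Qed.

End NodalUniqueness.

(** * The semidiscrete solution *)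

Section RegularSolution.
Context {R : realType}.
Local Notation P := (2 * pi : R).
Local Notation E2 := 'rV[R]_2.
Local Notation mu := (@lebesgue_measure R).
Variables (T k1 k2 K A : R) (X0 : R -> E2) (X Xt : R -> R -> E2).
Hypotheses (k10 : 0 < k1) (T0 : 0 < T).
Hypothesis sol : regular_solution T k1 k2 K X0 X Xt.
Hypotheses (A1 : 1 <= A) (Ak1 : k1^-1 <= A) (Ak2 : k2 <= A) (AK : 20 * `|K| <= A).

Let P0 : 0 < P. Proof. by rewrite mulr_gt0// pi_gt0. Qed.
Let A0 : 0 < A. Proof. exact: lt_le_trans A1. Qed.

Lemma solution_H2 t : 0 <= t <= T -> H2 (X t) /\ H2 (Xt t).
Proof. by move=> tT; have [_ [[[h _ _ _ _] _ _ _] _] _ _] := sol; apply: h; rewrite in_itv. Qed.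

Lemma solution_speed t x : 0 <= t <= T -> k1 <= enorm (derive1 (X t) x) <= k2.
Proof. by move=> tT; have [_ _ _ h] := sol; apply: h; rewrite in_itv. Qed.

Lemma solution_norms : {ae mu, forall t, 0 <= t <= T ->
  (H2norm (X t) <= `|K|%:E)%E /\ (H2norm (Xt t) <= `|K|%:E)%E}.
Proof.
have [_ _ hK _] := sol; have := ess_sup_ge mu ((fun t => H2norm (X t) + H2norm (Xt t))%E \_ `[0, T]).
rewrite -/(W1infty_norm T X Xt) hK => h; apply: (aeW h) => t.
rewrite /patch => k tT; move: k; rewrite ifT; last by rewrite inE/= in_itv.
move=> k; have kk : (K%:E <= `|K|%:E)%E by rewrite lee_fin ler_norm.
have n0 (v : R -> E2) : (0 <= H2norm v)%E by exact: sqrte_ge0.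
by split; apply: le_trans (le_trans k kk); [rewrite leeDl|rewrite leeDr].
Qed.

Definition regular_time t : Prop :=
  [/\ 0 <= t <= T, (H2norm (X t) <= `|K|%:E)%E, (H2norm (Xt t) <= `|K|%:E)%E &
    {ae mu, forall x, 0 <= x <= P -> Xt t x = flow_rhs (X t) x}].

Lemma regular_time_ae : {ae mu, forall t, 0 <= t <= T -> regular_time t}.
Proof.
have [_ [[_ _ _ hp] _] _ _] := sol.
apply: (aeW (aeI solution_norms hp)) => t [k pde] tT; have [n1 n2] := k tT.
have tin : t \in `[0, T] by rewrite in_itv.
by split=> //; apply: (aeW (pde tin)) => x h xP; apply: h; rewrite in_itv.
Qed.

Definition nonlocal t : R := P / curve_length (X t).

Lemma solution_length t : 0 <= t <= T -> P * k1 <= curve_length (X t).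
Proof.
move=> tT; have [_ cw _ _ _] := H2_C1 (solution_H2 tT).1.
have -> : P * k1 = sint 0 P (fun _ => k1) by rewrite sint_cst ?ltW// subr0 mulrC.
apply: le_sint.
- by apply: integrable_on_continuous => z; exact: cst_continuous.
- by apply: integrable_on_cont; exact: within_enorm.
by move=> x _; case/andP: (solution_speed x tT).
Qed.

(** At almost every time the curve and its velocity are bounded in H2 and the
    equation holds almost everywhere on the circle; this determines the
    regularity that the consistency estimate uses. *)
Theorem regular_slice t : regular_time t -> flow_slice A (X t) (Xt t) (nonlocal t) /\
  exists G : R -> R, [/\ forall x, 0 <= G x, integrable_on 0 P G, sint 0 P G <= A ^+ 2 &
        forall x y, 0 <= x -> x <= y -> y <= P ->
          enorm (derive1 (X t) y - derive1 (X t) x) ^+ 2 <= (y - x) * sint x y G].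
Proof.
move=> [tT n1 n2 pde]; have [Hv Hu] := solution_H2 tT.
have K0 : 0 <= `|K| by exact: normr_ge0.
have KA : `|K| <= A by move: AK K0; lra.
have [_ _ [G [G0 iG GK HG]]] := H2_bounds K0 Hv n1.
have [ub dub _] := H2_bounds K0 Hu n2.
have [Dv _ ev _ _] := H2_C1 Hv; have [Du _ _ _ _] := H2_C1 Hu.
have [pv _ _ _] := Hv; have [pu _ _ _] := Hu.
have v0 x : 0 <= x <= P -> derive1 (X t) x != 0.
  move=> _; rewrite -enorm_gt0; case/andP: (solution_speed x tT) => h _; exact: lt_le_trans h.
have Lge := solution_length tT.
have L0 : 0 < curve_length (X t) by apply: lt_le_trans Lge; rewrite mulr_gt0.
have lam0 : 0 < nonlocal t by rewrite divr_gt0.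
have lamne : nonlocal t != 0 by rewrite gt_eqF.
split; last by exists G; split=> //; apply: (le_trans GK); rewrite ler_pXn2r// nnegrE// ltW.
split.
- split=> //; rewrite gtr0_norm//; apply: le_trans Ak1; rewrite /nonlocal ler_pdivrMr//.
  by rewrite [k1^-1 * _]mulrC ler_pdivlMr.
- exact: Dv.
- move=> x xP; case/andP: (solution_speed x tT) => h1 h2; apply/andP; split; last exact: le_trans h2 Ak2.
  apply: le_trans h1; rewrite -[leRHS]invrK lef_pV2 ?posrE ?invr_gt0//.
- split; first by move=> x xP; apply: (le_trans (ub x xP)); move: AK K0; lra.
  have lip x y : 0 <= x -> x <= y -> y <= P -> enorm (Xt t y - Xt t x) <= A * (y - x).
    move=> x0 xy yP; apply: (@le_trans _ _ (2 * (5 * `|K|) * (y - x))).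
      apply: (mean_value_vec xy) => z /andP[xz zy]; have zP : 0 <= z <= P by rewrite (le_trans x0) ?(le_trans zy).
        exact: Du.
      exact: dub.
    by apply: ler_wpM2r; [rewrite subr_ge0|move: AK K0; lra].
  move=> x y /andP[x0 xP] /andP[y0 yP]; have [xy|/ltW yx] := leP x y.
    by rewrite ger0_norm ?subr_ge0//; exact: lip.
  by rewrite enormBC distrC ger0_norm ?subr_ge0//; exact: lip.
split.
- by move=> x xP; exact: (velocity_normal Hv Hu v0 lamne erefl pde xP).
- by move=> i; exact: (@turning_continuous _ _ _ _ Hv Hu v0 i).
- by move=> i x xP; exact: (tangent_primitive Hv Hu v0 lamne erefl pde i xP).
Qed.

End RegularSolution.

Section Convergence.
Context {R : realType}.
Local Notation P := (2 * pi : R).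
Local Notation E2 := 'rV[R]_2.
Local Notation mu := (@lebesgue_measure R).
Variables (T k1 k2 K A : R) (X0 : R -> E2) (X Xt : R -> R -> E2).
Hypotheses (k10 : 0 < k1) (T0 : 0 < T).
Hypothesis sol : regular_solution T k1 k2 K X0 X Xt.
Hypotheses (A1 : 1 <= A) (Ak1 : k1^-1 <= A) (Ak2 : k2 <= A) (AK : 20 * `|K| <= A).
Variables (N : nat) (xi : nat -> R) (phi : 'I_N -> R -> R).
Hypotheses (part : partition_of_S1 N xi) (basis : nodal_basis xi phi).
Local Notation h := (mesh N xi).
Hypothesis h0 : 0 < h.
Hypotheses (h1 : h <= 1) (hA : 4 * A ^+ 2 * h <= 1).
Hypothesis sizes : forall j : 'I_N, h / A <= elem_size xi j <= h.
Hypothesis steps : forall j : 'I_N, `|elem_size xi (ordS j) - elem_size xi j| <= A * h ^+ 2.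

Let M : R := 230 * 230 * 30 * A ^+ 20.
Let E1 : R := expR (growth M * T).
Hypothesis small : E1 * h <= (1 / (128 * M ^+ 2)) ^+ 2.

Let P0 : 0 < P. Proof. by rewrite mulr_gt0// pi_gt0. Qed.
Let A0 : 0 < A. Proof. exact: lt_le_trans A1. Qed.
Let N0 : (0 < N)%N. Proof. exact: partition_gt0 part. Qed.
Let K0 : 0 <= `|K|. Proof. exact: normr_ge0. Qed.
Let E10 : 0 <= E1. Proof. exact: expR_ge0. Qed.
Let M8 : 8 * A <= M.
Proof.
have k : A <= A ^+ 20 by rewrite ler_eXnr.
have q2 : 0 <= A ^+ 20 by rewrite exprn_ge0// ltW.
rewrite /M; move: k q2; move: (A ^+ 20) => a k q2; lra.
Qed.
Let M1 : 1 <= M. Proof. by move: M8 A1; lra. Qed.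
Let M0 : 0 < M. Proof. exact: lt_le_trans M1. Qed.

Local Notation x_ := (fun (j : 'I_N) (t : R) => X t (xi j.+1)).
Local Notation g_ := (fun (j : 'I_N) (t : R) => cut_velocity `|K| Xt (xi j.+1) t).

Let nodeP (j : 'I_N) : 0 <= xi j.+1 <= P. Proof. exact: (node_S1 part (ltn_ord j)). Qed.
Let leftP (j : 'I_N) : 0 <= xi j <= P. Proof. exact: (node_S1 part (ltnW (ltn_ord j))). Qed.
Let elemP (j : 'I_N) x : xi j <= x <= xi j.+1 -> 0 <= x <= P.
Proof.
have /andP[a _] := leftP j; have /andP[_ b] := nodeP j.
by move=> /andP[c d]; rewrite (le_trans a)// (le_trans d).
Qed.

Let H2s t : 0 <= t <= T -> H2 (X t) /\ H2 (Xt t). Proof. exact: solution_H2 sol t. Qed.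
Let cX x : {within `[0, T], continuous (fun t => X t x)}.
Proof. by have [_ [[[_ c _ _ _] _ _ _] _] _ _] := sol; exact: c. Qed.
Let mX x i : measurable_fun `[0, T] (fun t => Xt t x 0 i).
Proof. by have [_ [[[_ _ m _ _] _ _ _] _] _ _] := sol; exact: m. Qed.
Let wX x : weak_derivative `[0, T] (C1c T) (X^~ x) (Xt^~ x).
Proof. by have [_ [[[_ _ _ w _] _ _ _] _] _ _] := sol; exact: w. Qed.
Let bX := solution_norms sol.

Let curve_lip x s t : 0 <= x <= P -> 0 <= s <= T -> 0 <= t <= T -> enorm (X t x - X s x) <= A * `|t - s|.
Proof. exact: (curve_time_lipschitz T0 K0 AK H2s (fun x => @cX x) mX wX bX). Qed.
Let edge_lip x y s t : 0 <= x <= P -> 0 <= y <= P -> 0 <= s <= T -> 0 <= t <= T ->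
  enorm (X t y - X t x - (X s y - X s x)) <= A * `|y - x| * `|t - s|.
Proof. exact: (edge_time_lipschitz T0 K0 AK H2s (fun x => @cX x) mX wX bX). Qed.
Let slope_lip x s t : 0 <= x <= P -> 0 <= s <= T -> 0 <= t <= T ->
  enorm (derive1 (X t) x - derive1 (X s) x) <= A * `|t - s|.
Proof. exact: (derivative_time_lipschitz T0 K0 AK H2s (fun x => @cX x) mX wX bX). Qed.

Let edgeE t (j : 'I_N) : 0 <= t <= T -> edge (x_^~ t) j = X t (xi j.+1) - X t (xi j).
Proof. by move=> tT; have [[p _ _ _] _] := H2s tT; rewrite /edge (node_left part j p). Qed.

Let near_time t e : 0 <= t <= T -> 0 < e -> exists s, regular_time T K X Xt s /\ `|t - s| <= e.
Proof.
move=> /andP[t0 tT] e0; have H := regular_time_ae sol.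
have [tl|tl] := ltP t T.
  have lt : t < Num.min (t + e) T by rewrite lt_min tl ltrDl e0.
  have [s /andP[s1 s2] Hs] := ae_exists lt H; exists s; move: s2; rewrite lt_min => /andP[s2 s3].
  split; first by apply: Hs; rewrite (le_trans t0 (ltW s1)) ltW.
  by rewrite distrC gtr0_norm ?subr_gt0//; lra.
have lt : Num.max (t - e) 0 < t by rewrite gt_max ltrBlDr ltrDl e0 (lt_le_trans T0).
have [s /andP[s1 s2] Hs] := ae_exists lt H; exists s; move: s1; rewrite gt_max => /andP[s1 s3].
split; first by apply: Hs; rewrite ltW// (le_trans (ltW s2)).
by rewrite gtr0_norm ?subr_gt0//; lra.
Qed.

Let slice_data t : regular_time T K X Xt t -> exists E G,
  [/\ flow_slice A (X t) (Xt t) (nonlocal X t),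
      consistent M h (x_^~ t) (fun j => Xt t (xi j.+1)) E,
      \sum_(j < N) oscillation xi G j ^+ 2 <= h * A ^+ 2 &
      forall (j : 'I_N) x, xi j <= x <= xi j.+1 ->
        enorm (edge (x_^~ t) j - elem_size xi j *: derive1 (X t) x) <= 2 * oscillation xi G j * elem_size xi j].
Proof.
move=> good; have tT : 0 <= t <= T by case: good.
have [sl [G [G0 iG GA incr]]] := regular_slice k10 sol A1 Ak1 Ak2 AK good.
have [_ cw _ _ _] := H2_C1 (H2s tT).1.
have c := slice_consistent part h0 h1 hA sizes steps sl erefl cw G0 iG GA incr (lexx M).
have o := sum_oscillation part h0 sizes G0 iG GA.
by exists (consistency_error xi A h G), G; split=> // j x xj; exact: (inscribed_edge_linear part sl G0 iG incr xj).
Qed.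

Let lenx j t : 0 <= t <= T -> h / M <= enorm (edge (x_^~ t) j) <= M * h.
Proof.
move=> tT.
have close e : 0 < e -> h / M - e <= enorm (edge (x_^~ t) j) <= M * h + e.
  move=> e0; have q0 : 0 < e / (A * P) by rewrite divr_gt0// mulr_gt0.
  have [s [gs ts]] := near_time tT q0; have sT : 0 <= s <= T by case: gs.
  have [E [G [_ [c _] _ _]]] := slice_data gs; have [_ /andP[c1 c2]] := c j.
  have k := le_trans (enorm_dist _ _) (edge_lip (leftP j) (nodeP j) sT tT).
  rewrite -!edgeE// in k.
  have q2 : A * `|xi j.+1 - xi j| * `|t - s| <= e.
    have eE : e = A * P * (e / (A * P)) by rewrite [RHS]mulrC divfK// gt_eqF// mulr_gt0.
    rewrite [leRHS]eE.
    apply: ler_pM => //; first by rewrite mulr_ge0// ltW.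
    apply: ler_wpM2l; first exact: ltW.
    have := @dist_segment _ 0 P (xi j) (xi j.+1) (leftP j) (nodeP j); by rewrite subr0.
  move: (le_trans k q2); rewrite ler_norml => /andP[k3 k4].
  by apply/andP; split; move: c1 c2 k3 k4; lra.
by apply/andP; split; apply/ler_addgt0Pr => e /close/andP[]; lra.
Qed.

Let NhM : 2 * pi <= N%:R * h <= M.
Proof.
have z : 0 <= (0 : R) <= T by rewrite lexx ltW.
have [s [gs _]] := near_time z ltr01; have [E [G [sl _ _ _]]] := slice_data gs.
have /andP[a b] := number_of_elements part sizes sl.
by rewrite a (le_trans b M8).
Qed.

Let good_times : {ae mu, forall t, 0 < t < T ->
  (forall j, is_derive t 1 (x_ j) (g_ j t)) /\ exists E, consistent M h (x_^~ t) (g_^~ t) E}.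
Proof.
have D (j : 'I_N) := curve_time_derivative T0 K0 H2s (fun x => @cX x) mX wX bX (nodeP j).
have c (j : 'I_N) := cut_velocity_ae K0 H2s bX (nodeP j).
apply: (aeW (aeI (ae_fin_forall D) (aeI (ae_fin_forall c) (regular_time_ae sol)))) => t [Dt [ct rt]] tT.
have tT' : 0 <= t <= T by case/andP: tT => *; rewrite !ltW.
have [E [G [_ cE _ _]]] := slice_data (rt tT').
have e : (g_^~ t) = fun j => Xt t (xi j.+1) by apply/funext => j; rewrite ct.
by split; [move=> j; rewrite ct//; exact: Dt|exists E; rewrite e].
Qed.

Definition convergence_constant : R :=
  96 * A ^+ 2 * T + 24 * M * E1 + (384 * A ^+ 2 + 24 * M * T * E1) + (108 * A ^+ 2 + 9 * A ^+ 2 * M * E1).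

Let pi8 : P <= 8. Proof. by have := @pihalf_lt2 R; lra. Qed.
Let sumsize : \sum_(j < N) elem_size xi j = P. Proof. exact: sum_elem_size part. Qed.

(** An elementwise bound with a constant part and a part depending on the
    neighbouring nodes. *)
Let sum_elements (c : R) (b b' : 'I_N -> R) (F : R) : 0 <= c -> (forall j, 0 <= b j) -> (forall j, 0 <= b' j) ->
  \sum_j b j <= F -> \sum_j b' j <= F ->
  \sum_j elem_size xi j * (3 * (c + b j + b' j)) <= 24 * c + 6 * h * F.
Proof.
move=> c0 b0 b0' bF bF'.
apply: (@le_trans _ _ (\sum_(j < N) (3 * c * elem_size xi j + 3 * h * b j + 3 * h * b' j))).
  apply: ler_sum => j _; have /andP[_ s] := sizes j.
  have k := ler_wpM2r (b0 j) s; have k' := ler_wpM2r (b0' j) s; lra.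
rewrite !big_split/= -!mulr_sumr sumsize.
have k1' : 3 * h * \sum_j b j <= 3 * h * F by apply: ler_wpM2l => //; rewrite mulr_ge0// ltW.
have k2' : 3 * h * \sum_j b' j <= 3 * h * F by apply: ler_wpM2l => //; rewrite mulr_ge0// ltW.
have k3' : c * P <= c * 8 by apply: ler_wpM2l.
lra.
Qed.

Let coef_ge0 (c : R) : 0 <= c -> 0 <= c * A ^+ 2 * h ^+ 2.
Proof. by move=> c0; apply: mulr_ge0; [apply: mulr_ge0 => //; exact: sqr_ge0|exact: sqr_ge0]. Qed.

Let sum_pred (b : 'I_N -> R) : \sum_j b (ord_pred j) = \sum_j b j.
Proof. by rewrite -[LHS](sum_ordS (fun j => b (ord_pred j))); apply: eq_bigr => j _; rewrite ordSK. Qed.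

Let three_sqr (a b c : R) : (a + b + c) ^+ 2 <= 3 * (a ^+ 2 + b ^+ 2 + c ^+ 2).
Proof. by have := sqr_ge0 (a - b); have := sqr_ge0 (b - c); have := sqr_ge0 (a - c); rewrite !expr2; lra. Qed.

Let convex_bound (a b w : E2) (y : R) : 0 <= y <= 1 ->
  enorm (w - (a + y *: (b - a))) <= enorm (w - a) + enorm (w - b).
Proof.
move=> /andP[y0 y1].
have -> : w - (a + y *: (b - a)) = (1 - y) *: (w - a) + y *: (w - b).
  by apply/rowP => i; rewrite !mxE; ring.
apply: (le_trans (enormD _ _)); rewrite (@enormZ _ (1 - y)) (@enormZ _ y) !ger0_norm ?subr_ge0//.
by apply: lerD; rewrite ler_piMl ?enorm_ge0//; lra.
Qed.

Let coord01 (j : 'I_N) x : xi j <= x <= xi j.+1 -> 0 <= local_coord xi j x <= 1.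
Proof.
move=> /andP[a b]; have s := elem_size_gt0 part j; rewrite /local_coord; apply/andP; split.
  by apply: divr_ge0; [rewrite subr_ge0|exact: ltW].
by rewrite ler_pdivrMr// mul1r /elem_size lerD2r.
Qed.

(** A piecewise affine function compared with a curve of speed at most [c]. *)
Let nodal_bound (c : R) (v : R -> E2) (Z : 'I_N -> E2) (j : 'I_N) x : 0 <= c -> periodic v P ->
  (forall x y, 0 <= x <= P -> 0 <= y <= P -> enorm (v y - v x) <= c * `|y - x|) ->
  xi j <= x <= xi j.+1 ->
  enorm (v x - \sum_i phi i x *: Z i) ^+ 2 <=
    3 * (4 * c ^+ 2 * h ^+ 2 + enorm (v (xi j.+1) - Z j) ^+ 2
         + enorm (v (xi (ord_pred j).+1) - Z (ord_pred j)) ^+ 2).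
Proof.
move=> c0 pv lip xj; rewrite (sum_phi_elem part basis Z xj).
have k := convex_bound (Z (ord_pred j)) (Z j) (v x) (coord01 xj).
have far (y : R) : xi j <= y <= xi j.+1 -> enorm (v x - v y) <= c * h.
  move=> yj; apply: (le_trans (lip _ _ (elemP yj) (elemP xj))); apply: ler_wpM2l => //.
  apply: (le_trans (dist_segment yj xj)); by case/andP: (sizes j).
have nl : v (xi j) = v (xi (ord_pred j).+1) by exact: (node_left part j pv).
have jl : xi j <= xi j <= xi j.+1 by rewrite lexx ltW// node_lt.
have jr : xi j <= xi j.+1 <= xi j.+1 by rewrite lexx ltW// node_lt.
have a : enorm (v x - Z (ord_pred j)) <= c * h + enorm (v (xi (ord_pred j).+1) - Z (ord_pred j)).
  rewrite -nl -[v x](subrK (v (xi j))) -addrA; apply: (le_trans (enormD _ _)).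
  by rewrite lerD2r; exact: far.
have b : enorm (v x - Z j) <= c * h + enorm (v (xi j.+1) - Z j).
  rewrite -[v x](subrK (v (xi j.+1))) -addrA; apply: (le_trans (enormD _ _)).
  by rewrite lerD2r; exact: far.
apply: (@le_trans _ _ ((2 * c * h + enorm (v (xi j.+1) - Z j) + enorm (v (xi (ord_pred j).+1) - Z (ord_pred j))) ^+ 2)).
  rewrite ler_pXn2r// ?nnegrE ?enorm_ge0//; first by apply: (le_trans k); move: a b; lra.
  by rewrite !addr_ge0 ?enorm_ge0// !mulr_ge0// ltW.
apply: (le_trans (three_sqr _ _ _)); rewrite le_eqVlt; apply/orP; left; apply/eqP; ring.
Qed.

Let sint_sum (I : Type) (r : seq I) (f : I -> R -> R) a b : (forall i, integrable_on a b (f i)) ->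
  sint a b (fun t => \sum_(i <- r) f i t) = \sum_(i <- r) sint a b (f i).
Proof.
move=> H; elim: r => [|i r IH].
  rewrite big_nil (eq_sint (g := fun _ => 0 * 0)); last by move=> x _; rewrite big_nil mulr0.
  by rewrite sintZ ?mul0r//; apply: integrable_on_continuous => z; exact: cst_continuous.
rewrite big_cons -IH -sintD//; last exact: integrable_on_sum.
by apply: eq_sint => x _; rewrite big_cons.
Qed.

(** The side errors follow from the energy through the identity: squared
    difference of two sides = squared length difference + twice the exact
    length times the defect. The vertex errors are integrals of the velocity
    errors. Estimates at an arbitrary time are taken from a regular time at
    distance at most h, all quantities being Lipschitz in time. *)
Theorem semidiscrete_convergence : exists Xn : 'I_N -> R -> E2,
  [/\ semidiscrete_solution xi phi T X0 Xn,
      (forall Yn, semidiscrete_solution xi phi T X0 Yn ->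
         forall j (t : R), t \in `[0, T] -> Yn j t = Xn j t),
      (error_sq phi T X Xt Xn <= (convergence_constant * h ^+ 2)%:E)%E &
      forall t : R, t \in `[0, T] -> forall j, 0 < side Xn j t].
Proof.
have LxA : 5 * `|K| <= A by move: AK K0; lra.
have xl j i s t : 0 <= s <= T -> 0 <= t <= T -> `|x_ j t 0 i - x_ j s 0 i| <= A * `|t - s|.
  move=> sT tT; rewrite /= -coordB; apply: (le_trans (enorm_coord _ _)); exact: curve_lip.
have gi j i : integrable_on 0 T (fun t => g_ j t 0 i) by exact: cut_velocity_integrable.
have gb j t i : `|g_ j t 0 i| <= A by apply: le_trans LxA; exact: cut_velocity_le.
have [Y [V [Y0 DY resY enY [iV YV iD intD]]]] :=
  energy_bootstrap N0 T0 M1 h0 NhM (ltW A0) xl lenx gi gb good_times small.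
have vel j t : 0 <= t <= T -> tderivable T (Y j) t /\ tderiv T (Y j) t = V j t.
  by move=> tT; exact: tderiv_is_derive (DY j t tT).
have X00 : X 0 = X0 by have [_ [[_ _ e _] _] _ _] := sol.
have semi : semidiscrete_solution xi phi T X0 Y.
  apply/(semidiscrete_nodal part basis T0); split.
  - by move=> j t tT; case: (vel j t tT).
  - by move=> j; rewrite Y0 X00.
  - move=> t tT j; have [r _] := resY j t tT; rewrite -{}r; congr nodal_residual.
    by apply/funext => k; case: (vel k t tT).
have lenYB j t : 0 <= t <= T -> h / (2 * M) <= enorm (edge (Y^~ t) j) <= 2 * M * h.
  by move=> tT; case: (resY j t tT).
have l0 : 0 < h / (2 * M) by rewrite divr_gt0// mulr_gt0.
exists Y; split=> //.
- move=> Yn /(semidiscrete_nodal part basis T0)[dYn Yn0 rYn] j t; rewrite in_itv/= => tT.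
  have [Z hZ] := choice (fun j => tderiv_extend T0 (dYn j)).
  rewrite -((hZ j).1 t tT).
  pose W j := tderiv T (Yn j).
  have DZ j' (s : R) : 0 <= s <= T -> is_derive s 1 (Z j') (W j' s) by exact: (hZ j').2.
  have resY' j' (s : R) : 0 <= s <= T -> nodal_residual (Y^~ s) (V^~ s) j' = 0.
    by move=> sT; have [r _] := resY j' s sT; exact: r.
  have resZ j' (s : R) : 0 <= s <= T -> nodal_residual (Z^~ s) (W^~ s) j' = 0.
    move=> sT; have ZE : (Z^~ s) = (Yn^~ s) by apply/funext => k'; exact: (hZ k').1.
    by have r := rYn s sT j'; rewrite ZE; exact: r.
  have init j' : Z j' 0 = Y j' 0.
    have z : 0 <= (0 : R) <= T by rewrite lexx ltW.
    by rewrite ((hZ j').1 0 z) Yn0 Y0 X00.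
  exact: (nodal_flow_unique N0 T0 l0 DY DZ resY' resZ lenYB init tT j).
- pose D t := \sum_j enorm (g_ j t - V j t) ^+ 2.
  have iDs : integrable_on 0 T D by exact: integrable_on_sum.
  have velocity_error : (\int[mu]_(t in `[0%R, T]) L2sq (Xt t \- discrete_velocity phi T Y t)%R
      <= ((96 * A ^+ 2 * T + 24 * M * E1) * h ^+ 2)%:E)%E.
    pose c := 4 * A ^+ 2 * h ^+ 2.
    have ic : integrable_on 0 T (fun _ : R => 24 * c) by apply: integrable_on_continuous => z; exact: cst_continuous.
    have iDh := integrable_onZ (6 * h) iDs.
    apply: (@le_trans _ _ (sint 0 T (fun t => 24 * c + 6 * h * D t))%:E).
      apply: le_integral_majorant => //.
      - by move=> t _; apply: integral_ge0 => x _; rewrite lee_fin sqr_ge0.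
      - move=> t; apply: addr_ge0; first by apply: mulr_ge0 => //; exact: coef_ge0.
        by apply: mulr_ge0; [apply: mulr_ge0 => //; exact: ltW|apply: sumr_ge0 => j _; exact: sqr_ge0].
      - exact: integrable_onD.
      have ct (j : 'I_N) := cut_velocity_ae K0 H2s bX (nodeP j).
      apply: (aeW (aeI (ae_fin_forall ct) (regular_time_ae sol))) => t [gE rt] tT.
      have [E [G [[_ _ _ [_ ulip] _] _ _ _]]] := slice_data (rt tT).
      have [_ [pu cu _ _]] := H2s tT.
      have e : (Xt t \- discrete_velocity phi T Y t)%R = fun x => Xt t x - \sum_i phi i x *: V i t.
        apply/funext => x; rewrite /= discrete_velocityE//; last by move=> j; case: (vel j t tT).
        by congr (_ - _); apply: eq_bigr => i _; case: (vel i t tT) => _ ->.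
      rewrite e; pose b j := enorm (g_ j t - V j t) ^+ 2.
      have cc : continuous (fun x => Xt t x - \sum_i phi i x *: V i t).
        by move=> x; apply: (@continuousB _ _ _ (Xt t) (fun x => \sum_i phi i x *: V i t)); [exact: cu|exact: continuous_sum_phi].
      have kk (j : 'I_N) x : xi j <= x <= xi j.+1 ->
          enorm (Xt t x - \sum_i phi i x *: V i t) ^+ 2 <= 3 * (c + b j + b (ord_pred j)).
        move=> xj; have nb := nodal_bound (V^~ t) (ltW A0) pu ulip xj.
        have cE (i : 'I_N) : cut_velocity `|K| Xt (xi i.+1) t = Xt t (xi i.+1) by exact: (gE i tT).
        by rewrite /b /c (cE j) (cE (ord_pred j)); exact: nb.
      have ccj (j : 'I_N) i : {within `[xi j, xi j.+1], continuous (fun x : R => (Xt t x - \sum_i phi i x *: V i t) 0 i)}.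
        by apply: continuous_subspaceT; exact: continuous_coord.
      have [_ k] := L2sq_le_elements part ccj (fun _ _ _ => erefl) kk.
      apply: (le_trans k).
      rewrite lee_fin; apply: sum_elements => //.
        + exact: coef_ge0.
        + by move=> j; exact: sqr_ge0.
        + by move=> j; exact: sqr_ge0.
        + by rewrite (sum_pred b).
    rewrite lee_fin sintD// (sint_cst _ (ltW T0)) sintZ// subr0.
    have k : 6 * h * sint 0 T D <= 6 * h * (4 * M * E1 * h) by apply: ler_wpM2l => //; rewrite mulr_ge0// ltW.
    apply: (le_trans (lerD (lexx _) k)); rewrite le_eqVlt; apply/orP; left; apply/eqP.
    by rewrite /c; ring.
  have curve_err t : 0 <= t <= T -> (H1sq (X t \- discrete_curve phi Y t)%R <=
      ((384 * A ^+ 2 + 24 * M * T * E1 + (108 * A ^+ 2 + 9 * A ^+ 2 * M * E1)) * h ^+ 2)%:E)%E.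
    move=> tT; have [Hv _] := H2s tT; have [Dv _ _ _ _] := H2_C1 Hv; have [pv _ _ _] := Hv.
    have /andP[t0 tT'] := tT.
    have lip x y : 0 <= x <= P -> 0 <= y <= P -> enorm (X t y - X t x) <= 2 * A * `|y - x|.
      wlog xy : x y / x <= y.
        move=> H; have [xy|/ltW yx] := leP x y; first exact: H.
        by move=> ? ?; rewrite enormBC distrC; exact: H.
      move=> /andP[x0 _] /andP[_ yP]; rewrite ger0_norm ?subr_ge0//.
      apply: (mean_value_vec xy) => z /andP[xz zy].
        by apply: Dv; rewrite (le_trans x0 xz) (le_trans zy).
      have /andP[_ w2] := solution_speed sol z tT; exact: le_trans w2 Ak2.
    pose e2 j := enorm (x_ j t - Y j t) ^+ 2.
    have e2_le j : e2 j <= T * sint 0 T (fun r => enorm (g_ j r - V j r) ^+ 2).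
      have iDt := integrable_onS (lexx 0) tT' (iD j).
      pose f i r := g_ j r 0 i - V j r 0 i.
      have if_ i : integrable_on 0 t (f i).
        by apply: (integrable_onS (lexx 0) tT'); apply: integrable_onB; [exact: gi|exact: iV].
      have if2 i : integrable_on 0 t (fun r => f i r ^+ 2).
        apply: (integrable_on_le _ _ iDt).
          by apply: measurable_funX; exact: integrable_on_measurable (if_ i).
        move=> r _; rewrite ger0_norm ?sqr_ge0// -[leLHS]real_normK ?num_real//.
        by rewrite ler_pXn2r ?nnegrE ?enorm_ge0// /f -coordB enorm_coord.
      have ci i : (x_ j t - Y j t) 0 i = sint 0 t (f i).
        rewrite coordB sintB; [|exact: integrable_onS (lexx 0) tT' (gi j i)|exact: integrable_onS (lexx 0) tT' (iV j i)].
        rewrite -(YV j i t tT) -(curve_time_primitive T0 K0 H2s (fun x => @cX x) mX wX bX i (nodeP j) (lexx 0) t0 tT').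
        by rewrite Y0; ring.
      have S : sint 0 t (fun r => enorm (g_ j r - V j r) ^+ 2) = sint 0 t (fun r => f 0 r ^+ 2) + sint 0 t (fun r => f 1 r ^+ 2).
        by rewrite -sintD//; apply: eq_sint => r _; rewrite enorm_sqrE /f !coordB.
      apply: (@le_trans _ _ (t * sint 0 t (fun r => enorm (g_ j r - V j r) ^+ 2))).
        rewrite /e2 enorm_sqrE !ci S mulrDr.
        have q0 := sint_sqr_le t0 (if_ 0) (if2 0); have q1 := sint_sqr_le t0 (if_ 1) (if2 1).
        by move: q0 q1; rewrite subr0; exact: lerD.
      apply: ler_pM => //; first by apply: sint_ge0 => r _; exact: sqr_ge0.
      by apply: sint_subset (iD j) (lexx 0) t0 tT' => r; exact: sqr_ge0.
    have sum_e2 : \sum_j e2 j <= T * (4 * M * E1 * h).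
      apply: (@le_trans _ _ (T * sint 0 T D)); last by apply: ler_wpM2l => //; exact: ltW.
      by rewrite /D sint_sum// mulr_sumr; apply: ler_sum => j _; exact: e2_le.
    have [s [gs ts]] := near_time tT h0; have sT : 0 <= s <= T by case: gs.
    have [E [G [_ _ so lin]]] := slice_data gs.
    pose om (i : 'I_N) : R := oscillation xi G i.
    pose r2 j := enorm (edge (x_^~ t) j - edge (Y^~ t) j) ^+ 2.
    have sum_r2 : \sum_j r2 j <= 3 * M * h * (E1 * h ^+ 2).
      apply: (@le_trans _ _ (3 * M * h * energy h (x_^~ t) (Y^~ t))); last first.
        apply: ler_wpM2l; last exact: enY.
        by apply: mulr_ge0; [apply: mulr_ge0 => //|]; exact: ltW.
      rewrite /energy mulr_sumr; apply: ler_sum => j _; rewrite /r2.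
      have df := defect_ge0 (x_^~ t) (Y^~ t) j; have /andP[_ lx] := lenx j tT.
      have E2' : enorm (edge (x_^~ t) j - edge (Y^~ t) j) ^+ 2 =
          (enorm (edge (Y^~ t) j) - enorm (edge (x_^~ t) j)) ^+ 2
          + 2 * enorm (edge (x_^~ t) j) * defect (x_^~ t) (Y^~ t) j.
        rewrite /defect; move: (edge (x_^~ t) j) (edge (Y^~ t) j) => p q.
        have k : dot q p = enorm p * dot q (dir p) by rewrite -{1}(dirK p) (@dotZr _ (enorm p)).
        rewrite enorm_sqr dotBl !dotBr -!enorm_sqr [dot p q]dotC k; ring.
      rewrite E2'; move: df lx; move: (defect _ _ _) (enorm (edge (x_^~ t) j)) (enorm (edge (Y^~ t) j)) => d p q d0 lp.
      have sq : 0 <= (q - p) ^+ 2 by exact: sqr_ge0.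
      have a1 : p * d <= M * h * d by apply: ler_wpM2r.
      have a2 : 3 * M * h * ((q - p) ^+ 2 / h) = 3 * M * (q - p) ^+ 2 by field; rewrite gt_eqF.
      have a3 : (q - p) ^+ 2 <= 3 * M * (q - p) ^+ 2 by apply: ler_peMl => //; move: (M1); lra.
      have a4 : 0 <= M * h * d by apply: mulr_ge0 => //; apply: mulr_ge0; exact: ltW.
      by rewrite mulrDr a2; move: a1 a3 a4; lra.
    have b0 (j : 'I_N) x : xi j <= x <= xi j.+1 -> enorm (X t x - \sum_i phi i x *: Y i t) ^+ 2 <=
        3 * (16 * A ^+ 2 * h ^+ 2 + e2 j + e2 (ord_pred j)).
      have c0 : 0 <= 2 * A by rewrite mulr_ge0// ltW.
      move=> xj; have := nodal_bound (Y^~ t) c0 pv lip xj.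
      by have -> : 4 * (2 * A) ^+ 2 * h ^+ 2 = 16 * A ^+ 2 * h ^+ 2 by ring.
    have b1 (j : 'I_N) x : xi j <= x <= xi j.+1 ->
        enorm (derive1 (X t) x - (elem_size xi j)^-1 *: edge (Y^~ t) j) ^+ 2 <=
        3 * (4 * A ^+ 2 * h ^+ 2 + 4 * om j ^+ 2 + (A / h) ^+ 2 * r2 j).
      move=> xj; have xP := elemP xj; have hj := elem_size_gt0 part j; set q := elem_size xi j in hj *.
      have hj0 : q != 0 by rewrite gt_eqF.
      have qi : 0 <= q^-1 by rewrite invr_ge0 ltW.
      have -> : derive1 (X t) x - q^-1 *: edge (Y^~ t) j = (derive1 (X t) x - derive1 (X s) x)
          + q^-1 *: (edge (x_^~ s) j - edge (x_^~ t) j)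
          - q^-1 *: (edge (x_^~ s) j - q *: derive1 (X s) x)
          + q^-1 *: (edge (x_^~ t) j - edge (Y^~ t) j).
        move: (edge (x_^~ s) j) (edge (x_^~ t) j) (edge (Y^~ t) j) (derive1 (X t) x) (derive1 (X s) x) => a b c d e.
        by apply/rowP => i; rewrite !mxE; field.
      have n1 : enorm (derive1 (X t) x - derive1 (X s) x) <= A * h.
        by apply: (le_trans (slope_lip xP sT tT)); apply: ler_wpM2l => //; exact: ltW.
      have n2 : enorm (q^-1 *: (edge (x_^~ s) j - edge (x_^~ t) j)) <= A * h.
        rewrite (@enormZ _ q^-1) (ger0_norm qi) mulrC ler_pdivrMr// !edgeE//.
        apply: (le_trans (edge_lip (leftP j) (nodeP j) tT sT)).
        rewrite distrC [`|xi j - _|]distrC [`|xi j.+1 - _|]gtr0_norm// -/q mulrAC ler_pM2r//.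
        by apply: ler_wpM2l; [exact: ltW|rewrite distrC].
      have n3 : enorm (q^-1 *: (edge (x_^~ s) j - q *: derive1 (X s) x)) <= 2 * om j.
        by rewrite (@enormZ _ q^-1) (ger0_norm qi) mulrC ler_pdivrMr//; exact: lin.
      have n4 : enorm (q^-1 *: (edge (x_^~ t) j - edge (Y^~ t) j)) <= A / h * enorm (edge (x_^~ t) j - edge (Y^~ t) j).
        rewrite (@enormZ _ q^-1) (ger0_norm qi); apply: ler_wpM2r; first exact: enorm_ge0.
        have /andP[k _] := sizes j; rewrite -[A / h]invrK lef_pV2 ?posrE ?invr_gt0 ?divr_gt0//.
        by rewrite invf_div.
      set N1 := derive1 (X t) x - derive1 (X s) x in n1 *; set N2 := _ *: _ in n2 *; set N3 := _ *: _ in n3 *; set N4 := _ *: _ in n4 *.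
      apply: (@le_trans _ _ ((2 * A * h + 2 * om j + A / h * enorm (edge (x_^~ t) j - edge (Y^~ t) j)) ^+ 2)).
        have k := le_trans (enormD _ _) (lerD (le_trans (enormB _ _) (lerD (le_trans (enormD _ _) (lerD n1 n2)) n3)) n4).
        have k' : enorm (N1 + N2 - N3 + N4) <= 2 * A * h + 2 * om j + A / h * enorm (edge (x_^~ t) j - edge (Y^~ t) j).
          by apply: (le_trans k); rewrite lerD2r lerD2r le_eqVlt; apply/orP; left; apply/eqP; ring.
        rewrite ler_pXn2r// ?nnegrE ?enorm_ge0//; exact: le_trans (enorm_ge0 _) k'.
      apply: (le_trans (three_sqr _ _ _)); rewrite /r2 le_eqVlt; apply/orP; left; apply/eqP; ring.
    apply: (le_trans (curve_error part basis Hv b0 b1)); rewrite lee_fin.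
    rewrite (eq_bigr (fun j => elem_size xi j * (3 * (16 * A ^+ 2 * h ^+ 2 + e2 j + e2 (ord_pred j)))
      + elem_size xi j * (3 * (4 * A ^+ 2 * h ^+ 2 + 4 * om j ^+ 2 + (A / h) ^+ 2 * r2 j)))); last by move=> j _; rewrite mulrDr.
    rewrite big_split/=.
    have part0 : \sum_j elem_size xi j * (3 * (16 * A ^+ 2 * h ^+ 2 + e2 j + e2 (ord_pred j))) <=
        24 * (16 * A ^+ 2 * h ^+ 2) + 6 * h * (T * (4 * M * E1 * h)).
      apply: sum_elements => //; [exact: coef_ge0|by move=> j; exact: sqr_ge0|by move=> j; exact: sqr_ge0|].
      by rewrite (sum_pred e2).
    have part1 : \sum_j elem_size xi j * (3 * (4 * A ^+ 2 * h ^+ 2 + 4 * om j ^+ 2 + (A / h) ^+ 2 * r2 j)) <=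
        96 * A ^+ 2 * h ^+ 2 + 12 * h * (h * A ^+ 2) + 3 * h * (A / h) ^+ 2 * (3 * M * h * (E1 * h ^+ 2)).
      apply: (@le_trans _ _ (\sum_(j < N) (12 * A ^+ 2 * h ^+ 2 * elem_size xi j + 12 * h * om j ^+ 2
          + 3 * h * (A / h) ^+ 2 * r2 j))).
        apply: ler_sum => j _; have /andP[_ sz] := sizes j.
        have w0 : 0 <= 4 * om j ^+ 2 + (A / h) ^+ 2 * r2 j by apply: addr_ge0; apply: mulr_ge0 => //; exact: sqr_ge0.
        have k := ler_wpM2r w0 sz; move: k.
        by move: (om j ^+ 2) (r2 j) ((A / h) ^+ 2) => w r a k; lra.
      rewrite !big_split/= -!mulr_sumr sumsize.
      have a0 : 0 <= A ^+ 2 * h ^+ 2 := mulr_ge0 (sqr_ge0 A) (sqr_ge0 h).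
      have k1' : 12 * h * \sum_(j < N) om j ^+ 2 <= 12 * h * (h * A ^+ 2) by apply: ler_wpM2l => //; rewrite mulr_ge0// ltW.
      have k2' : 3 * h * (A / h) ^+ 2 * \sum_j r2 j <= 3 * h * (A / h) ^+ 2 * (3 * M * h * (E1 * h ^+ 2)).
        apply: ler_wpM2l => //; apply: mulr_ge0; [apply: mulr_ge0 => //; exact: ltW|exact: sqr_ge0].
      apply: lerD => //; apply: lerD => //.
      have := ler_wpM2l a0 pi8; lra.
    apply: (le_trans (lerD part0 part1)); rewrite le_eqVlt; apply/orP; left; apply/eqP.
    by field; rewrite gt_eqF.
  rewrite /error_sq.
  have -> : convergence_constant * h ^+ 2 = (96 * A ^+ 2 * T + 24 * M * E1) * h ^+ 2 +
      (384 * A ^+ 2 + 24 * M * T * E1 + (108 * A ^+ 2 + 9 * A ^+ 2 * M * E1)) * h ^+ 2.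
    by rewrite /convergence_constant; ring.
  rewrite EFinD; apply: leeD; first exact: velocity_error.
  apply: ge_ereal_sup => _ [t tT <-]; apply: curve_err.
  by move: tT; rewrite /= in_itv.
- by move=> t; rewrite in_itv/= => tT j; case/andP: (lenYB j t tT) => k _; exact: lt_le_trans k.
Qed.

End Convergence.

(** One constant dominates all data; the threshold makes elements short enough
    for the chord estimates and closes the bootstrap. *)
Theorem theorem2p5 (R : realType) (Cp CP k1 k2 T K : R)
    (hCp : 0 < Cp) (hk1 : 0 < k1) (hk12 : k1 < k2) (hT : 0 < T) :
  exists h0 C : R, 0 < h0 /\
    forall (X0 : R -> 'rV[R]_2) (X Xt : R -> R -> 'rV[R]_2),
      regular_solution T k1 k2 K X0 X Xt ->
    forall (N : nat) (xi : nat -> R) (phi : 'I_N -> R -> R),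
      partition_of_S1 N xi -> regular_partition N xi Cp CP ->
      nodal_basis xi phi -> mesh N xi <= h0 ->
    exists Xn : 'I_N -> R -> 'rV[R]_2,
      [/\ semidiscrete_solution xi phi T X0 Xn,
          (forall Yn, semidiscrete_solution xi phi T X0 Yn ->
             forall j (t : R), t \in `[0, T] -> Yn j t = Xn j t),
          (error_sq phi T X Xt Xn <= (C * mesh N xi ^+ 2)%:E)%E &
          forall t : R, t \in `[0, T] -> forall j, 0 < side Xn j t].
Proof.
have k20 : 0 < k2 by exact: lt_trans hk12.
have i1 : 0 <= k1^-1 by rewrite invr_ge0 ltW.
have i2 : 0 <= Cp^-1 by rewrite invr_ge0 ltW.
have nK := normr_ge0 K; have nC := normr_ge0 CP.
pose A := 1 + k1^-1 + k2 + 20 * `|K| + Cp^-1 + `|CP|.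
have [A1 Ak1 Ak2 AK] : [/\ 1 <= A, k1^-1 <= A, k2 <= A & 20 * `|K| <= A] by rewrite /A; split; lra.
have [ACp ACP] : Cp^-1 <= A /\ `|CP| <= A by rewrite /A; split; lra.
have A0 : 0 < A := lt_le_trans ltr01 A1.
pose M : R := 230 * 230 * 30 * A ^+ 20.
have M0 : 0 < M.
  rewrite /M; have : 0 < A ^+ 20 by rewrite exprn_gt0.
  by move: (A ^+ 20) => a a0; lra.
pose E1 := expR (growth M * T).
have E10 : 0 < E1 by exact: expR_gt0.
pose b1 := (4 * A ^+ 2)^-1; pose b2 := (1 / (128 * M ^+ 2)) ^+ 2 / E1.
have b10 : 0 < b1 by rewrite invr_gt0; apply: mulr_gt0; [exact: ltr0Sn|exact: exprn_gt0].
have b20 : 0 < b2.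
  apply: divr_gt0 => //; apply: exprn_gt0; apply: divr_gt0; first exact: ltr01.
  by apply: mulr_gt0; [exact: ltr0Sn|exact: exprn_gt0].
exists (Num.min (Num.min 1 b1) b2), (convergence_constant T A).
split; first by rewrite !lt_min ltr01 b10 b20.
move=> X0 X Xt sol N xi phi part reg basis.
rewrite !le_min => /andP[/andP[h1 hb1] hb2].
have N0 := partition_gt0 part.
have le_mesh (j : 'I_N) : elem_size xi j <= mesh N xi by exact: le_bigmax.
have h0 : 0 < mesh N xi := lt_le_trans (elem_size_gt0 part (Ordinal N0)) (le_mesh _).
have hA : 4 * A ^+ 2 * mesh N xi <= 1.
  have p : 0 < 4 * A ^+ 2 by apply: mulr_gt0; [exact: ltr0Sn|exact: exprn_gt0].
  by move: hb1; rewrite /b1 -[X in _ <= X]div1r ler_pdivlMr// mulrC.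
have small : E1 * mesh N xi <= (1 / (128 * M ^+ 2)) ^+ 2.
  by move: hb2; rewrite /b2 ler_pdivlMr// mulrC.
have sizes (j : 'I_N) : mesh N xi / A <= elem_size xi j <= mesh N xi.
  have [c _] := reg j; rewrite le_mesh andbT; apply: le_trans c; rewrite mulrC ler_pM2r//.
  by rewrite -[X in _ <= X]invrK lef_pV2 ?posrE ?invr_gt0.
have steps (j : 'I_N) : `|elem_size xi (ordS j) - elem_size xi j| <= A * mesh N xi ^+ 2.
  have [_ c] := reg j; apply: (le_trans c); apply: ler_wpM2r; first exact: sqr_ge0.
  exact: le_trans (ler_norm CP) ACP.
exact: (semidiscrete_convergence hk1 hT sol A1 Ak1 Ak2 AK part basis h0 h1 hA sizes steps small).
Qed.
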